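(* Let $n\in\mathbb{N}$, $0<a_1<a_2<\dots<a_n<1$, $C_-=\emptyset$, $C=C_+=\{a_1,\dots,a_n\}$, and let $J(u)=\frac12\int_B|\nabla u|^2\,dx-\frac1{8\pi}\int_BF(u)\,dx$, $u\in H^1_0(B)$, with $f\in C^1(\mathbb{R})$ of $4\pi$-critical growth satisfying (g0), (g1) and (g2). Then there exist sequences $s_k\to\infty$ and $v_k\in C^1_{0;r}(B)$ with $\|v_k'\|_\infty\to0$ such that the sequence $u_k=\delta_{1/s_k}(\mu_C+v_k)$ satisfies $$J(u_k)\to\tfrac12\|\nabla\mu_C\|_2^2,\qquad J'(u_k)\to0\ \text{ in } H_0^1(B)$$ (the derivative being identified with an element of $H^1_0(B)$ by the Riesz theorem). Furthermore, for every $c\in(\frac12,\frac n2)$ there exist points $0<a_1<a_2<\dots<a_n<1$ such that $\frac12\|\nabla\mu_C\|_2^2=c$ for $C=\{a_1,\dots,a_n\}$.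
   Context: $B\subset\mathbb{R}^2$ is the open unit disk, $r=|x|$; radial functions are written as functions of $r$. $H^1_{0;r}(B)$ is the subspace of radial functions in $H^1_0(B)$, and $C^1_{0;r}(B)$ is the space of radial $C^1$ functions with compact support in $B$. For $s>0$, $\delta_su(r)=s^{-1/2}u(r^s)$; $\delta_s$ is an isometry of $H^1_{0;r}(B)$ with the norm $\|\nabla u\|_2$. Nonlinearity: $f:\mathbb{R}\to\mathbb{R}$ is continuous, $F(s)=\int_0^sf(t)\,dt$, and $g$ is defined by $\frac1{8\pi}f(t)=g(t)e^{4\pi t^2}$. The function $f$ is of $4\pi$-critical growth if $\lim_{|s|\to\infty}g(s)e^{-\delta s^2}=0$ for every $\delta>0$. Conditions: (g0) $\lim_{|t|\to\infty}\frac{g'(t)}{g(t)t}=0$; (g1) there is $T>0$ such that $\inf_{t\ge T}g(t)>0$ and $\sup_{t\le-T}g(t)<0$; (g2) $\lim_{|t|\to\infty}\frac{F(t)}{f(t)t}=0$. Tower function: for disjoint closed sets $C_+,C_-\subset(0,1)$ with nonempty union $C$, a tower is the continuous radial function in $H^1_0(B)$ equal to $\pm\sqrt{\frac1{2\pi}\log\frac1r}$ on $C_\pm$ and of the form $A_I+B_I\log\frac1r$ ($A_I,B_I\in\mathbb{R}$) on each connected component $I$ of $(0,1)\setminus C$. When $C_-=\emptyset$ it is denoted $\mu_C$, so that $\mu_C(r)=\sqrt{\frac1{2\pi}\log\frac1r}$ for $r\in C$. (In particular $\mu_C$ is constant on the component with left endpoint $0$ and vanishes at $r=1$.)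
   Formalization: The assumption f(0)=0 is added in the first part; without it the claim fails: u_k→0 uniformly on compact annuli, so J'(u_k)φ→−(f(0)/8π)∫φ. E.g. f(t)=8π tanh(t−1)e^{4πt²} satisfies all stated hypotheses but f(0)≠0. *)

(* Defs.v *)
From HB Require Import structures.
From mathcomp Require Import all_boot all_order all_algebra.
From mathcomp Require Import all_classical all_reals all_analysis.

Set Implicit Arguments.
Unset Strict Implicit.
Unset Printing Implicit Defensive.

Import Order.TTheory GRing.Theory Num.Theory.
Import numFieldNormedType.Exports.

Local Open Scope classical_set_scope.
Local Open Scope ring_scope.

Section Disk.
Context {R : realType}.
Implicit Types (u v w phi : R * R -> R) (e : R * R) (h : R -> R).

Local Notation lebesgue2 :=
  ((@lebesgue_measure R \x @lebesgue_measure R)%E).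

(* The library's own norm on R * R is the maximum norm. *)
Definition enorm (x : R * R) : R := Num.sqrt (x.1 ^+ 2 + x.2 ^+ 2).

Definition disk : set (R * R) := [set x | enorm x < 1].

Definition radial h : R * R -> R := fun x => h (enorm x).

Definition e1 : R * R := (1, 0).
Definition e2 : R * R := (0, 1).

(* C^1 functions with compact support in the open disk, extended by 0. *)
Definition C1c phi : Prop :=
  [/\ forall x : R * R, derivable phi x e1 /\ derivable phi x e2,
      continuous ('D_e1 phi), continuous ('D_e2 phi),
      compact (closure [set x | phi x != 0]) &
      closure [set x | phi x != 0] `<=` disk].

Definition L2 u : Prop :=
  measurable_fun disk u /\
  lebesgue2.-integrable disk (EFin \o (fun x => u x ^+ 2)).

Definition is_weak_derivative e u v : Prop :=
  L2 v /\ forall phi, C1c phi ->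
    \int[lebesgue2]_(x in disk) (u x * 'D_e phi x) =
    - \int[lebesgue2]_(x in disk) (v x * phi x).

(* Weak derivatives are unique up to null sets, so the integrals below do not
   depend on which representative is chosen; the default value 0 only matters
   for functions outside H1. *)
Definition weak_derivative e u : R * R -> R :=
  xget (fun=> 0) [set v | is_weak_derivative e u v].

Definition H1 u : Prop :=
  [/\ L2 u, exists v, is_weak_derivative e1 u v
          & exists v, is_weak_derivative e2 u v].

Definition H1_norm u : R :=
  Num.sqrt (\int[lebesgue2]_(x in disk)
    (u x ^+ 2 + weak_derivative e1 u x ^+ 2 + weak_derivative e2 u x ^+ 2)).

Definition H10 u : Prop :=
  H1 u /\ exists phi : nat -> R * R -> R,
    (forall n, C1c (phi n)) /\
    H1_norm (u \- phi n) @[n --> \oo] --> (0 : R).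

(* Inner product and norm of H10: the norm of u is the L^2 norm of its
   gradient. *)
Definition grad_inner u v : R :=
  \int[lebesgue2]_(x in disk)
    (weak_derivative e1 u x * weak_derivative e1 v x +
     weak_derivative e2 u x * weak_derivative e2 v x).

Definition grad_norm u : R := Num.sqrt (grad_inner u u).

(* Frechet differentiability of Phi at u in the Hilbert space H10; w is the
   Riesz representative of the derivative. *)
Definition is_H10_derivative (Phi : (R * R -> R) -> R) u w : Prop :=
  [/\ H10 u, H10 w &
      forall eps : R, 0 < eps -> exists2 d : R, 0 < d &
        forall v, H10 v -> grad_norm v < d ->
          `|Phi (u \+ v) - Phi u - grad_inner w v| <= eps * grad_norm v].

Definition dilation (s : R) h : R -> R :=
  fun r => (Num.sqrt s)^-1 * h (r `^ s).

Definition sup_norm01 h : \bar R := ereal_sup [set `|h r|%:E | r in `]0, 1[].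

End Disk.

Section Tower.
Context {R : realType}.

Definition tower_profile (r : R) : R := Num.sqrt (ln r^-1 / (2 * pi)).

Definition is_tower (Cp Cm : set R) (h : R -> R) : Prop :=
  [/\ forall x, disk x -> {for x, continuous (radial h)},
      H10 (radial h),
      forall r, Cp r -> h r = tower_profile r,
      forall r, Cm r -> h r = - tower_profile r &
      forall x : R, (`]0, 1[%classic `\` (Cp `|` Cm)) x ->
        exists A B : R, forall r : R,
          connected_component (`]0, 1[%classic `\` (Cp `|` Cm)) x r ->
          h r = A + B * ln r^-1].

(* For admissible C the tower is unique as a function on [0, 1[; its values
   elsewhere are never used. *)
Definition tower (C : set R) : R -> R :=
  xget (fun=> 0) [set h | is_tower C set0 h].

End Tower.

Section Nonlinearity.
Context {R : realType}.
Implicit Types (f g h : R -> R).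

Definition C1 f : Prop := (forall t, derivable f t 1) /\ continuous (derive1 f).

Definition cvg_abs_infty h (l : R) : Prop :=
  h t @[t --> +oo] --> l /\ h t @[t --> -oo] --> l.

Definition primitive f (s : R) : R :=
  if 0 <= s then \int[lebesgue_measure]_(t in `[0, s]) f t
  else - \int[lebesgue_measure]_(t in `[s, 0]) f t.

(* The function g such that f t / (8 pi) = g t * exp (4 pi t^2). *)
Definition g_of f (t : R) : R :=
  f t / (8 * pi) * expR (- (4 * pi * t ^+ 2)).

Definition critical_growth f : Prop :=
  forall d : R, 0 < d ->
    cvg_abs_infty (fun t => g_of f t * expR (- (d * t ^+ 2))) 0.

Definition cond_g0 f : Prop :=
  cvg_abs_infty (fun t => derive1 (g_of f) t / (g_of f t * t)) 0.

Definition cond_g1 f : Prop :=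
  exists2 T : R, 0 < T &
    0 < inf [set g_of f t | t in [set t | T <= t]] /\
    sup [set g_of f t | t in [set t | t <= - T]] < 0.

Definition cond_g2 f : Prop :=
  cvg_abs_infty (fun t => primitive f t / (f t * t)) 0.

Definition J f (u : R * R -> R) : R :=
  grad_norm u ^+ 2 / 2 -
  (8 * pi)^-1 *
  \int[(@lebesgue_measure R \x @lebesgue_measure R)%E]_(x in disk)
    primitive f (u x).

End Nonlinearity.

(* Main.v *)
(* In the variable y = |x|^2 and the logarithmic scale sigma = - (ln y) / s, the
   dilated tower is sqrt s times a concave polygonal line through the points of the
   parabola sigma = 4 pi t^2 above the nodes, and lying strictly inside it elsewhere.
   By critical growth f(u) is therefore exponentially small against the weight e^(- s
   sigma) of Lebesgue measure, except near the nodes. There the height of the line is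
   corrected by small hats; lowering a node makes the charge of f at it tend to 0,
   raising it makes the charge tend to infinity, so by the intermediate value theorem
   the charge can be made equal to the slope jump of the line. The flux of the
   gradient of u and that of the solution z of - laplacian z = f(u) / (8 pi) are then
   step functions with the same jumps, so the norm of J'(u) = u - z is controlled by
   the width rho of the hats; letting rho tend to 0 slowly as s tends to infinity
   gives the sequence. A weak Trudinger inequality makes J differentiable. For the
   levels, let the heights sqrt(log(1/a_i) / (2 pi)) be in geometric progression: all
   terms of the energy but one are then equal, and the ratio tunes their value. *)
Require Import Defs.
From HB Require Import structures.
From mathcomp Require Import all_boot all_order all_algebra.
From mathcomp Require Import all_classical all_reals all_analysis.
From mathcomp Require Import measurable_realfun.
From mathcomp Require Import ring lra.

Set Implicit Arguments.
Unset Strict Implicit.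
Unset Printing Implicit Defensive.

Import Order.TTheory GRing.Theory Num.Theory.
Import numFieldNormedType.Exports.

Local Open Scope classical_set_scope.
Local Open Scope ring_scope.

(** * Calculus in one variable *)

(** The obstacle is that critical growth leaves [g] free up to subexponential factors. On the
    parabola the product of f(u) and the weight e^(- s sigma) is 8 pi g(u), so no explicit height of
    a node yields a prescribed charge; only strictly below and strictly above the parabola is the
    charge under control. Hence the intermediate value argument, which says no more about the
    heights than |h| <= eps. It can be run at each node separately, because every annulus meets a
    single hat. The variable y = |x|^2 makes area equal to pi dy and the Laplacian of k(|x|^2) equal
    to 4 (y k')', so a flux is a primitive. From - laplacian z = f(u) / (8 pi) one gets sqrt s y z'
    = - int_0^y sqrt s f(u) / (32 pi), which is the origin of 32 pi; for the tower the same quantity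
    is minus a sum of slope jumps. The order of choices matters: rho comes first, then eps of order
    rho^2, so that even the slopes of the hats are at most rho; then the decay exponent [th] and its
    constant, which may degenerate with rho; and s last, large enough to absorb them. All final
    errors are C rho with C independent of rho. *)

Section OneVariable.
Context {R : realType}.
Implicit Types (f F : R -> R) (a b x y t : R).

(** The square of the positive part, a C^1 function from which all smooth cut-offs below are built.
    The product form gives the Caratheodory quotient at 0 directly. *)
Definition pos2 x := x * Num.max 0 x.

(** A quadratic spline rising from 0 to 1 on [0, 1]: the primitive of the triangle [dramp], whose
    peak is 2, at 1/2. *)
Definition ramp t := 2 * (pos2 t - 2 * pos2 (t - 2^-1) + pos2 (t - 1)).

Definition dramp t :=
  4 * (Num.max 0 t - 2 * Num.max 0 (t - 2^-1) + Num.max 0 (t - 1)).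

Lemma continuous_max0 : continuous (fun x : R => Num.max 0 x).
Proof. by move=> x; apply: continuous_max; [exact: cvg_cst|exact: cvg_id]. Qed.

Lemma is_derive_pos2 x : is_derive x 1 pos2 (2 * Num.max 0 x).
Proof.
have [x0|x0|->] := ltgtP x 0.
- apply: (@near_eq_is_derive _ _ _ (cst 0)); last by rewrite mulr0; exact: is_derive_cst.
  near=> y; rewrite /pos2 max_l ?mulr0//.
  by apply: ltW; near: y; exact: lt_nbhsl.
- apply: (@near_eq_is_derive _ _ _ (fun y => y ^+ 2)).
    near=> y; rewrite /pos2 max_r ?expr2//.
    by apply: ltW; near: y; exact: lt_nbhsr.
  by apply: is_derive_eq; rewrite /GRing.scale/=; ring.
- rewrite mulr0; apply/is_derive1_caratheodory.
  exists (fun x => Num.max 0 x); split; last by rewrite maxxx.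
    by move=> z; rewrite /pos2 mul0r !subr0 mulrC.
  exact: continuous_max0.
Unshelve. all: by end_near. Qed.

Lemma is_derive_affine (g : R -> R) dg k c x : is_derive (k * x + c) 1 g dg ->
  is_derive x 1 (fun x => g (k * x + c)) (k * dg).
Proof.
move=> gd.
have h : is_derive x 1 (fun x => k * x + c) k.
  by apply: is_derive_eq; rewrite addr0 scaler1.
by have := @is_derive1_comp _ g (fun x => k * x + c) x _ _ gd h; rewrite mulrC.
Qed.

Lemma is_derive_ramp t : is_derive t 1 ramp (dramp t).
Proof.
have h c : is_derive t 1 (fun t => pos2 (t - c)) (2 * Num.max 0 (t - c)).
  have := @is_derive_affine pos2 _ 1 (- c) t (is_derive_pos2 _).
  by under eq_fun do rewrite mul1r; rewrite !mul1r.
have h0 := is_derive_pos2 t.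
have h1 := h 2^-1; have h2 := h 1.
rewrite /ramp; apply: is_derive_eq; rewrite /dramp /GRing.scale/=; ring.
Qed.

Lemma dramp_continuous : continuous dramp.
Proof.
have h c : continuous (fun t : R => Num.max 0 (t - c)).
  move=> x; apply: (@continuous_comp _ _ _ (fun t => t - c) (fun t => Num.max 0 t)).
    by apply: cvgB; [exact: cvg_id|exact: cvg_cst].
  exact: continuous_max0.
move=> x; apply: cvgM; first exact: cvg_cst.
apply: cvgD; last exact: h.
apply: cvgB; first exact: continuous_max0.
by apply: cvgM; [exact: cvg_cst|exact: h].
Qed.

Lemma dramp_bound t : 0 <= dramp t <= 2.
Proof.
rewrite /dramp; case: (leP 0 t); case: (leP 0 (t - 2^-1)); case: (leP 0 (t - 1)); lra.
Qed.

Lemma dramp_out t : t <= 0 \/ 1 <= t -> dramp t = 0.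
Proof.
rewrite /dramp; case: (leP 0 t); case: (leP 0 (t - 2^-1)); case: (leP 0 (t - 1)); lra.
Qed.

Lemma ramp_le0 t : t <= 0 -> ramp t = 0.
Proof.
by move=> t0; rewrite /ramp /pos2 !max_l ?mulr0; lra.
Qed.

Lemma ramp_ge1 t : 1 <= t -> ramp t = 1.
Proof.
by move=> t0; rewrite /ramp /pos2 !max_r; [field|lra..].
Qed.

Lemma ramp_bound t : 0 <= ramp t <= 1.
Proof.
rewrite /ramp /pos2; case: (leP 0 t); case: (leP 0 (t - 2^-1)); case: (leP 0 (t - 1)); nra.
Qed.

Lemma is_derive_continuous f df x : is_derive x 1 f df -> {for x, continuous f}.
Proof. by move=> fd; apply: differentiable_continuous; exact/derivable1_diffP. Qed.

Lemma within_continuous f (A : set R) : continuous f -> {within A, continuous f}.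
Proof. by move=> cf; apply: continuous_subspaceT. Qed.

Lemma continuous_integrable f a b : continuous f ->
  lebesgue_measure.-integrable `[a, b] (EFin \o f).
Proof.
move=> cf; apply: continuous_compact_integrable; first exact: segment_compact.
exact: within_continuous.
Qed.

Lemma Rintegral_derive F f a b : a <= b -> (forall x, is_derive x 1 F (f x)) ->
  continuous f -> \int[lebesgue_measure]_(x in `[a, b]) f x = F b - F a.
Proof.
rewrite le_eqVlt => /predU1P[-> _ _|ab Ff cf].
  by rewrite set_itv1 Rintegral_set1 subrr.
rewrite /Rintegral (@continuous_FTC2 _ f F)//.
- exact: within_continuous.
- split.
  + by move=> x _; have [] := Ff x.
  + by apply: cvg_at_right_filter; apply: is_derive_continuous.
  + by apply: cvg_at_left_filter; apply: is_derive_continuous.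
- by move=> x _; rewrite derive1E; have [_ ->] := Ff x.
Qed.

(** A base point [a] to the left of both 0 and [s] removes the sign convention in [primitive], so
    that the fundamental theorem applies to a single integral. *)
Lemma primitive_eq f a s : continuous f -> a <= 0 -> a <= s ->
  primitive f s = \int[lebesgue_measure]_(t in `[a, s]) f t -
                  \int[lebesgue_measure]_(t in `[a, 0]) f t.
Proof.
move=> cf a0 as_; rewrite /primitive; case: ifPn => [s0|].
  rewrite Rintegral_itvB ?bnd_simp//; last exact: continuous_integrable.
  rewrite Rintegral_itv_obnd_cbnd//.
  apply: integrableS (continuous_integrable 0 s cf) => //.
  by apply: subset_itvr; rewrite bnd_simp.
rewrite -ltNge => s0.
rewrite -[RHS]opprB Rintegral_itvB ?bnd_simp ?(ltW s0)//; last exact: continuous_integrable.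
rewrite Rintegral_itv_obnd_cbnd//.
apply: integrableS (continuous_integrable s 0 cf) => //.
by apply: subset_itvr; rewrite bnd_simp.
Qed.

Lemma is_derive_primitive f x : continuous f -> is_derive x 1 (primitive f) (f x).
Proof.
move=> cf; pose a := Num.min (x - 1) (-1).
have ax : a < x by rewrite /a gt_min ltrBlDr ltrDl ltr01.
have a0 : a <= 0 by rewrite /a ge_min lerN10 orbT.
have xx1 : x < x + 1 by rewrite ltrDl.
have [d1 d2] := @continuous_FTC1_closed _ f a x (x + 1) xx1
  (continuous_integrable _ _ cf) ax (cf x).
rewrite derive1E in d2.
have h : is_derive x 1 (fun s => \int[lebesgue_measure]_(t in `[a, s]) f t -
                  \int[lebesgue_measure]_(t in `[a, 0]) f t) (f x - 0).
  by apply: is_deriveB; split.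
rewrite subr0 in h; apply: near_eq_is_derive h.
near=> s; rewrite (@primitive_eq _ a)//.
by apply: ltW; near: s; exact: lt_nbhsr.
Unshelve. all: by end_near. Qed.

Lemma primitive0 f : primitive f 0 = 0.
Proof. by rewrite /primitive lexx set_itv1 Rintegral_set1. Qed.

Lemma MVT_le f df (C : R) a b : (forall x, is_derive x 1 f (df x)) ->
  (forall x, Num.min a b <= x <= Num.max a b -> `|df x| <= C) ->
  `|f b - f a| <= C * `|b - a|.
Proof.
move=> fd dfC.
wlog ab : a b dfC / a <= b.
  move=> H; have [|/ltW ba] := leP a b; first exact: H.
  by rewrite distrC (distrC b); apply: H => // x; rewrite minC maxC; apply: dfC.
have [x xab ->] := @MVT_segment _ f df a b ab (fun x _ => fd x)
  (within_continuous (fun x => is_derive_continuous (fd x))).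
by rewrite normrM ler_wpM2r// dfC// min_l// max_r//; move: xab; rewrite in_itv/=.
Qed.

Lemma continuous_bounded f a b : continuous f ->
  exists2 C, 0 < C & forall x, a <= x <= b -> `|f x| <= C.
Proof.
move=> cf; have [ab|ba] := leP a b; last first.
  by exists 1 => // x /andP[h1 h2]; have := le_trans h1 h2; rewrite leNgt ba.
have cn : {within `[a, b], continuous (fun x => `|f x|)}.
  apply: within_continuous => x; apply: continuous_comp; first exact: cf.
  exact: norm_continuous.
have [c _ cP] := EVT_max ab cn.
exists (`|f c| + 1) => [|x xab]; first by rewrite ltr_wpDl.
by rewrite (le_trans (cP x _)) ?lerDl// in_itv.
Qed.

End OneVariable.

(** * Planar integration *)

Section Plane.
Context {R : realType}.
Local Notation mu := (@lebesgue_measure R).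
Local Notation mu2 := ((@lebesgue_measure R \x @lebesgue_measure R)%E).

Local Notation mR := (measurableTypeR R).
Local Notation P := (measurableTypeR R * measurableTypeR R)%type.
Local Notation mf2 := (@measurable_fun _ _ (measurableTypeR R * measurableTypeR R)%type R).
Local Notation I01 := `[(0 : R), 1[%classic.

(** An open set is the union of the boxes with rational corners that it contains, and there are
    countably many of these. *)
Lemma open_measurable2 (U : set (R * R)) : open U -> measurable (U : set P).
Proof.
move=> oU.
pose box (t : (rat * rat) * (rat * rat)) : set (R * R) :=
  `](ratr t.1.1 : R), ratr t.1.2[%classic `*` `](ratr t.2.1 : R), ratr t.2.2[%classic.
have -> : U = \bigcup_(t in [set t | box t `<=` U]) box t.
  apply/seteqP; split => [[x y] Uxy|z [t /= tU]]; last exact: tU.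
  have [[V W] /= [/nbhs_ballP[e e0 eV] /nbhs_ballP[d d0 dW]] VWU] : nbhs (x, y) U.
    by move: oU; rewrite openE => /(_ _ Uxy).
  have rat_box (c r : R) : 0 < r -> exists2 t : rat * rat, c \in `](ratr t.1 : R), ratr t.2[ &
      `](ratr t.1 : R), ratr t.2[%classic `<=` ball c r.
    move=> r0.
    have [a] := @rat_in_itvoo R (c - r) c ltac:(lra).
    have [b] := @rat_in_itvoo R c (c + r) ltac:(lra).
    rewrite !in_itv/= => /andP[cb br] /andP[ra ac].
    exists (a, b); first by rewrite in_itv/= ac.
    move=> z /=; rewrite in_itv/= => /andP[az zb].
    by rewrite /ball/= ltr_norml; apply/andP; split; lra.
  have [s xs sV] := rat_box x e e0; have [t yt tW] := rat_box y d d0.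
  exists (s, t); last by split.
  by move=> [u v] [/= us vt]; apply: VWU; split; [apply/eV/sV|apply/dW/tW].
rewrite bigcup_mkcond; apply: countable_bigcupT_measurable => // t.
by case: ifP => // _; apply: measurableX; exact: measurable_itv.
Qed.

Lemma continuous_measurable2 (u : R * R -> R) : continuous u -> mf2 setT u.
Proof.
move=> cu; apply: (measurability _ (RGenOpens.measurableE R)).
move=> _ [_ [a [b ->] <-]]; rewrite setTI.
by apply: open_measurable2; move/continuousP : cu; apply; exact: interval_open.
Qed.

Definition sqn (x : R * R) : R := x.1 ^+ 2 + x.2 ^+ 2.

Lemma sqn_ge0 x : 0 <= sqn x.
Proof. by rewrite addr_ge0// sqr_ge0. Qed.

Lemma continuous_sqn : continuous sqn.
Proof.
move=> x; apply: cvgD; apply: cvgM; (exact: cvg_fst || exact: cvg_snd).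
Qed.

Lemma measurable_sqn : mf2 setT sqn.
Proof. by apply: continuous_measurable2; exact: continuous_sqn. Qed.

Lemma enormE x : enorm x = Num.sqrt (sqn x).
Proof. by []. Qed.

Lemma diskE : disk = [set x : R * R | sqn x < 1].
Proof.
apply/seteqP; split => x; rewrite /disk/= enormE => h.
  by rewrite -(sqr_sqrtr (sqn_ge0 x)) expr_lt1.
by rewrite -[ltRHS]sqrtr1 ltr_sqrt.
Qed.

Lemma open_disk : open (@disk R).
Proof.
rewrite diskE; have /continuousP := continuous_sqn.
by move=> /(_ _ (@open_lt R 1)).
Qed.

Lemma measurable_disk : measurable (@disk R : set P).
Proof. by apply: open_measurable2; exact: open_disk. Qed.

(** The chord lengths of a disk of radius r add up to its area: x = r sin t turns the integrand into
    2 r^2 cos^2 t, with primitive r^2 (t + sin t cos t). *)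
Lemma integral_half_circle (r : R) : 0 < r ->
  (\int[mu]_(x in `[(- r)%R, r]) (2 * Num.sqrt (r ^+ 2 - x ^+ 2))%:E = (pi * r ^+ 2)%:E)%E.
Proof.
move=> r0; pose F (t : R) := r * sin t.
have dF (t : R) : is_derive t (1 : R) F (r * cos t).
  by apply: is_derive_eq; rewrite /GRing.scale/=; ring.
have F' : derive1 F = fun t => r * cos t.
  by apply/funext => t; rewrite derive1E; have [_ ->] := dF t.
have cF' : continuous (fun t : R => r * cos t).
  by move=> t; apply: cvgM; [exact: cvg_cst|exact: continuous_cos].
have cF : continuous F by move=> t; exact: is_derive_continuous.
have p0 : - (pi / 2) <= pi / 2 :> R by have := pi_gt0 R; lra.
have FN : F (- (pi / 2)) = - r by rewrite /F sinN sin_pihalf mulrN1.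
have FP : F (pi / 2) = r by rewrite /F sin_pihalf mulr1.
have := @integration_by_substitution_increasing R F (fun x => 2 * Num.sqrt (r ^+ 2 - x ^+ 2)) _ _ p0.
rewrite FN FP => -> //; first last.
- apply: within_continuous => x; apply: cvgM; first exact: cvg_cst.
  apply: continuous_comp; last exact: sqrt_continuous.
  by apply: cvgB; [exact: cvg_cst|exact: exprn_continuous].
- split.
  + by move=> t _; have [] := dF t.
  + by apply: cvg_at_right_filter; exact: cF.
  + by apply: cvg_at_left_filter; exact: cF.
- by rewrite F'; apply: (cvgP (r * cos (pi / 2))); apply: cvg_at_left_filter; exact: cF'.
- by rewrite F'; apply: (cvgP (r * cos (- (pi / 2)))); apply: cvg_at_right_filter; exact: cF'.
- by rewrite F' => t _; exact: cF'.
- by move=> s t sI tI st; rewrite /F ltr_pM2l// ltr_sin.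
rewrite F'.
pose G (t : R) := r ^+ 2 * (t + sin t * cos t).
have dG (t : R) : is_derive t (1 : R) G (2 * r ^+ 2 * cos t ^+ 2).
  apply: is_derive_eq; rewrite /GRing.scale/=.
  have := cos2Dsin2 t; set c := cos t; set s := sin t => cs.
  by have -> : r ^+ 2 * (1 + (s * - s + c * c)) = r ^+ 2 * (1 - (c ^+ 2 + s ^+ 2) + 2 * c ^+ 2); [ring|rewrite cs; ring].
have E (t : R) : t \in `[- (pi / 2), pi / 2]%R ->
    2 * Num.sqrt (r ^+ 2 - (r * sin t) ^+ 2) * (r * cos t) = 2 * r ^+ 2 * cos t ^+ 2.
  rewrite in_itv/= => tI.
  have -> : r ^+ 2 - (r * sin t) ^+ 2 = (r * cos t) ^+ 2 by rewrite !exprMn cos2sin2; ring.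
  rewrite sqrtr_sqr ger0_norm; first by ring.
  by apply: mulr_ge0; [exact: ltW|exact: cos_ge0_pihalf].
rewrite (eq_integral (fun t : mR => (2 * r ^+ 2 * cos t ^+ 2)%:E)); last first.
  by move=> t; rewrite inE/= => /E Et; congr EFin; rewrite -Et.
rewrite (@continuous_FTC2 _ _ G)//.
- rewrite /G sinN cosN cos_pihalf !mulr0 !addr0 -EFinB; congr EFin.
  by field.
- rewrite lt_neqAle p0 andbT; apply/eqP; have := pi_gt0 R; lra.
- apply: within_continuous => t; apply: cvgM; first exact: cvg_cst.
  by apply: (@continuous_comp _ _ _ cos (fun x : R => x ^+ 2)); [exact: continuous_cos|exact: exprn_continuous].
- split.
  + by move=> t _; have [] := dG t.
  + by apply: cvg_at_right_filter; apply: is_derive_continuous.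
  + by apply: cvg_at_left_filter; apply: is_derive_continuous.
- by move=> t _; rewrite derive1E; have [_ ->] := dG t.
Qed.

(** The vertical section at x is a chord; for |x| >= r the square root of a nonpositive number is 0
    and the section is empty, as it should be. The maximum covers y <= 0. *)
Lemma area_disk (y : R) : mu2 [set x | sqn x < y] = (pi * Num.max 0 y)%:E.
Proof.
have [y0|y0] := leP y 0.
  rewrite (_ : [set _ | _] = set0) ?measure0 ?mulr0//.
  by apply/seteqP; split => // x /= /(le_lt_trans (sqn_ge0 x)); rewrite ltNge y0.
pose r : R := Num.sqrt y; have r0 : 0 < r by rewrite sqrtr_gt0.
have ry : y = r ^+ 2 by rewrite sqr_sqrtr// ltW.
rewrite ry -integral_half_circle// /product_measure1 [RHS]integral_mkcond.
apply: eq_integral => x _ /=; rewrite patchE.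
rewrite (_ : xsection _ x = `](- Num.sqrt (r ^+ 2 - x ^+ 2)), (Num.sqrt (r ^+ 2 - x ^+ 2))[%classic); last first.
  apply/seteqP; split => t; rewrite /xsection/= inE/= in_itv/= -ltr_norml /sqn/=.
    move=> h; rewrite -sqrtr_sqr ltr_sqrt; first by lra.
    by have := sqr_ge0 t; lra.
  move=> h; have s0 : 0 < Num.sqrt (r ^+ 2 - x ^+ 2) by exact: le_lt_trans h.
  rewrite -sqrtr_sqr in h; rewrite sqrtr_gt0 in s0.
  by rewrite ltr_sqrt// in h; lra.
rewrite lebesgue_measure_itv/= lte_fin.
pose s : R := Num.sqrt (r ^+ 2 - x ^+ 2); rewrite -/s.
have -> : (if - s < s then (s%:E + (- - s)%:E)%E else 0%E) = (2 * s)%:E.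
  case: ifPn => [_|]; first by rewrite -EFinD; congr EFin; ring.
  rewrite -leNgt => h; have : 0 <= s by exact: sqrtr_ge0.
  by move=> h2; have -> : s = 0; [lra|rewrite mulr0].
case: ifPn => //; rewrite notin_setE/= in_itv/= => /negP.
rewrite -ler_norml -ltNge => /ltW rx.
rewrite /s ler0_sqrtr ?mulr0// subr_le0 -(real_normK (num_real x)).
by rewrite ler_pXn2r ?nnegrE// ltW.
Qed.

(** Since the area of {|x|^2 < y} is linear in y, the image of planar measure under |x|^2 is pi
    times Lebesgue measure on the half-line. The two measures are compared on the rays ]-oo, y[, a
    generating family closed under intersection. *)
Lemma pushforward_sqn (A : set mR) : measurable A -> A `<=` `[0, +oo[%classic ->
  pushforward mu2 (sqn : P -> mR) A = (pi%:E * mu A)%E.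
Proof.
move=> mA A0.
have pi0 : 0 <= pi :> R by rewrite ltW// pi_gt0.
pose m1' := [the measure _ _ of pushforward mu2 (sqn : P -> mR)].
pose m1 := m1' measurable_sqn.
pose m2 := [the measure _ _ of mscale (NngNum pi0)
   [the measure _ _ of mrestr mu (measurable_itv `[(0 : R), +oo[)]].
have : m1 A = m2 A.
  pose G : set (set mR) := [set A | exists x : R, A = `]-oo, x[%classic].
  apply: (@measure_unique _ _ (measurableTypeR R) G (fun n => `]-oo, (n%:R : R)[%classic) _ _ _ _ m1 m2) => //.
  - exact: RGenInftyO.measurableE.
  - move=> _ _ [a ->] [b ->]; exists (Num.min a b).
    by apply/seteqP; split => x /=; rewrite !in_itv/= lt_min => /andP.
  - by move=> n; exists n%:R.
  - apply/seteqP; split => // x _; exists (Num.truncn `|x|).+1 => //=.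
    by rewrite in_itv/= (le_lt_trans (ler_norm _))// truncnS_gt.
  - move=> _ [y ->].
    rewrite /m1 /m1' /m2 /= /pushforward /mscale /mrestr/=.
    rewrite (_ : _ @^-1` _ = [set x | sqn x < y]); last first.
      by apply/seteqP; split => x /=; rewrite in_itv.
    rewrite area_disk /mrestr (_ : _ `&` _ = `[0, y[%classic); last first.
      apply/seteqP; split => x /=; rewrite !in_itv/= ?andbT.
        by move=> [-> ->].
      by move=> /andP[-> ->].
    rewrite lebesgue_measure_itv/= lte_fin EFinM; congr (_ * _)%E.
    by case: ltgtP => //; rewrite -EFinB subr0.
  - move=> k; rewrite /m1 /m1' /= /pushforward (_ : _ @^-1` _ = [set x | sqn x < k%:R]); last first.
      by apply/seteqP; split => x /=; rewrite in_itv.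
    by rewrite area_disk ltry.
by rewrite /m1 /m1' /m2 /= /mscale/= /mrestr setIidl.
Qed.

Lemma ge0_radial_integral (G : mR -> \bar R) : measurable_fun I01 G ->
  (forall y, (0 <= G y)%E) ->
  (\int[mu2]_(x in disk) G (sqn x) = pi%:E * \int[mu]_(y in I01) G y)%E.
Proof.
move=> mG G0.
have pi0 : 0 <= pi :> R by rewrite ltW// pi_gt0.
have m01 : measurable (I01 : set mR) by exact: measurable_itv.
rewrite -(@ge0_integral_mscale _ _ _ mu _ _ (NngNum pi0)) //.
transitivity (\int[pushforward mu2 (sqn : P -> mR)]_(y in I01) G y)%E; last first.
  apply: eq_measure_integral => [|ms A mA A01]; first exact: measurable_sqn.
  rewrite -[RHS]/(pi%:E * mu A)%E -pushforward_sqn//.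
  by move=> x /A01/=; rewrite !in_itv/= andbT => /andP[].
rewrite ge0_integral_pushforward//.
  congr (integral _ _ _); rewrite diskE; apply/seteqP.
  by split => x /=; rewrite in_itv/= ?sqn_ge0.
exact: measurable_sqn.
Qed.

Lemma measurable_radial (G : mR -> R) : measurable_fun I01 G ->
  mf2 disk (fun x => G (sqn x)).
Proof.
move=> mG; apply: (@measurable_comp _ _ _ P mR R I01 G disk sqn) => //.
- by move=> _ [x dx <-]; rewrite /= in_itv/= sqn_ge0/=; move: dx; rewrite diskE.
- by apply: measurable_funTS; exact: measurable_sqn.
Qed.

Lemma radial_integrable (G : R -> R) : mu.-integrable I01 (EFin \o G) ->
  mu2.-integrable disk (EFin \o (fun x => G (sqn x))).
Proof.
move=> /integrableP[/measurable_EFinP mG iG].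
apply/integrableP; split; first by apply/measurable_EFinP; exact: measurable_radial.
rewrite (@ge0_radial_integral (abse \o (EFin \o G))) => [|_|y /=]; last by rewrite lee_fin.
  2: by apply: measurableT_comp => //; exact/measurable_EFinP.
by rewrite lte_mul_pinfty// lee_fin ltW// pi_gt0.
Qed.

Lemma radial_Rintegral (G : R -> R) : mu.-integrable I01 (EFin \o G) ->
  \int[mu2]_(x in disk) G (sqn x) = pi * \int[mu]_(y in I01) G y.
Proof.
move=> iG; have iG2 := radial_integrable iG.
have m01 : measurable (I01 : set mR) by exact: measurable_itv.
have mG : measurable_fun I01 (EFin \o G : mR -> \bar R) by case/integrableP : iG.
have fG := integrable_fin_num m01 iG.
rewrite -[RHS]/(fine (pi%:E * (fine (\int[mu]_(y in I01) (G y)%:E))%:E)%E) fineK//; congr fine.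
rewrite [LHS]integralE [in RHS]integralE muleBr//; last first.
  apply: fin_num_adde_defr.
  exact: integrable_pos_fin_num.
rewrite -(ge0_radial_integral (measurable_funepos mG) (funepos_ge0 _)).
rewrite -(ge0_radial_integral (measurable_funeneg mG) (funeneg_ge0 _)).
by congr (_ - _)%E; apply: eq_integral => x _; rewrite ?funeposE ?funenegE.
Qed.

End Plane.

(** * Partial derivatives and test functions in the plane *)

Section SmoothPlane.
Context {R : realType}.
Local Notation mu2 := ((@lebesgue_measure R \x @lebesgue_measure R)%E).
Local Notation P := (measurableTypeR R * measurableTypeR R)%type.
Implicit Types (phi psi u : R * R -> R).

Lemma is_derive_e1 phi (x y : R) (df : R) :
  is_derive (x, y) e1 phi df <-> is_derive x (1 : R) (fun t => phi (t, y)) df.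
Proof.
have E : (fun h : R => h^-1 *: ((phi \o shift (x, y)) (h *: e1) - phi (x, y))) =
    (fun h : R => h^-1 *: (((fun t => phi (t, y)) \o shift x) (h *: (1 : R)) - phi (x, y))).
  apply/funext => h; congr (_ *: (phi _ - _)).
  by rewrite /shift /e1/= -[LHS]/(h *: (1 : R) + x, h *: (0 : R) + y) scaler0 add0r.
by split=> -[d1 d2]; split; rewrite /derivable /derive ?E -?E //; move: d1 d2; rewrite /derivable /derive E.
Qed.

Lemma is_derive_e2 phi (x y : R) (df : R) :
  is_derive (x, y) e2 phi df <-> is_derive y (1 : R) (fun t => phi (x, t)) df.
Proof.
have E : (fun h : R => h^-1 *: ((phi \o shift (x, y)) (h *: e2) - phi (x, y))) =
    (fun h : R => h^-1 *: (((fun t => phi (x, t)) \o shift y) (h *: (1 : R)) - phi (x, y))).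
  apply/funext => h; congr (_ *: (phi _ - _)).
  by rewrite /shift /e2/= -[LHS]/(h *: (0 : R) + x, h *: (1 : R) + y) scaler0 add0r.
by split=> -[d1 d2]; split; rewrite /derivable /derive ?E -?E //; move: d1 d2; rewrite /derivable /derive E.
Qed.

(** The partial derivatives are carried as explicit functions, so that sums, products and
    compositions yield formulas and not just differentiability. *)
Record C1P phi (d1 d2 : R * R -> R) : Prop := {
  C1P_d1 : forall x, is_derive x e1 phi (d1 x);
  C1P_d2 : forall x, is_derive x e2 phi (d2 x);
  C1P_c1 : continuous d1;
  C1P_c2 : continuous d2 }.

(** Vertical increments are controlled by continuity of one slice. Horizontal ones need uniformity
    in the other variable, which the mean value theorem gives, since [d1] is bounded by |d1 (x, y)|
    + 1 near the point. *)
Lemma C1P_continuous phi d1 d2 : C1P phi d1 d2 -> continuous phi.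
Proof.
move=> [p1 p2 c1 _] [x y]; apply/cvgrPdist_lt => /= e e0.
have cy : {for y, continuous (fun t => phi (x, t))}.
  by apply: is_derive_continuous; apply/is_derive_e2; exact: p2.
have /cvgrPdist_lt/(_ 1 ltr01) := c1 (x, y).
move=> [[V W] /= [/nbhs_ballP[r1 /= r10 V1] W1] VW].
pose C := `|d1 (x, y)| + 1.
have C0 : 0 < C by rewrite ltr_wpDl.
have e20 : 0 < e / 2 by rewrite divr_gt0.
move/cvgrPdist_lt : (cy) => /(_ (e / 2) e20) cy2.
exists (ball x (Num.min r1 (e / (2 * C))), [set t | W t /\ `|phi (x, y) - phi (x, t)| < e / 2]).
  split => /=; last by apply: filterI.
  by apply: nbhsx_ballx; rewrite lt_min r10 divr_gt0// mulr_gt0.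
move=> [x' y'] /= [xx' [Wy' yy']].
rewrite -(subrKA (phi (x, y'))) (le_lt_trans (ler_normD _ _))// [ltRHS]splitr ltr_leD//.
have := @MVT_le _ (fun t => phi (t, y')) (fun t => d1 (t, y')) C x' x.
have rx : `|x - x'| < r1 /\ `|x - x'| < e / (2 * C).
  by move: xx'; rewrite /ball/= lt_min => /andP[].
move=> H; apply: (le_trans (H _ _)).
- by move=> t; apply/is_derive_e1; exact: p1.
- move=> t tx; have : `|d1 (x, y) - d1 (t, y')| < 1.
    apply: (VW (t, y')); split => //=; apply: V1; rewrite /ball/=.
    apply: le_lt_trans rx.1; move: tx.
    by case: (leP x' x) => ? /andP[? ?]; [rewrite !ger0_norm; lra|rewrite !ler0_norm; lra].
  rewrite /C; have := ler_distD (d1 (x, y)) 0 (d1 (t, y')); rewrite !sub0r !normrN.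
  by move=> ? ?; lra.
- have -> : e / 2 = C * (e / (2 * C)) by field; rewrite gt_eqF.
  by rewrite ler_pM2l// ltW// rx.2.
Qed.

Lemma C1PM phi d1 d2 psi d1' d2' : C1P phi d1 d2 -> C1P psi d1' d2' ->
  C1P (fun x => phi x * psi x) (fun x => phi x * d1' x + psi x * d1 x)
    (fun x => phi x * d2' x + psi x * d2 x).
Proof.
move=> h1 h2; have := C1P_continuous h1; have := C1P_continuous h2.
case: h1 h2 => [p1 p2 c1 c2] [q1 q2 b1 b2] cpsi cphi; split.
- by move=> x; have := @is_deriveM _ _ phi psi x e1 _ _ (p1 x) (q1 x).
- by move=> x; have := @is_deriveM _ _ phi psi x e2 _ _ (p2 x) (q2 x).
- by move=> x; apply: cvgD; apply: cvgM; [exact: cphi|exact: b1|exact: cpsi|exact: c1].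
- by move=> x; apply: cvgD; apply: cvgM; [exact: cphi|exact: b2|exact: cpsi|exact: c2].
Qed.

Lemma C1PD phi d1 d2 psi d1' d2' : C1P phi d1 d2 -> C1P psi d1' d2' ->
  C1P (fun x => phi x + psi x) (fun x => d1 x + d1' x) (fun x => d2 x + d2' x).
Proof.
case=> [p1 p2 c1 c2] [q1 q2 b1 b2]; split.
- by move=> x; have := @is_deriveD _ _ _ phi psi x e1 _ _ (p1 x) (q1 x).
- by move=> x; have := @is_deriveD _ _ _ phi psi x e2 _ _ (p2 x) (q2 x).
- by move=> x; apply: cvgD; [exact: c1|exact: b1].
- by move=> x; apply: cvgD; [exact: c2|exact: b2].
Qed.

Lemma C1P_comp phi d1 d2 (f df : R -> R) : C1P phi d1 d2 ->
  (forall t, is_derive t (1 : R) f (df t)) -> continuous df ->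
  C1P (fun x => f (phi x)) (fun x => df (phi x) * d1 x) (fun x => df (phi x) * d2 x).
Proof.
move=> h; have cphi := C1P_continuous h; case: h => [p1 p2 c1 c2] fd cd; split.
- move=> [x y]; apply/is_derive_e1.
  have h : is_derive x (1 : R) (fun t => phi (t, y)) (d1 (x, y)) by apply/is_derive_e1.
  exact: (@is_derive1_comp _ f (fun t => phi (t, y)) x _ _ (fd _) h).
- move=> [x y]; apply/is_derive_e2.
  have h : is_derive y (1 : R) (fun t => phi (x, t)) (d2 (x, y)) by apply/is_derive_e2.
  exact: (@is_derive1_comp _ f (fun t => phi (x, t)) y _ _ (fd _) h).
- move=> x; apply: cvgM; last exact: c1.
  by apply: (@continuous_comp _ _ _ phi df); [exact: cphi|exact: cd].
- move=> x; apply: cvgM; last exact: c2.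
  by apply: (@continuous_comp _ _ _ phi df); [exact: cphi|exact: cd].
Qed.

Lemma C1P_cst (c : R) : C1P (cst c) (cst 0) (cst 0).
Proof. by split=> x; [exact: is_derive_cst|exact: is_derive_cst|exact: cst_continuous|exact: cst_continuous]. Qed.

Lemma C1P_fst : C1P fst (cst 1) (cst 0).
Proof.
split; [move=> [x y]; apply/is_derive_e1 => /=; exact: is_derive_id|
  move=> [x y]; apply/is_derive_e2 => /=; exact: is_derive_cst|move=> x; exact: cst_continuous|
  move=> x; exact: cst_continuous].
Qed.

Lemma C1P_snd : C1P snd (cst 0) (cst 1).
Proof.
split; [move=> [x y]; apply/is_derive_e1 => /=; exact: is_derive_cst|
  move=> [x y]; apply/is_derive_e2 => /=; exact: is_derive_id|move=> x; exact: cst_continuous|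
  move=> x; exact: cst_continuous].
Qed.

Lemma C1P_ext phi d1 d2 phi' d1' d2' : C1P phi d1 d2 ->
  phi =1 phi' -> d1 =1 d1' -> d2 =1 d2' -> C1P phi' d1' d2'.
Proof. by move=> h /funext <- /funext <- /funext <-. Qed.

Lemma C1P_sqn : C1P (@sqn R) (fun x => 2 * x.1) (fun x => 2 * x.2).
Proof.
have := C1PD (C1PM C1P_fst C1P_fst) (C1PM C1P_snd C1P_snd).
move/C1P_ext; apply => x; rewrite /sqn /cst; ring.
Qed.

Lemma closed_sqn_le (r : R) : closed [set x : R * R | sqn x <= r].
Proof.
rewrite (_ : [set _ | _] = sqn @^-1` [set t : R | t <= r])//.
apply: preimage_closed; last exact: closed_le.
by move=> x _; exact: continuous_sqn.
Qed.

Lemma compact_sqn_le (r : R) : compact [set x : R * R | sqn x <= r].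
Proof.
apply: (@subclosed_compact _ _ (`[- (1 + `|r|), 1 + `|r|]%classic `*` `[- (1 + `|r|), 1 + `|r|]%classic)).
- exact: closed_sqn_le.
- by apply: compact_setX; exact: segment_compact.
- move=> [x y]; rewrite /sqn/= => h; rewrite !in_itv/= -!ler_norml.
  have := ler_norm r; have := normr_ge0 r.
  have := real_normK (num_real x); have := real_normK (num_real y).
  have := sqr_ge0 (`|x| - 1); have := sqr_ge0 (`|y| - 1); rewrite !sqrrB1.
  by have := sqr_ge0 x; have := sqr_ge0 y; split; lra.
Qed.

Lemma C1c_intro phi d1 d2 (r : R) : C1P phi d1 d2 -> r < 1 ->
  (forall x, r <= sqn x -> phi x = 0) -> C1c phi.
Proof.
move=> [p1 p2 c1 c2] r1 phi0.
have sub : closure [set x | phi x != 0] `<=` [set x | sqn x <= r].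
  have : closed [set x : R * R | sqn x <= r].
    exact: closed_sqn_le.
  move/closure_id => ->; apply: closure_subset => x /= x0.
  by rewrite leNgt; apply: contra x0 => /ltW/phi0 ->.
split.
- by move=> x; have [? _] := p1 x; have [? _] := p2 x.
- by have -> : 'D_e1 phi = d1 by apply/funext => x; have [_ <-] := p1 x.
- by have -> : 'D_e2 phi = d2 by apply/funext => x; have [_ <-] := p2 x.
- by apply: (subclosed_compact _ (@compact_sqn_le r) sub); exact: closed_closure.
- by move=> x /sub /=; rewrite diskE/= => h; exact: le_lt_trans r1.
Qed.

(** The maximum of [sqn] on the compact support is below 1, so compact support in the open disk
    amounts to vanishing beyond some radius. *)
Lemma C1c_elim phi : C1c phi -> C1P phi ('D_e1 phi) ('D_e2 phi) /\
  exists2 r : R, 0 < r < 1 & forall x, r <= sqn x -> [/\ phi x = 0, 'D_e1 phi x = 0 & 'D_e2 phi x = 0].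
Proof.
move=> [p12 c1 c2 cK KD]; split.
  by split; [move=> x; have [? _] := p12 x; split|move=> x; have [_ ?] := p12 x; split|exact: c1|exact: c2].
set K := closure _ in cK KD.
have [r0 r01 Kr] : exists2 r : R, 0 < r < 1 & forall x, K x -> sqn x <= r.
  have [->|/set0P K0] := eqVneq K set0.
    by exists 2^-1 => //; apply/andP; split; lra.
  have cs : {within K, continuous (@sqn R)}.
    by apply: continuous_subspaceT; exact: continuous_sqn.
  have [c /set_mem Kc cP] := compact_EVT_max K0 cK cs.
  have c1' : sqn c < 1 by have := KD _ Kc; rewrite diskE.
  exists (Num.max (sqn c) 2^-1); last first.
    by move=> x Kx; rewrite le_max cP ?inE.
  by rewrite lt_max gt_max c1'; apply/andP; split; [rewrite invr_gt0 orbC ltr0n|lra].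
(* A radius strictly beyond the support: every point with sqn x >= r then has a neighbourhood on
   which [phi] vanishes, so its derivatives vanish there as well. *)
exists ((r0 + 1) / 2) => [|x rx]; first by move: r01 => /andP[? ?]; apply/andP; split; lra.
have phi0 z : r0 < sqn z -> phi z = 0.
  move=> rz; apply/eqP; apply: contraTT (rz) => z0; rewrite -leNgt; apply: Kr.
  exact: subset_closure.
have rx0 : r0 < sqn x by move: r01 => /andP[? ?]; lra.
have nx : \forall z \near x, cst 0 z = phi z.
  have : nbhs x (sqn @^-1` [set t | r0 < t]).
    by apply: continuous_sqn; exact: lt_nbhsr.
  by apply: filterS => z /= /phi0 ->.
have d0 e : 'D_e phi x = 0.
  by rewrite -(near_eq_derive e nx); have [_ ->] := is_derive_cst (0:R) x e.
by split => //; rewrite phi0.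
Qed.

Lemma continuous_bounded_disk u : continuous u ->
  exists2 C : R, 0 < C & forall x, sqn x <= 1 -> `|u x| <= C.
Proof.
move=> cu; have cn : {within [set x : R * R | sqn x <= 1], continuous (fun x => `|u x|)}.
  apply: continuous_subspaceT => x; apply: continuous_comp; first exact: cu.
  exact: norm_continuous.
have ne : [set x : R * R | sqn x <= 1] !=set0.
  by exists (0, 0); rewrite /= /sqn/= expr0n/= addr0.
have [c _ cP] := compact_EVT_max ne (@compact_sqn_le 1) cn.
exists (`|u c| + 1) => [|x x1]; first by rewrite ltr_wpDl.
by rewrite (le_trans (cP x _)) ?lerDl// inE.
Qed.

Lemma mu2_disk : mu2 (@disk R) = pi%:E.
Proof. by rewrite diskE area_disk max_r ?mulr1. Qed.

Lemma bounded_integrable_disk (u : P -> R) (C : R) : measurable_fun disk u ->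
  (forall x, disk x -> `|u x| <= C) -> mu2.-integrable disk (EFin \o u).
Proof.
move=> mu_ uC; apply: measurable_bounded_integrable => //.
- exact: measurable_disk.
- by have h : (mu2 (@disk R) < +oo)%E; [rewrite mu2_disk ltry|exact: h].
- exists C; split; first exact: num_real.
  by move=> M CM x dx /=; exact: le_trans (uC _ dx) (ltW CM).
Qed.

Lemma continuous_integrable_disk u : continuous u -> mu2.-integrable disk (EFin \o u).
Proof.
move=> cu; have [C _ uC] := continuous_bounded_disk cu.
apply: (@bounded_integrable_disk u C).
  by apply: measurable_funTS; exact: continuous_measurable2.
by move=> x; rewrite diskE/= => /ltW/uC.
Qed.

End SmoothPlane.

(** * Integrals of derivatives and the Gagliardo inequality *)

Section PlaneIntegrals.
Context {R : realType}.
Local Notation mu := (@lebesgue_measure R).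
Local Notation mu2 := ((@lebesgue_measure R \x @lebesgue_measure R)%E).
Local Notation mR := (measurableTypeR R).
Local Notation P := (measurableTypeR R * measurableTypeR R)%type.
Implicit Types (phi psi u : R * R -> R).

Lemma integral_derive0 (F f : R -> R) : (forall x, is_derive x (1 : R) F (f x)) ->
  continuous f -> (forall x, 1 <= `|x| -> F x = 0 /\ f x = 0) ->
  (\int[mu]_x (f x)%:E = 0)%E.
Proof.
move=> Ff cf F0.
rewrite (_ : (fun x => (f x)%:E) = (fun x : mR => (f x)%:E) \_ `[-1, 1]%classic); last first.
  apply/funext => x; rewrite patchE; case: ifPn => //.
  rewrite notin_setE/= in_itv/= => /negP; rewrite -ler_norml -ltNge => /ltW h.
  by have [_ ->] := F0 _ h.
rewrite -integral_mkcond.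
have N1 : -1 <= 1 :> R by lra.
have H := Rintegral_derive N1 Ff cf.
have i1 := continuous_integrable (-1) 1 cf.
have f1 : (\int[mu]_(x in `[(-1)%R, 1%R]) (f x)%:E)%E \is a fin_num.
  by apply: (integrable_fin_num _ i1); exact: measurable_itv.
rewrite -(fineK f1) -/(Rintegral mu _ _) H.
have [-> _] := F0 1 ltac:(by rewrite normr1).
have [-> _] := F0 (-1) ltac:(by rewrite normrN normr1).
by rewrite subrr.
Qed.

Lemma le_integral_derive (F f : R -> R) x : (forall x, is_derive x (1 : R) F (f x)) ->
  continuous f -> (forall x, 1 <= `|x| -> F x = 0) ->
  (`|F x|%:E <= \int[mu]_t `|f t|%:E)%E.
Proof.
move=> Ff cf F0; have [x1|x1] := leP 1 `|x|.
  by rewrite F0// normr0; apply: integral_ge0 => t _; rewrite lee_fin.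
have Nx : -1 <= x by move: x1; rewrite ltr_norml => /andP[/ltW].
have H := Rintegral_derive Nx Ff cf.
have F1 : F (-1) = 0 by rewrite F0// normrN normr1.
rewrite F1 subr0 in H; rewrite -H.
have i1 := continuous_integrable (-1) x cf.
rewrite (EFin_normr_Rintegral _ i1); last exact: measurable_itv.
apply: (@le_trans _ _ (\int[mu]_(t in `[(-1)%R, x]) `|(f t)%:E|)%E).
  apply: le_abse_integral => //.
  by case/integrableP : i1.
apply: ge0_subset_integral => //.
apply/measurable_EFinP; apply: measurableT_comp => //.
exact: continuous_measurable_fun.
Qed.

Lemma integral_disk_setT u : (forall x, 1 <= sqn x -> u x = 0) ->
  (\int[mu2]_(x in disk) (u x)%:E = \int[mu2]_x (u x)%:E)%E.
Proof.
move=> u0; rewrite integral_mkcond; congr integral.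
apply/funext => x; rewrite patchE; case: ifPn => //.
by rewrite notin_setE diskE/= => /negP; rewrite -leNgt => /u0 ->.
Qed.

Lemma integrable_disk_setT u : continuous u -> (forall x, 1 <= sqn x -> u x = 0) ->
  mu2.-integrable setT (EFin \o u).
Proof.
move=> cu u0; have := continuous_integrable_disk cu.
rewrite (integrable_mkcond _ measurable_disk)/=; congr (is_true (integrable _ _ _)).
apply/funext => x; rewrite patchE; case: ifPn => //.
by rewrite notin_setE diskE/= => /negP; rewrite -leNgt => /u0 /= ->.
Qed.

Lemma sqn_ge1l (x y : R) : 1 <= `|x| -> 1 <= sqn (x, y).
Proof.
rewrite /sqn/= -(real_normK (num_real x)) => x1; have := sqr_ge0 y; nra.
Qed.

Lemma sqn_ge1r (x y : R) : 1 <= `|y| -> 1 <= sqn (x, y).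
Proof.
rewrite /sqn/= -(real_normK (num_real y)) => x1; have := sqr_ge0 x; nra.
Qed.

Lemma continuous_slice1 u (y : R) : continuous u -> continuous (fun t => u (t, y)).
Proof.
move=> cu t; apply: (@continuous_comp _ _ _ (fun t : R => (t, y)) u); last exact: cu.
exact: (cvg_pair cvg_id (cvg_cst y)).
Qed.

Lemma continuous_slice2 u (x : R) : continuous u -> continuous (fun t => u (x, t)).
Proof.
move=> cu t; apply: (@continuous_comp _ _ _ (fun t : R => (x, t)) u); last exact: cu.
exact: (cvg_pair (cvg_cst x) cvg_id).
Qed.

(** By Fubini, since every line integral of the derivative is a difference of two values outside the
    disk. *)
Lemma C1P_integral0 phi d1 d2 : C1P phi d1 d2 ->
  (forall x, 1 <= sqn x -> [/\ phi x = 0, d1 x = 0 & d2 x = 0]) ->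
  \int[mu2]_(x in disk) d1 x = 0 /\ \int[mu2]_(x in disk) d2 x = 0.
Proof.
move=> [p1 p2 c1 c2] p0; rewrite /Rintegral; split.
- rewrite integral_disk_setT => [|x /p0[]//].
  rewrite -(@integral21_prod_meas1 _ _ _ _ _ mu mu (EFin \o d1)); last first.
    by apply: integrable_disk_setT => // x /p0[].
  rewrite integral0_eq// => y _; rewrite /fubini_G.
  apply: (@integral_derive0 (fun t => phi (t, y))) => [x||x /(@sqn_ge1l _ y)/p0[]//].
    by apply/is_derive_e1.
  exact: continuous_slice1.
- rewrite integral_disk_setT => [|x /p0[]//].
  rewrite -(@integral12_prod_meas1 _ _ _ _ _ mu mu (EFin \o d2)); last first.
    by apply: integrable_disk_setT => // x /p0[].
  rewrite integral0_eq// => x _; rewrite /fubini_F.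
  apply: (@integral_derive0 (fun t => phi (x, t))) => [y||y /(@sqn_ge1r x)/p0[]//].
    by apply/is_derive_e2.
  exact: continuous_slice2.
Qed.

(** Gagliardo's argument: |phi (x, y)| is at most the integral of |d1| along the horizontal line and
    of |d2| along the vertical one. The first bound, [al], depends on y only and the second, [be],
    on x only, so the integral of their product factors. *)
Lemma C1P_gagliardo phi d1 d2 : C1P phi d1 d2 ->
  (forall x, 1 <= sqn x -> [/\ phi x = 0, d1 x = 0 & d2 x = 0]) ->
  \int[mu2]_(x in disk) (phi x ^+ 2) <=
  (\int[mu2]_(x in disk) `|d1 x|) * (\int[mu2]_(x in disk) `|d2 x|).
Proof.
move=> h p0; have cphi := C1P_continuous h.
case: h => [p1 p2 c1 c2].
have cn (d : R * R -> R) : continuous d -> continuous (fun x => `|d x|).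
  by move=> cd x; apply: continuous_comp; [exact: cd|exact: norm_continuous].
have m1 : measurable_fun setT (fun x : P => `|d1 x|%:E).
  by apply/measurable_EFinP; apply: continuous_measurable2; exact: cn.
have m2 : measurable_fun setT (fun x : P => `|d2 x|%:E).
  by apply/measurable_EFinP; apply: continuous_measurable2; exact: cn.
have n1 (x : P) : (0 <= `|d1 x|%:E)%E by rewrite lee_fin.
have n2 (x : P) : (0 <= `|d2 x|%:E)%E by rewrite lee_fin.
pose al (y : mR) : \bar R := (\int[mu]_x `|d1 (x, y)|%:E)%E.
pose be (x : mR) : \bar R := (\int[mu]_y `|d2 (x, y)|%:E)%E.
have mal : measurable_fun setT al by exact: (@measurable_fun_fubini_tonelli_G _ _ mR mR R mu _ m1 n1).
have mbe : measurable_fun setT be by exact: (@measurable_fun_fubini_tonelli_F _ _ mR mR R mu _ m2 n2).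
have al0 y : (0 <= al y)%E by apply: integral_ge0 => ? _; rewrite lee_fin.
have be0 x : (0 <= be x)%E by apply: integral_ge0 => ? _; rewrite lee_fin.
have pab x y : ((phi (x, y) ^+ 2)%:E <= be x * al y)%E.
  rewrite -(real_normK (num_real _)) expr2 EFinM; apply: lee_pmul; rewrite ?lee_fin//.
    apply: (@le_integral_derive (fun t => phi (x, t)) (fun t => d2 (x, t))).
    - by move=> t; apply/is_derive_e2.
    - exact: continuous_slice2.
    - by move=> t /(@sqn_ge1r x)/p0[].
  apply: (@le_integral_derive (fun t => phi (t, y)) (fun t => d1 (t, y))).
  - by move=> t; apply/is_derive_e1.
  - exact: continuous_slice1.
  - by move=> t /(@sqn_ge1l _ y)/p0[].
have mba : measurable_fun setT (fun z : P => be z.1 * al z.2)%E.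
  by apply: emeasurable_funM; apply: measurableT_comp.
have I1 : (\int[mu2]_(x in disk) `|d1 x|%:E = \int[mu]_y al y)%E.
  rewrite integral_disk_setT => [|x /p0[_ -> _]]; last by rewrite normr0.
  by rewrite (@fubini_tonelli2 _ _ mR mR R mu mu _ m1 n1).
have I2 : (\int[mu2]_(x in disk) `|d2 x|%:E = \int[mu]_x be x)%E.
  rewrite integral_disk_setT => [|x /p0[_ _ ->]]; last by rewrite normr0.
  by rewrite (@fubini_tonelli1 _ _ mR mR R mu mu _ m2 n2).
have f1 : (\int[mu2]_(x in disk) `|d1 x|%:E)%E \is a fin_num.
  by apply: integrable_fin_num (continuous_integrable_disk (cn _ c1)); exact: measurable_disk.
have f2 : (\int[mu2]_(x in disk) `|d2 x|%:E)%E \is a fin_num.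
  by apply: integrable_fin_num (continuous_integrable_disk (cn _ c2)); exact: measurable_disk.
have csq : continuous (fun x => phi x ^+ 2).
  by move=> x; apply: (@continuous_comp _ _ _ phi (fun t => t ^+ 2)); [exact: cphi|exact: exprn_continuous].
have f3 : (\int[mu2]_(x in disk) (phi x ^+ 2)%:E)%E \is a fin_num.
  by apply: integrable_fin_num (continuous_integrable_disk csq); exact: measurable_disk.
rewrite /Rintegral -lee_fin EFinM !fineK// I1 I2.
rewrite integral_disk_setT => [|x /p0[-> _ _]]; last by rewrite expr0n.
apply: (@le_trans _ _ (\int[mu2]_z (be z.1 * al z.2))%E).
  apply: ge0_le_integral => //.
  - by move=> x _; rewrite lee_fin sqr_ge0.
  - by apply/measurable_EFinP; exact: continuous_measurable2.
  - by move=> [x y] _; exact: pab.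
have n3 (z : P) : (0 <= be z.1 * al z.2)%E by apply: mule_ge0.
rewrite (@fubini_tonelli1 _ _ mR mR R mu mu _ mba n3).
rewrite /fubini_F /=.
under eq_integral do rewrite ge0_integralZl//.
rewrite -I1 -(fineK f1).
rewrite ge0_integralZr// ?lee_fin ?fine_ge0//; last by apply: integral_ge0 => ? _; rewrite lee_fin.
by rewrite muleC.
Qed.

End PlaneIntegrals.

(** * Square integrable functions and weak derivatives *)

Lemma Rintegral_dominated d (T : measurableType d) (R : realType)
    (m : {measure set T -> \bar R}) (D : set T) (un : nat -> T -> R) (u g : T -> R) :
  measurable D -> (forall n, measurable_fun D (un n)) ->
  (forall x, D x -> un n x @[n --> \oo] --> u x) ->
  m.-integrable D (EFin \o g) -> (forall n x, D x -> `|un n x| <= g x) ->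
  m.-integrable D (EFin \o u) /\
  Rintegral m D (un n) @[n --> \oo] --> Rintegral m D u.
Proof.
move=> mD mun cun ig bun.
have mlim : measurable_fun D u by exact: (measurable_fun_cvg mun).
have cE x : D x -> (un n x)%:E @[n --> \oo] --> (u x)%:E.
  by move=> Dx; apply/fine_cvgP; split; [exact: nearW|exact: cun].
have bE x n : D x -> (`|(un n x)%:E| <= (g x)%:E)%E.
  by move=> Dx; rewrite lee_fin bun.
have [iu _ cI] := @dominated_convergence _ T R m D mD
  (fun n => EFin \o un n) (EFin \o u) (EFin \o g)
  (fun n => (measurable_EFinP _ _).2 (mun n)) ((measurable_EFinP _ _).2 mlim)
  (aeW _ cE) ig (aeW _ bE).
split => //.
have fu : (\int[m]_(x in D) (u x)%:E)%E \is a fin_num by exact: integrable_fin_num iu.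
by apply: fine_cvg; rewrite fineK.
Qed.

Section DiskL2.
Context {R : realType}.
Local Notation mu2 := ((@lebesgue_measure R \x @lebesgue_measure R)%E).
Local Notation mR := (measurableTypeR R).
Local Notation P := (measurableTypeR R * measurableTypeR R)%type.
Local Notation mf2 := (@measurable_fun _ _ (measurableTypeR R * measurableTypeR R)%type R).
Implicit Types (phi psi u v : R * R -> R).
Local Notation I u := (Rintegral mu2 disk u).
Local Notation Int u := (mu2.-integrable disk (EFin \o u)).

Lemma Int_mf u : Int u -> mf2 disk u.
Proof. by move=> /integrableP[/measurable_EFinP]. Qed.

Lemma Int_eq u v : (forall x, disk x -> u x = v x) -> Int u -> Int v.
Proof.
move=> uv; apply: eq_integrable; first exact: measurable_disk.
by move=> x /set_mem dx; rewrite /= uv.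
Qed.

Lemma I_eq u v : (forall x, disk x -> u x = v x) -> I u = I v.
Proof. by move=> uv; apply: eq_Rintegral => x /set_mem; exact: uv. Qed.

Lemma IntD u v : Int u -> Int v -> Int (fun x => u x + v x).
Proof.
by move=> iu iv; have := integrableD measurable_disk iu iv; apply: eq_integrable => //; exact: measurable_disk.
Qed.

Lemma IntZ (c : R) u : Int u -> Int (fun x => c * u x).
Proof.
by move=> iu; have := integrableZl measurable_disk c iu; apply: eq_integrable => //; exact: measurable_disk.
Qed.

Lemma IntB u v : Int u -> Int v -> Int (fun x => u x - v x).
Proof.
by move=> iu iv; have := integrableB measurable_disk iu iv; apply: eq_integrable => //; exact: measurable_disk.
Qed.

Lemma Int_le u v : mf2 disk u -> Int v -> (forall x, disk x -> `|u x| <= v x) -> Int u.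
Proof.
move=> mu_ iv uv; apply: (le_integrable measurable_disk _ _ iv).
  exact/measurable_EFinP.
move=> x dx /=; rewrite lee_fin (le_trans (uv _ dx))//; exact: ler_norm.
Qed.

Lemma Int_norm u : Int u -> Int (fun x => `|u x|).
Proof.
move=> iu; have mu_ := Int_mf iu.
by have := integrable_abse iu; apply: eq_integrable => //; exact: measurable_disk.
Qed.

Lemma I_D u v : Int u -> Int v -> I (fun x => u x + v x) = I u + I v.
Proof. by move=> iu iv; rewrite RintegralD//; exact: measurable_disk. Qed.

Lemma I_B u v : Int u -> Int v -> I (fun x => u x - v x) = I u - I v.
Proof. by move=> iu iv; rewrite RintegralB//; exact: measurable_disk. Qed.

Lemma I_Z (c : R) u : Int u -> I (fun x => c * u x) = c * I u.
Proof. by move=> iu; rewrite RintegralZl//; exact: measurable_disk. Qed.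

Lemma I_le u v : Int u -> Int v -> (forall x, disk x -> u x <= v x) -> I u <= I v.
Proof. by move=> iu iv uv; apply: le_Rintegral => //; exact: measurable_disk. Qed.

Lemma I_norm u : Int u -> `|I u| <= I (fun x => `|u x|).
Proof. by move=> iu; apply: le_normr_Rintegral => //; exact: measurable_disk. Qed.

Lemma L2_mf u : L2 u -> mf2 disk u.
Proof. by case. Qed.

Lemma L2_sq u : L2 u -> Int (fun x => u x ^+ 2).
Proof. by case. Qed.

Lemma L2_intro u : mf2 disk u -> Int (fun x => u x ^+ 2) -> L2 u.
Proof. by move=> mu_ iu; split; [exact: mu_|exact: iu]. Qed.

Lemma L2_eq u v : L2 u -> (forall x, disk x -> u x = v x) -> L2 v.
Proof.
move=> Lu uv; apply: L2_intro.
  apply: (eq_measurable_fun u); last exact: L2_mf.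
  by move=> x /set_mem; exact: uv.
by apply: Int_eq (L2_sq Lu) => x dx; rewrite uv.
Qed.

Lemma L2M u v : L2 u -> L2 v -> Int (fun x => u x * v x).
Proof.
move=> Lu Lv; apply: (@Int_le _ (fun x => u x ^+ 2 + v x ^+ 2)).
- by apply: measurable_funM; exact: L2_mf.
- by apply: IntD; exact: L2_sq.
- move=> x _; rewrite normrM -(real_normK (num_real (u x))) -(real_normK (num_real (v x))).
  have := normr_ge0 (u x); have := normr_ge0 (v x); nra.
Qed.

Lemma L2Z (c : R) u : L2 u -> L2 (fun x => c * u x).
Proof.
move=> Lu; apply: L2_intro; first by apply: measurable_funM => //; exact: L2_mf.
by apply: Int_eq (IntZ (c ^+ 2) (L2_sq Lu)) => x _; rewrite exprMn.
Qed.

Lemma L2D u v : L2 u -> L2 v -> L2 (fun x => u x + v x).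
Proof.
move=> Lu Lv; apply: L2_intro.
  by apply: measurable_funD; exact: L2_mf.
by apply: Int_eq (IntD (IntD (L2_sq Lu) (IntZ 2 (L2M Lu Lv))) (L2_sq Lv)) => x _; ring.
Qed.

Lemma L2B u v : L2 u -> L2 v -> L2 (fun x => u x - v x).
Proof.
move=> Lu Lv; have := L2D Lu (L2Z (-1) Lv).
by move/L2_eq; apply => x _; ring.
Qed.

Lemma L2_bounded u (C : R) : mf2 disk u -> (forall x, disk x -> `|u x| <= C) -> L2 u.
Proof.
move=> mu_ uC; apply: L2_intro => //.
apply: (@bounded_integrable_disk _ _ (C ^+ 2)).
  exact: measurable_funX.
move=> x dx; rewrite normrX lerXn2r ?nnegrE ?uC//.
exact: le_trans (uC _ dx).
Qed.

Lemma L2_continuous u : continuous u -> L2 u.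
Proof.
move=> cu; have [C _ uC] := continuous_bounded_disk cu.
apply: (@L2_bounded _ C); first by apply: measurable_funTS; exact: continuous_measurable2.
by move=> x; rewrite diskE/= => /ltW/uC.
Qed.

Lemma L2_Int u : L2 u -> Int u.
Proof.
move=> Lu; have := L2M Lu (L2_continuous (@cst_continuous _ _ (1 : R))).
by apply: eq_integrable => [|x _ /=]; [exact: measurable_disk|rewrite mulr1].
Qed.

Lemma I_sq_ge0 u : 0 <= I (fun x => u x ^+ 2).
Proof. by apply: Rintegral_ge0 => x _; exact: sqr_ge0. Qed.

Lemma I_sqD u v (t : R) : L2 u -> L2 v ->
  I (fun x => (u x + t * v x) ^+ 2) =
  I (fun x => u x ^+ 2) + 2 * t * I (fun x => u x * v x) + t ^+ 2 * I (fun x => v x ^+ 2).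
Proof.
move=> Lu Lv; have i1 := L2_sq Lu; have i2 := L2M Lu Lv; have i3 := L2_sq Lv.
have i4 := IntZ (2 * t) i2; have i5 := IntZ (t ^+ 2) i3.
rewrite -(I_Z (2 * t) i2) -(I_Z (t ^+ 2) i3) -(I_D i1 i4) -I_D//; last exact: IntD.
by apply: I_eq => x _; ring.
Qed.

Lemma cauchy_schwarz u v : L2 u -> L2 v ->
  I (fun x => u x * v x) ^+ 2 <= I (fun x => u x ^+ 2) * I (fun x => v x ^+ 2).
Proof.
move=> Lu Lv; have H t := I_sq_ge0 (fun x => u x + t * v x).
have {}H t : 0 <= I (fun x => u x ^+ 2) + 2 * t * I (fun x => u x * v x) + t ^+ 2 * I (fun x => v x ^+ 2).
  by rewrite -I_sqD.
have := I_sq_ge0 u; have := I_sq_ge0 v.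
move: H; set a := I (fun x => u x ^+ 2); set b := I (fun x => u x * v x); set c := I (fun x => v x ^+ 2) => H c0 a0.
move: c0; rewrite le_eqVlt => /predU1P[c0|c0].
  have [->|b0] := eqVneq b 0; first by rewrite expr0n/= mulr_ge0// -c0.
  (* With c = 0 the quadratic is affine in t, and this t gives it the value -1. *)
  have := H (- (a + 1) / (2 * b)); rewrite -c0 mulr0 addr0.
  have -> : 2 * (- (a + 1) / (2 * b)) * b = - (a + 1) by field.
  by lra.
have := H (- b / c).
have -> : a + 2 * (- b / c) * b + (- b / c) ^+ 2 * c = (a * c - b ^+ 2) / c by field; rewrite gt_eqF.
by rewrite pmulr_lge0 ?invr_gt0// subr_ge0.
Qed.

Lemma L2_cvg_mul u (un : nat -> R * R -> R) v : L2 u -> (forall n, L2 (un n)) -> L2 v ->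
  I (fun x => (u x - un n x) ^+ 2) @[n --> \oo] --> (0 : R) ->
  I (fun x => un n x * v x) @[n --> \oo] --> I (fun x => u x * v x).
Proof.
move=> Lu Ln Lv h; pose c := I (fun x => v x ^+ 2).
apply/cvgrPdist_le => /= e e0.
have c10 : 0 < c + 1 by rewrite ltr_wpDl// I_sq_ge0.
have e20 : 0 < e ^+ 2 / (c + 1) by rewrite divr_gt0// exprn_gt0.
move/cvgrPdist_le : h => /(_ _ e20); apply: filterS => n.
rewrite sub0r normrN ger0_norm ?I_sq_ge0// => h.
rewrite -(I_B (L2M Lu Lv) (L2M (Ln n) Lv)).
rewrite (@I_eq _ (fun x => (u x - un n x) * v x)); last by move=> x _; ring.
have := cauchy_schwarz (L2B Lu (Ln n)) Lv; rewrite -/c => cs.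
rewrite -ler_sqr ?nnegrE ?(ltW e0)// real_normK ?num_real//; apply: (le_trans cs).
have c0 : 0 <= c by exact: I_sq_ge0.
apply: (@le_trans _ _ (e ^+ 2 / (c + 1) * c)); first by rewrite ler_wpM2r.
rewrite -mulrA ler_piMr ?sqr_ge0// mulrC ler_pdivrMr// mul1r; lra.
Qed.

Lemma ramp_cvg (t : R) : ramp (n%:R * t) @[n --> \oo] --> ((0 < t)%R%:R : R).
Proof.
have [t0|t0] := ltP 0 t; last first.
  apply: cvg_near_cst; near=> n; apply: ramp_le0.
  by rewrite mulr_ge0_le0.
apply: cvg_near_cst; near=> n; apply: ramp_ge1.
rewrite -ler_pdivrMr// mul1r; near: n; exact: nbhs_infty_ger.
Unshelve. all: by end_near. Qed.

Definition boxes : set (set P) :=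
  [set A | exists a b c d : R, A = `]a, b[%classic `*` `]c, d[%classic].

(** Open boxes are closed under intersection, as measure uniqueness requires. They generate the
    product sigma-algebra because each open strip is a countable union of boxes. *)
Lemma measurable_boxes : @measurable _ P = <<s boxes >>.
Proof.
apply/seteqP; split; last first.
  apply: smallest_sub; first exact: sigma_algebra_measurable.
  by move=> _ [a [b [c [d ->]]]]; apply: measurableX; exact: measurable_itv.
apply: smallest_sub; first exact: smallest_sigma_algebra.
have nat_cover (z : R) : exists k : nat, -(k%:R) < z < k%:R.
  by exists (Num.truncn `|z|).+1; rewrite -ltr_norml truncnS_gt.
rewrite subUset; split.
- have m1 : @measurable_fun _ _ (g_sigma_algebraType boxes) mR setT (fst : R * R -> R).
    apply: (measurability _ (RGenOpens.measurableE R)).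
    move=> _ [_ [a [b ->] <-]]; rewrite setTI.
    rewrite (_ : _ @^-1` _ = \bigcup_k (`]a, b[%classic `*` `](- k%:R), k%:R[%classic)).
      apply: (@bigcup_measurable _ (g_sigma_algebraType boxes)) => k _.
      by apply: sub_sigma_algebra; exists a, b, (- k%:R), k%:R.
    apply/seteqP; split => [[x y] /= xab|[x y] [k _ [/= ]]//].
    by have [k ky] := nat_cover y; exists k => //; split => //=; rewrite in_itv.
  by move=> _ [A mA <-]; exact: m1.
- have m1 : @measurable_fun _ _ (g_sigma_algebraType boxes) mR setT (snd : R * R -> R).
    apply: (measurability _ (RGenOpens.measurableE R)).
    move=> _ [_ [a [b ->] <-]]; rewrite setTI.
    rewrite (_ : _ @^-1` _ = \bigcup_k (`](- k%:R), k%:R[%classic `*` `]a, b[%classic)).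
      apply: (@bigcup_measurable _ (g_sigma_algebraType boxes)) => k _.
      by apply: sub_sigma_algebra; exists (- k%:R), k%:R, a, b.
    apply/seteqP; split => [[x y] /= xab|[x y] [k _ [/= ]]//].
    by have [k ky] := nat_cover x; exists k => //; split => //=; rewrite in_itv.
  by move=> _ [A mA <-]; exact: m1.
Qed.

End DiskL2.

(** * Measures with a density, and functions whose integrals vanish on a generator *)

Section Density.
Context d (T : measurableType d) (R : realType).
Variables (m : {measure set T -> \bar R}) (f : T -> \bar R).
Hypotheses (mf : measurable_fun setT f) (f0 : forall x, (0 <= f x)%E).

Definition density (A : set T) : \bar R := (\int[m]_(x in A) f x)%E.

Let density0 : density set0 = 0%E.
Proof. by rewrite /density integral_set0. Qed.

Let density_ge0 A : (0 <= density A)%E.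
Proof. exact: integral_ge0. Qed.

Let density_sigma_additive : semi_sigma_additive density.
Proof.
move=> A mA tA mUA; rewrite /density ge0_integral_bigcup//; last exact: measurable_funTS.
by apply: is_cvg_ereal_nneg_natsum_cond => n _ _; exact: density_ge0.
Qed.

HB.instance Definition _ := isMeasure.Build _ _ _ density density0 density_ge0 density_sigma_additive.

End Density.

(** The positive and the negative part of [f] are densities of two finite measures. These agree on
    the generator, hence on all measurable sets, and so [f] has integral 0 over every one of
    them. *)
Lemma ae0_of_generator d (T : measurableType d) (R : realType)
    (m : {measure set T -> \bar R}) (f : T -> \bar R) (G : set (set T)) (g : nat -> set T) :
  measurable = <<s G >> -> setI_closed G -> (forall i, G (g i)) -> \bigcup_k g k = setT ->
  m.-integrable setT f -> (forall A, G A -> (\int[m]_(x in A) f x = 0)%E) ->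
  ae_eq m setT f (cst 0%E).
Proof.
move=> mG GI Gg gT fi fG.
have mf : measurable_fun setT f by case/integrableP : fi.
have GM A : G A -> measurable A by move=> GA; rewrite mG; exact: sub_sigma_algebra.
have fp := measurable_funepos mf; have fn := measurable_funeneg mf.
pose m1' := [the measure _ _ of density m f^\+%E].
pose m1 := m1' fp (@funepos_ge0 _ _ f).
pose m2' := [the measure _ _ of density m f^\-%E].
pose m2 := m2' fn (@funeneg_ge0 _ _ f).
have fin A : measurable A -> (m1 A \is a fin_num) /\ (m2 A \is a fin_num).
  move=> mA; have fA := integrableS measurableT mA (@subsetT _ A) fi; split.
    exact: integrable_pos_fin_num.
  exact: integrable_neg_fin_num.
have m12 A : measurable A -> m1 A = m2 A.
  apply: (measure_unique G g mG GI Gg gT) => [B GB|k].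
    have [f1 f2] := fin _ (GM _ GB).
    have := fG _ GB; rewrite integralE -/(density m f^\+%E B) -/(density m f^\-%E B) => /eqP.
    rewrite -[density m f^\+%E B]/(m1 B) -[density m f^\-%E B]/(m2 B).
    by rewrite -(fineK f1) -(fineK f2) -EFinB => /eqP[/eqP]; rewrite subr_eq0 => /eqP ->.
  by have [+ _] := fin _ (GM _ (Gg k)); rewrite ge0_fin_numE//; exact: integral_ge0.
apply: integral_ae_eq => // A _ mA; rewrite integral0 integralE.
rewrite -/(density m f^\+%E A) -/(density m f^\-%E A) -[density m f^\+%E A]/(m1 A) m12//.
by rewrite subee//; have [] := fin _ mA.
Qed.

(** * The fundamental lemma of the calculus of variations *)

Section FundamentalLemma.
Context {R : realType}.
Local Notation mu2 := ((@lebesgue_measure R \x @lebesgue_measure R)%E).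
Local Notation P := (measurableTypeR R * measurableTypeR R)%type.
Local Notation mf2 := (@measurable_fun _ _ (measurableTypeR R * measurableTypeR R)%type R).
Implicit Types (phi psi u v : R * R -> R).
Local Notation I u := (Rintegral mu2 disk u).
Local Notation Int u := (mu2.-integrable disk (EFin \o u)).

Lemma pos2_ge0 (t : R) : 0 <= pos2 t.
Proof. by rewrite /pos2; case: (leP 0 t) => ?; nra. Qed.

Lemma pos2_le1 (t : R) : t <= 1 -> pos2 t <= 1.
Proof. by rewrite /pos2; case: (leP 0 t) => ? ?; nra. Qed.

Lemma C1P_ramp_affine1 (k c : R) : C1P (fun x : R * R => ramp (k * (x.1 - c)))
  (fun x => dramp (k * (x.1 - c)) * k) (fun x => 0).
Proof.
have h := C1PD (C1PM (C1P_cst k) C1P_fst) (C1P_cst (- (k * c))).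
have := C1P_comp h is_derive_ramp dramp_continuous.
by move/C1P_ext; apply => x; rewrite /cst/= -mulrN -mulrDr//; ring.
Qed.

Lemma C1P_ramp_affine2 (k c : R) : C1P (fun x : R * R => ramp (k * (x.2 - c)))
  (fun x => 0) (fun x => dramp (k * (x.2 - c)) * k).
Proof.
have h := C1PD (C1PM (C1P_cst k) C1P_snd) (C1P_cst (- (k * c))).
have := C1P_comp h is_derive_ramp dramp_continuous.
by move/C1P_ext; apply => x; rewrite /cst/= -mulrN -mulrDr//; ring.
Qed.

Lemma C1P_pos2_sqn (c : R) : exists d1 d2, C1P (fun x : R * R => pos2 (c - sqn x)) d1 d2.
Proof.
have h := C1PD (C1P_cst c) (C1PM (C1P_cst (-1)) (@C1P_sqn R)).
have cd : continuous (fun x : R => 2 * Num.max 0 x).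
  by move=> x; apply: cvgM; [exact: cvg_cst|exact: continuous_max0].
have := C1P_comp h is_derive_pos2 cd.
set d1 := (X in C1P _ X _); set d2 := (X in C1P _ _ X) => H; exists d1, d2.
by apply: C1P_ext H _ _ _ => // x; rewrite /cst/= mulN1r.
Qed.

(** Indicators of boxes, weighted by [chi], are bounded pointwise limits of test functions. Hence v
    chi has integral 0 over each box and vanishes almost everywhere. *)
Lemma ae0_of_test v : L2 v -> (forall phi, C1c phi -> I (fun x => v x * phi x) = 0) ->
  {ae mu2, forall x, disk x -> v x = 0}.
Proof.
move=> Lv v0.
(* Positive inside the disk and 0 outside: dividing by it at the end costs nothing, and boxes
   sticking out of the disk need no separate treatment. *)
pose chi (x : R * R) : R := pos2 (1 - sqn x).
have Iv := L2_Int Lv.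
pose bx (a b c d : R) (x : R * R) : R := (0 < x.1 - a)%R%:R * (0 < b - x.1)%R%:R * ((0 < x.2 - c)%R%:R * (0 < d - x.2)%R%:R).
(* The ramps approximate the indicator of the box from inside; lowering the weight by 1/(n+1) makes
   the support compact in the open disk. *)
pose tst (a b c d : R) (n : nat) (x : R * R) : R :=
  pos2 (1 - n.+1%:R^-1 - sqn x) * ((ramp (n%:R * (x.1 - a)) * ramp (n%:R * (b - x.1))) * (ramp (n%:R * (x.2 - c)) * ramp (n%:R * (d - x.2)))).
have tstC a b c d n : C1c (tst a b c d n).
  have [d1 [d2 h]] := C1P_pos2_sqn (1 - n.+1%:R^-1).
  have r1 := C1P_ramp_affine1 n%:R a; have r2 := C1P_ramp_affine1 (- n%:R) b.
  have r3 := C1P_ramp_affine2 n%:R c; have r4 := C1P_ramp_affine2 (- n%:R) d.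
  have := C1PM h (C1PM (C1PM r1 r2) (C1PM r3 r4)).
  set D1 := (X in C1P _ X _); set D2 := (X in C1P _ _ X) => H.
  apply: (@C1c_intro _ _ D1 D2 (1 - n.+1%:R^-1)).
  - apply: C1P_ext H _ _ _ => // x; rewrite /tst.
    by rewrite mulNr -mulrN opprB mulNr -mulrN opprB.
  - by rewrite ltrBlDr ltrDl invr_gt0.
  - by move=> x hx; rewrite /tst {1}/pos2 max_l ?mulr0 ?mul0r// subr_le0.
have chi_bound n x : 0 <= pos2 (1 - n - sqn x) :> R by exact: pos2_ge0.
have tst_bound a b c d n x : `|tst a b c d n x| <= 1.
  have r01 (t : R) : 0 <= ramp t <= 1 by exact: ramp_bound.
  have rp (s t : R) : 0 <= ramp s * ramp t <= 1.
    by have /andP[? ?] := r01 s; have /andP[? ?] := r01 t; rewrite mulr_ge0// mulr_ile1.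
  rewrite /tst ger0_norm; last first.
    apply: mulr_ge0; first exact: chi_bound.
    by apply: mulr_ge0; have /andP[] := rp (n%:R * (x.1 - a)) (n%:R * (b - x.1)); have /andP[] := rp (n%:R * (x.2 - c)) (n%:R * (d - x.2)).
  apply: mulr_ile1; first exact: chi_bound.
  - by apply: mulr_ge0; have /andP[] := rp (n%:R * (x.1 - a)) (n%:R * (b - x.1)); have /andP[] := rp (n%:R * (x.2 - c)) (n%:R * (d - x.2)).
  - have : 0 <= n.+1%:R^-1 :> R by rewrite invr_ge0.
    by move: (n.+1%:R^-1) (sqn_ge0 x) => e ? ?; apply: pos2_le1; lra.
  - have /andP[? ?] := rp (n%:R * (x.1 - a)) (n%:R * (b - x.1)).
    by have /andP[? ?] := rp (n%:R * (x.2 - c)) (n%:R * (d - x.2)); rewrite mulr_ile1.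
have tst_cvg a b c d x : tst a b c d n x @[n --> \oo] --> chi x * bx a b c d x.
  apply: cvgM; last by apply: cvgM; apply: cvgM; exact: ramp_cvg.
  apply: (@cvg_comp _ _ _ (fun n : nat => 1 - n.+1%:R^-1 - sqn x) pos2 _ (nbhs (1 - sqn x))); last first.
    exact: (is_derive_continuous (is_derive_pos2 _)).
  apply: cvgB; last exact: cvg_cst.
  rewrite -[X in _ --> X]subr0; apply: cvgB; first exact: cvg_cst.
  exact: cvg_harmonic.
have box0 a b c d : (\int[mu2]_(x in disk) (v x * (chi x * bx a b c d x))%:E = 0)%E.
  have mt n : mf2 disk (tst a b c d n).
    have [h _] := C1c_elim (tstC a b c d n).
    by apply: measurable_funTS; apply: continuous_measurable2; exact: C1P_continuous h.
  have mv := L2_mf Lv.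
  have ilim : Int (fun x => v x * (chi x * bx a b c d x)) /\
      I (fun x => v x * tst a b c d n x) @[n --> \oo] --> I (fun x => v x * (chi x * bx a b c d x)).
    apply: (@Rintegral_dominated _ P R mu2 disk _ _ _ measurable_disk _ _ (Int_norm Iv)).
    - by move=> n; exact: measurable_funM.
    - by move=> x _; apply: cvgM; [exact: cvg_cst|exact: tst_cvg].
    - by move=> n x _; rewrite normrM ler_piMr.
  have [il] := ilim; rewrite (_ : (fun n => _) = cst 0); last by apply/funext => n; exact: v0.
  move/(cvg_unique (@Rhausdorff R) (cvg_cst _)) => h.
  by rewrite -(fineK (integrable_fin_num measurable_disk il)); congr EFin; rewrite h.
pose f (x : P) : \bar R := ((fun x => (v x * chi x)%:E) \_ disk) x.
have fi : mu2.-integrable setT f.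
  apply/(integrable_mkcond _ measurable_disk).
  apply: (@Int_le _ _ (fun x => `|v x|) _ (Int_norm Iv)).
    apply: measurable_funM; first exact: L2_mf.
    apply: measurable_funTS; apply: continuous_measurable2.
    by have [d1 [d2 /C1P_continuous]] := C1P_pos2_sqn 1.
  move=> x _; rewrite normrM ler_piMr// ger0_norm; last by have := chi_bound 0 x; rewrite subr0.
  by have := sqn_ge0 x; move=> ?; apply: pos2_le1; lra.
have := @ae0_of_generator _ P R mu2 f (@boxes R) (fun n => `](- n%:R), n%:R[%classic `*` `](- n%:R), n%:R[%classic) measurable_boxes.
have BI : setI_closed (@boxes R).
  move=> _ _ [a [b [c [d ->]]]] [a' [b' [c' [d' ->]]]].
  exists (Num.max a a'), (Num.min b b'), (Num.max c c'), (Num.min d d').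
  rewrite -setXI; congr (_ `*` _); apply/seteqP; split => x /=; rewrite !in_itv/= gt_max lt_min.
  - by move=> [/andP[-> ->] /andP[-> ->]].
  - by move=> /andP[/andP[-> ->] /andP[-> ->]].
  - by move=> [/andP[-> ->] /andP[-> ->]].
  - by move=> /andP[/andP[-> ->] /andP[-> ->]].
move=> /(_ BI) []//.
- by move=> i; exists (- i%:R), i%:R, (- i%:R), i%:R.
- apply/seteqP; split => // -[x y] _; exists (Num.truncn (Num.max `|x| `|y|)).+1 => //=.
  split => /=; rewrite in_itv/= -ltr_norml; apply: (le_lt_trans _ (truncnS_gt _)).
    by rewrite le_max lexx.
  by rewrite le_max lexx orbT.
- move=> _ [a [b [c [d ->]]]]; rewrite -[RHS](box0 a b c d) integral_mkcond [RHS]integral_mkcond.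
  apply: eq_integral => -[x y] _; rewrite !patchE /bx/=.
  rewrite !subr_gt0; case: ifPn => [/set_mem[/=]|].
    rewrite !in_itv/= => /andP[-> ->] /andP[-> ->]; rewrite !mulr1.
    by rewrite /f patchE.
  rewrite notin_setE/= !in_itv/= => h; case: ifP => // _.
  case: (a < x) h; case: (x < b); case: (c < y); case: (y < d); rewrite ?(mulr0,mul0r)//.
  by case; split.
move=> N [mN N0 fN]; exists N; split => // x h.
apply: fN => /= h2; apply: h => dx.
have := h2 Logic.I; rewrite /f patchE mem_set//= => -[] /eqP; rewrite mulf_eq0 => /orP[/eqP//|].
rewrite /chi /pos2; move: dx; rewrite diskE/= => dx.
by rewrite max_r; [nra|lra].
Unshelve. all: by end_near. Qed.

End FundamentalLemma.

(** * Weak derivatives and approximation by test functions *)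

Section WeakDerivatives.
Context {R : realType}.
Local Notation mu2 := ((@lebesgue_measure R \x @lebesgue_measure R)%E).
Local Notation mf2 := (@measurable_fun _ _ (measurableTypeR R * measurableTypeR R)%type R).
Implicit Types (phi psi u v g : R * R -> R) (e : R * R).
Local Notation I u := (Rintegral mu2 disk u).

Lemma C1c_continuous phi : C1c phi -> continuous phi.
Proof. by case/C1c_elim => /C1P_continuous. Qed.

Lemma C1c_L2 phi : C1c phi -> L2 phi.
Proof. by move/C1c_continuous; exact: L2_continuous. Qed.

Lemma C1c_L2_d1 phi : C1c phi -> L2 ('D_e1 phi).
Proof. by case/C1c_elim => -[_ _ c1 _] _; exact: L2_continuous. Qed.

Lemma C1c_L2_d2 phi : C1c phi -> L2 ('D_e2 phi).
Proof. by case/C1c_elim => -[_ _ _ c2] _; exact: L2_continuous. Qed.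

Lemma aeS (A B : set (R * R)) : A `<=` B -> {ae mu2, forall x, A x} -> {ae mu2, forall x, B x}.
Proof.
move=> AB [N [mN N0 sN]]; exists N; split => //.
by apply: subset_trans sN; exact: subsetC.
Qed.

Lemma aeI (A B : set (R * R)) : {ae mu2, forall x, A x} -> {ae mu2, forall x, B x} ->
  {ae mu2, forall x, A x /\ B x}.
Proof.
move=> [N [mN N0 sN]] [M [mM M0 sM]]; exists (N `|` M); split.
- exact: measurableU.
- exact: null_set_setU.
- move=> x /= /not_andP[h|h]; [by left; apply: sN|by right; apply: sM].
Qed.

Lemma I_ae u v : mf2 disk u -> mf2 disk v ->
  {ae mu2, forall x, disk x -> u x = v x} -> I u = I v.
Proof.
move=> mu_ mv uv; congr fine; apply: ae_eq_integral.
- exact: measurable_disk.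
- exact/measurable_EFinP.
- exact/measurable_EFinP.
- by apply: aeS uv => x h dx; rewrite h.
Qed.

Lemma wd_unique e u g g' : e = e1 \/ e = e2 -> is_weak_derivative e u g ->
  is_weak_derivative e u g' -> {ae mu2, forall x, disk x -> g x = g' x}.
Proof.
move=> ee [Lg gP] [Lg' gP'].
have : {ae mu2, forall x, disk x -> g x - g' x = 0}.
  apply: ae0_of_test; first exact: L2B.
  move=> phi cphi; have Lp := C1c_L2 cphi.
  rewrite (@I_eq _ _ (fun x => g x * phi x - g' x * phi x)); last by move=> x _; ring.
  rewrite I_B; [|exact: L2M..].
  by apply/eqP; rewrite subr_eq0 -eqr_opp -gP// gP'.
by apply: aeS => x h dx; apply/eqP; rewrite -subr_eq0 h.
Qed.

Lemma wd_spec e u g : is_weak_derivative e u g -> is_weak_derivative e u (weak_derivative e u).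
Proof. by move=> h; rewrite /weak_derivative; case: xgetP => [v -> //|/(_ g)]. Qed.

Lemma wd_ae e u g : e = e1 \/ e = e2 -> is_weak_derivative e u g ->
  {ae mu2, forall x, disk x -> weak_derivative e u x = g x}.
Proof. by move=> ee h; apply: (wd_unique ee _ h); exact: wd_spec h. Qed.

Lemma is_wd_eq e u u' g : (forall x, disk x -> u x = u' x) ->
  is_weak_derivative e u g -> is_weak_derivative e u' g.
Proof.
move=> uu [Lg gP]; split => // phi cphi; rewrite -gP//.
by apply: I_eq => x dx; rewrite uu.
Qed.

Lemma is_wd_eqr e u g g' : (forall x, disk x -> g x = g' x) ->
  is_weak_derivative e u g -> is_weak_derivative e u g'.
Proof.
move=> uu [Lg gP]; split => [|phi cphi]; first exact: L2_eq Lg _.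
by rewrite gP//; congr (- _); apply: I_eq => x dx; rewrite uu.
Qed.

(** Both functions have the same set of weak derivatives, so even the chosen representatives are
    equal, not merely equal almost everywhere. *)
Lemma weak_derivative_eq e u u' : (forall x, disk x -> u x = u' x) ->
  weak_derivative e u = weak_derivative e u'.
Proof.
move=> uu; rewrite /weak_derivative; congr (xget _ _).
by apply/seteqP; split => g /=; apply: is_wd_eq => x dx; rewrite uu.
Qed.

Lemma C1c_D_L2 e phi : e = e1 \/ e = e2 -> C1c phi -> L2 ('D_e phi).
Proof. by case=> ->; [exact: C1c_L2_d1|exact: C1c_L2_d2]. Qed.

Lemma is_wdD e u v g h : e = e1 \/ e = e2 -> L2 u -> L2 v -> is_weak_derivative e u g ->
  is_weak_derivative e v h -> is_weak_derivative e (fun x => u x + v x) (fun x => g x + h x).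
Proof.
move=> ee Lu Lv [Lg gP] [Lh hP]; split => [|phi cphi]; first exact: L2D.
have Lp := C1c_L2 cphi; have Ld := C1c_D_L2 ee cphi.
rewrite (@I_eq _ _ (fun x => u x * 'D_e phi x + v x * 'D_e phi x)); last by move=> x _; ring.
rewrite (@I_eq _ (fun x => (g x + h x) * phi x) (fun x => g x * phi x + h x * phi x)); last by move=> x _; ring.
rewrite (I_D (L2M Lu Ld) (L2M Lv Ld)) (I_D (L2M Lg Lp) (L2M Lh Lp)).
by rewrite gP// hP// opprD.
Qed.

Lemma is_wdZ e (c : R) u g : e = e1 \/ e = e2 -> L2 u -> is_weak_derivative e u g ->
  is_weak_derivative e (fun x => c * u x) (fun x => c * g x).
Proof.
move=> ee Lu [Lg gP]; split => [|phi cphi]; first exact: L2Z.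
have Lp := C1c_L2 cphi; have Ld := C1c_D_L2 ee cphi.
rewrite (@I_eq _ _ (fun x => c * (u x * 'D_e phi x))); last by move=> x _; ring.
rewrite (@I_eq _ (fun x => c * g x * phi x) (fun x => c * (g x * phi x))); last by move=> x _; ring.
by rewrite (I_Z c (L2M Lu Ld)) (I_Z c (L2M Lg Lp)) gP// mulrN.
Qed.

Lemma C1P_is_wd u d1 d2 : C1P u d1 d2 ->
  is_weak_derivative e1 u d1 /\ is_weak_derivative e2 u d2.
Proof.
move=> h; have cu := C1P_continuous h.
have Lu := L2_continuous cu.
have L1 := L2_continuous (C1P_c1 h); have L2' := L2_continuous (C1P_c2 h).
have key phi : C1c phi -> I (fun x => u x * 'D_e1 phi x + phi x * d1 x) = 0 /\
                         I (fun x => u x * 'D_e2 phi x + phi x * d2 x) = 0.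
  move=> /C1c_elim[hp [r /andP[_ r1] rp]]; apply: (C1P_integral0 (C1PM h hp)) => x x1.
  have [-> -> ->] := rp x (le_trans (ltW r1) x1).
  by split; ring.
split; split => // phi cphi; have [k1 k2] := key _ cphi; have Lp := C1c_L2 cphi.
- apply/eqP; rewrite -addr_eq0 -k1 -(I_D (L2M Lu (C1c_L2_d1 cphi)) (L2M L1 Lp)).
  by apply/eqP/I_eq => x _; ring.
- apply/eqP; rewrite -addr_eq0 -k2 -(I_D (L2M Lu (C1c_L2_d2 cphi)) (L2M L2' Lp)).
  by apply/eqP/I_eq => x _; ring.
Qed.

Lemma C1c_is_wd e phi : e = e1 \/ e = e2 -> C1c phi -> is_weak_derivative e phi ('D_e phi).
Proof. by move=> ee /C1c_elim[/C1P_is_wd[? ?] _]; case: ee => ->. Qed.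

Lemma is_wd_L2 e u g : is_weak_derivative e u g -> L2 g.
Proof. by case. Qed.

Definition L2_cvg (un : nat -> R * R -> R) u : Prop :=
  I (fun x => (u x - un n x) ^+ 2) @[n --> \oo] --> (0 : R).

(** The norm in [H10] is written with chosen weak derivatives of the difference. Up to null sets
    these are the differences of derivatives, so convergence splits into three L^2 convergences. *)
Lemma H10_approx u : H10 u ->
  [/\ L2 u, is_weak_derivative e1 u (weak_derivative e1 u),
      is_weak_derivative e2 u (weak_derivative e2 u) &
      exists phi : nat -> R * R -> R, [/\ forall n, C1c (phi n), L2_cvg phi u,
        L2_cvg (fun n => 'D_e1 (phi n)) (weak_derivative e1 u) &
        L2_cvg (fun n => 'D_e2 (phi n)) (weak_derivative e2 u)]].
Proof.
move=> [[Lu [g1 /wd_spec w1] [g2 /wd_spec w2]] [phi [cphi np]]]; split => //.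
exists phi; set f1 := weak_derivative e1 u in w1 *; set f2 := weak_derivative e2 u in w2 *.
have D1 n := C1c_is_wd (or_introl erefl) (cphi n).
have D2 n := C1c_is_wd (or_intror erefl) (cphi n).
have Ln n := C1c_L2 (cphi n).
have Lun n : L2 (fun x => u x - phi n x) by exact: L2B.
have W e g n : e = e1 \/ e = e2 -> is_weak_derivative e u g ->
    {ae mu2, forall x, disk x -> weak_derivative e (u \- phi n) x = g x - 'D_e (phi n) x}.
  move=> ee wg; apply: wd_ae => //.
  have := is_wdD ee Lu (L2Z (-1) (Ln n)) wg (is_wdZ (-1) ee (Ln n) (C1c_is_wd ee (cphi n))).
  move=> h; apply: (@is_wd_eqr _ _ (fun x => g x + -1 * 'D_e (phi n) x)); first by move=> x _; ring.
  by apply: is_wd_eq h => x _ /=; ring.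
have sqE n : H1_norm (u \- phi n) ^+ 2 = I (fun x => (u x - phi n x) ^+ 2) +
    I (fun x => (f1 x - 'D_e1 (phi n) x) ^+ 2) + I (fun x => (f2 x - 'D_e2 (phi n) x) ^+ 2).
  have La := L2B (is_wd_L2 w1) (is_wd_L2 (D1 n)); have Lb := L2B (is_wd_L2 w2) (is_wd_L2 (D2 n)).
  rewrite /H1_norm sqr_sqrtr; last first.
    by apply: Rintegral_ge0 => x _; rewrite !addr_ge0// sqr_ge0.
  rewrite -(I_D (L2_sq (Lun n)) (L2_sq La)) -I_D; [|by apply: IntD; exact: L2_sq|exact: L2_sq].
  have wm e g : e = e1 \/ e = e2 -> is_weak_derivative e u g -> mf2 disk (weak_derivative e (u \- phi n)).
    move=> ee wg; apply: L2_mf; apply: (@is_wd_L2 e (u \- phi n)); apply: wd_spec.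
    have := is_wdD ee Lu (L2Z (-1) (Ln n)) wg (is_wdZ (-1) ee (Ln n) (C1c_is_wd ee (cphi n))).
    by apply: is_wd_eq => x _ /=; ring.
  apply: I_ae.
  - apply: measurable_funD; first apply: measurable_funD.
    + by apply: measurable_funX; exact: L2_mf (Lun n).
    + by apply: measurable_funX; apply: (wm _ f1) => //; left.
    + by apply: measurable_funX; apply: (wm _ f2) => //; right.
  - apply: measurable_funD; first apply: measurable_funD; apply: measurable_funX; exact: L2_mf.
  - have a1 := W e1 f1 n (or_introl erefl) w1; have a2 := W e2 f2 n (or_intror erefl) w2.
    by apply: aeS (aeI a1 a2) => x [h1 h2] dx; rewrite h1// h2.
have sq0 : H1_norm (u \- phi n) ^+ 2 @[n --> \oo] --> (0 : R).
  by rewrite -[X in _ --> X](expr0n R 2) ; apply: (@continuous_cvg _ _ _ _ _ _ (fun t : R => t ^+ 2)) => //; exact: exprn_continuous.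
have sqz (h : nat -> R) : (forall n, 0 <= h n <= H1_norm (u \- phi n) ^+ 2) -> h n @[n --> \oo] --> (0 : R).
  by move=> hb; apply: (squeeze_cvgr _ (cvg_cst 0) sq0); exact: nearW.
split=> //; apply: sqz => n; rewrite sqE I_sq_ge0/=.
- by rewrite -addrA lerDl addr_ge0// I_sq_ge0.
- by rewrite -addrA addrCA lerDl addr_ge0// I_sq_ge0.
- by rewrite lerDr addr_ge0// I_sq_ge0.
Qed.

Lemma L2_cvg_is_wd e u g (phi : nat -> R * R -> R) : e = e1 \/ e = e2 -> L2 u -> L2 g -> (forall n, C1c (phi n)) ->
  L2_cvg phi u -> L2_cvg (fun n => 'D_e (phi n)) g -> is_weak_derivative e u g.
Proof.
move=> ee Lu Lg cphi c0 c1; split => // psi cpsi.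
have h1 := L2_cvg_mul Lu (fun n => C1c_L2 (cphi n)) (C1c_D_L2 ee cpsi) c0.
have h2 := L2_cvg_mul Lg (fun n => C1c_D_L2 ee (cphi n)) (C1c_L2 cpsi) c1.
apply: (cvg_unique (@Rhausdorff R) h1).
rewrite (_ : (fun n => _) = (fun n => - I (fun x => 'D_e (phi n) x * psi x))); first exact: cvgN.
by apply/funext => n; have [_ ->] := C1c_is_wd ee (cphi n).
Qed.

(** The converse of [H10_approx]: L^2 limits of test functions and of their derivatives give an
    element of [H10] with an explicit weak gradient. *)
Lemma H10_intro u g1 g2 (phi : nat -> R * R -> R) : L2 u -> L2 g1 -> L2 g2 -> (forall n, C1c (phi n)) ->
  L2_cvg phi u -> L2_cvg (fun n => 'D_e1 (phi n)) g1 -> L2_cvg (fun n => 'D_e2 (phi n)) g2 ->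
  [/\ H10 u, is_weak_derivative e1 u g1 & is_weak_derivative e2 u g2].
Proof.
move=> Lu Lg1 Lg2 cphi c0 c1 c2.
have w1 := L2_cvg_is_wd (or_introl erefl) Lu Lg1 cphi c0 c1.
have w2 := L2_cvg_is_wd (or_intror erefl) Lu Lg2 cphi c0 c2.
split => //; split; first by split => //; [exists g1|exists g2].
exists phi; split => //.
have D1 n := C1c_is_wd (or_introl erefl) (cphi n).
have D2 n := C1c_is_wd (or_intror erefl) (cphi n).
have Ln n := C1c_L2 (cphi n).
have Lun n : L2 (fun x => u x - phi n x) by exact: L2B.
have W e g n : e = e1 \/ e = e2 -> is_weak_derivative e u g ->
    is_weak_derivative e (u \- phi n) (fun x => g x - 'D_e (phi n) x).
  move=> ee wg.
  have := is_wdD ee Lu (L2Z (-1) (Ln n)) wg (is_wdZ (-1) ee (Ln n) (C1c_is_wd ee (cphi n))).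
  move=> h; apply: (@is_wd_eqr _ _ (fun x => g x + -1 * 'D_e (phi n) x)); first by move=> x _; ring.
  by apply: is_wd_eq h => x _ /=; ring.
have sqE n : H1_norm (u \- phi n) = Num.sqrt (I (fun x => (u x - phi n x) ^+ 2) +
    I (fun x => (g1 x - 'D_e1 (phi n) x) ^+ 2) + I (fun x => (g2 x - 'D_e2 (phi n) x) ^+ 2)).
  have W1 := W e1 g1 n (or_introl erefl) w1; have W2 := W e2 g2 n (or_intror erefl) w2.
  rewrite /H1_norm; congr Num.sqrt.
  rewrite -(I_D (L2_sq (Lun n)) (L2_sq (is_wd_L2 W1))) -I_D; [|by apply: IntD; [exact: L2_sq|exact: L2_sq (is_wd_L2 W1)]|exact: L2_sq (is_wd_L2 W2)].
  apply: I_ae.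
  - apply: measurable_funD; first apply: measurable_funD; apply: measurable_funX.
    + exact: L2_mf (Lun n).
    + exact: L2_mf (is_wd_L2 (wd_spec W1)).
    + exact: L2_mf (is_wd_L2 (wd_spec W2)).
  - apply: measurable_funD; first apply: measurable_funD; apply: measurable_funX.
    + exact: L2_mf (Lun n).
    + exact: L2_mf (is_wd_L2 W1).
    + exact: L2_mf (is_wd_L2 W2).
  - have a1 := wd_ae (or_introl erefl) W1; have a2 := wd_ae (or_intror erefl) W2.
    by apply: aeS (aeI a1 a2) => x [h1 h2] dx; rewrite h1// h2.
pose S n := I (fun x => (u x - phi n x) ^+ 2) + I (fun x => (g1 x - 'D_e1 (phi n) x) ^+ 2) +
  I (fun x => (g2 x - 'D_e2 (phi n) x) ^+ 2).
have hS : S n @[n --> \oo] --> (0 + 0 + 0 : R).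
  by apply: cvgD; [apply: cvgD; [exact: c0|exact: c1]|exact: c2].
rewrite !addr0 in hS.
have hq : Num.sqrt (S n) @[n --> \oo] --> Num.sqrt (0 : R).
  by apply: (@continuous_cvg _ _ _ _ _ _ Num.sqrt); [exact: sqrt_continuous|exact: hS].
rewrite sqrtr0 in hq.
have -> : (fun n => H1_norm (u \- phi n)) = (fun n => Num.sqrt (S n)) by apply/funext => n; exact: sqE.
exact: hq.
Qed.

Lemma H10_eq u u' : (forall x, disk x -> u x = u' x) -> H10 u -> H10 u'.
Proof.
move=> uu /H10_approx[Lu w1 w2 [phi [cphi c0 c1 c2]]].
have c0' : L2_cvg phi u'.
  rewrite /L2_cvg (_ : (fun n => _) = (fun n => I (fun x => (u x - phi n x) ^+ 2))) //.
  by apply/funext => n; apply: I_eq => x dx; rewrite uu.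
by have [] := H10_intro (L2_eq Lu uu) (is_wd_L2 w1) (is_wd_L2 w2) cphi c0' c1 c2.
Qed.

Lemma L2_cvgD (un vn : nat -> R * R -> R) u v : L2 u -> L2 v -> (forall n, L2 (un n)) -> (forall n, L2 (vn n)) ->
  L2_cvg un u -> L2_cvg vn v -> L2_cvg (fun n x => un n x + vn n x) (fun x => u x + v x).
Proof.
move=> Lu Lv Ln Mn cu cv.
have h : 2 * I (fun x => (u x - un n x) ^+ 2) + 2 * I (fun x => (v x - vn n x) ^+ 2) @[n --> \oo] --> (2 * 0 + 2 * 0 : R).
  by apply: cvgD; (apply: cvgM; first exact: cvg_cst); [exact: cu|exact: cv].
rewrite mulr0 addr0 in h.
apply: (squeeze_cvgr _ (cvg_cst 0) h); apply: nearW => n; rewrite I_sq_ge0/=.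
have i1 := L2_sq (L2B Lu (Ln n)); have i2 := L2_sq (L2B Lv (Mn n)).
rewrite -(I_Z 2 i1) -(I_Z 2 i2) -(I_D (IntZ 2 i1) (IntZ 2 i2)); apply: I_le.
- exact: L2_sq (L2B (L2D Lu Lv) (L2D (Ln n) (Mn n))).
- by apply: IntD; exact: IntZ.
- move=> x _; have := sqr_ge0 ((u x - un n x) - (v x - vn n x)); nra.
Qed.

Lemma L2_cvgZ (c : R) (un : nat -> R * R -> R) u : L2 u -> (forall n, L2 (un n)) ->
  L2_cvg un u -> L2_cvg (fun n x => c * un n x) (fun x => c * u x).
Proof.
move=> Lu Ln cu; rewrite /L2_cvg.
rewrite (_ : (fun n => _) = (fun n => c ^+ 2 * I (fun x => (u x - un n x) ^+ 2))); last first.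
  apply/funext => n; rewrite -(I_Z _ (L2_sq (L2B Lu (Ln n)))).
  by apply: I_eq => x _; ring.
by rewrite -(mulr0 (c ^+ 2)); apply: cvgM; [exact: cvg_cst|by []].
Qed.

Lemma C1cD phi psi : C1c phi -> C1c psi ->
  [/\ C1c (fun x => phi x + psi x),
    'D_e1 (fun x => phi x + psi x) = (fun x => 'D_e1 phi x + 'D_e1 psi x) &
    'D_e2 (fun x => phi x + psi x) = (fun x => 'D_e2 phi x + 'D_e2 psi x)].
Proof.
move=> /C1c_elim[h1 [r1 /andP[_ r11] p1]] /C1c_elim[h2 [r2 /andP[_ r21] p2]].
have h := C1PD h1 h2; split.
- apply: (C1c_intro h (_ : Num.max r1 r2 < 1)); first by rewrite gt_max r11.
  by move=> x; rewrite ge_max => /andP[/p1[-> _ _] /p2[-> _ _]]; rewrite addr0.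
- by apply/funext => x; have [_ ->] := C1P_d1 h x.
- by apply/funext => x; have [_ ->] := C1P_d2 h x.
Qed.

Lemma C1cZ (c : R) phi : C1c phi ->
  [/\ C1c (fun x => c * phi x),
    'D_e1 (fun x => c * phi x) = (fun x => c * 'D_e1 phi x) &
    'D_e2 (fun x => c * phi x) = (fun x => c * 'D_e2 phi x)].
Proof.
move=> /C1c_elim[h1 [r1 /andP[_ r11] p1]].
have h := C1PM (C1P_cst c) h1; split.
- apply: (C1c_intro h r11) => x /p1[-> _ _]; exact: mulr0.
- by apply/funext => x; have [_ ->] := C1P_d1 h x; rewrite /cst mulr0 addr0.
- by apply/funext => x; have [_ ->] := C1P_d2 h x; rewrite /cst mulr0 addr0.
Qed.

(** Membership together with one explicit weak gradient. The representatives chosen by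
    [weak_derivative] cannot be computed; [grad_innerE] and [grad_norm_sq] allow any others in their
    place. *)
Definition H10grad u g1 g2 : Prop :=
  [/\ H10 u, is_weak_derivative e1 u g1 & is_weak_derivative e2 u g2].

Lemma H10_H10grad u : H10 u -> H10grad u (weak_derivative e1 u) (weak_derivative e2 u).
Proof. by move=> hu; have [_ ? ? _] := H10_approx hu; split. Qed.

Lemma H10_L2 u : H10 u -> L2 u.
Proof. by case/H10_approx. Qed.

Lemma C1c_H10grad phi : C1c phi -> H10grad phi ('D_e1 phi) ('D_e2 phi).
Proof.
move=> cp; have z (u : R * R -> R) : L2_cvg (fun=> u) u.
  rewrite /L2_cvg (_ : (fun n => _) = cst 0); first exact: cvg_cst.
  apply/funext => n; rewrite (@I_eq _ _ (cst 0)).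
    by rewrite /Rintegral integral0.
  by move=> x _; rewrite subrr expr0n.
by have [] := @H10_intro phi _ _ (fun=> phi) (C1c_L2 cp) (C1c_L2_d1 cp) (C1c_L2_d2 cp) (fun=> cp) (z _) (z _) (z _).
Qed.

Lemma H10gradD u g1 g2 v h1 h2 : H10grad u g1 g2 -> H10grad v h1 h2 ->
  H10grad (fun x => u x + v x) (fun x => g1 x + h1 x) (fun x => g2 x + h2 x).
Proof.
move=> [hu u1 u2] [hv v1 v2].
have [Lu w1 w2 [phi [cphi c0 c1 c2]]] := H10_approx hu.
have [Lv x1 x2 [psi [cpsi d0 d1 d2]]] := H10_approx hv.
have Lp n := C1c_L2 (cphi n); have Lq n := C1c_L2 (cpsi n).
have Lp1 n := C1c_L2_d1 (cphi n); have Lq1 n := C1c_L2_d1 (cpsi n).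
have Lp2 n := C1c_L2_d2 (cphi n); have Lq2 n := C1c_L2_d2 (cpsi n).
have cpp n : C1c (fun x => phi n x + psi n x) by have [] := C1cD (cphi n) (cpsi n).
have k0 := L2_cvgD Lu Lv Lp Lq c0 d0.
have k1 := L2_cvgD (is_wd_L2 w1) (is_wd_L2 x1) Lp1 Lq1 c1 d1.
have k2 := L2_cvgD (is_wd_L2 w2) (is_wd_L2 x2) Lp2 Lq2 c2 d2.
have E1 : (fun n => 'D_e1 (fun x => phi n x + psi n x)) = (fun n x => 'D_e1 (phi n) x + 'D_e1 (psi n) x).
  by apply/funext => n; have [] := C1cD (cphi n) (cpsi n).
have E2 : (fun n => 'D_e2 (fun x => phi n x + psi n x)) = (fun n x => 'D_e2 (phi n) x + 'D_e2 (psi n) x).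
  by apply/funext => n; have [] := C1cD (cphi n) (cpsi n).
rewrite -E1 in k1; rewrite -E2 in k2.
have [h _ _] := H10_intro (L2D Lu Lv) (L2D (is_wd_L2 w1) (is_wd_L2 x1)) (L2D (is_wd_L2 w2) (is_wd_L2 x2)) cpp k0 k1 k2.
split; [exact: h|exact: (is_wdD (or_introl erefl) Lu Lv u1 v1)|exact: (is_wdD (or_intror erefl) Lu Lv u2 v2)].
Qed.

Lemma H10gradZ (c : R) u g1 g2 : H10grad u g1 g2 ->
  H10grad (fun x => c * u x) (fun x => c * g1 x) (fun x => c * g2 x).
Proof.
move=> [hu u1 u2].
have [Lu w1 w2 [phi [cphi c0 c1 c2]]] := H10_approx hu.
have Lp n := C1c_L2 (cphi n).
have Lp1 n := C1c_L2_d1 (cphi n); have Lp2 n := C1c_L2_d2 (cphi n).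
have cpp n : C1c (fun x => c * phi n x) by have [] := C1cZ c (cphi n).
have k0 := L2_cvgZ c Lu Lp c0.
have k1 := L2_cvgZ c (is_wd_L2 w1) Lp1 c1.
have k2 := L2_cvgZ c (is_wd_L2 w2) Lp2 c2.
have E1 : (fun n => 'D_e1 (fun x => c * phi n x)) = (fun n x => c * 'D_e1 (phi n) x).
  by apply/funext => n; have [] := C1cZ c (cphi n).
have E2 : (fun n => 'D_e2 (fun x => c * phi n x)) = (fun n x => c * 'D_e2 (phi n) x).
  by apply/funext => n; have [] := C1cZ c (cphi n).
rewrite -E1 in k1; rewrite -E2 in k2.
have [h _ _] := H10_intro (L2Z c Lu) (L2Z c (is_wd_L2 w1)) (L2Z c (is_wd_L2 w2)) cpp k0 k1 k2.
split; [exact: h|exact: (is_wdZ c (or_introl erefl) Lu u1)|exact: (is_wdZ c (or_intror erefl) Lu u2)].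
Qed.

Lemma H10grad_eq u u' g1 g2 g1' g2' : H10grad u g1 g2 ->
  (forall x, disk x -> u x = u' x) -> (forall x, disk x -> g1 x = g1' x) ->
  (forall x, disk x -> g2 x = g2' x) -> H10grad u' g1' g2'.
Proof.
move=> [hu u1 u2] uu gg1 gg2; split; first exact: H10_eq hu.
- exact: is_wd_eq uu (is_wd_eqr gg1 u1).
- exact: is_wd_eq uu (is_wd_eqr gg2 u2).
Qed.

Lemma H10gradB u g1 g2 v h1 h2 : H10grad u g1 g2 -> H10grad v h1 h2 ->
  H10grad (fun x => u x - v x) (fun x => g1 x - h1 x) (fun x => g2 x - h2 x).
Proof.
by move=> hu /(H10gradZ (-1))/(H10gradD hu)/H10grad_eq; apply => x _; rewrite mulN1r.
Qed.

Lemma grad_innerE u g1 g2 v h1 h2 : H10grad u g1 g2 -> H10grad v h1 h2 ->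
  grad_inner u v = I (fun x => g1 x * h1 x + g2 x * h2 x).
Proof.
move=> [hu u1 u2] [hv v1 v2].
apply: I_ae.
- apply: measurable_funD; apply: measurable_funM.
  + exact: L2_mf (is_wd_L2 (wd_spec u1)).
  + exact: L2_mf (is_wd_L2 (wd_spec v1)).
  + exact: L2_mf (is_wd_L2 (wd_spec u2)).
  + exact: L2_mf (is_wd_L2 (wd_spec v2)).
- apply: measurable_funD; apply: measurable_funM.
  + exact: L2_mf (is_wd_L2 u1).
  + exact: L2_mf (is_wd_L2 v1).
  + exact: L2_mf (is_wd_L2 u2).
  + exact: L2_mf (is_wd_L2 v2).
- have a1 := wd_ae (or_introl erefl) u1; have a2 := wd_ae (or_intror erefl) u2.
  have b1 := wd_ae (or_introl erefl) v1; have b2 := wd_ae (or_intror erefl) v2.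
  have a := aeI a1 a2; have b := aeI b1 b2.
  by apply: aeS (aeI a b) => x [[h1' h2'] [h3' h4']] dx; rewrite h1'// h2'// h3'// h4'.
Qed.

Lemma grad_norm_sq u g1 g2 : H10grad u g1 g2 ->
  grad_norm u ^+ 2 = I (fun x => g1 x ^+ 2 + g2 x ^+ 2).
Proof.
move=> hu; rewrite /grad_norm sqr_sqrtr.
  by rewrite (grad_innerE hu hu); apply: I_eq => x _; rewrite !expr2.
by rewrite (grad_innerE hu hu); apply: Rintegral_ge0 => x _; rewrite addr_ge0// -expr2 sqr_ge0.
Qed.

(** Density: each of the three pairings is continuous for the L^2 convergences supplied by
    [H10_approx]. *)
Lemma H10_weak_form X1 X2 F u g1 g2 : L2 X1 -> L2 X2 -> L2 F ->
  (forall phi, C1c phi -> I (fun x => X1 x * 'D_e1 phi x + X2 x * 'D_e2 phi x + F x * phi x) = 0) ->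
  H10grad u g1 g2 -> I (fun x => X1 x * g1 x + X2 x * g2 x + F x * u x) = 0.
Proof.
move=> L1 L2' LF h [hu u1 u2].
have [Lu w1 w2 [phi [cphi c0 c1 c2]]] := H10_approx hu.
have m1 := L2_cvg_mul (is_wd_L2 w1) (fun n => C1c_L2_d1 (cphi n)) L1 c1.
have m2 := L2_cvg_mul (is_wd_L2 w2) (fun n => C1c_L2_d2 (cphi n)) L2' c2.
have m0 := L2_cvg_mul Lu (fun n => C1c_L2 (cphi n)) LF c0.
pose S n := I (fun x => 'D_e1 (phi n) x * X1 x) + I (fun x => 'D_e2 (phi n) x * X2 x) + I (fun x => phi n x * F x).
have hS : S n @[n --> \oo] --> I (fun x => weak_derivative e1 u x * X1 x) + I (fun x => weak_derivative e2 u x * X2 x) + I (fun x => u x * F x).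
  by apply: cvgD => //; apply: cvgD.
have S0 : S = cst 0.
  apply/funext => n; rewrite /cst -(h _ (cphi n)) /S.
  have i1 := L2M (C1c_L2_d1 (cphi n)) L1; have i2 := L2M (C1c_L2_d2 (cphi n)) L2'.
  have i0 := L2M (C1c_L2 (cphi n)) LF.
  by rewrite -(I_D i1 i2) -(I_D (IntD i1 i2) i0); apply: I_eq => x _; ring.
rewrite S0 in hS; have -> := cvg_unique (@Rhausdorff R) (cvg_cst _) hS.
have i1 := L2M (is_wd_L2 w1) L1; have i2 := L2M (is_wd_L2 w2) L2'.
have i0 := L2M Lu LF.
rewrite -(I_D i1 i2) -(I_D (IntD i1 i2) i0); apply: I_ae.
- apply: measurable_funD; first apply: measurable_funD; apply: measurable_funM; apply: L2_mf => //.
  + exact: is_wd_L2 u1.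
  + exact: is_wd_L2 u2.
- exact: Int_mf (IntD (IntD i1 i2) i0).
- have a1 := wd_ae (or_introl erefl) u1; have a2 := wd_ae (or_intror erefl) u2.
  by apply: aeS (aeI a1 a2) => x [h1' h2'] dx; rewrite h1'// h2'//; ring.
Qed.

End WeakDerivatives.

(** * A weak Trudinger inequality *)

Section Trudinger.
Context {R : realType}.
Local Notation mu2 := ((@lebesgue_measure R \x @lebesgue_measure R)%E).
Local Notation P := (measurableTypeR R * measurableTypeR R)%type.
Local Notation mf2 := (@measurable_fun _ _ (measurableTypeR R * measurableTypeR R)%type R).
Implicit Types (phi psi u v g : R * R -> R) (a b t : R).
Local Notation I u := (Rintegral mu2 disk u).
Local Notation Int u := (mu2.-integrable disk (EFin \o u)).

Lemma mf_bool (p : R * R -> bool) :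
  @measurable_fun _ _ P bool disk p -> mf2 disk (fun x => (p x)%:R).
Proof.
by move=> mp; apply: (@measurable_comp _ _ _ P bool R setT (fun b : bool => b%:R) disk p).
Qed.

Lemma L2_bool (p : R * R -> bool) :
  @measurable_fun _ _ P bool disk p -> L2 (fun x => (p x)%:R : R).
Proof.
move=> mp; apply: (@L2_bounded _ _ 1); first exact: mf_bool.
by move=> x _; case: (p x); rewrite ?normr1 ?normr0.
Qed.

Lemma mf_ler v t : mf2 disk v -> @measurable_fun _ _ P bool disk (fun x => t <= v x).
Proof. by move=> mv; apply: measurable_fun_ler. Qed.

Lemma mf_ltr v t : mf2 disk v -> @measurable_fun _ _ P bool disk (fun x => v x < t).
Proof. by move=> mv; apply: measurable_fun_ltr. Qed.

Definition tail v t : R := I (fun x => (t <= v x)%R%:R).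

Lemma tail_le_pi v t : mf2 disk v -> tail v t <= pi.
Proof.
move=> mv; have := @Rintegral_cst _ P R mu2 _ measurable_disk 1.
have -> : fine (mu2 disk) = pi :> R by rewrite mu2_disk.
rewrite mul1r => <-; apply: I_le => [||x _]; last by case: (t <= v x).
- exact: L2_Int (L2_bool (mf_ler _ mv)).
- exact: L2_Int (L2_continuous (@cst_continuous _ _ (1 : R))).
Qed.

Lemma tail_ge0 v t : 0 <= tail v t.
Proof. by apply: Rintegral_ge0 => x _; case: (t <= v x). Qed.

Definition energy_below phi t : R :=
  I (fun x => (phi x < t)%R%:R * ('D_e1 phi x ^+ 2 + 'D_e2 phi x ^+ 2)).

Lemma ramp_arg_ge1 a b (p : R) : a < b -> b <= p -> 1 <= (p - a) / (b - a).
Proof. by move=> ab bp; rewrite ler_pdivlMr ?subr_gt0// mul1r lerD2r. Qed.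

Lemma ramp_arg_le0 a b (p : R) : a < b -> p <= a -> (p - a) / (b - a) <= 0.
Proof. by move=> ab bp; rewrite ler_pdivrMr ?subr_gt0// mul0r subr_le0. Qed.

Lemma mul_le_of_sq (x y c i1 i2 : R) : x ^+ 2 <= c * i1 -> y ^+ 2 <= c * i2 -> x * y <= c * (i1 + i2).
Proof.
by have := sqr_ge0 (x - y); have := sqr_ge0 x; have := sqr_ge0 y; nra.
Qed.

Lemma C1c_ramp phi a b : C1c phi -> 0 <= a -> a < b ->
  let w := fun x => ramp ((phi x - a) / (b - a)) in
  [/\ C1P w (fun x => dramp ((phi x - a) / (b - a)) * ((b - a)^-1 * 'D_e1 phi x))
            (fun x => dramp ((phi x - a) / (b - a)) * ((b - a)^-1 * 'D_e2 phi x)) &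
      forall x, 1 <= sqn x -> [/\ w x = 0,
        dramp ((phi x - a) / (b - a)) * ((b - a)^-1 * 'D_e1 phi x) = 0 &
        dramp ((phi x - a) / (b - a)) * ((b - a)^-1 * 'D_e2 phi x) = 0]].
Proof.
move=> /C1c_elim[h [r /andP[_ r1] rp]] a0 ab w.
have h2 := C1PD (C1PM (C1P_cst (b - a)^-1) h) (C1P_cst (- a / (b - a))).
split.
  have := C1P_comp h2 is_derive_ramp dramp_continuous.
  have E x : cst (b - a)^-1 x * phi x + cst (- a / (b - a)) x = (phi x - a) / (b - a).
    by rewrite /cst; ring.
  by move/C1P_ext; apply => x; rewrite E// /cst; ring.
move=> x x1; have [p0 -> ->] := rp x (le_trans (ltW r1) x1).
rewrite !mulr0 /w p0; split => //; apply: ramp_le0.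
by rewrite sub0r mulNr oppr_le0 divr_ge0// subr_ge0 ltW.
Qed.

(** Gagliardo's inequality for [phi] truncated between the levels a and b. The truncation is 1 above
    b, and its gradient lives on {a <= phi < b}; Cauchy-Schwarz pairs it with the indicator of {a <=
    phi}, producing [tail phi a]. The 4 is the square of the bound 2 on [dramp]. *)
Lemma tail_step phi a b : C1c phi -> 0 <= a -> a < b ->
  tail phi b <= 4 / (b - a) ^+ 2 * (energy_below phi b - energy_below phi a) * tail phi a.
Proof.
move=> cphi a0 ab; have [hw w0] := C1c_ramp cphi a0 ab.
set w := (X in C1P X _ _) in hw w0; set d1 := (X in C1P _ X _) in hw w0; set d2 := (X in C1P _ _ X) in hw w0.
have ba0 : 0 < b - a by rewrite subr_gt0.
have bai0 : 0 < (b - a)^-1 by rewrite invr_gt0.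
have mp : mf2 disk phi := L2_mf (C1c_L2 cphi).
have G := C1P_gagliardo hw w0.
have Lw := L2_continuous (C1P_continuous hw).
have Lb := L2_bool (mf_ler b mp); have La := L2_bool (mf_ler a mp).
have tw : tail phi b <= I (fun x => w x ^+ 2).
  apply: I_le => [||x _]; [exact: L2_Int|exact: L2_sq|].
  case: (leP b (phi x)) => bp; last exact: sqr_ge0.
  by rewrite /w ramp_ge1 ?expr1n//; exact: ramp_arg_ge1.
apply: (le_trans tw); apply: (le_trans G).
(* The indicator of the slab {a <= phi < b}, outside of which the truncated function is locally
   constant. *)
pose k x : R := (a <= phi x)%R%:R * (phi x < b)%R%:R.
have mk : mf2 disk k by apply: measurable_funM; apply: mf_bool; [exact: mf_ler|exact: mf_ltr].
have kb x : 0 <= k x <= 1 by rewrite /k; case: (a <= phi x); case: (phi x < b); rewrite ?(mul0r,mulr0,mulr1) ?lexx ?ler01.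
have L1 := C1c_L2_d1 cphi; have L2' := C1c_L2_d2 cphi.
have Lk g : L2 g -> L2 (fun x => k x * g x).
  move=> Lg; apply: L2_intro; first by apply: measurable_funM => //; exact: L2_mf.
  apply: Int_le (L2_sq Lg) _; first by apply: measurable_funX; apply: measurable_funM => //; exact: L2_mf.
  move=> x _; rewrite normrX normrM exprMn (real_normK (num_real (g x))).
  have /andP[k0 k1] := kb x; rewrite (ger0_norm k0).
  by apply: ler_piMl; [exact: sqr_ge0|rewrite expr_le1].
have key g d : L2 g -> continuous d -> (forall x, d x = dramp ((phi x - a) / (b - a)) * ((b - a)^-1 * g x)) ->
    I (fun x => `|d x|) ^+ 2 <= 4 / (b - a) ^+ 2 * tail phi a * I (fun x => (k x * g x) ^+ 2).
  move=> Lg cd dE.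
  have Ln : L2 (fun x => `|k x * g x|).
    apply: L2_intro; first by apply: measurableT_comp => //; exact: L2_mf (Lk _ Lg).
    by apply: Int_eq (L2_sq (Lk _ Lg)) => x _; rewrite real_normK ?num_real.
  have h1 : I (fun x => `|d x|) <= 2 / (b - a) * I (fun x => (a <= phi x)%R%:R * `|k x * g x|).
    rewrite -(I_Z _ (L2M La Ln)); apply: I_le.
    - exact: Int_norm (L2_Int (L2_continuous cd)).
    - exact: IntZ (L2M La Ln).
    move=> x _; rewrite dE normrM.
    have /andP[r0 r2] := dramp_bound ((phi x - a) / (b - a)).
    case: (leP a (phi x)) => ap; last first.
      have -> : dramp ((phi x - a) / (b - a)) = 0 by apply: dramp_out; left; apply: ramp_arg_le0 => //; exact: ltW.
      by rewrite normr0 mul0r; apply: mulr_ge0; [rewrite divr_ge0// ltW|apply: mulr_ge0].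
    rewrite /k ap; case: (ltP (phi x) b) => pb; last first.
      have -> : dramp ((phi x - a) / (b - a)) = 0 by apply: dramp_out; right; exact: ramp_arg_ge1.
      by rewrite normr0 mul0r; apply: mulr_ge0; [rewrite divr_ge0// ltW|apply: mulr_ge0].
    rewrite !mul1r (ger0_norm r0) normrM (ger0_norm (ltW bai0)) mulrA.
    by apply: ler_wpM2r => //; rewrite ler_wpM2r// ltW.
  have cs := cauchy_schwarz La Ln.
  have E1 : I (fun x => ((a <= phi x)%R%:R : R) ^+ 2) = tail phi a.
    by apply: I_eq => x _; case: (a <= phi x); rewrite ?expr1n ?expr0n.
  have E2 : I (fun x => `|k x * g x| ^+ 2) = I (fun x => (k x * g x) ^+ 2).
    by apply: I_eq => x _; rewrite real_normK ?num_real.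
  rewrite E1 E2 in cs.
  have h0 : 0 <= I (fun x => `|d x|) by apply: Rintegral_ge0.
  apply: (@le_trans _ _ ((2 / (b - a) * I (fun x => (a <= phi x)%R%:R * `|k x * g x|)) ^+ 2)).
    by rewrite lerXn2r ?nnegrE// (le_trans h0).
  rewrite exprMn -mulrA; apply: (@le_trans _ _ ((2 / (b - a)) ^+ 2 * (tail phi a * I (fun x => (k x * g x) ^+ 2)))).
    by apply: ler_wpM2l => //; exact: sqr_ge0.
  by rewrite le_eqVlt; apply/orP; left; apply/eqP; field; rewrite gt_eqF.
have k1 := key _ d1 L1 (C1P_c1 hw) (fun=> erefl).
have k2 := key _ d2 L2' (C1P_c2 hw) (fun=> erefl).
have en : I (fun x => (k x * 'D_e1 phi x) ^+ 2) + I (fun x => (k x * 'D_e2 phi x) ^+ 2) <=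
    energy_below phi b - energy_below phi a.
  have Lsq : Int (fun x => 'D_e1 phi x ^+ 2 + 'D_e2 phi x ^+ 2) := IntD (L2_sq L1) (L2_sq L2').
  have ieb t : Int (fun x => (phi x < t)%R%:R * ('D_e1 phi x ^+ 2 + 'D_e2 phi x ^+ 2)).
    apply: (Int_le _ Lsq).
      by apply: measurable_funM; [apply: mf_bool; exact: mf_ltr|exact: Int_mf Lsq].
    move=> x _; rewrite normrM (ger0_norm (addr_ge0 (sqr_ge0 _) (sqr_ge0 _))).
    by apply: ler_piMl; [exact: addr_ge0 (sqr_ge0 _) (sqr_ge0 _)|case: (phi x < t); rewrite ?normr1 ?normr0].
  rewrite /energy_below -(I_B (ieb b) (ieb a)) -(I_D (L2_sq (Lk _ L1)) (L2_sq (Lk _ L2'))).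
  apply: I_le.
  - exact: IntD (L2_sq (Lk _ L1)) (L2_sq (Lk _ L2')).
  - exact: IntB (ieb b) (ieb a).
  - move=> x _; rewrite -mulrBl !exprMn -mulrDr; apply: ler_wpM2r.
      exact: addr_ge0 (sqr_ge0 _) (sqr_ge0 _).
    rewrite /k; case: (ltP (phi x) a) => pa.
      by rewrite expr0n/= mul0r (lt_trans pa ab) subrr.
    by rewrite expr1n mul1r subr0; case: (phi x < b); rewrite ?expr1n ?expr0n.
have c0 : 0 <= 4 / (b - a) ^+ 2 * tail phi a.
  by apply: mulr_ge0; [rewrite divr_ge0// sqr_ge0|exact: tail_ge0].
apply: (le_trans (mul_le_of_sq k1 k2)).
by rewrite [leRHS]mulrAC; apply: ler_wpM2l.
Qed.

Lemma energy_below_mono phi a b : C1c phi -> a <= b ->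
  0 <= energy_below phi a <= energy_below phi b /\
  energy_below phi b <= I (fun x => 'D_e1 phi x ^+ 2 + 'D_e2 phi x ^+ 2).
Proof.
move=> cphi ab; have L1 := C1c_L2_d1 cphi; have L2' := C1c_L2_d2 cphi.
have mp : mf2 disk phi := L2_mf (C1c_L2 cphi).
have Lsq : Int (fun x => 'D_e1 phi x ^+ 2 + 'D_e2 phi x ^+ 2) := IntD (L2_sq L1) (L2_sq L2').
have s0 x : 0 <= 'D_e1 phi x ^+ 2 + 'D_e2 phi x ^+ 2 by rewrite addr_ge0// sqr_ge0.
have ieb t : Int (fun x => (phi x < t)%R%:R * ('D_e1 phi x ^+ 2 + 'D_e2 phi x ^+ 2)).
  apply: (Int_le _ Lsq).
    by apply: measurable_funM; [apply: mf_bool; exact: mf_ltr|exact: Int_mf Lsq].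
  move=> x _; rewrite normrM (ger0_norm (s0 _)).
  by apply: ler_piMl => //; case: (phi x < t); rewrite ?normr1 ?normr0.
split; last first.
  by apply: I_le => // x _; apply: ler_piMl => //; case: (phi x < b).
apply/andP; split; first by apply: Rintegral_ge0 => x _; rewrite mulr_ge0.
apply: I_le => // x _; apply: ler_wpM2r => //.
by case: (ltP (phi x) a) => // pa; rewrite (lt_le_trans pa ab).
Qed.

(** Climb to height t in N equal steps d = t / N. The product of the energy increments is at most (E
    / N)^N, so each factor amounts to 4 N E / t^2, which is at most 1/2 by hypothesis. *)
Lemma tail_C1c phi t (N : nat) (E : R) : C1c phi -> 0 < t ->
  I (fun x => 'D_e1 phi x ^+ 2 + 'D_e2 phi x ^+ 2) <= E -> 8 * N%:R * E <= t ^+ 2 ->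
  tail phi t <= pi / 2 ^+ N.
Proof.
move=> cphi t0 DE NE; have mp : mf2 disk phi := L2_mf (C1c_L2 cphi).
case: N NE => [|N'] NE; first by rewrite expr0 divr1; exact: tail_le_pi.
set N := N'.+1 in NE *; have N0 : 0 < N%:R :> R by rewrite ltr0n.
pose d := t / N%:R; have d0 : 0 < d by rewrite divr_gt0.
pose e (j : nat) := energy_below phi (j%:R * d).
have em j : 0 <= e j.+1 - e j.
  have [] := @energy_below_mono phi (j%:R * d) (j.+1%:R * d) cphi; last by rewrite subr_ge0 => /andP[].
  by rewrite ler_wpM2r ?ltW// ltr_nat.
have step (m : nat) : tail phi (m%:R * d) <= pi * \prod_(j < m) (4 / d ^+ 2 * (e j.+1 - e j)).
  elim: m => [|m IH]; first by rewrite big_ord0 mulr1; exact: tail_le_pi.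
  have := @tail_step phi (m%:R * d) (m.+1%:R * d) cphi.
  have -> : m.+1%:R * d - m%:R * d = d by rewrite -natr1; ring.
  move=> H; rewrite big_ord_recr/= [leRHS]mulrA.
  apply: (@le_trans _ _ _ _ _ (H _ _)).
  - by rewrite mulr_ge0// ltW.
  - by rewrite ltr_pM2r// ltr_nat.
  - rewrite [leLHS]mulrC; apply: ler_wpM2r => //.
    by apply: mulr_ge0; [rewrite divr_ge0// sqr_ge0|exact: em].
have := step N; have -> : N%:R * d = t by rewrite /d mulrC divfK// gt_eqF.
move/le_trans; apply; rewrite ler_wpM2l ?(ltW (pi_gt0 R))//.
have nn (i : 'I_N) : i \in predT -> 0 <= 4 / d ^+ 2 * (e i.+1 - e i).
  by move=> _; rewrite mulr_ge0// divr_ge0// sqr_ge0.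
(* The increments telescope in the arithmetic mean, which is why the energy enters only through its
   total. *)
have := (leif_AGM nn).1; rewrite cardT size_enum_ord => /le_trans; apply.
rewrite -exprVn lerXn2r ?nnegrE ?invr_ge0//.
  by rewrite divr_ge0// sumr_ge0// => i _; exact: nn.
rewrite -mulr_sumr ler_pdivrMr//.
have -> : \sum_(i < N) (e i.+1 - e i) = e N - e 0%N.
  by rewrite -(big_mkord xpredT (fun i => e i.+1 - e i)) telescope_sumr.
have [/andP[e0 _] eE] := @energy_below_mono phi (0%:R * d) (N%:R * d) cphi ltac:(by rewrite ler_wpM2r ?ltW// ltr_nat).
have eN : e N - e 0%N <= E by rewrite /e; lra.
apply: (@le_trans _ _ (4 / d ^+ 2 * E)); first by rewrite ler_wpM2l// divr_ge0// sqr_ge0.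
have -> : 4 / d ^+ 2 * E = 4 * N%:R ^+ 2 * E / t ^+ 2 by rewrite /d; field; rewrite !gt_eqF.
rewrite ler_pdivrMr ?exprn_gt0//.
have := ler_wpM2l (ltW N0) NE; move: (N%:R : R) (t ^+ 2) => n1 t1; lra.
Qed.

Lemma L2_cvg_sq (un : nat -> R * R -> R) u : L2 u -> (forall n, L2 (un n)) -> L2_cvg un u ->
  I (fun x => un n x ^+ 2) @[n --> \oo] --> I (fun x => u x ^+ 2).
Proof.
move=> Lu Ln c.
have c1 := L2_cvg_mul Lu Ln Lu c.
have E n : I (fun x => un n x ^+ 2) = 2 * I (fun x => un n x * u x) - I (fun x => u x * u x) + I (fun x => (u x - un n x) ^+ 2).
  have i1 := L2M (Ln n) Lu; have i2 := L2M Lu Lu; have i3 := L2_sq (L2B Lu (Ln n)).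
  rewrite -(I_Z 2 i1) -(I_B (IntZ 2 i1) i2) -(I_D (IntB (IntZ 2 i1) i2) i3).
  by apply: I_eq => x _; ring.
pose A := I (fun x => u x * u x); rewrite -/A in c1 E.
have lim : 2 * I (fun x => un n x * u x) - A + I (fun x => (u x - un n x) ^+ 2) @[n --> \oo] --> 2 * A - A + 0.
  apply: cvgD; last exact: c.
  by apply: cvgB; [apply: cvgM; [exact: cvg_cst|exact: c1]|exact: cvg_cst].
rewrite (_ : 2 * A - A + 0 = A) in lim; last by ring.
rewrite (_ : I (fun x => u x ^+ 2) = A); last by apply: I_eq => x _; rewrite expr2.
have -> : (fun n => I (fun x => un n x ^+ 2)) = (fun n => 2 * I (fun x => un n x * u x) - A + I (fun x => (u x - un n x) ^+ 2)).
  exact/funext.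
exact: lim.
Qed.

(** Chebyshev: where u >= t but v < t / 2, the difference exceeds t / 2. *)
Lemma tail_split u v t : L2 u -> L2 v -> 0 < t ->
  tail u t <= tail v (t / 2) + 4 / t ^+ 2 * I (fun x => (u x - v x) ^+ 2).
Proof.
move=> Lu Lv t0; have Lb := L2_Int (L2_bool (mf_ler t (L2_mf Lu))).
have La := L2_Int (L2_bool (mf_ler (t / 2) (L2_mf Lv))); have i3 := L2_sq (L2B Lu Lv).
rewrite -(I_Z _ i3) -(I_D La (IntZ _ i3)); apply: I_le => [||x _]; [exact: Lb|exact: IntD La (IntZ _ i3)|].
have p0 : 0 <= 4 / t ^+ 2 * (u x - v x) ^+ 2 by rewrite mulr_ge0 ?sqr_ge0// divr_ge0 ?sqr_ge0.
case: (leP t (u x)) => ut; last first.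
  by rewrite addr_ge0//; case: (t / 2 <= v x).
case: (leP (t / 2) (v x)) => vt; first by rewrite lerDl.
rewrite add0r mulrAC ler_pdivlMr ?exprn_gt0// mul1r.
move: (u x) (v x) t0 ut vt => a b ? ? ?; nra.
Qed.

Lemma L2_cvg_ae (un : nat -> R * R -> R) u u' : L2 u -> L2 u' -> (forall n, L2 (un n)) ->
  {ae mu2, forall x, disk x -> u x = u' x} -> L2_cvg un u -> L2_cvg un u'.
Proof.
move=> Lu Lu' Ln uu; rewrite /L2_cvg.
have -> // : (fun n => I (fun x => (u x - un n x) ^+ 2)) = (fun n => I (fun x => (u' x - un n x) ^+ 2)).
apply/funext => n; apply: I_ae.
- exact: Int_mf (L2_sq (L2B Lu (Ln n))).
- exact: Int_mf (L2_sq (L2B Lu' (Ln n))).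
- by apply: aeS uu => x h dx; rewrite h.
Qed.

Lemma H10grad_approx u g1 g2 : H10grad u g1 g2 ->
  exists phi : nat -> R * R -> R, [/\ forall n, C1c (phi n), L2_cvg phi u,
    L2_cvg (fun n => 'D_e1 (phi n)) g1 & L2_cvg (fun n => 'D_e2 (phi n)) g2].
Proof.
move=> [hu u1 u2]; have [Lu w1 w2 [phi [cphi c0 c1 c2]]] := H10_approx hu.
exists phi; split; [exact: cphi|exact: c0|..].
- exact: (L2_cvg_ae (is_wd_L2 w1) (is_wd_L2 u1) (fun n => C1c_L2_d1 (cphi n)) (wd_ae (or_introl erefl) u1) c1).
- exact: (L2_cvg_ae (is_wd_L2 w2) (is_wd_L2 u2) (fun n => C1c_L2_d2 (cphi n)) (wd_ae (or_intror erefl) u2) c2).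
Qed.

(** Approximation by test functions at half the height, whence 32 = 4 times 8. The strict inequality
    on the energy leaves room for the approximating energies. *)
Lemma tail_H10 v g1 g2 t (N : nat) (E : R) : H10grad v g1 g2 -> 0 < t ->
  I (fun x => g1 x ^+ 2 + g2 x ^+ 2) < E -> 32 * N%:R * E <= t ^+ 2 ->
  tail v t <= pi / 2 ^+ N.
Proof.
move=> hgv t0 gE NE.
have [phi [cphi c0 c1 c2]] := H10grad_approx hgv.
have [/H10_L2 Lv /is_wd_L2 L1 /is_wd_L2 L2'] := hgv.
have := L2_cvg_sq L1 (fun n => C1c_L2_d1 (cphi n)) c1.
have := L2_cvg_sq L2' (fun n => C1c_L2_d2 (cphi n)) c2.
move: gE; rewrite (I_D (L2_sq L1) (L2_sq L2')).
move: (I (fun x => g1 x ^+ 2)) (I (fun x => g2 x ^+ 2)) => A B hg s2 s1.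
have t20 : 0 < t / 2 by rewrite divr_gt0.
have lim : pi / 2 ^+ N + 4 / t ^+ 2 * I (fun x => (v x - phi n x) ^+ 2) @[n --> \oo] --> (pi / 2 ^+ N + 4 / t ^+ 2 * 0 : R).
  by apply: cvgD; [exact: cvg_cst|apply: cvgM; [exact: cvg_cst|exact: c0]].
rewrite mulr0 addr0 in lim.
rewrite -(cvg_lim (@Rhausdorff R) lim); apply: limr_ge; first exact: (cvgP _ lim).
have e0 : 0 < (E - (A + B)) / 2 by rewrite divr_gt0// subr_gt0.
have n1 : \forall n \near \oo, I (fun x => 'D_e1 (phi n) x ^+ 2) < A + (E - (A + B)) / 2.
  by apply: (cvgr_lt A s1); rewrite ltrDl.
have n2 : \forall n \near \oo, I (fun x => 'D_e2 (phi n) x ^+ 2) < B + (E - (A + B)) / 2.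
  by apply: (cvgr_lt B s2); rewrite ltrDl.
apply: filterS2 n1 n2 => n hn1 hn2.
apply: (le_trans (tail_split Lv (C1c_L2 (cphi n)) t0)); apply: lerD => //.
apply: (tail_C1c (cphi n) t20 (E := E)).
  rewrite (I_D (L2_sq (C1c_L2_d1 (cphi n))) (L2_sq (C1c_L2_d2 (cphi n)))).
  by apply: (le_trans (lerD (ltW hn1) (ltW hn2))); clear; lra.
have -> : (t / 2) ^+ 2 = t ^+ 2 / 4 by field.
rewrite ler_pdivlMr//; apply: le_trans NE; rewrite le_eqVlt; apply/orP; left; apply/eqP; ring.
Qed.

(** Closed form of the partial sums of (j + 1) q^j at q = 2/3; their limit is (1 - q)^-2 = 9. *)
Definition series_bound (n : nat) : R := 9 - (3 * n%:R + 9) * (2 / 3) ^+ n.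

Lemma series_boundE n : \sum_(j < n) j.+1%:R * (2 / 3 : R) ^+ j = series_bound n.
Proof.
elim: n => [|n IH]; first by rewrite big_ord0 /series_bound expr0; ring.
by rewrite big_ord_recr/= IH /series_bound exprS -[n.+1%:R]natr1; move: ((2 / 3) ^+ n) (n%:R : R) => r m; field.
Qed.

Lemma series_bound_le n : \sum_(j < n) j.+1%:R * (2 / 3 : R) ^+ j <= 9.
Proof.
rewrite series_boundE /series_bound gerBl; apply: mulr_ge0; last by rewrite exprn_ge0//; lra.
by rewrite addr_ge0// mulr_ge0.
Qed.

(* A weak form of the Trudinger inequality: the level sets at heights
   [sqrt (32 N E)] have measure at most [2 pi / 2 ^ N]. *)
Lemma trudinger v g1 g2 (E K : R) : H10grad v g1 g2 ->
  I (fun x => g1 x ^+ 2 + g2 x ^+ 2) < E -> 0 <= K -> 128 * K * E <= 1 ->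
  Int (fun x => v x ^+ 2 * expR (K * v x ^+ 2)) /\
  I (fun x => v x ^+ 2 * expR (K * v x ^+ 2)) <= 768 * pi * E.
Proof.
move=> hv gE K0 KE.
have E0 : 0 < E.
  by apply: le_lt_trans gE; apply: Rintegral_ge0 => x _; rewrite addr_ge0// sqr_ge0.
have Lv : L2 v by case: hv => /H10_L2.
have mv := L2_mf Lv.
have Lav : L2 (fun x => `|v x|).
  apply: L2_intro; first exact: measurableT_comp.
  by apply: Int_eq (L2_sq Lv) => x _; rewrite real_normK ?num_real.
pose t (n : nat) := Num.sqrt (32 * n%:R * E).
have tsq n : t n ^+ 2 = 32 * n%:R * E by rewrite sqr_sqrtr// !mulr_ge0// ltW.
have tle n : 32 * n%:R * E <= t n ^+ 2 by rewrite tsq.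
(* A bound for the integrand where t n <= |v| < t (n + 1): there v^2 <= 32 E (n + 1) and expR (K
   v^2) <= (4/3)^(n + 1). *)
pose c (n : nat) := 32 * E * (n.+1%:R * (4 / 3) ^+ n.+1).
have c0 n : 0 <= c n by rewrite !mulr_ge0 ?(ltW E0)// exprn_ge0//; lra.
(* The hypothesis gives 32 K E <= 1/4, and 1 - x <= expR (- x). *)
have q43 : expR (32 * K * E) <= 4 / 3.
  have h : 3 / 4 <= expR (- (32 * K * E)) by apply: le_trans (expR_ge1Dx _); lra.
  rewrite expRN in h; have e0 := expR_gt0 (32 * K * E).
  have := ler_wpM2r (ltW e0) h; rewrite mulVf ?gt_eqF//.
  by move: (expR _) => z; lra.
have hNv : H10grad (fun x => -1 * v x) (fun x => -1 * g1 x) (fun x => -1 * g2 x) := H10gradZ (-1) hv.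
have gE' : I (fun x => (-1 * g1 x) ^+ 2 + (-1 * g2 x) ^+ 2) < E.
  by rewrite (@I_eq _ _ (fun x => g1 x ^+ 2 + g2 x ^+ 2))// => x _; ring.
have tl n : tail (fun x => `|v x|) (t n) <= 2 * pi / 2 ^+ n.
  case: n => [|n].
    rewrite expr0 divr1; apply: (le_trans (tail_le_pi _ (L2_mf Lav))).
    by have := pi_gt0 R; lra.
  have tn : 0 < t n.+1 by rewrite sqrtr_gt0 !mulr_gt0.
  have t1 := tail_H10 hv tn gE (tle n.+1).
  have t2 := tail_H10 hNv tn gE' (tle n.+1).
  have Lb := L2_Int (L2_bool (mf_ler (t n.+1) (L2_mf Lav))).
  have La := L2_Int (L2_bool (mf_ler (t n.+1) mv)).
  have Lc := L2_Int (L2_bool (mf_ler (t n.+1) (L2_mf (L2Z (-1) Lv)))).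
  have : tail (fun x => `|v x|) (t n.+1) <= tail v (t n.+1) + tail (fun x => -1 * v x) (t n.+1).
    rewrite -(I_D La Lc); apply: I_le => [||x _]; [exact: Lb|exact: IntD La Lc|].
    rewrite mulN1r ler_normr; case: (t n.+1 <= v x) => /=; last by rewrite add0r.
    by rewrite lerDl.
  by rewrite (_ : 2 * pi / 2 ^+ n.+1 = pi / 2 ^+ n.+1 + pi / 2 ^+ n.+1); [lra|ring].
pose h (x : P) := v x ^+ 2 * expR (K * v x ^+ 2).
have mh : mf2 disk h.
  apply: measurable_funM; first exact: measurable_funX.
  apply: measurableT_comp; first exact: measurable_expR.
  by apply: measurable_funM => //; exact: measurable_funX.
have h0 x : 0 <= h x by rewrite mulr_ge0 ?sqr_ge0// ltW// expR_gt0.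
have hc x : ((h x)%:E <= \sum_(n <oo) (c n * (t n <= `|v x|)%R%:R)%:E)%E.
  (* The index of the shell containing |v x|; this single term of the series already dominates
     [h x]. *)
  pose n := Num.truncn (v x ^+ 2 / (32 * E)).
  have z0 : 0 <= v x ^+ 2 / (32 * E) by rewrite divr_ge0 ?sqr_ge0// mulr_ge0// ltW.
  have /andP[n1 n2] := truncn_itv z0; rewrite -/n in n1 n2.
  have E320 : 0 < 32 * E by rewrite mulr_gt0.
  rewrite ler_pdivlMr// in n1; rewrite ltr_pdivrMr// in n2.
  apply: (@le_trans _ _ (\sum_(0 <= i < n.+1) (c i * (t i <= `|v x|)%R%:R)%:E)%E); last first.
    by apply: nneseries_lim_ge => i _ _; rewrite lee_fin mulr_ge0.
  rewrite big_nat_recr//= -[leLHS]add0e; apply: leeD.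
    by apply: sume_ge0 => i _; rewrite lee_fin mulr_ge0.
  have -> : t n <= `|v x|.
    rewrite -sqrtr_sqr; apply: ler_wsqrtr; rewrite mulrAC mulrC; exact: n1.
  rewrite mulr1 lee_fin /h /c [leRHS]mulrA.
  apply: ler_pM; rewrite ?sqr_ge0 ?(ltW (expR_gt0 _))//.
    by rewrite mulrC; exact: ltW.
  apply: (@le_trans _ _ (expR (32 * K * E *+ n.+1))).
    rewrite ler_expR -mulr_natl; apply: (@le_trans _ _ (K * (n.+1%:R * (32 * E)))).
      by rewrite ler_wpM2l// ltW.
    by rewrite le_eqVlt; apply/orP; left; apply/eqP; ring.
  rewrite -mulr_natl expRM_natl; apply: lerXn2r => //; rewrite nnegrE ?(ltW (expR_gt0 _))//.
have mc n : measurable_fun disk (fun x : P => (c n * (t n <= `|v x|)%R%:R)%:E).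
  apply/measurable_EFinP; apply: measurable_funM => //; apply: mf_bool; exact: mf_ler (L2_mf Lav).
have cn0 n x : (0 <= (c n * (t n <= `|v x|)%R%:R)%:E)%E by rewrite lee_fin mulr_ge0.
have IE n : (\int[mu2]_(x in disk) (c n * (t n <= `|v x|)%R%:R)%:E = (c n * tail (fun x => `|v x|) (t n))%:E)%E.
  have Lb := L2_Int (L2_bool (mf_ler (t n) (L2_mf Lav))).
  rewrite /tail -(I_Z _ Lb) /Rintegral fineK//.
  by apply: integrable_fin_num (IntZ (c n) Lb); exact: measurable_disk.
(* The n-th term contributes at most c n times 2 pi / 2^n, that is (256/3) pi E (n + 1) (2/3)^n;
   summing with the bound 9 gives 768 pi E. *)
have main : (\int[mu2]_(x in disk) (h x)%:E <= (768 * pi * E)%:E)%E.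
  apply: (@le_trans _ _ (\int[mu2]_(x in disk) \sum_(n <oo) (c n * (t n <= `|v x|)%R%:R)%:E)%E).
    apply: ge0_le_integral.
    - exact: measurable_disk.
    - by move=> x _; rewrite lee_fin.
    - exact/measurable_EFinP.
    - by apply: ge0_emeasurable_sum => k; [move=> x _ _; exact: cn0|move=> _; exact: mc].
    - by move=> x _; exact: hc.
  rewrite (@integral_nneseries _ P R mu2 _ measurable_disk)//.
  apply: lime_le; first by apply: is_cvg_nneseries => n _ _; rewrite IE lee_fin mulr_ge0// tail_ge0.
  apply: nearW => n; under eq_bigr do rewrite IE.
  rewrite sumEFin lee_fin big_mkord.
  apply: (@le_trans _ _ (\sum_(i < n) (256 / 3 * pi * E) * (i.+1%:R * (2 / 3) ^+ i))); last first.
    rewrite -mulr_sumr (_ : 768 * pi * E = 256 / 3 * pi * E * 9); last by field.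
    apply: ler_wpM2l; last exact: series_bound_le.
    by rewrite !mulr_ge0 ?(ltW (pi_gt0 R)) ?(ltW E0)//; lra.
  apply: ler_sum => i _; apply: (@le_trans _ _ (c i * (2 * pi / 2 ^+ i))); first exact: ler_wpM2l.
  rewrite le_eqVlt; apply/orP; left; apply/eqP; rewrite /c exprS !expr_div_n.
  have -> : (4 : R) ^+ i = 2 ^+ i * 2 ^+ i by rewrite -exprMn; congr (_ ^+ _); ring.
  have p2 : (2 : R) ^+ i != 0 by rewrite expf_neq0.
  have p3 : (3 : R) ^+ i != 0 by rewrite expf_neq0.
  by move: (2 ^+ i) ((3 : R) ^+ i) p2 p3 (i.+1%:R : R) => a b a0 b0 m; field; rewrite a0 b0.
have ih : Int h.
  apply/integrableP; split; first exact/measurable_EFinP.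
  under eq_integral do rewrite /= ger0_norm//.
  exact: le_lt_trans main (ltry _).
split => //; rewrite -lee_fin /Rintegral fineK//.
by apply: integrable_fin_num ih; exact: measurable_disk.
Qed.

End Trudinger.

(** * Radial functions *)

Section RadialFunctions.
Context {R : realType}.
Local Notation mu := (@lebesgue_measure R).
Local Notation mu2 := ((@lebesgue_measure R \x @lebesgue_measure R)%E).
Local Notation mR := (measurableTypeR R).
Local Notation P := (measurableTypeR R * measurableTypeR R)%type.
Local Notation mf1 := (@measurable_fun _ _ (measurableTypeR R) R).
Local Notation mf2 := (@measurable_fun _ _ (measurableTypeR R * measurableTypeR R)%type R).
Local Notation I01 := `[(0 : R), 1[%classic.
Local Notation I u := (Rintegral mu2 disk u).
Local Notation IL u := (Rintegral mu I01 u).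
Local Notation IntL u := (mu.-integrable I01 (EFin \o u)).
Implicit Types (f g p q k : R -> R) (a b c y t : R).

Lemma measurable_I01 : measurable (I01 : set mR).
Proof. exact: measurable_itv. Qed.

Lemma IntL_mf g : IntL g -> mf1 I01 g.
Proof. by move=> /integrableP[/measurable_EFinP]. Qed.

Lemma mu_I01 : mu I01 = 1%E.
Proof. by rewrite lebesgue_measure_itv/= lte_fin ltr01 oppr0 adde0. Qed.

Lemma IntL_bounded g B : mf1 I01 g -> (forall y, I01 y -> `|g y| <= B) -> IntL g.
Proof.
move=> mg gB; apply: (@measurable_bounded_integrable _ mR R mu _ _ measurable_I01) => //.
  have h : (mu I01 < +oo)%E by rewrite mu_I01 ltry.
  exact: h.
exists B; split; first exact: num_real.
by move=> x Bx y Iy /=; apply: le_trans (gB _ Iy) (ltW Bx).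
Qed.

Lemma IntL_cst c : IntL (cst c).
Proof. by apply: (@IntL_bounded _ `|c|) => //; exact: measurable_cst. Qed.

Lemma IL_cst c : IL (cst c) = c.
Proof.
have := @Rintegral_cst _ mR R mu _ measurable_I01 c.
have -> : fine (mu (I01 : set mR)) = 1 by have := mu_I01 => ->.
by rewrite mulr1.
Qed.

Lemma IntL_eq f g : (forall y, I01 y -> f y = g y) -> IntL f -> IntL g.
Proof.
move=> fg; apply: eq_integrable => [|x]; first exact: measurable_I01.
by rewrite inE => Ix /=; rewrite fg.
Qed.

Lemma IL_eq f g : (forall y, I01 y -> f y = g y) -> IL f = IL g.
Proof. by move=> fg; apply: eq_Rintegral => x; rewrite inE => Ix; exact: fg. Qed.

Lemma IntL_le f g : mf1 I01 f -> IntL g -> (forall y, I01 y -> `|f y| <= g y) -> IntL f.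
Proof.
move=> mf ig fg; apply: (le_integrable measurable_I01 _ _ ig); first exact/measurable_EFinP.
by move=> x Ix /=; rewrite lee_fin; apply: le_trans (fg x Ix) (ler_norm _).
Qed.

Lemma IntL_D f g : IntL f -> IntL g -> IntL (fun y => f y + g y).
Proof. by move=> fi gi; exact: (integrableD measurable_I01 fi gi). Qed.

Lemma IntL_Z c f : IntL f -> IntL (fun y => c * f y).
Proof. by move=> fi; exact: (integrableZl measurable_I01 c fi). Qed.

Lemma IntL_B f g : IntL f -> IntL g -> IntL (fun y => f y - g y).
Proof. by move=> fi gi; exact: (integrableB measurable_I01 fi gi). Qed.

Lemma IntL_norm f : IntL f -> IntL (fun y => `|f y|).
Proof. by move=> fi; exact: (integrable_norm fi). Qed.

Lemma IL_D f g : IntL f -> IntL g -> IL (fun y => f y + g y) = IL f + IL g.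
Proof. by move=> fi gi; exact: (RintegralD measurable_I01 fi gi). Qed.

Lemma IL_B f g : IntL f -> IntL g -> IL (fun y => f y - g y) = IL f - IL g.
Proof. by move=> fi gi; exact: (RintegralB measurable_I01 fi gi). Qed.

Lemma IL_Z c f : IntL f -> IL (fun y => c * f y) = c * IL f.
Proof. by move=> fi; exact: (@RintegralZl _ mR R mu _ f c measurable_I01 fi). Qed.

Lemma IL_le f g : IntL f -> IntL g -> (forall y, I01 y -> f y <= g y) -> IL f <= IL g.
Proof. by move=> fi gi fg; exact: (le_Rintegral measurable_I01 fi gi fg). Qed.

Lemma IL_abs f : IntL f -> `|IL f| <= IL (fun y => `|f y|).
Proof. by move=> fi; exact: (le_normr_Rintegral measurable_I01 fi). Qed.

Lemma IL_sum n (F : 'I_n -> R -> R) : (forall i, IntL (F i)) ->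
  IntL (fun y => \sum_(i < n) F i y) /\ IL (fun y => \sum_(i < n) F i y) = \sum_(i < n) IL (F i).
Proof.
elim: n F => [|n IH] F iF.
  split; first by apply: IntL_eq (IntL_cst 0) => y _; rewrite big_ord0.
  by rewrite big_ord0 -[RHS](IL_cst 0); apply: IL_eq => y _; rewrite big_ord0.
have [i1 e1] := IH (fun i => F (widen_ord (leqnSn n) i)) (fun i => iF _).
have E y : \sum_(i < n.+1) F i y = \sum_(i < n) F (widen_ord (leqnSn n) i) y + F ord_max y.
  by rewrite big_ord_recr.
split; first by apply: IntL_eq (IntL_D i1 (iF ord_max)) => y _; rewrite E.
by rewrite big_ord_recr/= -e1 -(IL_D i1 (iF ord_max)); apply: IL_eq => y _; rewrite E.
Qed.

Lemma mf_indic a b : mf1 setT (fun t => (a <= t < b)%R%:R).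
Proof.
have m1 : @measurable_fun _ _ mR bool setT (fun t => (a <= t) && (t < b)).
  apply: measurable_and; first by apply: measurable_fun_ler => //; exact: measurable_cst.
  by apply: measurable_fun_ltr => //; exact: measurable_cst.
exact: (@measurable_comp _ _ _ mR bool R setT (fun b : bool => b%:R) setT).
Qed.

Lemma integral_derive_pos (F f : R -> R) a b : 0 < a -> a <= b ->
  (forall x : R, 0 < x -> is_derive x 1 F (f x)) -> (forall x : R, 0 < x -> {for x, continuous f}) ->
  mu.-integrable `[a, b] (EFin \o f) /\ \int[mu]_(x in `[a, b]) f x = F b - F a.
Proof.
move=> a0 ab Ff cf.
have cw : {within `[a, b], continuous f}.
  apply: continuous_in_subspaceT => x; rewrite inE/= in_itv/= => /andP[ax _].
  exact: cf (lt_le_trans a0 ax).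
split; first by apply: continuous_compact_integrable => //; exact: segment_compact.
move: ab cw; rewrite le_eqVlt => /predU1P[<- _|ab cw].
  by rewrite set_itv1 Rintegral_set1 subrr.
have b0 := lt_trans a0 ab.
rewrite /Rintegral (@continuous_FTC2 _ f F)//.
- split.
  + by move=> x; rewrite in_itv/= => /andP[ax _]; have [] := Ff x (lt_trans a0 ax).
  + by apply: cvg_at_right_filter; exact: is_derive_continuous (Ff a a0).
  + by apply: cvg_at_left_filter; exact: is_derive_continuous (Ff b b0).
- move=> x; rewrite in_itv/= => /andP[ax _].
  by rewrite derive1E; have [_ ->] := Ff x (lt_trans a0 ax).
Qed.

Lemma IL_itv (F f : R -> R) a b : 0 < a -> a <= b -> b <= 1 ->
  (forall x : R, 0 < x -> is_derive x 1 F (f x)) -> (forall x : R, 0 < x -> {for x, continuous f}) ->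
  IntL (fun t => (a <= t < b)%R%:R * f t) /\ IL (fun t => (a <= t < b)%R%:R * f t) = F b - F a.
Proof.
move=> a0 ab b1 Ff cf; have [i1 e1] := integral_derive_pos a0 ab Ff cf.
have i2 : mu.-integrable `[a, b[ (EFin \o f).
  by apply: integrableS i1 => //; apply: subset_itvl; rewrite bnd_simp.
have Eset : `[a, b[%classic = I01 `&` `[a, b[%classic.
  apply/seteqP; split => x; last by case.
  rewrite /= !in_itv/= => /andP[ax xb]; split; rewrite ?in_itv/= ?ax ?xb//.
  by rewrite (ltW (lt_le_trans a0 ax)) (lt_le_trans xb b1).
have Ef : f \_ `[a, b[%classic = (fun t => (a <= t < b)%R%:R * f t).
  apply/funext => t; rewrite patchE mem_setE in_itv/=.
  by case: ifP => _; rewrite ?mul1r ?mul0r.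
split.
  have : mu.-integrable (I01 `&` `[a, b[%classic) (EFin \o f) by rewrite -Eset.
  move=> h; have := (integrable_restrict mu (measurable_itv `[a, b[ : measurable (`[a, b[%classic : set mR)) measurable_I01 _).1 h.
  by rewrite restrict_EFin Ef.
rewrite -Ef -Rintegral_mkcondr -Eset -e1; apply: Rintegral_itv_bndo_bndc; exact: i2.
Qed.

(* The singularity of [dG] at 0 is harmless because [g] is bounded: cut at [a]
   and let [a] tend to 0. *)
Lemma IL_le_primitive g (G dG : R -> R) y B : 0 < y -> y <= 1 -> mf1 I01 g ->
  (forall t, I01 t -> `|g t| <= B) -> (forall t, y <= t -> t < 1 -> g t = 0) ->
  (forall t, 0 < t -> is_derive t 1 G (dG t)) -> (forall t, 0 < t -> {for t, continuous dG}) ->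
  (forall t, 0 < t -> 0 <= G t) -> (forall t, 0 < t < y -> `|g t| <= dG t) ->
  IL (fun t => `|g t|) <= G y.
Proof.
move=> y0 y1 mg gB g0 GdG cdG G0 gdG.
have B0 : 0 <= B by apply: le_trans (gB 0 _); rewrite ?normr_ge0//= in_itv/= lexx ltr01.
have key a : 0 < a -> a < y -> IL (fun t => `|g t|) <= B * a + G y.
  move=> a0 ay; have [i1 e1] := IL_itv a0 (ltW ay) y1 GdG cdG.
  have mi := @measurable_funTS _ _ mR R I01 _ (mf_indic 0 a).
  have ib : IntL (fun t => (0 <= t < a)%R%:R : R).
    apply: (@IntL_bounded _ 1) => // t _; case: (0 <= t < a); rewrite ?normr1 ?normr0//.
  have eb : IL (fun t => (0 <= t < a)%R%:R : R) = a.
    have Ef : (cst (1 : R)) \_ `[0, a[%classic = (fun t => (0 <= t < a)%R%:R : R).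
      by apply/funext => t; rewrite patchE mem_setE in_itv/=; case: ifP.
    have a1 : a <= 1 := ltW (lt_le_trans ay y1).
    have Eset : `[0, a[%classic = I01 `&` `[0, a[%classic.
      apply/seteqP; split => x; last by case.
      by rewrite /= !in_itv/= => /andP[ax xb]; split; rewrite ?in_itv/= ?ax ?xb// (lt_le_trans xb a1).
    rewrite -Ef -Rintegral_mkcondr -Eset Rintegral_cst; last exact: measurable_itv.
    have mE : mu `[0, a[ = a%:E by rewrite lebesgue_measure_itv/= lte_fin a0 oppr0 adde0.
    have -> : fine (mu (`[0, a[%classic : set mR)) = a by have := mE => ->.
    exact: mul1r.
  have ig : IntL g := IntL_bounded mg gB.
  apply: (@le_trans _ _ (IL (fun t => B * (0 <= t < a)%R%:R + (a <= t < y)%R%:R * dG t))).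
    apply: IL_le; [exact: IntL_norm|exact: IntL_D (IntL_Z _ ib) i1|] => t It.
    have := It; rewrite /= in_itv/= => /andP[t0 t1].
    rewrite t0/=; case: (ltP t a) => ta.
      by rewrite mulr1/= mul0r addr0; exact: gB.
    rewrite mulr0 add0r/=; case: (ltP t y) => ty.
      by rewrite mul1r; apply: gdG; rewrite ty (lt_le_trans a0 ta).
    by rewrite g0// normr0 mul0r.
  rewrite (IL_D (IntL_Z _ ib) i1) (IL_Z _ ib) eb e1 lerD2l gerBl; exact: G0.
apply/ler_addgt0Pr => e e0.
pose a := Num.min (y / 2) (e / (B + 1)).
have B1 : 0 < B + 1 by rewrite ltr_wpDl.
have a0 : 0 < a by rewrite lt_min !divr_gt0.
have ay : a < y by rewrite gt_min ltr_pdivrMr// ltr_pMr// ltr1n.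
apply: (le_trans (key a a0 ay)); rewrite addrC lerD2l.
apply: (@le_trans _ _ (B * (e / (B + 1)))); first by rewrite ler_wpM2l// ge_min lexx orbT.
rewrite mulrA ler_pdivrMr// mulrC; apply: ler_wpM2l; first exact: ltW.
by rewrite lerDl.
Qed.

Lemma IL_ge_primitive q y : continuous q -> 0 <= y -> y <= 1 ->
  IntL (fun t => (y <= t)%R%:R * q t) /\
  IL (fun t => (y <= t)%R%:R * q t) = primitive q 1 - primitive q y.
Proof.
move=> cq y0 y1.
have i1 : mu.-integrable `[y, 1[ (EFin \o q).
  apply: integrableS (continuous_integrable y 1 cq) => //.
  by apply: subset_itvl; rewrite bnd_simp.
have Eset : `[y, 1[%classic = I01 `&` `[y, 1[%classic.
  apply/seteqP; split => x; last by case.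
  rewrite /= !in_itv/= => /andP[ax xb]; split; rewrite ?in_itv/= ?ax ?xb//.
  by rewrite (le_trans y0 ax).
have Ef t : I01 t -> (q \_ `[y, 1[%classic) t = (y <= t)%R%:R * q t.
  rewrite /= in_itv/= patchE mem_setE in_itv/= => /andP[_ ->]; rewrite andbT.
  by case: ifP => _; rewrite ?mul1r ?mul0r.
split.
  apply: (IntL_eq Ef); have : mu.-integrable (I01 `&` `[y, 1[%classic) (EFin \o q) by rewrite -Eset.
  move=> h; have := (integrable_restrict mu (measurable_itv `[y, 1[ : measurable (`[y, 1[%classic : set mR)) measurable_I01 _).1 h.
  by rewrite restrict_EFin.
rewrite -(IL_eq Ef) -Rintegral_mkcondr -Eset.
have <- := @Rintegral_derive R (primitive q) q y 1 y1 (fun x => is_derive_primitive x cq) cq.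
by apply: Rintegral_itv_bndo_bndc; exact: i1.
Qed.

(** Zero within 1/(n+1) of [y0] and from 1 - 1/(n+1) on. The first factor removes a jump of the
    derivative at [y0], the second makes the primitive constant near the boundary. *)
Definition cutoff y0 (n : nat) y : R :=
  ramp (n.+1%:R * `|y - y0| - 1) * ramp (n.+1%:R * (1 - y) - 1).

Lemma cutoff_bound y0 n y : 0 <= cutoff y0 n y <= 1.
Proof.
have /andP[a0 a1] := ramp_bound (n.+1%:R * `|y - y0| - 1).
have /andP[b0 b1] := ramp_bound (n.+1%:R * (1 - y) - 1).
by rewrite /cutoff mulr_ge0//= mulr_ile1.
Qed.

Lemma ramp_continuous : continuous (@ramp R).
Proof. by move=> t; exact: is_derive_continuous (is_derive_ramp t). Qed.

Lemma ramp_comp f y : {for y, continuous f} -> {for y, continuous (fun t => ramp (f t))}.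
Proof. by move=> cf; exact: continuous_comp cf (@ramp_continuous _). Qed.

Lemma cutoff_continuous y0 n : continuous (cutoff y0 n).
Proof.
move=> y.
have h1 : {for y, continuous (fun t => ramp (n.+1%:R * `|t - y0| - 1))}.
  apply: ramp_comp; apply: (@cvgB _ R); last exact: cvg_cst.
  apply: (@cvgM _ R); first exact: cvg_cst.
  by apply: cvg_norm; apply: (@cvgB _ R); [exact: cvg_id|exact: cvg_cst].
have h2 : {for y, continuous (fun t => ramp (n.+1%:R * (1 - t) - 1))}.
  apply: ramp_comp; apply: (@cvgB _ R); last exact: cvg_cst.
  by apply: (@cvgM _ R); [exact: cvg_cst|apply: (@cvgB _ R); [exact: cvg_cst|exact: cvg_id]].
exact: cvgM h1 h2.
Qed.

Lemma near_ge (c d : R) : 0 < c -> \forall n \near \oo, d <= n.+1%:R * c.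
Proof.
move=> c0; exists (Num.truncn (`|d| / c)) => // n /= hn.
have h : `|d| / c < (Num.truncn (`|d| / c)).+1%:R.
  by have /andP[] := truncn_itv (divr_ge0 (normr_ge0 d) (ltW c0)).
rewrite ltr_pdivrMr// in h; apply: (le_trans (ler_norm d)); apply: (le_trans (ltW h)).
by apply: ler_wpM2r; [exact: ltW|rewrite ler_nat ltnS].
Qed.

Lemma cutoff_cvg y0 y : y != y0 -> y < 1 -> \forall n \near \oo, cutoff y0 n y = 1.
Proof.
move=> yy y1; have n0 : 0 < `|y - y0| by rewrite normr_gt0 subr_eq0.
have n1 : 0 < 1 - y by rewrite subr_gt0.
have h1 := near_ge 2 n0; have h2 := near_ge 2 n1.
apply: filterS2 h1 h2 => n h1 h2.
by rewrite /cutoff !ramp_ge1 ?mulr1//; rewrite lerBrDr -[_ + 1]/2.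
Qed.

Lemma radial_C1c k q r : (forall y, is_derive y (1 : R) k (q y)) -> continuous q -> r < 1 ->
  (forall y, r <= y -> k y = 0) ->
  C1c (fun x => k (sqn x)) /\
  C1P (fun x => k (sqn x)) (fun x => q (sqn x) * (2 * x.1)) (fun x => q (sqn x) * (2 * x.2)).
Proof.
move=> kq cq r1 k0; have h := C1P_comp C1P_sqn kq cq; split => //.
by apply: (C1c_intro h r1) => x; exact: k0.
Qed.

Lemma disk_I01 x : disk x -> I01 (sqn x).
Proof. by rewrite diskE /= in_itv/= sqn_ge0. Qed.

Lemma sqn1_le (x : R * R) : disk x -> `|x.1| <= 1 /\ `|x.2| <= 1.
Proof.
rewrite diskE /= /sqn => h; have h1 := sqr_ge0 x.1; have h2 := sqr_ge0 x.2.
rewrite -!sqrtr_sqr; split; rewrite -[leRHS]sqrtr1; apply: ler_wsqrtr; lra.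
Qed.

Lemma L2_cvg_bounded (un : nat -> R * R -> R) (u : R * R -> R) (B : R) :
  (forall n, mf2 disk (un n)) -> (forall n x, disk x -> `|un n x| <= B) ->
  (forall x, disk x -> `|u x| <= B) ->
  (forall x, disk x -> un n x @[n --> \oo] --> u x) -> L2_cvg un u.
Proof.
move=> mun unB uB unu; have mu' : mf2 disk u by exact: (@measurable_fun_cvg _ P R disk un u).
have := @Rintegral_dominated _ P R mu2 disk (fun n x => (u x - un n x) ^+ 2) (cst 0)
  (cst ((B + B) ^+ 2)) measurable_disk.
move=> H; have [||||_] := H.
- by move=> n; apply: measurable_funX; exact: measurable_funB.
- move=> x dx; have h : u x - un n x @[n --> \oo] --> u x - u x.
    by apply: (@cvgB _ R); [exact: cvg_cst|exact: unu].
  by have := cvgM h h; rewrite subrr mulr0 => hh; exact: hh.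
- exact: continuous_integrable_disk (@cst_continuous _ _ _).
- move=> n x dx; rewrite normrX /cst; apply: lerXn2r; rewrite ?nnegrE//.
    by apply: addr_ge0; exact: le_trans (uB x dx).
  by apply: le_trans (ler_normB _ _) _; apply: lerD; [exact: uB|exact: unB].
- by rewrite /L2_cvg (_ : I (cst 0) = 0)// (Rintegral_cst _ measurable_disk) mul0r.
Qed.

Lemma mul_cvg_cst (un : nat -> R) (l c : R) : un n @[n --> \oo] --> l -> un n * c @[n --> \oo] --> l * c.
Proof. by move=> h; apply: cvgM => //; exact: cvg_cst. Qed.

(* The primitives of [p], cut off near [y0] and near the boundary, are C^1 with
   compact support. *)
Lemma H10_radial k p y0 (M : R) : (forall y, `|p y| <= M) ->
  (forall y, y != y0 -> {for y, continuous p}) -> (I01 y0 -> p y0 = 0) ->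
  (forall y, I01 y -> k y = - IL (fun t => (y <= t)%R%:R * p t)) ->
  mf1 I01 p /\
  H10grad (fun x => k (sqn x)) (fun x => p (sqn x) * (2 * x.1)) (fun x => p (sqn x) * (2 * x.2)).
Proof.
move=> pM cp py0 kE.
pose q (n : nat) y := p y * cutoff y0 n y.
have M0 : 0 <= M := le_trans (normr_ge0 _) (pM 0).
have qM n y : `|q n y| <= M.
  have /andP[c0 c1] := cutoff_bound y0 n y.
  rewrite /q normrM (ger0_norm c0); apply: le_trans (pM y).
  by rewrite ler_piMr.
have cq n : continuous (q n).
  move=> y; have [->|yy] := eqVneq y y0; last first.
    by apply: cvgM; [exact: cp|exact: cutoff_continuous].
  have n0 : 0 < (n.+1%:R : R)^-1 by rewrite invr_gt0 ltr0n.
  apply: (near_cst_continuous 0); exists (n.+1%:R^-1) => // t /=; rewrite distrC => ht.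
  rewrite /q /cutoff ramp_le0 ?mul0r ?mulr0// subr_le0 -ler_pdivlMl ?ltr0n// mulr1; exact: ltW.
have qp y : I01 y -> q n y @[n --> \oo] --> p y.
  move=> Iy; have := Iy; rewrite /= in_itv/= => /andP[_ y1].
  have [yy|yy] := eqVneq y y0.
    have -> : (fun n => q n y) = (fun=> 0).
      by apply/funext => n; rewrite /q yy py0 ?mul0r// -yy.
    by rewrite yy py0 -?yy//; exact: cvg_cst.
  apply: cvg_near_cst; have := cutoff_cvg yy y1.
  by apply: filterS => n h; rewrite /q h mulr1.
(* Normalised at 1, hence identically 0 from 1 - 1/(n+1) on, where [q n] vanishes. *)
pose kn (n : nat) y := primitive (q n) y - primitive (q n) 1.
have dkn n y : is_derive y (1 : R) (kn n) (q n y).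
  rewrite -[q n y]subr0; apply: is_deriveB; exact: is_derive_primitive.
have k1 n y : 1 - n.+1%:R^-1 <= y -> kn n y = 0.
  move=> hy; have := @MVT_le _ (kn n) (q n) 0 1 y (dkn n).
  have k10 : kn n 1 = 0 by rewrite /kn subrr.
  rewrite k10 subr0 mul0r normr_le0 => h; apply/eqP/h => t /andP[t1 _].
  have ht : 1 - n.+1%:R^-1 <= t.
    by apply: le_trans t1; rewrite le_min gerBl invr_ge0 ler0n hy.
  rewrite normr_le0 /q /cutoff [ramp (n.+1%:R * (1 - t) - 1)]ramp_le0 ?mulr0//.
  rewrite subr_le0 -ler_pdivlMl ?ltr0n// mulr1.
  by move: (n.+1%:R^-1) ht => z ht; clear -ht; lra.
have k2 n : 1 - n.+1%:R^-1 < 1 :> R by rewrite gtrBl invr_gt0 ltr0n.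
have C n := radial_C1c (dkn n) (cq n) (k2 n) (k1 n).
have knE n y : I01 y -> kn n y = - IL (fun t => (y <= t)%R%:R * q n t).
  rewrite /= in_itv/= => /andP[y0' y1].
  by have [_ ->] := IL_ge_primitive (cq n) y0' (ltW y1); rewrite opprB.
have miq n : mf1 I01 (q n) by apply: measurable_funTS; exact: continuous_measurable_fun.
have mp : mf1 I01 p by apply: (@measurable_fun_cvg _ mR R I01 q p miq).
have mge y : mf1 I01 (fun t => (y <= t)%R%:R).
  have m1 : @measurable_fun _ _ mR bool I01 (fun t => y <= t).
    by apply: measurable_fun_ler => //; exact: measurable_cst.
  exact: (@measurable_comp _ _ _ mR bool R setT (fun b : bool => b%:R) I01).
have iM : IntL (cst M) := IntL_cst M.
have b01 y t : `|(y <= t)%R%:R| <= 1 :> R by case: (y <= t); rewrite ?normr1 ?normr0.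
have knk y : I01 y -> kn n y @[n --> \oo] --> k y.
  move=> Iy; rewrite kE//; under eq_cvg do rewrite knE//.
  apply: cvgN; apply: (@Rintegral_dominated _ mR R mu I01 _ _ (cst M) measurable_I01 _ _ iM _).2.
  - by move=> n; apply: measurable_funM.
  - by move=> t It; apply: cvgM; [exact: cvg_cst|exact: qp].
  - by move=> n t _; rewrite normrM -[leRHS]mul1r ler_pM.
have knM n y : I01 y -> `|kn n y| <= M.
  rewrite /= in_itv/= => /andP[y0' y1].
  have := @MVT_le _ (kn n) (q n) M 1 y (dkn n) (fun t _ => qM n t).
  have -> : kn n 1 = 0 by rewrite /kn subrr.
  rewrite subr0 => /le_trans; apply.
  rewrite -[leRHS]mulr1 ler_wpM2l// distrC ger0_norm; lra.
have kM y : I01 y -> `|k y| <= M.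
  move=> Iy; have h : `|kn n y| @[n --> \oo] --> `|k y| by apply: cvg_norm; exact: knk.
  rewrite -(cvg_lim (@Rhausdorff R) h); apply: limr_le; first exact: (cvgP _ h).
  by apply: nearW => n; exact: knM.
have Cc n := C1P_continuous (C n).2.
have mk : mf2 disk (fun x => k (sqn x)).
  apply: (@measurable_fun_cvg _ P R disk (fun n x => kn n (sqn x))) => [n|x dx].
    by apply: measurable_funTS; exact: continuous_measurable2 (Cc n).
  exact: knk (disk_I01 dx).
have mpr : mf2 disk (fun x => p (sqn x)) := measurable_radial mp.
have mfst : mf2 disk (fun x => 2 * x.1).
  by apply: measurable_funTS; exact: continuous_measurable2 (C1P_continuous (C1PM (C1P_cst 2) C1P_fst)).
have msnd : mf2 disk (fun x => 2 * x.2).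
  by apply: measurable_funTS; exact: continuous_measurable2 (C1P_continuous (C1PM (C1P_cst 2) C1P_snd)).
have bd (g : R -> R) (w : R) (x : R * R) : (forall y, `|g y| <= M) -> `|w| <= 1 -> `|g (sqn x) * (2 * w)| <= M * 2.
  move=> gM w1; rewrite normrM ler_pM// normrM ger0_norm//; lra.
have D1 n : 'D_e1 (fun x => kn n (sqn x)) = (fun x => q n (sqn x) * (2 * x.1)).
  by apply/funext => x; have [_ ->] := C1P_d1 (C n).2 x.
have D2 n : 'D_e2 (fun x => kn n (sqn x)) = (fun x => q n (sqn x) * (2 * x.2)).
  by apply/funext => x; have [_ ->] := C1P_d2 (C n).2 x.
have c1 : L2_cvg (fun n x => q n (sqn x) * (2 * x.1)) (fun x => p (sqn x) * (2 * x.1)).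
  apply: (@L2_cvg_bounded _ _ (M * 2)) => [n|n x dx|x dx|x dx].
  + exact: measurable_funM (measurable_radial (miq n)) mfst.
  + by have [h _] := sqn1_le dx; exact: (bd _ _ _ (qM n) h).
  + by have [h _] := sqn1_le dx; exact: (bd _ _ _ pM h).
  + exact: mul_cvg_cst (qp _ (disk_I01 dx)).
have c2 : L2_cvg (fun n x => q n (sqn x) * (2 * x.2)) (fun x => p (sqn x) * (2 * x.2)).
  apply: (@L2_cvg_bounded _ _ (M * 2)) => [n|n x dx|x dx|x dx].
  + exact: measurable_funM (measurable_radial (miq n)) msnd.
  + by have [_ h] := sqn1_le dx; exact: (bd _ _ _ (qM n) h).
  + by have [_ h] := sqn1_le dx; exact: (bd _ _ _ pM h).
  + exact: mul_cvg_cst (qp _ (disk_I01 dx)).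
split; first exact: mp.
apply: (H10_intro (phi := fun n x => kn n (sqn x))).
- by apply: (@L2_bounded _ _ M) => // x dx; exact: kM (disk_I01 dx).
- apply: (@L2_bounded _ _ (M * 2)); first exact: measurable_funM.
  by move=> x dx; apply: bd => //; have [] := sqn1_le dx.
- apply: (@L2_bounded _ _ (M * 2)); first exact: measurable_funM.
  by move=> x dx; apply: bd => //; have [] := sqn1_le dx.
- by move=> n; exact: (C n).1.
- apply: (@L2_cvg_bounded _ _ M) => [n|n x dx|x dx|x dx].
  + by apply: measurable_funTS; exact: continuous_measurable2 (Cc n).
  + exact: knM (disk_I01 dx).
  + exact: kM (disk_I01 dx).
  + exact: knk (disk_I01 dx).
- exact: (eq_ind_r (fun z => L2_cvg z _) c1 (funext D1)).
- exact: (eq_ind_r (fun z => L2_cvg z _) c2 (funext D2)).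
Qed.

(** The gradient of k(|x|^2) is k'(|x|^2) 2x; the factor |2x|^2 = 4 y is the weight in the
    one-dimensional integral. *)
Lemma I_radial_grad p q : IntL (fun y => y * (p y * q y)) ->
  I (fun x => p (sqn x) * (2 * x.1) * (q (sqn x) * (2 * x.1)) +
              p (sqn x) * (2 * x.2) * (q (sqn x) * (2 * x.2))) =
  4 * pi * IL (fun y => y * (p y * q y)).
Proof.
move=> i; rewrite -[4 * pi]mulrC -mulrA -(IL_Z 4 i) -(radial_Rintegral (IntL_Z 4 i)).
by apply: I_eq => x _; rewrite /sqn; ring.
Qed.

End RadialFunctions.

(** * Towers *)

Section Polygon.
Context {R : realType}.
Implicit Types (p : nat -> R) (t : R).

(** The [p k] are heights over the abscissae 4 pi p_k^2, so the chord between consecutive nodes has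
    slope (p_(k+1) - p_k) / (4 pi (p_(k+1)^2 - p_k^2)), here simplified. The line is flat beyond the
    last node. *)
Definition slope p n k : R := if (k < n)%N then (4 * pi * (p k + p k.+1))^-1 else 0.

Definition jump p n k : R := slope p n k - slope p n k.+1.

Section Fixed.
Variables (n : nat) (p : nat -> R).
Hypotheses (p0 : p 0%N = 0) (pS : forall k, (k < n)%N -> p k < p k.+1).

Lemma node_le j k : (j <= k)%N -> (k <= n)%N -> p j <= p k.
Proof.
elim: k => [|k IH]; first by rewrite leqn0 => /eqP ->.
rewrite leq_eqVlt => /predU1P[-> //|jk] kn.
exact: le_trans (IH jk (ltnW kn)) (ltW (pS kn)).
Qed.

Lemma node_ge0 k : (k <= n)%N -> 0 <= p k.
Proof. by move=> kn; rewrite -p0 node_le. Qed.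

Lemma slope_gt0 k : (k < n)%N -> 0 < slope p n k.
Proof.
move=> kn; rewrite /slope kn invr_gt0 !mulr_gt0 ?pi_gt0//.
by apply: ltr_wpDl; [exact: node_ge0 (ltnW kn)|exact: le_lt_trans (node_ge0 (ltnW kn)) (pS kn)].
Qed.

Lemma jump_gt0 k : (k < n)%N -> 0 < jump p n k.
Proof.
move=> kn; rewrite /jump subr_gt0 {1}/slope; case: ltnP => [kn1|_]; last exact: slope_gt0.
rewrite /slope kn ltf_pV2 ?posrE.
- by rewrite ltr_pM2l ?mulr_gt0 ?pi_gt0//; apply: ltrD; exact: pS.
- have := slope_gt0 kn1; rewrite /slope kn1 invr_gt0//.
- have := slope_gt0 kn; rewrite /slope kn invr_gt0//.
Qed.

Lemma slope_node k : (k < n)%N -> slope p n k * (4 * pi * p k.+1 ^+ 2 - 4 * pi * p k ^+ 2) = p k.+1 - p k.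
Proof.
move=> kn; have := slope_gt0 kn; rewrite /slope kn invr_gt0 => h.
by apply: (mulfI (lt0r_neq0 h)); rewrite mulrA mulfV ?lt0r_neq0// mul1r; ring.
Qed.

Lemma sum_jump k : (k <= n)%N -> \sum_(k <= j < n) jump p n j = slope p n k.
Proof.
move=> kn; rewrite (eq_big_nat _ _ (F2 := fun j => - slope p n j.+1 - - slope p n j)).
  by rewrite telescope_sumr// /slope ltnn oppr0 sub0r opprK.
by move=> j _; rewrite /jump opprK addrC.
Qed.

(** Summation by parts: jumps already passed count with their abscissa, the others share the current
    one. *)
Lemma sum_jump_node k : (k <= n)%N ->
  \sum_(0 <= j < k) jump p n j * (4 * pi * p j.+1 ^+ 2) + slope p n k * (4 * pi * p k ^+ 2) = p k.
Proof.
elim: k => [|k IH] kn; first by rewrite big_nil p0 expr0n/= !mulr0 addr0.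
rewrite big_nat_recr//= -[RHS](subrK (p k)) -(slope_node kn) -[X in _ = _ + X](IH (ltnW kn)).
by rewrite [jump p n k]/jump; ring.
Qed.

Lemma sum_jump_p k : (k <= n)%N ->
  \sum_(0 <= j < k) jump p n j * p j.+1 + slope p n k * p k =
  \sum_(0 <= j < k) slope p n j * (p j.+1 - p j).
Proof.
elim: k => [|k IH] kn; first by rewrite !big_nil p0 !mulr0 addr0.
by rewrite !big_nat_recr//= -(IH (ltnW kn)) /jump; ring.
Qed.

(** A concave polygonal line from the origin that ends flat is the sum of its slope jumps times
    truncated identities. This is the form that turns into a sum of capped logarithms. *)
Lemma polygonE k t : 0 <= t -> (k <= n)%N -> p k <= t -> ((k < n)%N -> t <= p k.+1) ->
  \sum_(0 <= j < n) jump p n j * Num.min (4 * pi * t ^+ 2) (4 * pi * p j.+1 ^+ 2) =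
  p k + slope p n k * (4 * pi * t ^+ 2 - 4 * pi * p k ^+ 2).
Proof.
move=> t0 kn pkt tpk; rewrite (big_cat_nat (n := k))//=.
have pi4 : 0 <= 4 * pi :> R by rewrite mulr_ge0// ltW// pi_gt0.
rewrite (eq_big_nat _ _ (F2 := fun j => jump p n j * (4 * pi * p j.+1 ^+ 2))); last first.
  move=> j /andP[_ jk]; rewrite min_r// ler_wpM2l// lerXn2r ?nnegrE//.
    by apply: node_ge0; exact: leq_trans kn.
  by apply: le_trans pkt; apply: node_le.
rewrite (eq_big_nat _ _ (m := k) (F2 := fun j => jump p n j * (4 * pi * t ^+ 2))); last first.
  move=> j /andP[kj jn]; rewrite min_l// ler_wpM2l// lerXn2r ?nnegrE//.
    exact: node_ge0.
  by apply: le_trans (tpk (leq_ltn_trans kj jn)) _; apply: node_le.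
rewrite -mulr_suml sum_jump//; rewrite -[X in _ = X + _](sum_jump_node kn).
by ring.
Qed.

Lemma polygon_node i : (i < n)%N ->
  \sum_(0 <= j < n) jump p n j * Num.min (4 * pi * p i.+1 ^+ 2) (4 * pi * p j.+1 ^+ 2) = p i.+1.
Proof.
move=> ilt; rewrite (@polygonE i.+1) ?node_ge0 ?subrr ?mulr0 ?addr0//.
by move=> h; exact: ltW (pS h).
Qed.

(** Between nodes the gap factors as (t - p_k) (p_(k+1) - t) / (p_k + p_(k+1)); beyond the last node
    the line stays at the height p_n < t. *)
Lemma polygon_lt t : 0 < t -> (forall j, (j < n)%N -> t != p j.+1) ->
  \sum_(0 <= j < n) jump p n j * Num.min (4 * pi * t ^+ 2) (4 * pi * p j.+1 ^+ 2) < t.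
Proof.
move=> t0 tp.
have [k kn /andP[pk kp]] : exists2 k, (k <= n)%N & (p k <= t) && ((k < n)%N ==> (t <= p k.+1)).
  have ex : exists k, (k <= n)%N && (p k <= t) by exists 0%N; rewrite p0 ltW.
  have ub k : (k <= n)%N && (p k <= t) -> (k <= n)%N by case/andP.
  case: (ex_maxnP ex ub) => k /andP[kn pk] kmax; exists k; rewrite ?pk//=.
  apply/implyP => kn1; rewrite leNgt; apply/negP => /ltW h.
  by have := kmax k.+1; rewrite kn1 h ltnn => /(_ isT).
rewrite (polygonE (ltW t0) kn pk (implyP kp)).
have pk0 : 0 <= p k by exact: node_ge0.
have tk : p k < t.
  rewrite lt_neqAle pk andbT; case: k kn {pk kp pk0} => [|k] kn.
    by rewrite p0 lt_eqF.
  by rewrite eq_sym tp.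
rewrite /slope; move: kp; case: ifP => [kn1 /= kp|_ _]; last by rewrite mul0r addr0.
have tk1 : t < p k.+1 by rewrite lt_neqAle kp tp.
have d0 : 0 < p k + p k.+1 by rewrite ltr_wpDl// (lt_trans t0).
rewrite -subr_gt0.
have pi0 := lt0r_neq0 (pi_gt0 R).
have -> : t - (p k + (4 * pi * (p k + p k.+1))^-1 * (4 * pi * t ^+ 2 - 4 * pi * p k ^+ 2)) =
  (t - p k) * (p k.+1 - t) / (p k + p k.+1).
  by move: (pi : R) pi0 (lt0r_neq0 d0) => z z0 d1; field; rewrite d1.
by rewrite divr_gt0// mulr_gt0// subr_gt0.
Qed.

End Fixed.

End Polygon.

(** Summing over jumps makes the line independent of the order in which the nodes are listed. *)
Definition polygon (R : realType) n (m b : 'I_n -> R) (t : R) : R := \sum_i m i * Num.min t (b i).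

(* [b] are the nodes and [m] the slope jumps of the concave polygonal line
   that meets the parabola [sigma = 4 pi t^2] exactly at the nodes. *)
Record inscribed (R : realType) n (m b : 'I_n -> R) : Prop := {
  ins_m : forall i, 0 < m i;
  ins_b : forall i, 0 < b i;
  ins_inj : injective b;
  ins_node : forall i, 4 * pi * polygon m b (b i) ^+ 2 = b i;
  ins_lt : forall t, 0 < t -> (forall i, t != b i) -> 4 * pi * polygon m b t ^+ 2 < t }.

Section Inscribed.
Context {R : realType}.

Lemma tower_profile_sq (r : R) : 0 < r < 1 ->
  0 < tower_profile r /\ 4 * pi * tower_profile r ^+ 2 = - (2 * ln r).
Proof.
move=> /andP[r0 r1]; have l0 : ln r < 0 by apply: ln_lt0; rewrite r0.
have h : 0 < ln r^-1 / (2 * pi).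
  by rewrite divr_gt0 ?mulr_gt0 ?pi_gt0// lnV ?posrE// oppr_gt0 l0.
split; first by rewrite sqrtr_gt0.
rewrite sqr_sqrtr ?ltW// lnV ?posrE//; have := lt0r_neq0 (pi_gt0 R).
by move: (pi : R) => z z0; field.
Qed.

Lemma tower_profile_lt (r r' : R) : 0 < r -> r < r' -> r' < 1 -> tower_profile r' < tower_profile r.
Proof.
move=> r0 rr r1; have r0' := lt_trans r0 rr.
rewrite /tower_profile ltr_sqrt.
  by rewrite ltr_pM2r ?invr_gt0 ?mulr_gt0 ?pi_gt0// !lnV ?posrE// ltrN2 ltr_ln ?posrE.
have l0 : ln r < 0 by apply: ln_lt0; rewrite r0 (lt_trans rr r1).
by rewrite divr_gt0 ?mulr_gt0 ?pi_gt0// lnV ?posrE// oppr_gt0 l0.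
Qed.

(** The abscissae - 2 ln (a i) decrease in i, while the line is described from the origin outwards;
    hence the reversal n - i. The last identity rewrites the energy as a sum of slope times height
    increment. *)
Lemma exists_inscribed n (a : 'I_n -> R) : (forall i, 0 < a i < 1) ->
  (forall i j : 'I_n, (i < j)%N -> a i < a j) ->
  exists2 m : 'I_n -> R, inscribed m (fun i => - (2 * ln (a i))) &
    exists p : nat -> R, [/\ p 0%N = 0, forall i : 'I_n, p (n - i)%N = tower_profile (a i) &
      \sum_i m i * polygon m (fun i => - (2 * ln (a i))) (- (2 * ln (a i))) =
      \sum_(0 <= j < n) slope p n j * (p j.+1 - p j)].
Proof.
move=> a01 amono.
(* For 1 <= k <= n this is the profile at a_(n-k), with p 0 = 0; [insub] only serves to make it
   total on the naturals. *)
pose p (k : nat) : R := if k is k'.+1 then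
  (if insub (n - k)%N is Some o then tower_profile (a o) else 0) else 0.
have pE (i : 'I_n) : p (n - i)%N = tower_profile (a i).
  have := ltn_ord i; rewrite -subn_gt0 /p; case E : (n - i)%N => [//|k] _.
  rewrite insubT => [|h]; first by rewrite -E subKn// ltnW.
  by congr (tower_profile (a _)); apply/val_inj => /=; rewrite -E subKn// ltnW.
have pE' k (kn : (k < n)%N) : p k.+1 = tower_profile (a (rev_ord (Ordinal kn))).
  by rewrite -pE /= subKn.
have p0 : p 0%N = 0 by [].
clearbody p.
have pS k : (k < n)%N -> p k < p k.+1.
  move=> kn; rewrite (pE' k kn); case: k kn => [|k] kn.
    by rewrite p0; have [] := tower_profile_sq (a01 (rev_ord (Ordinal kn))).
  have kn' : (k < n)%N by exact: ltnW.
  rewrite (pE' k kn'); apply: tower_profile_lt.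
  - by have /andP[] := a01 (rev_ord (Ordinal kn)).
  - by apply: amono => /=; rewrite ltn_sub2l.
  - by have /andP[] := a01 (rev_ord (Ordinal kn')).
pose m (i : 'I_n) := jump p n (rev_ord i).
have sqE (i : 'I_n) : - (2 * ln (a i)) = 4 * pi * p (rev_ord i).+1 ^+ 2.
  have -> : (rev_ord i).+1 = (n - i)%N by rewrite /= -subSn// subSS.
  by rewrite pE; have [_ ->] := tower_profile_sq (a01 i).
have polE t : polygon m (fun i => - (2 * ln (a i))) (4 * pi * t ^+ 2) =
    \sum_(0 <= j < n) jump p n j * Num.min (4 * pi * t ^+ 2) (4 * pi * p j.+1 ^+ 2).
  rewrite big_mkord /polygon (reindex_inj rev_ord_inj)/=; apply: eq_bigr => i _.
  by rewrite sqE /m rev_ordK.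
have node (i : 'I_n) : polygon m (fun i => - (2 * ln (a i))) (- (2 * ln (a i))) = p (rev_ord i).+1.
  by rewrite [X in polygon _ _ X]sqE polE polygon_node.
have [pk0 b0] : (forall k, (k < n)%N -> 0 < p k.+1) /\ (forall i, 0 < - (2 * ln (a i))).
  have h k : (k < n)%N -> 0 < p k.+1.
    by move=> kn; apply: le_lt_trans (pS k kn); exact: node_ge0 p0 pS _ (ltnW kn).
  by split => // i; rewrite sqE !mulr_gt0 ?pi_gt0 ?exprn_gt0 ?h.
exists m.
  split.
  - by move=> i; exact: jump_gt0.
  - exact: b0.
  - move=> i j /oppr_inj/(mulfI (lt0r_neq0 (ltr0n _ 2))) h.
    have /ln_inj e : ln (a i) = ln (a j) by exact: h.
    have {e} e : a i = a j by apply: e; rewrite posrE; [have /andP[]:= a01 i|have /andP[]:= a01 j].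
    apply/val_inj; case: (ltngtP i j) => // /amono; rewrite e ltxx//.
  - by move=> i; rewrite node -sqE.
  - move=> t t0 tb; set u := Num.sqrt (t / (4 * pi)).
    have pi4 : 0 < 4 * pi :> R by rewrite mulr_gt0// pi_gt0.
    have u0 : 0 < u by rewrite sqrtr_gt0 divr_gt0.
    have tE : t = 4 * pi * u ^+ 2.
      by rewrite sqr_sqrtr ?divr_ge0 ?ltW// mulrC divfK// gt_eqF.
    have hl : polygon m (fun i => - (2 * ln (a i))) t < u.
      rewrite tE polE; apply: polygon_lt => // j jn; apply/eqP => e.
      have := tb (rev_ord (Ordinal jn)); rewrite sqE rev_ordK /= -e -tE eqxx//.
    rewrite [ltRHS]tE ltr_pM2l// ltr_pXn2r// ?nnegrE ?(ltW u0)//.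
    apply: sumr_ge0 => i _; rewrite mulr_ge0 ?ltW ?jump_gt0//.
    by rewrite lt_min t0 b0.
exists p; split => //.
rewrite -(sum_jump_p p0 (leqnn n)) /slope ltnn mul0r addr0 big_mkord.
rewrite (reindex_inj rev_ord_inj)/=; apply: eq_bigr => i _.
by rewrite node /m rev_ordK.
Qed.

End Inscribed.

(** * Capped logarithms and their Gram matrix *)

Section TruncatedLogarithm.
Context {R : realType}.
Local Notation mu := (@lebesgue_measure R).
Local Notation mR := (measurableTypeR R).
Local Notation mf1 := (@measurable_fun _ _ (measurableTypeR R) R).
Local Notation I01 := `[(0 : R), 1[%classic.
Local Notation IL u := (Rintegral mu I01 u).
Local Notation IntL u := (mu.-integrable I01 (EFin \o u)).
Implicit Types (c y t : R).

(** The left end is excluded because [dcapped_log] vanishes at its kink; the two integrands differ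
    at one point. *)
Lemma IL_oitv (F f : R -> R) (a b : R) : 0 < a -> a <= b -> b <= 1 ->
  (forall x : R, 0 < x -> is_derive x 1 F (f x)) -> (forall x : R, 0 < x -> {for x, continuous f}) ->
  IntL (fun t => (a < t < b)%R%:R * f t) /\ IL (fun t => (a < t < b)%R%:R * f t) = F b - F a.
Proof.
move=> a0 ab b1 Ff cf; have [i1 e1] := IL_itv a0 ab b1 Ff cf.
pose g t : R := (a <= t < b)%R%:R * f t.
have E t : (I01 `\ a) t -> g t = (a < t < b)%R%:R * f t.
  by move=> [_ /= /eqP ta]; rewrite /g (lt_neqAle a t) (eq_sym a t) ta.
have ae : {ae mu, forall t, I01 t -> (EFin \o g) t = (EFin \o (fun t => (a < t < b)%R%:R * f t)) t}.
  exists [set a]; split; [exact: measurable_set1|exact: lebesgue_measure_set1|].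
  move=> t /= h; apply: contrapT => ta; apply: h => It.
  by rewrite E//; split.
have mg : measurable_fun (I01 : set mR) (EFin \o g : mR -> \bar R) by case/integrableP : i1.
have mh : measurable_fun (I01 : set mR) (EFin \o (fun t => (a < t < b)%R%:R * f t) : mR -> \bar R).
  apply/measurable_EFinP; apply: (@eq_measurable_fun _ _ mR R _ (fun t => g t * (t != a)%R%:R)).
    move=> t _; rewrite /g (lt_neqAle a t) (eq_sym a t); case: eqVneq => //=; rewrite ?mulr1 ?mulr0 ?mul0r//.
  apply: measurable_funM; first exact/measurable_EFinP.
  have m1 : @measurable_fun _ _ mR bool I01 (fun t => t != a).
    by apply: measurable_neg; apply: measurable_fun_eqr => //; exact: measurable_cst.
  exact: (@measurable_comp _ _ _ mR bool R setT (fun b : bool => b%:R) I01).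
split.
  apply: (IntL_le _ (IntL_norm i1)) => [|t _]; first exact/measurable_EFinP.
  rewrite !normrM; apply: ler_wpM2r => //; case: (ltP a t) => [/ltW ->//|_].
  by rewrite normr0.
by rewrite -e1 /Rintegral; congr fine; apply/esym; exact: (ae_eq_integral _ _ measurable_I01 mg mh ae).
Qed.

(** For y > 0 this is the minimum of - ln y and c. Capping inside the logarithm makes it continuous
    on the whole line, in particular at 0. *)
Definition capped_log c y : R := - ln (Num.max y (expR (- c))).

(** The strict inequality gives the derivative the value 0 at the kink, as [H10_radial] asks at its
    exceptional point. *)
Definition dcapped_log c y : R := - ((expR (- c) < y)%R%:R / Num.max y (expR (- c))).

Lemma max_exp_gt0 c y : 0 < Num.max y (expR (- c)).
Proof. by rewrite lt_max expR_gt0 orbT. Qed.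

Lemma capped_logE c y : 0 < y -> capped_log c y = Num.min (- ln y) c.
Proof.
move=> y0; rewrite /capped_log; case: (leP y (expR (- c))) => h.
  rewrite expRK opprK min_r// lerNr -[leRHS]expRK ler_ln ?posrE ?expR_gt0//.
rewrite min_l// lerNl -[leLHS]expRK ler_ln ?posrE ?expR_gt0//; exact: ltW.
Qed.

Lemma continuous_max_l c : continuous (fun y => Num.max y c).
Proof.
move=> y; rewrite (_ : (fun y => Num.max y c) = (fun y => Num.max 0 (y - c) + c)); last first.
  by apply/funext => t; rewrite addr_maxl add0r subrK maxC.
apply: (@cvgD _ R); last exact: cvg_cst.
have h : {for y, continuous (fun t => t - c)}.
  by apply: (@cvgB _ R); [exact: cvg_id|exact: cvg_cst].
exact: continuous_comp h (@continuous_max0 _ _).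
Qed.

Lemma continuous_capped_log c : continuous (capped_log c).
Proof.
move=> y; apply: (@cvgN _ R).
apply: (@continuous_comp _ _ _ (fun y => Num.max y (expR (- c))) (@ln R)).
  exact: continuous_max_l.
by apply: continuous_ln; exact: max_exp_gt0.
Qed.

Lemma dcapped_log_bound c y : `|dcapped_log c y| <= expR c.
Proof.
have m0 := max_exp_gt0 c y.
rewrite /dcapped_log normrN normrM ger0_norm// (ger0_norm (ltW _)) ?invr_gt0//.
apply: (@le_trans _ _ (Num.max y (expR (- c)))^-1).
  by apply: ler_piMl; [rewrite invr_ge0 ltW|case: (_ < y)].
by rewrite -[leRHS]invrK -expRN lef_pV2 ?posrE ?expR_gt0// le_max lexx orbT.
Qed.

Lemma dcapped_log_continuous c y : y != expR (- c) -> {for y, continuous (dcapped_log c)}.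
Proof.
move=> yc; have [h|h] := ltP y (expR (- c)).
  apply: (near_cst_continuous 0); near=> t; rewrite /dcapped_log.
  have -> : (expR (- c) < t) = false by apply/negbTE; rewrite -leNgt; apply: ltW; near: t; exact: lt_nbhsl.
  by rewrite mul0r oppr0.
have {}h : expR (- c) < y by rewrite lt_neqAle eq_sym yc.
have hc : {for y, continuous (fun t => - (Num.max t (expR (- c)))^-1)}.
  apply: (@cvgN _ R); apply: (@cvgV _ R); first by rewrite gt_eqF// max_exp_gt0.
  exact: continuous_max_l.
rewrite /prop_for /continuous_at.
have -> : dcapped_log c y = - (Num.max y (expR (- c)))^-1 by rewrite /dcapped_log h mul1r.
apply: cvg_trans hc; apply: near_eq_cvg; near=> t.
have tc : expR (- c) < t by near: t; exact: lt_nbhsr.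
by rewrite /dcapped_log tc mul1r.
Unshelve. all: by end_near. Qed.

Lemma dcapped_log_node c : dcapped_log c (expR (- c)) = 0.
Proof. by rewrite /dcapped_log ltxx mul0r oppr0. Qed.

Lemma is_derive_ln_pos (x : R) : 0 < x -> is_derive x 1 (@ln R) x^-1.
Proof. exact: is_derive1_ln. Qed.

Lemma continuous_inv_pos (x : R) : 0 < x -> {for x, continuous (fun t : R => t^-1)}.
Proof. by move=> x0; apply: (@cvgV _ R); [rewrite gt_eqF|exact: cvg_id]. Qed.

Lemma capped_log_int c y : 0 < c -> I01 y ->
  capped_log c y = - IL (fun t => (y <= t)%R%:R * dcapped_log c t).
Proof.
move=> c0; rewrite /= in_itv/= => /andP[y0 y1]; have e0 := expR_gt0 (- c).
have e1 : expR (- c) < 1 by rewrite expR_lt1 oppr_lt0.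
rewrite /capped_log; congr (- _); case: (leP y (expR (- c))) => h.
  have [i E] := IL_oitv e0 (ltW e1) (lexx 1) is_derive_ln_pos continuous_inv_pos.
  rewrite ln1 sub0r in E; rewrite -[LHS]opprK -E -mulN1r -(IL_Z _ i).
  apply: IL_eq => t; rewrite /= in_itv/= => /andP[t0 t1]; rewrite t1 andbT /dcapped_log.
  case: (ltP (expR (- c)) t) => ct; last by rewrite !mul0r oppr0 !mulr0.
  by rewrite (le_trans h (ltW ct)) !mul1r mulN1r.
have [i E] := IL_itv (lt_trans e0 h) (ltW y1) (lexx 1) is_derive_ln_pos continuous_inv_pos.
rewrite ln1 sub0r in E; rewrite -[LHS]opprK -E -mulN1r -(IL_Z _ i).
apply: IL_eq => t; rewrite /= in_itv/= => /andP[t0 t1]; rewrite t1 andbT /dcapped_log.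
case: (leP y t) => yt; last by rewrite !mul0r mulr0.
by rewrite (lt_le_trans h yt) max_l ?(ltW (lt_le_trans h yt))// !mul1r mulN1r.
Qed.

Lemma H10_capped_log c : 0 < c ->
  mf1 I01 (dcapped_log c) /\
  H10grad (fun x => capped_log c (sqn x)) (fun x => dcapped_log c (sqn x) * (2 * x.1))
    (fun x => dcapped_log c (sqn x) * (2 * x.2)).
Proof.
move=> c0; apply: (H10_radial (dcapped_log_bound c) (@dcapped_log_continuous c)).
  by move=> _; exact: dcapped_log_node.
by move=> y; exact: capped_log_int.
Qed.

(** Both derivatives are - 1/y above the larger threshold expR (- min c d) and one of them vanishes
    below it, so what remains is the integral of 1/y. *)
Lemma IL_dcapped_log c d : 0 < c -> 0 < d ->
  IntL (fun y => y * (dcapped_log c y * dcapped_log d y)) /\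
  IL (fun y => y * (dcapped_log c y * dcapped_log d y)) = Num.min c d.
Proof.
wlog cd : c d / c <= d.
  move=> H c0 d0; have [|/ltW dc] := leP c d; first by move=> cd; have := H _ _ cd c0 d0; rewrite min_l.
  have [i E] := H _ _ dc d0 c0; rewrite min_l// in E.
  have S y : y * (dcapped_log d y * dcapped_log c y) = y * (dcapped_log c y * dcapped_log d y) by ring.
  by split; [apply: IntL_eq i => y _|rewrite -[RHS]E; apply: IL_eq => y _; rewrite S].
move=> c0 d0; rewrite min_l//; have e0 := expR_gt0 (- c).
have e1 : expR (- c) <= 1 by rewrite expR_le1 oppr_le0 ltW.
have [i E] := IL_oitv e0 e1 (lexx 1) is_derive_ln_pos continuous_inv_pos.
rewrite ln1 expRK sub0r opprK in E.
have S y : I01 y -> (expR (- c) < y < 1)%R%:R / y = y * (dcapped_log c y * dcapped_log d y).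
  rewrite /= in_itv/= => /andP[y0 y1]; rewrite y1 andbT /dcapped_log.
  case: (ltP (expR (- c)) y) => cy; last by rewrite !mul0r oppr0 mul0r mulr0.
  have dy : expR (- d) < y by apply: le_lt_trans cy; rewrite ler_expR lerN2.
  rewrite dy max_l ?(ltW dy)// -[true%:R]/(1 : R) !mul1r; have yn : y != 0 by rewrite gt_eqF// (lt_trans e0).
  by rewrite /=; field.
by split; [exact: IntL_eq S i|rewrite -(IL_eq S)].
Qed.

End TruncatedLogarithm.

(** * Existence and uniqueness of the tower *)

Section Towers.
Context {R : realType}.
Local Notation mu := (@lebesgue_measure R).
Local Notation mu2 := ((@lebesgue_measure R \x @lebesgue_measure R)%E).
Local Notation mf1 := (@measurable_fun _ _ (measurableTypeR R) R).
Local Notation I01 := `[(0 : R), 1[%classic.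
Local Notation I u := (Rintegral mu2 disk u).
Local Notation IL u := (Rintegral mu I01 u).
Local Notation IntL u := (mu.-integrable I01 (EFin \o u)).
Implicit Types (c y t r : R) (u : R * R -> R).

Lemma H10grad_sum n (U G1 G2 : 'I_n -> R * R -> R) : (forall i, H10grad (U i) (G1 i) (G2 i)) ->
  H10grad (fun x => \sum_i U i x) (fun x => \sum_i G1 i x) (fun x => \sum_i G2 i x).
Proof.
elim: n U G1 G2 => [|n IH] U G1 G2 hU.
  have C0 := C1P_cst (0 : R).
  have c0 : C1c (cst (0 : R)) by apply: (C1c_intro C0 ltr01).
  apply: (H10grad_eq (C1c_H10grad c0)) => x _; rewrite big_ord0//.
    by have [_ ->] := C1P_d1 C0 x.
  by have [_ ->] := C1P_d2 C0 x.
apply: (H10grad_eq (H10gradD (IH _ _ _ (fun i => hU (widen_ord (leqnSn n) i))) (hU ord_max))) => x _;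
  by rewrite big_ord_recr.
Qed.

(** The integral of div (u X) over the disk vanishes: clear for test functions, and extended by
    density. *)
Lemma H10_div X1 X2 d11 d12 d21 d22 u g1 g2 : C1P X1 d11 d12 -> C1P X2 d21 d22 ->
  H10grad u g1 g2 -> I (fun x => X1 x * g1 x + X2 x * g2 x + (d11 x + d22 x) * u x) = 0.
Proof.
move=> h1 h2; apply: H10_weak_form.
- exact: L2_continuous (C1P_continuous h1).
- exact: L2_continuous (C1P_continuous h2).
- exact: L2D (L2_continuous (C1P_c1 h1)) (L2_continuous (C1P_c2 h2)).
move=> phi cphi; have [hp [r /andP[_ r1] p0]] := C1c_elim cphi.
have p1 x : 1 <= sqn x -> [/\ phi x = 0, 'D_e1 phi x = 0 & 'D_e2 phi x = 0].
  by move=> x1; apply: p0; exact: le_trans (ltW r1) x1.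
have [i1 _] := C1P_integral0 (C1PM h1 hp) ltac:(by move=> x /p1[-> -> ->]; rewrite !mulr0 !mul0r addr0).
have [_ i2] := C1P_integral0 (C1PM h2 hp) ltac:(by move=> x /p1[-> -> ->]; rewrite !mulr0 !mul0r addr0).
have j1 := continuous_integrable_disk (C1P_c1 (C1PM h1 hp)).
have j2 := continuous_integrable_disk (C1P_c2 (C1PM h2 hp)).
rewrite -[RHS](addr0 0) -{1}i1 -i2 -(I_D j1 j2); apply: I_eq => x _.
by move: ('D_e1 phi x) ('D_e2 phi x) => a b; ring.
Qed.

(** Test with the field X = x, of divergence 2: a constant has gradient 0, so 2 pi c = 0. This
    stands in for a trace theorem at the boundary. *)
Lemma H10_cst c : H10 (cst c : R * R -> R) -> c = 0.
Proof.
move=> hc; have [w1 w2] := C1P_is_wd (C1P_cst c).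
have := H10_div C1P_fst C1P_snd (And3 hc w1 w2).
rewrite (@I_eq _ _ (cst (2 * c))) => [|x _]; last by rewrite /cst; ring.
rewrite (Rintegral_cst _ measurable_disk); have -> : fine (mu2 disk) = pi :> R by rewrite mu2_disk.
move/eqP; rewrite !mulf_eq0 pnatr_eq0/= (gt_eqF (pi_gt0 R)) orbF => /eqP//.
Qed.

Definition tlog n (m b : 'I_n -> R) y : R := \sum_i m i * capped_log (b i) y.

Definition dtlog n (m b : 'I_n -> R) y : R := \sum_i m i * dcapped_log (b i) y.

Lemma tlogE n (m b : 'I_n -> R) y : 0 < y -> tlog m b y = polygon m b (- ln y).
Proof. by move=> y0; apply: eq_bigr => i _; rewrite capped_logE. Qed.

Lemma continuous_sum n (F : 'I_n -> R -> R) : (forall i, continuous (F i)) ->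
  continuous (fun y => \sum_i F i y).
Proof.
elim: n F => [|n IH] F cF.
  rewrite (_ : (fun y => \sum_(i < 0) F i y) = cst 0); first exact: cst_continuous.
  by apply/funext => y; rewrite big_ord0.
rewrite (_ : (fun y => \sum_(i < n.+1) F i y) =
    (fun y => \sum_(i < n) F (widen_ord (leqnSn n) i) y + F ord_max y)).
  by move=> y; apply: (@cvgD _ R); [exact: (IH _ (fun i => cF _))|exact: cF].
by apply/funext => y; rewrite big_ord_recr.
Qed.

Lemma continuous_tlog n (m b : 'I_n -> R) : continuous (tlog m b).
Proof.
apply: continuous_sum => i y; apply: (@cvgM _ R); first exact: cvg_cst.
exact: continuous_capped_log.
Qed.

Lemma H10_tlog n (m b : 'I_n -> R) : (forall i, 0 < b i) ->
  mf1 I01 (dtlog m b) /\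
  H10grad (fun x => tlog m b (sqn x)) (fun x => dtlog m b (sqn x) * (2 * x.1))
    (fun x => dtlog m b (sqn x) * (2 * x.2)).
Proof.
move=> b0; split.
  apply: measurable_sum => i; apply: measurable_funM; first exact: measurable_cst.
  by have [] := H10_capped_log (b0 i).
have h := H10grad_sum (fun i => H10gradZ (m i) (H10_capped_log (b0 i)).2).
apply: (H10grad_eq h) => x _ //; rewrite /dtlog mulr_suml; apply: eq_bigr => i _; exact: mulrA.
Qed.

(** Expanding the square, the Gram entries min (b i) (b j) reassemble in the inner sum into the
    value of the line at b i. *)
Lemma IL_dtlog n (m b : 'I_n -> R) : (forall i, 0 < b i) ->
  IntL (fun y => y * (dtlog m b y * dtlog m b y)) /\
  IL (fun y => y * (dtlog m b y * dtlog m b y)) = \sum_i m i * polygon m b (b i).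
Proof.
move=> b0.
have E y : \sum_i \sum_j m i * m j * (y * (dcapped_log (b i) y * dcapped_log (b j) y)) =
    y * (dtlog m b y * dtlog m b y).
  rewrite /dtlog big_distrlr/= mulr_sumr; apply: eq_bigr => i _.
  by rewrite mulr_sumr; apply: eq_bigr => j _; ring.
have ij i j := IL_dcapped_log (b0 i) (b0 j).
have si i := IL_sum (fun j => IntL_Z (m i * m j) (ij i j).1).
have [ii e] := IL_sum (fun i => (si i).1).
split; first by apply: IntL_eq ii => y _; rewrite E.
rewrite -(IL_eq (fun y _ => E y)) e; apply: eq_bigr => i _.
rewrite (si i).2 /polygon mulr_sumr; apply: eq_bigr => j _.
by rewrite (IL_Z _ (ij i j).1) (ij i j).2; ring.
Qed.

Lemma radial_sqn (k : R -> R) : radial (fun r => k (r ^+ 2)) = (fun x : R * R => k (sqn x)).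
Proof. by apply/funext => x; rewrite /radial enormE sqr_sqrtr// sqn_ge0. Qed.

Lemma continuous_radial (k : R -> R) : continuous k -> continuous (fun x : R * R => k (sqn x)).
Proof.
by move=> ck x; apply: (@continuous_comp _ _ _ (@sqn R) k); [exact: continuous_sqn|exact: ck].
Qed.

Lemma ln_sqr r : 0 < r -> ln (r ^+ 2) = 2 * ln r.
Proof. by move=> r0; rewrite lnXn// mulr_natl. Qed.

Section Nodes.
Variables (n : nat) (a m : 'I_n -> R).
Hypothesis a01 : forall i, 0 < a i < 1.
Local Notation b := (fun i => - (2 * ln (a i))).
Hypothesis insc : inscribed m b.

Lemma tlog_node i : tlog m b (a i ^+ 2) = tower_profile (a i).
Proof.
have /andP[a0 a1] := a01 i; have [p0 pE] := tower_profile_sq (a01 i).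
rewrite tlogE ?exprn_gt0//= ln_sqr//.
have := ins_node insc i; rewrite -[RHS]pE => h.
have pi4 : 4 * pi != 0 :> R by rewrite mulf_neq0// gt_eqF// pi_gt0.
have z0 : 0 <= polygon m b (- (2 * ln (a i))).
  by apply: sumr_ge0 => j _; rewrite mulr_ge0 ?(ltW (ins_m insc _))// le_min !(ltW (ins_b insc _)).
by move/(mulfI pi4): h; move/eqP; rewrite eqrXn2 ?(ltW p0)// => /eqP.
Qed.

Lemma tower_isP : is_tower (range a) set0 (fun r => tlog m b (r ^+ 2)).
Proof.
split.
- by rewrite radial_sqn => x _; exact: continuous_radial (@continuous_tlog _ m b) x.
- by rewrite radial_sqn; have [_ []] := H10_tlog m (ins_b insc).
- by move=> r [i _ <-]; exact: tlog_node.
- by [].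
move=> x Ax.
(* Each summand is on one side of its kink throughout the component: constantly b i if the node lies
   to the right, and 2 ln (1/r) if to the left. *)
exists (\sum_i m i * (if a i < x then 0 else b i)), (\sum_i m i * (if a i < x then 2 else 0)) => r.
move=> [C [Cx CA Cc] Cr]; have Ci := (connected_intervalP C).1 Cc.
have /CA[/=] := Cr; rewrite in_itv/= => /andP[r0 r1] _.
have /CA[/=] := Cx; rewrite in_itv/= => /andP[x0 x1] _.
have nC i : ~ C (a i) by move=> /CA[_]; apply; left; exists i.
rewrite tlogE ?exprn_gt0// ln_sqr// lnV ?posrE// mulr_suml -big_split/=; apply: eq_bigr => i _.
have /andP[a0 a1] := a01 i.
rewrite -mulrA -mulrDr; congr (_ * _).
have mE : (Num.min (- (2 * ln r)) (- (2 * ln (a i))) = if a i < r then - (2 * ln r) else - (2 * ln (a i))).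
  case: ifPn => [ar|]; last rewrite -leNgt => ra.
    by rewrite min_l// lerN2 ler_pM2l// ler_ln ?posrE// ltW.
  by rewrite min_r// lerN2 ler_pM2l// ler_ln ?posrE.
(* The component is an interval that contains no node, so no node separates r from x. *)
rewrite mE; have -> : (a i < r) = (a i < x).
  apply/idP/idP => h; rewrite ltNge; apply/negP => h'; apply: (nC i).
    by apply: (Ci x r) => //; rewrite h' ltW.
  by apply: (Ci r x) => //; rewrite h' ltW.
by case: ifP => _; ring.
Qed.

End Nodes.

Lemma tower_gap (h : R -> R) (C : set R) (l u : R) : is_tower C set0 h -> 0 <= l -> l < u -> u <= 1 ->
  (forall c, C c -> ~~ (l < c < u)) -> exists A B, forall r, l < r < u -> h r = A + B * ln r^-1.
Proof.
move=> [_ _ _ _ H] l0 lu u1 gap.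
have mid : l < (l + u) / 2 < u by rewrite midf_lt//= midf_lt.
have sub : `]l, u[%classic `<=` `]0, 1[%classic `\` (C `|` set0).
  move=> r /=; rewrite !in_itv/= => /andP[lr ru]; split.
    by rewrite (le_lt_trans l0 lr) (lt_le_trans ru u1).
  by case=> // /gap; rewrite lr ru.
have [|A [B AB]] := H ((l + u) / 2); first by apply: sub; rewrite /= in_itv/=.
exists A, B => r lr; apply: AB.
apply: (connected_component_max (B := `]l, u[%classic)) => //=; rewrite ?in_itv//=.
by apply/connected_intervalP; exact: interval_is_interval.
Qed.

Lemma agree_right (f g : R -> R) (l u : R) : l < u -> {for l, continuous f} -> {for l, continuous g} ->
  (forall t, l < t < u -> f t = g t) -> f l = g l.
Proof.
move=> lu cf cg fg.
have h1 : f t @[t --> l^'+] --> f l := cvg_at_right_filter cf.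
have h2 : g t @[t --> l^'+] --> g l := cvg_at_right_filter cg.
apply: (cvg_unique (@Rhausdorff R) h1); apply: cvg_trans h2; apply: near_eq_cvg; near=> t.
by apply/esym/fg; apply/andP; split; near: t; [exact: nbhs_right_gt|exact: nbhs_right_lt].
Unshelve. all: by end_near. Qed.

Lemma agree_left (f g : R -> R) (l u : R) : l < u -> {for u, continuous f} -> {for u, continuous g} ->
  (forall t, l < t < u -> f t = g t) -> f u = g u.
Proof.
move=> lu cf cg fg.
have h1 : f t @[t --> u^'-] --> f u := cvg_at_left_filter cf.
have h2 : g t @[t --> u^'-] --> g u := cvg_at_left_filter cg.
apply: (cvg_unique (@Rhausdorff R) h1); apply: cvg_trans h2; apply: near_eq_cvg; near=> t.
by apply/esym/fg; apply/andP; split; near: t; [exact: nbhs_left_gt|exact: nbhs_left_lt].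
Unshelve. all: by end_near. Qed.

(** Restriction to a diameter; using |t| turns continuity at the centre into a two-sided statement
    on the line. *)
Lemma continuous_slice (h : R -> R) t : (forall x, disk x -> {for x, continuous (radial h)}) ->
  `|t| < 1 -> {for t, continuous (fun t => h `|t|)}.
Proof.
move=> ch t1.
have E s : radial h (s, 0) = h `|s|.
  by rewrite /radial /enorm/= expr0n/= addr0 sqrtr_sqr.
rewrite (_ : (fun t => h `|t|) = (fun s => radial h (s, 0))); last by apply/funext => s; rewrite E.
apply: (@continuous_comp _ _ _ (fun s : R => (s, 0 : R)) (radial h)).
  have h' : (s, 0 : R) @[s --> t] --> (t, 0 : R) := cvg_pair (@cvg_id _ _) (cvg_cst _).
  exact: h'.
by apply: ch; rewrite /disk/= /enorm/= expr0n/= addr0 sqrtr_sqr.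
Qed.

Lemma continuous_lnV A B t : 0 < t -> {for t, continuous (fun t => A + B * ln t^-1)}.
Proof.
move=> t0; apply: (@cvgD _ R); first exact: cvg_cst.
apply: (@cvgM _ R); first exact: cvg_cst.
apply: (@continuous_comp _ _ _ (fun t : R => t^-1) (@ln R)); first exact: continuous_inv_pos.
by apply: continuous_ln; rewrite invr_gt0.
Qed.

Section Uniqueness.
Variables (n : nat) (a m : 'I_n -> R) (h : R -> R) (i0 : 'I_n).
Hypothesis a01 : forall i, 0 < a i < 1.
Local Notation b := (fun i => - (2 * ln (a i))).
Hypothesis insc : inscribed m b.
Hypothesis hT : is_tower (range a) set0 h.

(** The difference of two towers, extended evenly so that it is continuous at 0. It vanishes at the
    nodes and is affine in ln r between them. *)
Let e t : R := h `|t| - tlog m b (t ^+ 2).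

Let e_continuous t : `|t| < 1 -> {for t, continuous e}.
Proof.
move=> t1; apply: (@cvgB _ R); first by apply: continuous_slice => //; case: hT.
apply: (@continuous_comp _ _ _ (fun t : R => t ^+ 2) (tlog m b)); last exact: continuous_tlog.
exact: exprn_continuous.
Qed.

Let e_node i : e (a i) = 0.
Proof.
have /andP[a0 a1] := a01 i; rewrite /e gtr0_norm// (tlog_node a01 insc).
have [_ _ E _ _] := hT; rewrite E ?subrr//; exists i => //.
Qed.

Let e_gap (l u : R) : 0 <= l -> l < u -> u <= 1 -> (forall i, ~~ (l < a i < u)) ->
  exists A B, forall r, l < r < u -> e r = A + B * ln r^-1.
Proof.
move=> l0 lu u1 gap; have gap' c : range a c -> ~~ (l < c < u) by move=> [i _ <-].
have [A [B AB]] := tower_gap hT l0 lu u1 gap'.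
have [A' [B' AB']] := tower_gap (tower_isP a01 insc) l0 lu u1 gap'.
exists (A - A'), (B - B') => r lru; have /andP[lr _] := lru.
by rewrite /e gtr0_norm ?(le_lt_trans l0 lr)// AB// AB'//; ring.
Qed.

Let e_left (l u A B : R) : 0 < l -> l < u -> u <= 1 ->
  (forall r, l < r < u -> e r = A + B * ln r^-1) -> e l = A + B * ln l^-1.
Proof.
move=> l0 lu u1 H; apply: (agree_right lu _ (@continuous_lnV A B _ l0) H).
by apply: e_continuous; rewrite gtr0_norm// (lt_le_trans lu).
Qed.

Let e_right (l u A B : R) : 0 <= l -> l < u -> u < 1 ->
  (forall r, l < r < u -> e r = A + B * ln r^-1) -> e u = A + B * ln u^-1.
Proof.
move=> l0 lu u1 H; have u0 := le_lt_trans l0 lu.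
apply: (agree_left lu _ (@continuous_lnV A B _ u0) H).
by apply: e_continuous; rewrite gtr0_norm.
Qed.

(** Passing from t to t^2 doubles the logarithm, so e (t^2) - e t = - B ln t. This is at least |B|
    in size for t < 1/e, whereas continuity at 0 makes it small. *)
Let e_first (u A B : R) : 0 < u -> u <= 1 -> (forall r, 0 < r < u -> e r = A + B * ln r^-1) -> B = 0.
Proof.
move=> u0 u1 H; apply/eqP/negP => /negP B0.
have c0 : {for 0, continuous e} by apply: e_continuous; rewrite normr0.
have nb : 0 < `|B| / 2 by rewrite divr_gt0// normr_gt0.
have c1 : e t @[t --> 0^'+] --> e 0 := cvg_at_right_filter c0.
have n1 : \forall t \near (0 : R)^'+, `|e 0 - e t| < `|B| / 2.
  by move/cvgrPdist_lt: c1 => /(_ _ nb).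
have sq : {for (0 : R), continuous (fun t => e (t ^+ 2))}.
  apply: (@continuous_comp _ _ _ (fun t : R => t ^+ 2) e); first exact: exprn_continuous.
  by rewrite /prop_for expr0n/=.
have c2 : e (t ^+ 2) @[t --> 0^'+] --> e (0 ^+ 2) := cvg_at_right_filter sq.
rewrite expr0n/= in c2.
have n2 : \forall t \near (0 : R)^'+, `|e 0 - e (t ^+ 2)| < `|B| / 2.
  by move/cvgrPdist_lt: c2 => /(_ _ nb).
have n3 : \forall t \near (0 : R)^'+, 0 < t < Num.min u (expR (- 1)).
  near=> t; apply/andP; split; near: t; [exact: nbhs_right_gt|apply: nbhs_right_lt].
  by rewrite lt_min u0 expR_gt0.
have n4 := filterI (filterI n1 n2) n3.
have [t [[h1 h2] /andP[t0]]] := @filter_ex _ ((0 : R)^'+) _ _ (n4 _ _).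
rewrite lt_min => /andP[tu te].
have t1 : t < 1 := lt_le_trans tu u1.
have tt : t ^+ 2 < u by apply: le_lt_trans tu; rewrite expr2 ler_piMl ?ltW.
have := H t; rewrite t0 tu => /(_ isT) e1; have := H (t ^+ 2); rewrite exprn_gt0// tt => /(_ isT) e2.
have : `|e (t ^+ 2) - e t| < `|B|.
  rewrite (_ : e (t ^+ 2) - e t = (e 0 - e t) - (e 0 - e (t ^+ 2))); last by ring.
  by apply: le_lt_trans (ler_normB _ _) _; rewrite [ltRHS]splitr ltrD.
rewrite e1 e2 (_ : _ - _ = B * (ln (t ^+ 2)^-1 - ln t^-1)); last by ring.
rewrite !lnV ?posrE ?exprn_gt0// ln_sqr// normrM ltNge => /negP; apply.
rewrite ler_peMr// (_ : _ - _ = - ln t); last by ring.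
apply: le_trans (ler_norm _); rewrite lerNr -[leRHS]expRK ler_ln ?posrE ?expR_gt0//; exact: ltW.
Unshelve. all: by end_near. Qed.

Let lower r : 0 < r -> (exists2 i, a i < r & forall j, a j < r -> a j <= a i) \/ (forall j, r <= a j).
Proof.
move=> r0; have [/existsP[i ir]|/existsPn h'] := boolP [exists i, a i < r]; [left|right].
  case: (@Order.TotalTheory.arg_maxP _ _ _ i (fun i => a i < r) a ir) => j jr jmax.
  by exists j => // k kr; exact: jmax.
by move=> j; rewrite leNgt.
Qed.

Let upper r : (exists2 i, r < a i & forall j, r < a j -> a i <= a j) \/ (forall j, a j <= r).
Proof.
have [/existsP[i ir]|/existsPn h'] := boolP [exists i, r < a i]; [left|right].
  case: (@Order.TotalTheory.arg_minP _ _ _ i (fun i => r < a i) a ir) => j jr jmax.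
  by exists j => // k kr; exact: jmax.
by move=> j; rewrite leNgt.
Qed.

(** Between neighbouring nodes an affine function of ln r with two zeros vanishes; below the first
    node it is constant by [e_first], and zero at that node. *)
Let e_inner r i : 0 < r -> r < a i -> e r = 0.
Proof.
move=> r0 ri; have [/existsP[j /eqP <-]|/existsPn nr] := boolP [exists j, a j == r]; first exact: e_node.
have [[u ru umin]|hu] := upper r; last by move: (hu i); rewrite leNgt ri.
have /andP[u0 u1] := a01 u.
have [[l lr lmax]|hl] := lower r0.
  have /andP[l0 l1] := a01 l; have lu := lt_trans lr ru.
  have [j|A [B AB]] := e_gap (ltW l0) lu (ltW u1).
    apply/negP => /andP[lj ju]; have [jr|rj|e'] := ltgtP (a j) r.
    - by have := lmax _ jr; rewrite leNgt lj.
    - by have := umin _ rj; rewrite leNgt ju.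
    - by have := nr j; rewrite e' eqxx.
  have el := e_left l0 lu (ltW u1) AB; have eu := e_right (ltW l0) lu u1 AB.
  rewrite e_node in el; rewrite e_node in eu.
  have d : ln (a l)^-1 - ln (a u)^-1 != 0.
    by rewrite subr_eq0 gt_eqF// ltr_ln ?posrE ?invr_gt0// ltf_pV2 ?posrE.
  have B0 : B = 0.
    by apply: (mulIf d); rewrite mul0r mulrBr -[RHS](subrr 0) {1}el {1}eu; ring.
  by rewrite B0 mul0r addr0 in el; rewrite AB ?lr// B0 mul0r addr0 -el.
have [j|A [B AB]] := e_gap (lexx 0) u0 (ltW u1).
  apply/negP => /andP[lj ju]; have [jr|rj|e'] := ltgtP (a j) r.
  - by have := hl j; rewrite leNgt jr.
  - by have := umin _ rj; rewrite leNgt ju.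
  - by have := nr j; rewrite e' eqxx.
have B0 := e_first u0 (ltW u1) AB.
have eu := e_right (lexx 0) u0 u1 AB; rewrite e_node in eu.
by rewrite B0 mul0r addr0 in eu; rewrite AB ?r0// B0 mul0r addr0 -eu.
Qed.

Let e0 : e 0 = 0.
Proof.
have /andP[u0 u1] := a01 i0.
apply: (agree_right u0 _ (@cst_continuous _ _ (0 : R) 0)).
  by apply: e_continuous; rewrite normr0.
by move=> t /andP[t0 tu]; exact: e_inner t0 tu.
Qed.

(** Continuity and the nodes leave only the outermost annulus, where one condition is missing: the
    boundary value. It is supplied by membership in [H10]. *)
Lemma tower_unique r : 0 <= r < 1 -> h r = tlog m b (r ^+ 2).
Proof.
suff E : forall r, 0 <= r < 1 -> e r = 0.
  move=> r01; have := E _ r01; have /andP[r0 _] := r01; rewrite /e ger0_norm//.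
  by move/eqP; rewrite subr_eq0 => /eqP.
have [i ai1 imax] : exists2 i, a i < 1 & forall j, a j <= a i.
  have [[i ? H]|/(_ i0)] := lower ltr01; last by rewrite leNgt; case/andP: (a01 i0) => _ ->.
  by exists i => // j; apply: H; case/andP: (a01 j).
have /andP[l0 l1] := a01 i.
have [j|A [B AB]] := e_gap (ltW l0) l1 (lexx 1); first by rewrite ltNge imax.
have el := e_left l0 l1 (lexx 1) AB; rewrite e_node in el.
(* A difference of towers is therefore a multiple of b i minus the capped logarithm with kink at the
   outermost node. *)
have eE s : 0 <= s < 1 -> e s = - (B / 2) * (b i - capped_log (b i) (s ^+ 2)).
  move=> /andP[s0 s1]; move: s0; rewrite le_eqVlt => /predU1P[<-|s0].
    rewrite e0 expr0n/= /capped_log max_r ?expR_ge0// expRK opprK subrr mulr0//.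
  rewrite capped_logE ?exprn_gt0// ln_sqr//; have [si|is_|->] := ltgtP s (a i).
  - by rewrite (e_inner s0 si) min_r ?subrr ?mulr0// lerN2 ler_pM2l// ler_ln ?posrE// ltW.
  - rewrite min_l; last by rewrite lerN2 ler_pM2l// ler_ln ?posrE// ltW.
    rewrite AB ?is_//; move: el; rewrite !lnV ?posrE// => el.
    by rewrite -[LHS]subr0 {1}el; field.
  - by rewrite e_node minxx subrr mulr0.
suff B0 : B = 0 by move=> t t01; rewrite eE// B0 mul0r oppr0 mul0r.
apply/eqP/negP => /negP B0.
have hh : H10 (radial h) by case: hT.
have ht : H10 (fun x => tlog m b (sqn x)) by have [_ []] := H10_tlog m (ins_b insc).
have hc : H10 (fun x => capped_log (b i) (sqn x)) by have [_ []] := H10_capped_log (ins_b insc i).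
(* If B were nonzero, this combination of elements of [H10] would be the positive constant b i,
   against [H10_cst]. *)
have [hK _ _] := H10gradD (H10_H10grad hc)
  (H10gradZ (- (2 / B)) (H10gradB (H10_H10grad hh) (H10_H10grad ht))).
have /H10_cst : H10 (cst (b i) : R * R -> R).
  apply: H10_eq hK => x dx.
  have x1 : 0 <= enorm x < 1 by rewrite sqrtr_ge0.
  have := eE _ x1; rewrite /e ger0_norm ?(andP x1).1// enormE sqr_sqrtr ?sqn_ge0// /radial enormE => ->.
  by rewrite /cst; field.
by move/eqP; rewrite gt_eqF//; exact: ins_b insc i.
Qed.

End Uniqueness.

Lemma towerE n (a m : 'I_n -> R) r : (0 < n)%N -> (forall i, 0 < a i < 1) ->
  inscribed m (fun i => - (2 * ln (a i))) -> 0 <= r < 1 ->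
  tower (range a) r = tlog m (fun i => - (2 * ln (a i))) (r ^+ 2).
Proof.
move=> n0 a01 insc r01; apply: (tower_unique (Ordinal n0) a01 insc _ r01).
by rewrite /tower; case: xgetP => [y ->//|/(_ _ (tower_isP a01 insc))].
Qed.

End Towers.

(** * Energy levels of towers *)

Section TowerEnergy.
Context {R : realType}.

Lemma enorm_disk (x : R * R) : disk x -> 0 <= enorm x < 1.
Proof. by move=> dx; rewrite sqrtr_ge0. Qed.

Lemma tower_H10grad n (a m : 'I_n -> R) : (0 < n)%N -> (forall i, 0 < a i < 1) ->
  inscribed m (fun i => - (2 * ln (a i))) ->
  H10grad (radial (tower (range a)))
    (fun x => dtlog m (fun i => - (2 * ln (a i))) (sqn x) * (2 * x.1))
    (fun x => dtlog m (fun i => - (2 * ln (a i))) (sqn x) * (2 * x.2)).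
Proof.
move=> n0 a01 insc; apply: (H10grad_eq (H10_tlog m (ins_b insc)).2) => // x dx.
by rewrite /radial (towerE n0 a01 insc (enorm_disk dx)) enormE sqr_sqrtr// sqn_ge0.
Qed.

Lemma tower_energy n (a m : 'I_n -> R) : (0 < n)%N -> (forall i, 0 < a i < 1) ->
  inscribed m (fun i => - (2 * ln (a i))) ->
  grad_norm (radial (tower (range a))) ^+ 2 =
  4 * pi * \sum_i m i * polygon m (fun i => - (2 * ln (a i))) (- (2 * ln (a i))).
Proof.
move=> n0 a01 insc; have [i e] := IL_dtlog m (ins_b insc).
rewrite (grad_norm_sq (tower_H10grad n0 a01 insc)) -e -(I_radial_grad i).
by apply: I_eq => x _; ring.
Qed.

(** With heights in ratio q the first segment contributes 1 to 4 pi times the energy sum, and every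
    further one contributes (q - 1) / (q + 1), which takes all values in ]0, 1[. *)
Lemma exists_tower_energy n (c : R) : 1 / 2 < c < n%:R / 2 ->
  exists a : 'I_n -> R, [/\ forall i, 0 < a i < 1,
    forall i j : 'I_n, (i < j)%N -> a i < a j &
    grad_norm (radial (tower (range a))) ^+ 2 / 2 = c].
Proof.
move=> /andP[c1 cn].
have n1 : (1 < n)%N by rewrite -(ltr_nat R); move: (n%:R : R) cn => z cn; lra.
case: n n1 cn => [//|n] n1 cn; have n0 : 0 < n%:R :> R by rewrite ltr0n.
rewrite -natr1 in cn.
(* There are now n + 1 nodes, so the level is (1 + n th) / 2; this [th] solves for c, and the bounds
   on c put it in ]0, 1[. *)
pose th := (2 * c - 1) / n%:R.
have th0 : 0 < th by rewrite divr_gt0//; lra.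
have th1 : th < 1 by rewrite ltr_pdivrMr//; move: (n%:R : R) cn => z cn; lra.
(* The solution of (q - 1) / (q + 1) = th. *)
pose q := (1 + th) / (1 - th).
have d0 : 0 < 1 - th by rewrite subr_gt0.
have q1 : 1 < q by rewrite ltr_pdivlMr//; lra.
have q0 : 0 < q := lt_trans ltr01 q1.
have qth : (q - 1) / (q + 1) = th.
  have e1 : q + 1 = 2 / (1 - th) by rewrite /q; field; rewrite gt_eqF.
  by rewrite e1 /q; field; rewrite gt_eqF.
(* Chosen so that - 2 ln (a i) = (q^(n-i))^2, the abscissa of the node of relative height
   q^(n-i). *)
pose a (i : 'I_n.+1) := expR (- ((q ^+ (n - i)) ^+ 2 / 2)).
have lna i : - (2 * ln (a i)) = (q ^+ (n - i)) ^+ 2 by rewrite expRK; field.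
have a01 i : 0 < a i < 1.
  by rewrite expR_gt0 expR_lt1 oppr_lt0 divr_gt0// !exprn_gt0.
have amono (i j : 'I_n.+1) : (i < j)%N -> a i < a j.
  move=> ij; rewrite ltr_expR ltrN2 ltr_pM2r ?invr_gt0// ltr_pXn2r ?nnegrE ?exprn_ge0 ?ltW//.
  by rewrite ltr_eXn2l// ltn_sub2l// (leq_trans ij)// -ltnS.
exists a; split => //.
have [m insc [p [p0 pE sE]]] := exists_inscribed a01 amono.
rewrite (tower_energy (ltn0Sn n) a01 insc) sE.
(* The outermost radius; its height k satisfies 4 pi k^2 = 1 and is the unit of the progression. *)
have ek : 0 < expR (- (1 / 2) : R) < 1 by rewrite expR_gt0 expR_lt1 oppr_lt0 divr_gt0.
have [k0 kE] := tower_profile_sq ek; set k := tower_profile _ in k0 kE.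
rewrite expRK in kE.
have pj (j : nat) : (j < n.+1)%N -> p j.+1 = q ^+ j * k.
  move=> jn; have := pE (rev_ord (Ordinal jn)); rewrite /= subKn// => ->.
  have [t0 tE] := tower_profile_sq (a01 (rev_ord (Ordinal jn))).
  rewrite lna /= subSS subKn// in tE.
  have pi4 : 4 * pi != 0 :> R by rewrite mulf_neq0// gt_eqF// pi_gt0.
  have : 4 * pi * tower_profile (a (rev_ord (Ordinal jn))) ^+ 2 = 4 * pi * (q ^+ j * k) ^+ 2.
    rewrite tE; transitivity ((q ^+ j) ^+ 2 * (4 * pi * k ^+ 2)); first by rewrite kE; field.
    by move: (pi : R) (q ^+ j) => z y; ring.
  move/(mulfI pi4)/eqP; rewrite eqrXn2 ?(ltW t0)// => [/eqP//|].
  by rewrite mulr_ge0 ?exprn_ge0 ?ltW.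
have pi0 : pi != 0 :> R by rewrite gt_eqF// pi_gt0.
have kn : k != 0 by rewrite gt_eqF.
have s0 : slope p n.+1 0 * (p 1%N - p 0%N) = (4 * pi)^-1.
  rewrite /slope ltn0Sn p0 pj// expr0 mul1r add0r subr0; move: (pi : R) pi0 => z z0; field.
  by rewrite kn z0.
have sj (j : nat) : (j < n)%N -> slope p n.+1 j.+1 * (p j.+2 - p j.+1) = (4 * pi)^-1 * th.
  move=> jn; rewrite /slope ltnS jn !pj ?ltnS// ?(ltnW jn)// -qth exprS.
  have qj : q ^+ j != 0 by rewrite gt_eqF// exprn_gt0.
  have qq : q + 1 != 0 by rewrite gt_eqF// addr_gt0.
  have qq' : q ^+ j * k + q * q ^+ j * k = q ^+ j * k * (q + 1) by ring.
  rewrite qq'; move: (pi : R) (q ^+ j) qj pi0 => z y y0 z0; field.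
  by rewrite z0 qq kn y0.
rewrite big_nat_recl// s0 (eq_big_nat _ _ (F2 := fun=> (4 * pi)^-1 * th)).
  rewrite sumr_const_nat subn0 -[_ *+ n]mulr_natl /th; move: (pi : R) (n%:R : R) pi0 n0 => z y z0 y0; field.
  by rewrite z0 gt_eqF.
by move=> j /andP[_ jn]; exact: sj.
Qed.

End TowerEnergy.

(** * The nonlinearity and its energy *)

Lemma add_le_mul (R : realType) (x y : R) : 0 <= x -> 1 <= y -> 2 * x + 2 * y <= (2 * x + 2) * y.
Proof. nra. Qed.

Lemma sqrD_le (R : realType) (x y z : R) : x ^+ 2 <= z -> (x + y) ^+ 2 <= 2 * z + 2 * y ^+ 2.
Proof. have := sqr_ge0 (x - y); nra. Qed.

Lemma sum3_le (R : realType) (x y z w l1 l2 l3 l4 : R) : x <= l1 * w -> y <= l2 * w -> z <= l3 * w -> 0 <= l4 * w ->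
  x + y + z <= (l4 + l1 + l2 + l3) * w.
Proof. lra. Qed.

Section Growth.
Context {R : realType}.
Variable f : R -> R.
Hypotheses (fC1 : C1 f) (f0 : f 0 = 0) (fcrit : critical_growth f).
Implicit Types (t u v B K : R).

Lemma f_derive t : is_derive t 1 f (derive1 f t).
Proof. by rewrite derive1E; apply: derivableP; exact: fC1.1. Qed.

Lemma f_continuous : continuous f.
Proof. by move=> t; exact: is_derive_continuous (f_derive t). Qed.

Lemma f_lipschitz B : exists2 L, 0 < L & forall s t, `|s| <= B -> `|t| <= B -> `|f s - f t| <= L * `|s - t|.
Proof.
have [L L0 HL] := continuous_bounded (- B) B fC1.2; exists L => // s t sB tB.
apply: MVT_le f_derive _ => x /andP[x1 x2]; apply: HL.
move: sB tB; rewrite !ler_norml => /andP[s1 s2] /andP[t1 t2].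
apply/andP; split; first by apply: le_trans x1; rewrite le_min t1.
by apply: le_trans x2 _; rewrite ge_max t2.
Qed.

Lemma near_pinfty_ge (A : R -> Prop) : (\forall t \near +oo, A t) -> exists2 T : R, 0 < T & forall t, T <= t -> A t.
Proof.
move=> [M [_ HM]]; exists (`|M| + 1); first by rewrite ltr_wpDl.
move=> t Mt; apply: HM; apply: le_lt_trans (ler_norm M) _; apply: lt_le_trans Mt.
by rewrite ltrDl.
Qed.

Lemma near_ninfty_le (A : R -> Prop) : (\forall t \near -oo, A t) -> exists2 T : R, 0 < T & forall t, t <= - T -> A t.
Proof.
move=> [M [_ HM]]; exists (`|M| + 1); first by rewrite ltr_wpDl.
move=> t Mt; apply: HM; apply: le_lt_trans Mt _; rewrite ltrNl.
by apply: le_lt_trans (ler_norm (- M)) _; rewrite normrN ltrDl.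
Qed.

(** For large |t| this is critical growth with d = K - 4 pi. On a bounded interval the Lipschitz
    bound together with f 0 = 0 supplies the factor |t|. *)
Lemma f_growth K : 4 * pi < K -> exists2 C, 0 < C & forall t, `|f t| <= C * `|t| * expR (K * t ^+ 2).
Proof.
move=> Kpi; have d0 : 0 < K - 4 * pi by rewrite subr_gt0.
have [gp gn] := fcrit d0.
have n1 : \forall t \near +oo, `|g_of f t * expR (- ((K - 4 * pi) * t ^+ 2))| < 1.
  by move/cvgrPdist_lt: gp => /(_ 1 ltr01); apply: filterS => t; rewrite sub0r normrN.
have n2 : \forall t \near -oo, `|g_of f t * expR (- ((K - 4 * pi) * t ^+ 2))| < 1.
  by move/cvgrPdist_lt: gn => /(_ 1 ltr01); apply: filterS => t; rewrite sub0r normrN.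
have [T1 T10 H1] := near_pinfty_ge n1; have [T2 T20 H2] := near_ninfty_le n2.
have pi0 : 0 < 8 * pi :> R by rewrite mulr_gt0// pi_gt0.
have big t : `|g_of f t * expR (- ((K - 4 * pi) * t ^+ 2))| < 1 -> `|f t| <= 8 * pi * expR (K * t ^+ 2).
  have -> : g_of f t * expR (- ((K - 4 * pi) * t ^+ 2)) = f t / (8 * pi) * expR (- (K * t ^+ 2)).
    rewrite /g_of -[LHS]mulrA -expRD; congr (_ * expR _).
    by move: (pi : R) => z; ring.
  rewrite normrM (gtr0_norm (expR_gt0 _)) expRN -ltr_pdivlMr ?invr_gt0 ?expR_gt0// invrK mul1r.
  rewrite normrM normfV (gtr0_norm pi0) ltr_pdivrMr// => /ltW.
  by rewrite mulrC.
pose T := T1 + T2 + 1; have T0 : 0 < T by rewrite !addr_gt0.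
have [L L0 HL] := f_lipschitz T.
exists (L + 8 * pi); first by rewrite addr_gt0.
move=> t; have e0 := expR_gt0 (K * t ^+ 2).
have K0 : 0 < K by apply: lt_trans Kpi; rewrite mulr_gt0// pi_gt0.
have e1 : 1 <= expR (K * t ^+ 2) by rewrite -expR0 ler_expR mulr_ge0 ?sqr_ge0// ltW.
have [tT|Tt] := leP `|t| T.
  have := HL t 0 tT; rewrite normr0 f0 !subr0 => /(_ (ltW T0)) h.
  apply: (le_trans h); rewrite -mulrA.
  have h2 : `|t| <= `|t| * expR (K * t ^+ 2) by rewrite ler_peMr.
  apply: ler_pM => //; [exact: ltW|by rewrite lerDl ltW].
have t1 : 1 <= `|t| by apply: le_trans (ltW Tt); rewrite lerDr addr_ge0// ltW.
have h : `|f t| <= 8 * pi * expR (K * t ^+ 2).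
  apply: big; have [t0|t0] := leP 0 t.
    apply: H1; rewrite ger0_norm// in Tt; apply: le_trans (ltW Tt).
    by rewrite /T -addrA lerDl addr_ge0// ltW.
  apply: H2; rewrite ltr0_norm// in Tt; rewrite lerNr; apply: le_trans (ltW Tt).
  by rewrite /T -addrA addrCA lerDl addr_ge0// ltW.
apply: (le_trans h); rewrite ler_pM2r// -[leLHS]mulr1.
by apply: ler_pM => //; [exact: ltW|rewrite lerDr ltW].
Qed.

Lemma F_derive t : is_derive t 1 (primitive f) (f t).
Proof. by apply: is_derive_primitive; exact: f_continuous. Qed.

Lemma F_bound K C : (forall t, `|f t| <= C * `|t| * expR (K * t ^+ 2)) -> 0 <= K -> 0 < C ->
  forall t, `|primitive f t| <= C * t ^+ 2 * expR (K * t ^+ 2).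
Proof.
move=> H K0 C0 t; have := @MVT_le _ (primitive f) f (C * `|t| * expR (K * t ^+ 2)) 0 t F_derive.
rewrite primitive0 !subr0 => h; apply: le_trans (h _) _; last first.
  by rewrite le_eqVlt; apply/orP; left; apply/eqP; rewrite -(real_normK (num_real t)); ring.
move=> x /andP[x1 x2]; have xt : `|x| <= `|t|.
  rewrite ler_norml; apply/andP; split.
    apply: le_trans x1; rewrite le_min oppr_le0 normr_ge0 /= lerNl -normrN; exact: ler_norm.
  by apply: le_trans x2 _; rewrite ge_max normr_ge0 ler_norm.
apply: le_trans (H x) _; apply: ler_pM; rewrite ?(ltW (expR_gt0 _))// ?mulr_ge0// ?(ltW C0)//.
  by rewrite ler_wpM2l// ltW.
by rewrite ler_expR ler_wpM2l// -[x ^+ 2]real_normK ?num_real// -[t ^+ 2]real_normK ?num_real// lerXn2r ?nnegrE.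
Qed.

(** The increment v is unbounded, so a plain Taylor bound does not suffice. For |v| <= 1 the
    remainder has derivative f (u + s) - f u, which is Lipschitz; for |v| > 1 the three terms are
    bounded one by one, v^2 >= 1 absorbing constants. The exponent 2 k comes from (u + v)^2 <= 2 u^2
    + 2 v^2. *)
Lemma F_taylor B : exists C K, [/\ 0 < C, 0 < K & forall u v, `|u| <= B ->
  `|primitive f (u + v) - primitive f u - f u * v| <= C * (v ^+ 2 * expR (K * v ^+ 2))].
Proof.
have pi0 := pi_gt0 R.
have [C0 C00 HC] := @f_growth (4 * pi + 1) ltac:(by rewrite ltrDl).
have K0 : 0 < 4 * pi + 1 :> R by rewrite addr_gt0// mulr_gt0.
move: (4 * pi + 1) K0 HC => k k0 HC; have HF := F_bound HC (ltW k0) C00.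
have [L L0 HL] := f_lipschitz (B + 1).
pose C1 := C0 * (2 * B ^+ 2 + 2) * expR (2 * k * B ^+ 2).
pose C2 := C0 * B ^+ 2 * expR (k * B ^+ 2); pose C3 := C0 * `|B| * expR (k * B ^+ 2).
have B22 : 0 <= 2 * B ^+ 2 + 2 by rewrite addr_ge0// mulr_ge0// sqr_ge0.
have C10 : 0 <= C1 by rewrite /C1 mulr_ge0 ?(ltW (expR_gt0 _))// mulr_ge0// ltW.
have C20 : 0 <= C2 by rewrite /C2 mulr_ge0 ?(ltW (expR_gt0 _))// mulr_ge0 ?sqr_ge0// ltW.
have C30 : 0 <= C3 by rewrite /C3 mulr_ge0 ?(ltW (expR_gt0 _))// mulr_ge0// ltW.
exists (L + C1 + C2 + C3), (2 * k); split; [by rewrite !ltr_wpDr|by rewrite mulr_gt0|].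
move=> u v uB.
have B0 : 0 <= B by exact: le_trans uB.
have k20 : 0 <= 2 * k by rewrite mulr_ge0// ltW.
have e1 : 1 <= expR (2 * k * v ^+ 2) by rewrite -[leLHS]expR0 ler_expR mulr_ge0// sqr_ge0.
have uB2 : u ^+ 2 <= B ^+ 2.
  by rewrite -(real_normK (num_real u)) lerXn2r ?nnegrE.
have v20 := sqr_ge0 v.
have ve : v ^+ 2 <= v ^+ 2 * expR (2 * k * v ^+ 2) by rewrite ler_peMr.
have [v1|v1] := leP `|v| 1.
  have D s : is_derive s (1 : R) (fun s => primitive f (u + s) - primitive f u - f u * s) (f (u + s) - f u).
    have h1 : is_derive s (1 : R) (fun s => primitive f (u + s)) (f (u + s)).
      rewrite -[f (u + s)]mul1r.
      have E : (fun s => primitive f (u + s)) = (fun s => primitive f (1 * s + u)).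
        by apply/funext => z; rewrite mul1r addrC.
      rewrite E; apply: is_derive_affine; rewrite mul1r addrC; exact: F_derive.
    have h2 : is_derive s (1 : R) (fun s => f u * s) (f u).
      rewrite -[X in is_derive _ _ _ X]mulr1; apply: is_deriveZ.
    rewrite -[f (u + s) - f u]/(f (u + s) - f u) -[f (u + s)]subr0.
    by apply: is_deriveB.
  have := @MVT_le _ _ _ (L * `|v|) 0 v D; rewrite addr0 subrr mulr0 !subr0 => h.
  apply: le_trans (h _) _.
    move=> x /andP[x1 x2]; have xv : `|x| <= `|v|.
      rewrite ler_norml; apply/andP; split.
        apply: le_trans x1; rewrite le_min oppr_le0 normr_ge0 /= lerNl -normrN; exact: ler_norm.
      by apply: le_trans x2 _; rewrite ge_max normr_ge0 ler_norm.
    apply: le_trans (HL _ _ _ _) _.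
    - by apply: le_trans (ler_normD _ _) _; rewrite lerD// (le_trans xv).
    - by rewrite (le_trans uB)// lerDl.
    - by rewrite addrAC subrr add0r ler_wpM2l// ltW.
  have -> : L * `|v| * `|v| = L * v ^+ 2 by rewrite -(real_normK (num_real v)) expr2 mulrA.
  apply: ler_pM => //; first exact: ltW.
  by rewrite -!addrA lerDl !addr_ge0.
have v21 : 1 <= v ^+ 2 by rewrite -(real_normK (num_real v)) expr_ge1// ltW.
have b1 : `|primitive f (u + v)| <= C1 * (v ^+ 2 * expR (2 * k * v ^+ 2)).
  apply: le_trans (HF _) _.
  have s2 : (u + v) ^+ 2 <= 2 * B ^+ 2 + 2 * v ^+ 2.
    exact: sqrD_le uB2.
  have -> : C1 * (v ^+ 2 * expR (2 * k * v ^+ 2)) =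
     C0 * ((2 * B ^+ 2 + 2) * v ^+ 2) * (expR (2 * k * B ^+ 2) * expR (2 * k * v ^+ 2)).
    by rewrite /C1; ring.
  rewrite -expRD; apply: ler_pM; [exact: mulr_ge0 (ltW C00) (sqr_ge0 _)|exact: expR_ge0|..].
    by rewrite ler_pM2l//; apply: (le_trans s2); exact: add_le_mul (sqr_ge0 B) v21.
  rewrite ler_expR (_ : 2 * k * B ^+ 2 + 2 * k * v ^+ 2 = k * (2 * B ^+ 2 + 2 * v ^+ 2)); last by ring.
  by rewrite ler_pM2l.
have b2 : `|primitive f u| <= C2 * (v ^+ 2 * expR (2 * k * v ^+ 2)).
  apply: le_trans (HF _) _.
  apply: (@le_trans _ _ C2); last by rewrite ler_peMr// (le_trans v21).
  rewrite /C2; apply: ler_pM; [exact: mulr_ge0 (ltW C00) (sqr_ge0 _)|exact: expR_ge0|..].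
    by rewrite ler_pM2l.
  by rewrite ler_expR ler_pM2l.
have b3 : `|f u * v| <= C3 * (v ^+ 2 * expR (2 * k * v ^+ 2)).
  rewrite normrM; apply: ler_pM => //.
    apply: le_trans (HC _) _; apply: ler_pM; [exact: mulr_ge0 (ltW C00) (normr_ge0 _)|exact: expR_ge0|..].
      by rewrite ler_pM2l// (ger0_norm B0).
    by rewrite ler_expR ler_pM2l.
  by apply: le_trans (ve); rewrite -(real_normK (num_real v)) expr2 ler_peMr// ltW.
apply: le_trans (ler_normB _ _) _; apply: (le_trans (lerD (ler_normB _ _) (lexx _))).
exact: sum3_le b1 b2 b3 (mulr_ge0 (ltW L0) (le_trans v20 ve)).
Qed.

Lemma f_lower : cond_g1 f -> exists T c, [/\ 0 < T, 0 < c & forall t, T <= t -> c * expR (4 * pi * t ^+ 2) <= f t].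
Proof.
move=> [T T0 [Hinf _]]; set A := [set g_of f t | t in _] in Hinf.
(* A set without infimum gets the default value 0, which contradicts positivity. *)
have hA : has_inf A by apply: contrapT => /inf_out e; rewrite e ltxx in Hinf.
have pi0 : 0 < 8 * pi :> R by rewrite mulr_gt0// pi_gt0.
exists T, (inf A * (8 * pi)); split; [exact: T0|exact: mulr_gt0|move=> t Tt].
have : inf A <= g_of f t by apply: ge_inf; [exact: hA.2|exists t].
rewrite /g_of expRN ler_pdivlMr ?expR_gt0// ler_pdivlMr//.
by rewrite mulrAC.
Qed.

(** For large t this is (g2), with f positive by (g1); on the remaining bounded interval F is at
    most a multiple of t^2. *)
Lemma F_le_fg rho : cond_g1 f -> cond_g2 f -> 0 < rho ->
  exists2 C, 0 < C & forall t, 0 <= t -> `|primitive f t| <= rho * (`|f t| * t) + C * t ^+ 2.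
Proof.
move=> g1 [g2 _] rho0; have [T1 [c [T10 c0 Hc]]] := f_lower g1.
have n1 : \forall t \near +oo, `|primitive f t / (f t * t)| < rho.
  by move/cvgrPdist_lt: g2 => /(_ rho rho0); apply: filterS => t; rewrite sub0r normrN.
have [T2 T20 H2] := near_pinfty_ge n1.
have pi0 := pi_gt0 R.
have [C0 C00 HC] := @f_growth (4 * pi + 1) ltac:(by rewrite ltrDl).
have K0 : 0 < 4 * pi + 1 :> R by rewrite addr_gt0// mulr_gt0.
move: (4 * pi + 1) K0 HC => k k0 HC; have HF := F_bound HC (ltW k0) C00.
pose T := T1 + T2; exists (C0 * expR (k * T ^+ 2)); first by rewrite mulr_gt0// expR_gt0.
move=> t t0; have [tT|Tt] := leP t T.
  apply: le_trans (HF t) _; rewrite -[leLHS]add0r; apply: lerD.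
    by rewrite !mulr_ge0// ltW.
  rewrite mulrAC ler_wpM2r ?sqr_ge0// ler_pM2l// ler_expR ler_pM2l// lerXn2r ?nnegrE//.
  by rewrite addr_ge0// ltW.
have t1 : T1 <= t by apply: le_trans (ltW Tt); rewrite lerDl ltW.
have t2 : T2 <= t by apply: le_trans (ltW Tt); rewrite lerDr ltW.
have tp : 0 < t := lt_le_trans T10 t1.
have fp : 0 < f t by apply: lt_le_trans (Hc t t1); rewrite mulr_gt0// expR_gt0.
have := H2 t t2; rewrite normrM normfV [`|f t * t|]normrM (gtr0_norm tp) ltr_pdivrMr; last first.
  by rewrite mulr_gt0// gtr0_norm.
move=> /ltW /le_trans; apply; rewrite lerDl !mulr_ge0 ?sqr_ge0 ?(ltW (expR_gt0 _))//; exact: ltW.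
Qed.

End Growth.

(** * Frechet differentiability of [J] at bounded functions *)

Section Frechet.
Context {R : realType}.
Local Notation mu2 := ((@lebesgue_measure R \x @lebesgue_measure R)%E).
Local Notation mR := (measurableTypeR R).
Local Notation P := (measurableTypeR R * measurableTypeR R)%type.
Local Notation mf2 := (@measurable_fun _ _ (measurableTypeR R * measurableTypeR R)%type R).
Local Notation I u := (Rintegral mu2 disk u).
Local Notation Int u := (mu2.-integrable disk (EFin \o u)).
Variable f : R -> R.
Hypotheses (fC1 : C1 f) (f0 : f 0 = 0) (fcrit : critical_growth f).
Implicit Types (u v z : R * R -> R).

Lemma mf_comp_continuous (g : R -> R) u : continuous g -> mf2 disk u -> mf2 disk (fun x => g (u x)).
Proof.
move=> cg mu'; apply: (@measurable_comp _ _ _ P mR R setT g disk u) => //.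
exact: continuous_measurable_fun.
Qed.

Lemma grad_norm_ge0 v : 0 <= grad_norm v.
Proof. exact: sqrtr_ge0. Qed.

(** The remainder in [F_taylor] is exactly of the form integrated by [trudinger], provided the
    gradient of v is small. *)
Lemma J_taylor u (B : R) : H10 u -> (forall x, disk x -> `|u x| <= B) ->
  exists C d : R, [/\ 0 < C, 0 < d & forall v, H10 v -> grad_norm v ^+ 2 < d ->
    [/\ Int (fun x => primitive f (u x)), Int (fun x => primitive f (u x + v x)) &
    `|I (fun x => primitive f (u x + v x)) - I (fun x => primitive f (u x)) - I (fun x => f (u x) * v x)|
      <= C * grad_norm v ^+ 2]].
Proof.
move=> hu uB; have [C [K [C0 K0 HCK]]] := F_taylor fC1 f0 fcrit B.
have cf := f_continuous fC1.
have cF : continuous (primitive f) by move=> t; exact: is_derive_continuous (F_derive fC1 t).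
have Lu := H10_L2 hu; have mu' := L2_mf Lu.
have Lf : L2 (fun x => f (u x)).
  have [M M0 HM] := continuous_bounded (- B) B cf.
  apply: (@L2_bounded _ _ M); first exact: mf_comp_continuous.
  by move=> x dx; apply: HM; rewrite -ler_norml; exact: uB.
have iF : Int (fun x => primitive f (u x)).
  have [M M0 HM] := continuous_bounded (- B) B cF.
  apply: (@bounded_integrable_disk _ _ M); first exact: mf_comp_continuous.
  by move=> x dx; apply: HM; rewrite -ler_norml; exact: uB.
(* Any E <= 2 d then satisfies the smallness condition 128 K E <= 1 of [trudinger]. *)
pose d := (256 * K)^-1; have d0 : 0 < d by rewrite invr_gt0; apply: mulr_gt0 => //; rewrite ltr0n.
have p0 : 0 < 768 * pi :> R by apply: mulr_gt0; [rewrite ltr0n|exact: pi_gt0].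
exists (C * (768 * pi)), d; split; [exact: mulr_gt0 C0 p0|exact: d0|].
move=> v hv vd; have Lv := H10_L2 hv.
have gv := H10_H10grad hv; have gE := grad_norm_sq gv.
have key (E : R) : grad_norm v ^+ 2 < E -> E <= 2 * d ->
    Int (fun x => v x ^+ 2 * expR (K * v x ^+ 2)) /\
    I (fun x => v x ^+ 2 * expR (K * v x ^+ 2)) <= 768 * pi * E.
  move=> vE Ed; apply: (trudinger gv _ (ltW K0)); first by rewrite -gE.
  apply: (@le_trans _ _ (128 * K * (2 * d))); first by rewrite ler_pM2l//; apply: mulr_gt0 => //; rewrite ltr0n.
  by rewrite /d le_eqVlt; apply/orP; left; apply/eqP; field; rewrite gt_eqF.
have d2 : d <= 2 * d by rewrite ler_peMl ?ltW// ltr1n.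
have [iE _] := key d vd d2.
have iC := IntZ C iE.
have Hx x : disk x -> `|primitive f (u x + v x) - primitive f (u x) - f (u x) * v x| <=
    C * (v x ^+ 2 * expR (K * v x ^+ 2)) by move=> dx; apply: HCK; exact: uB.
have ifv := L2M Lf Lv.
have muv : mf2 disk (fun x => u x + v x) := L2_mf (L2D Lu Lv).
have mFv : mf2 disk (fun x => primitive f (u x + v x)) by exact: (mf_comp_continuous cF muv).
have iR : Int (fun x => primitive f (u x + v x) - primitive f (u x) - f (u x) * v x).
  apply: (Int_le _ iC Hx); apply: measurable_funB; last exact: Int_mf ifv.
  by apply: measurable_funB => //; exact: Int_mf iF.
have iFv : Int (fun x => primitive f (u x + v x)).
  by apply: Int_eq (IntD (IntD iR iF) ifv) => x _; ring.
split => //.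
rewrite -(I_B iFv iF) -(I_B (IntB iFv iF) ifv).
apply: le_trans (I_norm iR) _; apply: le_trans (I_le (Int_norm iR) iC Hx) _.
rewrite (I_Z C iE) -mulrA ler_pM2l//.
rewrite -ler_pdivrMl//; apply/ler_addgt0Pr => e e0.
(* [trudinger] wants an energy bound strictly above [grad_norm v ^+ 2]; the excess is arbitrarily
   small and disappears in the limit. *)
rewrite ler_pdivrMl//; pose e' := Num.min e (d - grad_norm v ^+ 2).
have e'0 : 0 < e' by rewrite lt_min e0 subr_gt0.
have [|//|_ h] := key (grad_norm v ^+ 2 + e'); first by rewrite ltrDl.
  apply: le_trans d2; rewrite -lerBrDl /e' ge_min; apply/orP; right; exact: lexx.
apply: le_trans h _; rewrite ler_pM2l// lerD2l /e' ge_min lexx//.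
Qed.

Lemma eq_sum3 (a b c i1 i2 i3 i : R) : a = i1 -> b = i3 -> c = i ->
  i = i1 + 2 * i2 + i3 -> c = a + 2 * i2 + b.
Proof. by move=> -> -> ->. Qed.

Lemma frechet_arith (gu guv gv X Y Z G W k C eps : R) : gu + 2 * G + gv ^+ 2 = guv ->
  G - k * Z = W -> `|X - Y - Z| <= C * gv ^+ 2 -> 0 < k -> 0 <= gv -> 0 < 1 / 2 + k * C ->
  gv <= eps / (1 / 2 + k * C) ->
  `|guv / 2 - k * X - (gu / 2 - k * Y) - W| <= eps * gv.
Proof.
move=> <- <- HE k0 gv0 A0 ve.
have HE' : `|k * (X - Y - Z)| <= k * C * gv ^+ 2.
  by rewrite normrM (gtr0_norm k0) -mulrA ler_pM2l.
rewrite (_ : _ - _ = gv ^+ 2 / 2 - k * (X - Y - Z)); last by field.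
apply: le_trans (ler_normB _ _) _; rewrite ger0_norm ?divr_ge0 ?sqr_ge0//.
apply: (@le_trans _ _ ((1 / 2 + k * C) * gv ^+ 2)).
  apply: (le_trans (lerD (lexx _) HE')).
  by rewrite le_eqVlt; apply/orP; left; apply/eqP; field.
rewrite expr2 mulrA ler_wpM2r// mulrC -ler_pdivlMr//.
Qed.

Lemma grad_norm_sqD u v g1 g2 h1 h2 : H10grad u g1 g2 -> H10grad v h1 h2 ->
  grad_norm (fun x => u x + v x) ^+ 2 =
  grad_norm u ^+ 2 + 2 * I (fun x => g1 x * h1 x + g2 x * h2 x) + grad_norm v ^+ 2.
Proof.
move=> hu hv.
have [Lg1 Lg2] : L2 g1 /\ L2 g2 by case: hu => _ /is_wd_L2 ? /is_wd_L2.
have [Lh1 Lh2] : L2 h1 /\ L2 h2 by case: hv => _ /is_wd_L2 ? /is_wd_L2.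
have j1 := IntD (L2_sq Lg1) (L2_sq Lg2); have j2 := IntD (L2M Lg1 Lh1) (L2M Lg2 Lh2).
have j3 := IntD (L2_sq Lh1) (L2_sq Lh2).
have E : I (fun x => (g1 x + h1 x) ^+ 2 + (g2 x + h2 x) ^+ 2) = I (fun x => g1 x ^+ 2 + g2 x ^+ 2) +
    2 * I (fun x => g1 x * h1 x + g2 x * h2 x) + I (fun x => h1 x ^+ 2 + h2 x ^+ 2).
  rewrite -(I_Z 2 j2) -(I_D j1 (IntZ 2 j2)) -(I_D (IntD j1 (IntZ 2 j2)) j3).
  by apply: I_eq => x _; ring.
exact: (eq_sum3 (grad_norm_sq hu) (grad_norm_sq hv) (grad_norm_sq (H10gradD hu hv)) E).
Qed.

(** The hypothesis says that z represents v -> (8 pi)^-1 int f(u) v. The quadratic part of [J]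
    contributes u itself, and the rest is of second order. *)
Lemma H10_derivative_J u z (B : R) g1 g2 z1 z2 : H10grad u g1 g2 -> (forall x, disk x -> `|u x| <= B) ->
  H10grad z z1 z2 ->
  (forall v h1 h2, H10grad v h1 h2 ->
    I (fun x => z1 x * h1 x + z2 x * h2 x) = (8 * pi)^-1 * I (fun x => f (u x) * v x)) ->
  is_H10_derivative (J f) u (fun x => u x - z x).
Proof.
move=> hu uB hz weak; have hw := H10gradB hu hz.
have Hu : H10 u by case: hu.
have [C [d [C0 d0 HJ]]] := J_taylor Hu uB.
split; [exact: Hu|by case: hw|move=> eps eps0].
have p0 : 0 < (8 * pi)^-1 :> R by rewrite invr_gt0 mulr_gt0// pi_gt0.
pose A := 1 / 2 + (8 * pi)^-1 * C.
have A0 : 0 < A by rewrite addr_gt0 ?divr_gt0// mulr_gt0.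
pose d' := Num.min 1 (Num.min d (eps / A)).
have d'0 : 0 < d' by rewrite !lt_min ltr01 d0 divr_gt0.
exists d' => // v hv; rewrite !lt_min => /andP[v1 /andP[vd ve]].
have gv0 := grad_norm_ge0 v.
have v2d : grad_norm v ^+ 2 < d.
  by apply: le_lt_trans vd; rewrite expr2 ler_piMl// ltW.
have [i1 i2 HE] := HJ v hv v2d.
have gv := H10_H10grad hv; have hs := H10gradD hu gv.
move: (weak_derivative e1 v) (weak_derivative e2 v) gv hs => h1 h2 gv hs.
have Lg1 : L2 g1 by case: hu => _ /is_wd_L2.
have Lg2 : L2 g2 by case: hu => _ _ /is_wd_L2.
have Lh1 : L2 h1 by case: gv => _ /is_wd_L2.
have Lh2 : L2 h2 by case: gv => _ _ /is_wd_L2.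
have Lz1 : L2 z1 by case: hz => _ /is_wd_L2.
have Lz2 : L2 z2 by case: hz => _ _ /is_wd_L2.
have Es := grad_norm_sqD hu gv.
have Ew : grad_inner (fun x => u x - z x) v = I (fun x => g1 x * h1 x + g2 x * h2 x) - (8 * pi)^-1 * I (fun x => f (u x) * v x).
  rewrite (grad_innerE hw gv) -(weak _ _ _ gv).
  have j2 := IntD (L2M Lg1 Lh1) (L2M Lg2 Lh2); have j4 := IntD (L2M Lz1 Lh1) (L2M Lz2 Lh2).
  by rewrite -(I_B j2 j4); apply: I_eq => x _; ring.
exact: (frechet_arith (esym Es) (esym Ew) HE p0 gv0 A0 (ltW ve)).
Qed.

End Frechet.

(** * The corrected profile *)

Section Hats.
Context {R : realType}.
Implicit Types (rho c t : R).

(** A C^1 bump of height 1 at c, supported in [c - rho, c + rho]: one ramp up, followed by one ramp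
    down. *)
Definition hat rho c t : R := ramp (rho^-1 * (t - c) + 1) - ramp (rho^-1 * (t - c)).

Definition dhat rho c t : R :=
  rho^-1 * dramp (rho^-1 * (t - c) + 1) - rho^-1 * dramp (rho^-1 * (t - c)).

Lemma is_derive_hat rho c t : is_derive t 1 (hat rho c) (dhat rho c t).
Proof.
have h (k d : R) (x : R) : is_derive x 1 (fun t => ramp (k * t + d)) (k * dramp (k * x + d)).
  by apply: is_derive_affine; exact: is_derive_ramp.
have -> : hat rho c = (fun t => ramp (rho^-1 * t + (1 - rho^-1 * c)) - ramp (rho^-1 * t + (- (rho^-1 * c)))).
  by apply/funext => x; rewrite /hat; congr (ramp _ - ramp _); ring.
have -> : dhat rho c t = rho^-1 * dramp (rho^-1 * t + (1 - rho^-1 * c)) - rho^-1 * dramp (rho^-1 * t + (- (rho^-1 * c))).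
  by rewrite /dhat; congr (_ * dramp _ - _ * dramp _); ring.
by apply: is_deriveB.
Qed.

Lemma continuous_dhat rho c : continuous (dhat rho c).
Proof.
have h (k d : R) : continuous (fun t => k * dramp (k * (t - c) + d)).
  move=> t; apply: (@cvgM _ R); first exact: cvg_cst.
  apply: (@continuous_comp _ _ _ (fun t : R => k * (t - c) + d) (@dramp R)); last exact: dramp_continuous.
  apply: (@cvgD _ R); last exact: cvg_cst.
  apply: (@cvgM _ R); first exact: cvg_cst.
  by apply: (@cvgB _ R); [exact: cvg_id|exact: cvg_cst].
rewrite (_ : dhat rho c = (fun t => rho^-1 * dramp (rho^-1 * (t - c) + 1) - rho^-1 * dramp (rho^-1 * (t - c) + 0))).
  by move=> t; apply: (@cvgB _ R); exact: h.
by apply/funext => t; rewrite /dhat addr0.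
Qed.

Lemma hat_out rho c t : 0 < rho -> rho <= `|t - c| -> hat rho c t = 0 /\ dhat rho c t = 0.
Proof.
move=> r0; rewrite /hat /dhat; have [tc|tc] := leP 0 (t - c).
  rewrite ger0_norm// => h; have h1 : 1 <= rho^-1 * (t - c) by rewrite mulrC ler_pdivlMr// mul1r.
  have h2 : 1 <= rho^-1 * (t - c) + 1 by rewrite lerDr (le_trans _ h1).
  by rewrite !ramp_ge1// !dramp_out ?mulr0 ?subrr//; right.
rewrite ltr0_norm// => h.
have h1 : rho^-1 * (t - c) + 1 <= 0 by rewrite -lerBrDr sub0r mulrC ler_pdivrMr// mulN1r lerNr.
have h2 : rho^-1 * (t - c) <= 0 by apply: le_trans h1; rewrite lerDl.
by rewrite !ramp_le0// !dramp_out ?mulr0 ?subrr//; left.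
Qed.

Lemma hat_bound rho c t : 0 <= hat rho c t <= 1.
Proof.
rewrite /hat; move: (rho^-1 * (t - c)) => x.
have /andP[a0 a1] := ramp_bound (x + 1); have /andP[b0 b1] := ramp_bound x.
have [x0|x0] := leP x 0; first by rewrite (ramp_le0 x0) subr0 a0.
by rewrite (@ramp_ge1 _ (x + 1)) ?lerDr ?(ltW x0)// subr_ge0 b1 gerBl.
Qed.

Lemma hat_center rho c : hat rho c c = 1.
Proof. by rewrite /hat subrr mulr0 add0r ramp_ge1// ramp_le0// subr0. Qed.

Lemma dhat_bound rho c t : 0 < rho -> `|dhat rho c t| <= 2 / rho.
Proof.
move=> r0; rewrite /dhat -mulrBr normrM gtr0_norm ?invr_gt0// mulrC.
apply: ler_wpM2r; first by rewrite invr_ge0 ltW.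
move: (rho^-1 * (t - c)) => x.
have /andP[a0 a1] := dramp_bound (x + 1); have /andP[b0 b1] := dramp_bound x.
have [x0|x0] := leP x 0; first by rewrite (@dramp_out _ x) ?subr0 ?ger0_norm//; left.
rewrite (@dramp_out _ (x + 1)) ?sub0r ?normrN ?ger0_norm//; right; rewrite lerDr; exact: ltW.
Qed.

Definition hats n rho (h b : 'I_n -> R) t : R := \sum_i h i * hat rho (b i) t.

Definition dhats n rho (h b : 'I_n -> R) t : R := \sum_i h i * dhat rho (b i) t.

Lemma is_derive_hats n rho (h b : 'I_n -> R) t : is_derive t 1 (hats rho h b) (dhats rho h b t).
Proof.
rewrite /hats /dhats; elim: n h b => [|n IH] h b.
  rewrite (_ : (fun t => \sum_i h i * hat rho (b i) t) = cst 0); last first.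
    by apply/funext => x; rewrite big_ord0.
  by rewrite big_ord0; exact: is_derive_cst.
rewrite (_ : (fun t => \sum_i h i * hat rho (b i) t) =
    (fun t => \sum_(i < n) h (widen_ord (leqnSn n) i) * hat rho (b (widen_ord (leqnSn n) i)) t +
              h ord_max * hat rho (b ord_max) t)); last first.
  by apply/funext => x; rewrite big_ord_recr.
rewrite big_ord_recr/=.
have h1 := IH (fun i => h (widen_ord (leqnSn n) i)) (fun i => b (widen_ord (leqnSn n) i)).
have h2 : is_derive t 1 (fun x => h ord_max * hat rho (b ord_max) x) (h ord_max * dhat rho (b ord_max) t).
  by apply: is_deriveZ; exact: is_derive_hat.
exact: is_deriveD h1 h2.
Qed.

Lemma continuous_dhats n rho (h b : 'I_n -> R) : continuous (dhats rho h b).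
Proof.
by apply: continuous_sum => i t; apply: (@cvgM _ R); [exact: cvg_cst|exact: continuous_dhat].
Qed.

Lemma continuous_hats n rho (h b : 'I_n -> R) : continuous (hats rho h b).
Proof. by move=> t; exact: is_derive_continuous (is_derive_hats rho h b t). Qed.

End Hats.

Lemma continuous_min_l (R : realType) (c : R) : continuous (fun t => Num.min t c).
Proof.
rewrite (_ : (fun t => Num.min t c) = (fun t => (t + c) - Num.max t c)); last first.
  by apply/funext => x; case: leP => _; ring.
move=> t; apply: (@cvgB _ R); last exact: continuous_max_l.
by apply: (@cvgD _ R); [exact: cvg_id|exact: cvg_cst].
Qed.

(** * Small perturbations of the polygonal line *)

Section Perturbation.
Context {R : realType}.
Variables (n : nat) (m b : 'I_n -> R) (i0 : 'I_n).
Hypothesis insc : inscribed m b.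
Implicit Types (rho t eps : R) (h : 'I_n -> R).

Let m0 i : 0 <= m i. Proof. exact: ltW (ins_m insc i). Qed.

Let b0 i : 0 <= b i. Proof. exact: ltW (ins_b insc i). Qed.

(** The initial slope of the line, since all jumps are still ahead at the origin and the line ends
    flat. *)
Definition kappa : R := \sum_i m i.

(** An abscissa beyond all nodes with a margin of 1: from here on the line is flat and no hat is
    felt. *)
Definition reach : R := 1 + \sum_i b i.

Lemma kappa_gt0 : 0 < kappa.
Proof.
rewrite /kappa (bigD1 i0)//=; apply: ltr_wpDr; first by apply: sumr_ge0 => i _.
exact: ins_m insc i0.
Qed.

Lemma le_reach i : b i + 1 <= reach.
Proof.
by rewrite /reach addrC lerD2l (bigD1 i)//= lerDl; apply: sumr_ge0 => j _.
Qed.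

Lemma reach_gt0 : 0 < reach.
Proof. by rewrite /reach ltr_pwDl// sumr_ge0. Qed.

Lemma polygon_ge0 t : 0 <= t -> 0 <= polygon m b t.
Proof. by move=> t0; apply: sumr_ge0 => i _; rewrite mulr_ge0// le_min t0 b0. Qed.

Lemma polygon_le t : polygon m b t <= kappa * t.
Proof.
rewrite /kappa mulr_suml; apply: ler_sum => i _.
by rewrite ler_wpM2l// ge_min lexx.
Qed.

Lemma polygon_mono s t : s <= t -> polygon m b s <= polygon m b t.
Proof.
by move=> st; apply: ler_sum => i _; rewrite ler_wpM2l// le_min !ge_min st lexx orbT.
Qed.

Lemma polygon_small t : (forall i, t <= b i) -> polygon m b t = kappa * t.
Proof. by move=> H; rewrite /kappa mulr_suml; apply: eq_bigr => i _; rewrite min_l. Qed.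

Lemma polygon_reach t : reach <= t -> polygon m b t = polygon m b reach.
Proof.
move=> H; apply: eq_bigr => i _; have := le_reach i => h.
by rewrite !min_r//; move: H h; set x := reach; move: (b i) => y; lra.
Qed.

Lemma continuous_polygon : continuous (polygon m b).
Proof.
apply: continuous_sum => i t; apply: (@cvgM _ R); [exact: cvg_cst|exact: continuous_min_l].
Qed.

(** The supports of the hats are pairwise disjoint and lie in the interval from rho to [reach]. *)
Definition well_separated rho : Prop :=
  [/\ 0 < rho, rho <= 1 / 2, forall i, 2 * rho <= b i & forall i j, i != j -> 2 * rho < `|b i - b j|].

Lemma exists_well_separated : exists2 r : R, 0 < r & forall rho, 0 < rho <= r -> well_separated rho.
Proof.
have min_pos (T : finType) (F : T -> R) : (forall x, 0 < F x) -> exists2 r, 0 < r & forall x, r <= F x.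
  move=> F0; exists (\big[Num.min/1]_(x : T) F x); last by move=> x; exact: bigmin_le_cond.
  by elim/big_ind: _ => // x y; rewrite lt_min => -> ->.
have [r1 r10 H1] := min_pos _ (fun i => b i / 2) ltac:(by move=> i; rewrite divr_gt0// (ins_b insc)).
have [|r2 r20 H2] := min_pos _ (fun ij : 'I_n * 'I_n => if ij.1 == ij.2 then 1 else `|b ij.1 - b ij.2| / 3).
  move=> [i j]/=; case: eqVneq => // ij; rewrite divr_gt0// normr_gt0 subr_eq0.
  by apply: contra_neq ij => e; exact: (ins_inj insc e).
exists (Num.min (1 / 2) (Num.min r1 r2)); first by rewrite !lt_min r10 r20 !andbT.
move=> rho /andP[rho0]; rewrite !le_min => /and3P[h0 h1 h2]; split => //.
  by move=> i; rewrite mulrC -ler_pdivlMr//; exact: le_trans h1 (H1 i).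
move=> i j ij; have := H2 (i, j); rewrite /= (negbTE ij) => h3.
have d0 : 0 < `|b i - b j|.
  by rewrite normr_gt0 subr_eq0; apply: contra_neq ij => e; exact: (ins_inj insc e).
move: (`|b i - b j|) h3 d0 => d h3 d0; lra.
Qed.

Section Fixed.
Variables (rho : R) (sep : well_separated rho).

Let r0 : 0 < rho. Proof. by case: sep. Qed.

Lemma near_node_uniq t i j : `|t - b i| <= rho -> `|t - b j| <= rho -> i = j.
Proof.
case: sep => _ _ _ H hi hj; apply/eqP/negP => /negP /H; apply/negP; rewrite -leNgt.
rewrite (_ : b i - b j = (t - b j) - (t - b i)); last by ring.
by apply: le_trans (ler_normB _ _) _; rewrite mulr_natl mulr2n lerD.
Qed.

Lemma hats_near h t i : `|t - b i| <= rho ->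
  hats rho h b t = h i * hat rho (b i) t /\ dhats rho h b t = h i * dhat rho (b i) t.
Proof.
move=> hi; have out j : j != i -> hat rho (b j) t = 0 /\ dhat rho (b j) t = 0.
  move=> ji; apply: hat_out => //; rewrite leNgt; apply: contra_neqN ji => /ltW hj.
  exact: near_node_uniq hj hi.
by split; rewrite /hats /dhats (bigD1 i)//= big1 ?addr0// => j /out[e1 e2]; rewrite ?e1 ?e2 mulr0.
Qed.

Lemma hats_far h t : (forall i, rho <= `|t - b i|) -> hats rho h b t = 0 /\ dhats rho h b t = 0.
Proof.
move=> H; split; rewrite /hats /dhats big1// => i _; have [e1 e2] := hat_out r0 (H i).
  by rewrite e1 mulr0.
by rewrite e2 mulr0.
Qed.

Lemma near_or_far t : (exists i, `|t - b i| <= rho) \/ (forall i, rho <= `|t - b i|).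
Proof.
have [/existsP[i h]|/existsPn H] := boolP [exists i, `|t - b i| <= rho]; first by left; exists i.
by right => i; have := H i; rewrite -ltNge => /ltW.
Qed.

Lemma hats_bound h eps t : 0 <= eps -> (forall i, `|h i| <= eps) ->
  `|hats rho h b t| <= eps /\ `|dhats rho h b t| <= eps * (2 / rho).
Proof.
move=> e0 he; have p0 : 0 <= eps * (2 / rho) by rewrite mulr_ge0// divr_ge0// ltW.
have [[i hi]|H] := near_or_far t; last by have [-> ->] := hats_far h H; rewrite normr0.
have [-> ->] := hats_near h hi; have /andP[c0 c1] := hat_bound rho (b i) t.
rewrite !normrM (ger0_norm c0); split; last by apply: ler_pM => //; exact: dhat_bound.
by apply: le_trans (he i); rewrite ler_piMr.
Qed.

Lemma hats_small h t : t <= rho -> hats rho h b t = 0 /\ dhats rho h b t = 0.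
Proof.
move=> tr; apply: hats_far => i; have [_ _ /(_ i) H _] := sep.
rewrite ler0_norm; move: (b i) H => y; move: r0; lra.
Qed.

Lemma hats_reach h t : reach <= t -> hats rho h b t = 0 /\ dhats rho h b t = 0.
Proof.
move=> tr; apply: hats_far => i; have [_ r1 _ _] := sep; have := le_reach i.
by move: tr; set x := reach; move: (b i) r0 => y ? ? ?; rewrite ger0_norm; lra.
Qed.

End Fixed.

End Perturbation.

(** * Exponential decay below the parabola *)

Section Rate.
Context {R : realType}.
Variables (n : nat) (m b : 'I_n -> R) (i0 : 'I_n).
Hypothesis insc : inscribed m b.
Variables (rho eps : R) (sep : well_separated b rho).
Hypotheses (eps0 : 0 < eps) (epsk : eps <= kappa m * rho / 2).
Implicit Types (t : R) (h : 'I_n -> R).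

Let r0 : 0 < rho. Proof. by case: sep. Qed.

Let k0 : 0 < kappa m. Proof. exact: kappa_gt0 i0 insc. Qed.

Let kr0 : 0 < kappa m * rho. Proof. exact: mulr_gt0. Qed.

Lemma polygon_ge_rho t : rho <= t -> kappa m * rho <= polygon m b t.
Proof.
move=> rt; apply: le_trans (polygon_mono insc rt).
suff -> : polygon m b rho = kappa m * rho by []; apply: polygon_small => i.
by have [_ _ /(_ i) h _] := sep; move: r0 h; move: (b i) => y; lra.
Qed.

Lemma near_node_ge t i : `|t - b i| <= rho -> rho <= t.
Proof.
have [_ _ /(_ i) h _] := sep; rewrite ler_norml => /andP[h1 _].
by move: h h1; move: (b i) => y; lra.
Qed.

Definition profile h t : R := polygon m b t + hats rho h b t.

Lemma continuous_profile h : continuous (profile h).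
Proof.
by move=> t; apply: (@cvgD _ R); [exact: continuous_polygon|exact: continuous_hats].
Qed.

(** Hats act only beyond rho, where the line is at least kappa rho; the bound on eps lets them take
    away at most half of it. *)
Lemma profile_bound h t : (forall i, `|h i| <= eps) -> 0 <= t ->
  [/\ 0 <= profile h t, profile h t <= 2 * kappa m * t & rho <= t -> kappa m * rho / 2 <= profile h t].
Proof.
move=> he t0; rewrite /profile; have p1 := polygon_le insc t; have p0 := polygon_ge0 insc t0.
have kt : 0 <= kappa m * t by rewrite mulr_ge0// ltW.
have [[i hi]|H] := near_or_far b rho t.
  have rt := near_node_ge hi; have p2 := polygon_ge_rho rt.
  have [bb _] := hats_bound sep t (ltW eps0) he.
  have krt : kappa m * rho <= kappa m * t by rewrite ler_pM2l.
  move: bb; rewrite ler_norml => /andP[b1 b2].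
  move: epsk kr0 p1 p0 p2 b1 b2 krt kt; rewrite -[2 * kappa m * t]mulrA.
  move: (kappa m * rho) (kappa m * t) (polygon m b t) (hats rho h b t) => kr kkt p bb *.
  by split => [||_]; lra.
have [-> _] := hats_far sep h H; rewrite addr0; split => //.
  by apply: le_trans p1 _; rewrite -mulrA ler_peMl// ler1n.
by move=> /polygon_ge_rho; apply: le_trans; rewrite ler_pdivrMr// ler_peMr ?ltW// ltr1n.
Qed.

Lemma profile_reach h t : reach b <= t -> profile h t = profile h (reach b).
Proof.
move=> rt; rewrite /profile (polygon_reach insc rt).
by rewrite (hats_reach insc sep h rt).1 (hats_reach insc sep h (lexx _)).1.
Qed.

Lemma profile_small h t : t <= rho -> profile h t = kappa m * t.
Proof.
move=> tr; rewrite /profile (hats_small sep h tr).1 addr0; apply: polygon_small => i.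
by have [_ _ /(_ i) h' _] := sep; move: r0 h' tr; move: (b i) => y; lra.
Qed.

Local Notation low := (profile (fun=> - eps)).

Lemma low_bound t : 0 <= t -> 0 <= low t <= polygon m b t.
Proof.
move=> t0; have he (i : 'I_n) : `|(fun=> - eps) i| <= eps by rewrite normrN ger0_norm// ltW.
have [-> _ _] := profile_bound he t0.
rewrite /profile gerDl /hats; apply: sumr_le0 => i _.
by have /andP[? _] := hat_bound rho (b i) t; rewrite mulNr oppr_le0 mulr_ge0// ltW.
Qed.

(** The line touches the parabola at the nodes only, and there the profile has been lowered by
    eps. *)
Lemma low_lt t : 0 < t -> 4 * pi * low t ^+ 2 < t.
Proof.
move=> t0; have /andP[l0 l1] := low_bound (ltW t0).
have pi4 : 0 < 4 * pi :> R by rewrite mulr_gt0// pi_gt0.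
have le : 4 * pi * low t ^+ 2 <= 4 * pi * polygon m b t ^+ 2.
  by rewrite ler_pM2l// lerXn2r// nnegrE// (le_trans l0).
have [/existsP[i /eqP ti]|/existsPn nt] := boolP [exists i, t == b i]; last first.
  by apply: le_lt_trans le _; apply: ins_lt => // i; exact: nt.
rewrite ti -[ltRHS](ins_node insc i) ltr_pM2l// ltr_pXn2r// ?nnegrE ?polygon_ge0 -?ti ?(ltW t0)//.
have hi : `|t - b i| <= rho by rewrite ti subrr normr0 ltW.
rewrite /profile (hats_near sep _ hi).1 ti hat_center mulr1 gtrDl oppr_lt0//.
Qed.

(** Compactness turns the strict inequality [low_lt] into a uniform one. The two noncompact ends are
    harmless: near 0 the profile is linear, so its square is of smaller order than t, and beyond
    [reach] it is constant. *)
Lemma exists_rate : exists th K : R, [/\ 0 < th, th < 1 / 2, 4 * pi < K &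
  forall t, 0 <= t -> K * low t ^+ 2 <= (1 - 2 * th) * t].
Proof.
have pi4 : 0 < 4 * pi :> R by rewrite mulr_gt0// pi_gt0.
pose p4 : R := 4 * pi; have p40 : 0 < p4 := pi4.
(* For t <= eta the profile is kappa t, and 4 pi (kappa t)^2 <= t / 8. *)
pose eta := Num.min rho (8 * p4 * kappa m ^+ 2)^-1.
have q0 : 0 < 8 * p4 * kappa m ^+ 2 by apply: mulr_gt0; [apply: mulr_gt0|exact: exprn_gt0].
have eta0 : 0 < eta by rewrite lt_min r0 invr_gt0.
have rr : rho <= reach b.
  have := le_reach insc i0; have [_ _ /(_ i0)] := sep.
  by move: r0; set x := reach b; move: (b i0) => y; lra.
have er : eta <= reach b by apply: le_trans rr; rewrite ge_min lexx.
have cr : {within `[eta, reach b], continuous (fun t => p4 * low t ^+ 2 / t)}.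
  apply: continuous_in_subspaceT => t; rewrite inE/= in_itv/= => /andP[et _].
  apply: (@cvgM _ R); last by apply: continuous_inv_pos; exact: lt_le_trans et.
  apply: (@cvgM _ R); first exact: cvg_cst.
  apply: (@continuous_comp _ _ _ low (fun x : R => x ^+ 2)); first exact: continuous_profile.
  exact: exprn_continuous.
have [c cin cmax] := EVT_max er cr.
have c0 : 0 < c by move: cin; rewrite in_itv/= => /andP[? _]; exact: lt_le_trans eta0 _.
(* The entry 1/8 covers t <= eta and keeps r1 positive. *)
pose r1 := Num.max (1 / 8) (p4 * low c ^+ 2 / c).
have r1l : 1 / 8 <= r1 by rewrite le_max lexx.
have r11 : r1 < 1.
  have lc : p4 * low c ^+ 2 / c < 1 by rewrite ltr_pdivrMr// mul1r; exact: low_lt.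
  by rewrite gt_max lc andbT; lra.
have mid t : eta <= t -> t <= reach b -> p4 * low t ^+ 2 <= r1 * t.
  move=> et tr; have t0 : 0 < t := lt_le_trans eta0 et.
  have := cmax t; rewrite in_itv/= et tr => /(_ isT) h.
  by rewrite -ler_pdivrMr//; apply: le_trans h _; rewrite le_max lexx orbT.
have all t : 0 <= t -> p4 * low t ^+ 2 <= r1 * t.
  move=> t0; have [te|/ltW et] := leP t eta.
    rewrite profile_small; last by apply: le_trans te _; rewrite ge_min lexx.
    apply: (@le_trans _ _ (1 / 8 * t)); last by rewrite ler_wpM2r.
    have te' : t <= (8 * p4 * kappa m ^+ 2)^-1 by apply: le_trans te _; rewrite ge_min lexx orbT.
    rewrite -[_^-1]mul1r ler_pdivlMr// in te'.
    have E (p k : R) : p * (k * t) ^+ 2 = 1 / 8 * (t * (t * (8 * p * k ^+ 2))) by field.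
    by rewrite E ler_pM2l// ler_piMr.
  have [tr|/ltW rt] := leP t (reach b); first exact: mid.
  rewrite profile_reach//; apply: le_trans (mid _ er (lexx _)) _.
  by rewrite ler_wpM2l//; lra.
(* Half of the slack 1 - r1 goes to the exponent, since 1 - 2 th = (1 + r1) / 2; the other half
   raises the constant above 4 pi, as K r1 / (4 pi) = (1 + r1) / 2. *)
exists ((1 - r1) / 4), (p4 * ((1 + r1) / (2 * r1))).
have r10 : 0 < r1 by lra.
split; [lra|lra| |].
  by rewrite ltr_pMr// ltr_pdivlMr ?mulr_gt0//; lra.
move=> t t0; have := all t t0.
rewrite (_ : p4 * _ * _ = (1 + r1) / (2 * r1) * (p4 * low t ^+ 2)); last by ring.
move=> h; apply: le_trans (ler_wpM2l _ h) _; first by rewrite divr_ge0//; lra.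
by rewrite le_eqVlt; apply/orP; left; apply/eqP; field; rewrite gt_eqF.
Qed.

(** Here tau = - ln y, so Lebesgue measure is e^(- tau) d tau and the bound leaves an integrable
    e^(- th tau). One of the two [th] in [exists_rate] is spent on the linear factor s low <= kappa
    tau. *)
Lemma f_decay (f : R -> R) : C1 f -> f 0 = 0 -> critical_growth f ->
  exists Kc th : R, [/\ 0 < Kc, 0 < th, th < 1 / 2 &
    forall s tau, 1 <= s -> 0 <= tau ->
      Num.sqrt s * `|f (Num.sqrt s * low (tau / s))| <= Kc * expR ((1 - th) * tau)].
Proof.
move=> fC1 f0 fc; have [th [K [th0 th1 K4 HK]]] := exists_rate.
have [C C0 HC] := f_growth fC1 f0 fc K4.
exists (C * kappa m / th), th; split => //; first by rewrite divr_gt0// mulr_gt0.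
move=> s tau s1 tau0; have s0 : 0 < s := lt_le_trans ltr01 s1.
have ts : 0 <= tau / s by rewrite divr_ge0// ltW.
have /andP[l0 l1] := low_bound ts; have sq0 : 0 <= Num.sqrt s := sqrtr_ge0 s.
have sqs : Num.sqrt s * Num.sqrt s = s by rewrite -expr2 sqr_sqrtr// ltW.
have e1 : expR (K * (Num.sqrt s * low (tau / s)) ^+ 2) <= expR ((1 - 2 * th) * tau).
  rewrite ler_expR exprMn sqr_sqrtr ?(ltW s0)// mulrCA.
  have := ler_wpM2l (ltW s0) (HK _ ts).
  by rewrite [leRHS]mulrCA (mulrC s (tau / s)) divfK// gt_eqF.
have e2 : Num.sqrt s * `|Num.sqrt s * low (tau / s)| <= kappa m * tau.
  rewrite ger0_norm ?mulr_ge0// mulrA sqs; apply: (@le_trans _ _ (s * (kappa m * (tau / s)))).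
    by rewrite ler_pM2l//; apply: le_trans l1 (polygon_le insc _).
  by rewrite mulrCA (mulrC s (tau / s)) divfK// gt_eqF.
have e3 : tau <= expR (th * tau) / th.
  rewrite ler_pdivlMr// mulrC; apply: le_trans (expR_ge1Dx _); rewrite lerDr//.
apply: (@le_trans _ _ (C * (kappa m * tau) * expR ((1 - 2 * th) * tau))).
  apply: (@le_trans _ _ (Num.sqrt s * (C * `|Num.sqrt s * low (tau / s)| * expR (K * (Num.sqrt s * low (tau / s)) ^+ 2)))).
    by rewrite ler_wpM2l.
  rewrite mulrA [Num.sqrt s * (C * _)]mulrCA; apply: ler_pM; rewrite ?expR_ge0//.
    by rewrite mulr_ge0 ?(ltW C0)// mulr_ge0.
  by rewrite ler_pM2l.
rewrite (_ : (1 - th) * tau = th * tau + (1 - 2 * th) * tau); last by ring.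
rewrite expRD mulrA ler_wpM2r ?expR_ge0// mulrAC.
by rewrite mulrA -[leRHS]mulrA ler_wpM2l// ltW// mulr_gt0.
Qed.

End Rate.

(** * Charges at the nodes *)

Lemma continuous_compose (R : realType) (k g : R -> R) (t : R) : {for t, continuous k} -> continuous g ->
  {for t, continuous (fun t => g (k t))}.
Proof. by move=> ck cg; apply: (@continuous_comp _ _ _ k g) => //; exact: cg. Qed.

Lemma max_lipschitz (R : realType) (c x y : R) : `|Num.max c x - Num.max c y| <= `|x - y|.
Proof.
have := ler_norm (x - y); have := ler_norm (y - x); rewrite (distrC y x).
case: (leP c x) => h1; case: (leP c y) => h2 a1 a2; rewrite ler_norml; apply/andP; split; lra.
Qed.

Lemma min_lipschitz (R : realType) (c x y : R) : `|Num.min x c - Num.min y c| <= `|x - y|.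
Proof.
have := ler_norm (x - y); have := ler_norm (y - x); rewrite (distrC y x).
case: (leP x c) => h1; case: (leP y c) => h2 a1 a2; rewrite ler_norml; apply/andP; split; lra.
Qed.

Section Masses.
Context {R : realType}.
Local Notation mu := (@lebesgue_measure R).
Local Notation mR := (measurableTypeR R).
Local Notation mf1 := (@measurable_fun _ _ (measurableTypeR R) R).
Local Notation I01 := `[(0 : R), 1[%classic.
Local Notation IL u := (Rintegral mu I01 u).
Local Notation IntL u := (mu.-integrable I01 (EFin \o u)).

Lemma is_derive_pow (c th t : R) : 0 < th -> 0 < t ->
  is_derive t 1 (fun t => c / th * expR (th * ln t)) (c * expR ((1 - th) * - ln t)).
Proof.
move=> th0 t0.
have h1 : is_derive t 1 (fun t => th * ln t) (th * t^-1).
  by apply: is_deriveZ; exact: is_derive1_ln.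
have h2 : is_derive t 1 (fun t => expR (th * ln t)) (expR (th * ln t) * (th * t^-1)).
  apply: (is_derive1_comp (f := @expR R) (g := fun t => th * ln t)).
have h3 : is_derive t 1 (fun t => c / th * expR (th * ln t)) (c / th * (expR (th * ln t) * (th * t^-1))).
  by apply: is_deriveZ.
apply: is_derive_eq h3 _.
have -> : t^-1 = expR (- ln t) by rewrite expRN lnK.
rewrite (_ : (1 - th) * - ln t = th * ln t + - ln t); last by ring.
by rewrite expRD; field; rewrite gt_eqF.
Qed.

Lemma continuous_pow (c th t : R) : 0 < t ->
  {for t, continuous (fun t => c * expR (th * - ln t))}.
Proof.
move=> t0; apply: (@cvgM _ R); first exact: cvg_cst.
apply: (@continuous_comp _ _ _ (fun t : R => th * - ln t) (@expR R)); last exact: continuous_expR.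
apply: (@cvgM _ R); first exact: cvg_cst.
by apply: (@cvgN _ R); exact: continuous_ln.
Qed.

(** [expR (th * ln t)] is t^th, so the dominating function is c t^(th - 1) with primitive (c / th)
    t^th. *)
Lemma IL_pow_le (g : R -> R) (c th y B : R) : 0 < th -> 0 <= c -> 0 < y -> y <= 1 -> mf1 I01 g ->
  (forall t, I01 t -> `|g t| <= B) -> (forall t, y <= t -> t < 1 -> g t = 0) ->
  (forall t, 0 < t < y -> `|g t| <= c * expR ((1 - th) * - ln t)) ->
  IL (fun t => `|g t|) <= c / th * expR (th * ln y).
Proof.
move=> th0 c0 y0 y1 mg gB g0 gc.
apply: (@IL_le_primitive _ g (fun t => c / th * expR (th * ln t)) (fun t => c * expR ((1 - th) * - ln t)) y B y0 y1 mg gB g0 _ _ _ gc).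
- by move=> t t0; exact: is_derive_pow.
- by move=> t t0; exact: continuous_pow.
- move=> t t0; apply: mulr_ge0; last exact: expR_ge0.
  by apply: divr_ge0 => //; exact: ltW.
Qed.

Variables (n : nat) (m b : 'I_n -> R) (i0 : 'I_n).
Hypothesis insc : inscribed m b.
Variables (rho eps : R) (sep : well_separated b rho).
Hypotheses (eps0 : 0 < eps) (epsk : eps <= kappa m * rho / 2) (eps1 : eps <= 1).
Variable f : R -> R.
Hypotheses (fC1 : C1 f) (f0 : f 0 = 0) (fcrit : critical_growth f) (fg1 : cond_g1 f).
Implicit Types (t s h : R) (i : 'I_n).

Definition sigma s t : R := - ln t / s.

(** The annulus where sigma is within rho of b i, written as a half-open interval in t so that its
    integrals are explicit. *)
Definition chi s i t : R := (expR (- (s * (b i + rho))) <= t < expR (- (s * (b i - rho))))%R%:R.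

(** Only the i-th hat enters, since the others vanish on the i-th annulus; thus the n conditions on
    the charges decouple. The factor sqrt s / (32 pi) makes the charge comparable with a slope
    jump. *)
Definition node_density s i h t : R :=
  Num.sqrt s / (32 * pi) * f (Num.sqrt s * (polygon m b (sigma s t) + h * hat rho (b i) (sigma s t))).

(* The charge of [f] in the annulus around the i-th node, when the profile is
   raised by [h] there; it is to match the slope jump [m i]. *)
Definition mass s i h : R := IL (fun t => chi s i t * node_density s i h t).

Let r0 : 0 < rho. Proof. by case: sep. Qed.

Let rb i : 0 < b i - rho.
Proof. by have [_ _ /(_ i) h _] := sep; move: r0 h; move: (b i) => y; lra. Qed.

Lemma chi_bool s i t : chi s i t = 0 \/ chi s i t = 1.
Proof. by rewrite /chi; case: (_ <= _ < _); [right|left]. Qed.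

Lemma chi_sigma s i t : 0 < s -> 0 < t -> chi s i t = (b i - rho < sigma s t <= b i + rho)%R%:R.
Proof.
move=> s0 t0; rewrite /chi /sigma; congr (_ %:R).
rewrite ltr_pdivlMr// ler_pdivrMr// andbC.
rewrite -{1 2}[t]lnK ?posrE// ler_expR ltr_expR.
rewrite [(b i - rho) * s]mulrC [(b i + rho) * s]mulrC.
by rewrite lerNl ltrNr.
Qed.

Lemma chi_near s i t : 0 < s -> 0 < t -> chi s i t = 1 -> `|sigma s t - b i| <= rho.
Proof.
move=> s0 t0; rewrite chi_sigma//; case: (boolP (_ < _ <= _)) => [/andP[h1 h2] _|_ /eqP]; last by rewrite eq_sym oner_eq0.
by rewrite ler_norml; move: h1 h2; move: (b i) (sigma s t) => x y; lra.
Qed.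

Lemma chi_uniq s i j t : 0 < s -> 0 < t -> chi s i t = 1 -> chi s j t = 1 -> i = j.
Proof.
by move=> s0 t0 hi hj; exact: near_node_uniq sep _ _ _ (chi_near s0 t0 hi) (chi_near s0 t0 hj).
Qed.

Lemma far_of_chi s t : 0 < s -> 0 < t -> (forall i, chi s i t = 0) ->
  forall i, rho <= `|sigma s t - b i|.
Proof.
move=> s0 t0 H i; have := H i; rewrite chi_sigma//; case: (boolP (_ < _ <= _)) => [_ /eqP|+ _].
  by rewrite oner_eq0.
rewrite negb_and -leNgt -ltNge => /orP[h|h].
  by rewrite ler0_norm; move: h r0; move: (b i) (sigma s t) => x y; lra.
by rewrite ger0_norm; move: h r0; move: (b i) (sigma s t) => x y; lra.
Qed.

Lemma sigma_ge0 s t : 0 < s -> I01 t -> 0 <= sigma s t.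
Proof.
move=> s0; rewrite /= in_itv/= => /andP[_ t1].
by rewrite /sigma divr_ge0 ?(ltW s0)// oppr_ge0 ln_le0// ltW.
Qed.

Lemma measurable_sigma s : mf1 setT (sigma s).
Proof.
apply: measurable_funM; last exact: measurable_cst.
by apply: measurable_funN; exact: measurable_ln.
Qed.

Lemma measurable_comp_sigma s (k : R -> R) : continuous k -> mf1 setT (fun t => k (sigma s t)).
Proof.
move=> ck; apply: (@measurable_comp _ _ _ mR mR R setT k setT (sigma s)) => //.
  exact: continuous_measurable_fun.
exact: measurable_sigma.
Qed.

Lemma polygon_le_reach t : polygon m b t <= polygon m b (reach b).
Proof.
have [h|/ltW h] := leP t (reach b); first exact: (polygon_mono insc h).
by rewrite (polygon_reach insc h).
Qed.

Lemma node_arg_bound s i h t : 0 < s -> I01 t -> `|h| <= 1 ->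
  `|Num.sqrt s * (polygon m b (sigma s t) + h * hat rho (b i) (sigma s t))| <=
  Num.sqrt s * (polygon m b (reach b) + 1).
Proof.
move=> s0 It h1; rewrite normrM ger0_norm ?sqrtr_ge0// ler_wpM2l ?sqrtr_ge0//.
apply: le_trans (ler_normD _ _) _; apply: lerD.
  by rewrite ger0_norm ?polygon_le_reach// (polygon_ge0 insc)// sigma_ge0.
have /andP[c0 c1] := hat_bound rho (b i) (sigma s t).
by rewrite normrM (ger0_norm c0) mulr_ile1.
Qed.

Lemma measurable_node_density s i h : mf1 I01 (node_density s i h).
Proof.
apply: measurable_funTS; apply: measurable_funM; first exact: measurable_cst.
apply: (@measurable_comp_sigma s (fun t => f (Num.sqrt s * (polygon m b t + h * hat rho (b i) t)))).
move=> t; have ck : {for t, continuous (fun t => Num.sqrt s * (polygon m b t + h * hat rho (b i) t))}.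
  apply: (@cvgM _ R); first exact: cvg_cst.
  apply: (@cvgD _ R); first exact: continuous_polygon.
  apply: (@cvgM _ R); first exact: cvg_cst.
  exact: is_derive_continuous (is_derive_hat rho (b i) t).
exact: continuous_compose ck (f_continuous fC1).
Qed.

Lemma measurable_chi s i : mf1 I01 (chi s i).
Proof. by apply: measurable_funTS; exact: mf_indic. Qed.

Lemma node_density_bounded s i : 0 < s -> exists2 B, 0 < B &
  forall h t, `|h| <= 1 -> I01 t -> `|chi s i t * node_density s i h t| <= B.
Proof.
move=> s0; have cf := f_continuous fC1.
pose A := Num.sqrt s * (polygon m b (reach b) + 1).
have [B B0 HB] := continuous_bounded (- A) A cf.
have p0 : 0 < 32 * pi :> R by apply: mulr_gt0; [rewrite ltr0n|exact: pi_gt0].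
have c0 : 0 < Num.sqrt s / (32 * pi) by rewrite divr_gt0// sqrtr_gt0.
exists (Num.sqrt s / (32 * pi) * B); first exact: mulr_gt0.
move=> h t h1 It; apply: (@le_trans _ _ `|node_density s i h t|).
  by case: (chi_bool s i t) => ->; rewrite ?mul0r ?normr0// mul1r.
rewrite normrM (gtr0_norm c0) ler_pM2l//; apply: HB; rewrite -ler_norml.
exact: node_arg_bound.
Qed.

Lemma IntL_mass s i h : 0 < s -> `|h| <= 1 -> IntL (fun t => chi s i t * node_density s i h t).
Proof.
move=> s0 h1; have [B _ HB] := node_density_bounded i s0.
apply: (@IntL_bounded _ _ B) => [|t It]; last exact: HB.
by apply: measurable_funM; [exact: measurable_chi|exact: measurable_node_density].
Qed.

Lemma mass_lipschitz s i : 0 < s -> exists2 C, 0 < C &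
  forall h h', `|h| <= 1 -> `|h'| <= 1 -> `|mass s i h - mass s i h'| <= C * `|h - h'|.
Proof.
move=> s0; have [L L0 HL] := f_lipschitz fC1 (Num.sqrt s * (polygon m b (reach b) + 1)).
have p0 : 0 < 32 * pi :> R by apply: mulr_gt0; [rewrite ltr0n|exact: pi_gt0].
have q0 : 0 < Num.sqrt s by rewrite sqrtr_gt0.
have c0 : 0 < Num.sqrt s / (32 * pi) by rewrite divr_gt0.
pose C := Num.sqrt s / (32 * pi) * (L * Num.sqrt s).
exists C; first exact: mulr_gt0 c0 (mulr_gt0 L0 q0).
move=> h h' h1 h1'; have i1 := IntL_mass i s0 h1; have i2 := IntL_mass i s0 h1'.
rewrite /mass -(IL_B i1 i2); apply: le_trans (IL_abs (IntL_B i1 i2)) _.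
rewrite -[leRHS](IL_cst (C * `|h - h'|)).
apply: IL_le; [exact: IntL_norm (IntL_B i1 i2)|exact: IntL_cst|move=> t It].
rewrite -mulrBr; apply: (@le_trans _ _ `|node_density s i h t - node_density s i h' t|).
  by case: (chi_bool s i t) => ->; rewrite ?mul0r ?normr0// mul1r.
rewrite /node_density -mulrBr normrM (gtr0_norm c0) /cst /C -[leRHS]mulrA ler_pM2l//.
apply: le_trans (HL _ _ (node_arg_bound i s0 It h1) (node_arg_bound i s0 It h1')) _.
rewrite -[leRHS]mulrA ler_pM2l// -mulrBr normrM (gtr0_norm q0) ler_pM2l//.
rewrite opprD addrACA subrr add0r -mulrBl normrM.
have /andP[d0 d1] := hat_bound rho (b i) (sigma s t).
by rewrite (ger0_norm d0) ler_piMr.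
Qed.

Lemma mass_ivt s i : 0 < s -> mass s i (- eps) <= m i <= mass s i eps ->
  exists2 h, `|h| <= eps & mass s i h = m i.
Proof.
move=> s0 hm; have [C C0 HC] := mass_lipschitz i s0.
(* The charge is controlled for |h| <= 1 only; clamping extends it to a continuous function on the
   line, as required for the intermediate value theorem. *)
pose clamp x : R := Num.max (- 1) (Num.min x 1).
have cl1 x : `|clamp x| <= 1.
  by rewrite ler_norml /clamp le_max lexx/= ge_max ge_min lexx orbT andbT; lra.
have clE x : `|x| <= 1 -> clamp x = x.
  by rewrite ler_norml /clamp => /andP[x1 x2]; rewrite min_l// max_r.
have cl2 x y : `|clamp x - clamp y| <= `|x - y|.
  by apply: le_trans (max_lipschitz _ _ _) (min_lipschitz _ _ _).
have cg : continuous (fun x => mass s i (clamp x)).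
  move=> x; apply/cvgrPdist_lt => e e0; exists (e / C); first exact: divr_gt0.
  move=> y /= xy; apply: le_lt_trans (HC _ _ (cl1 _) (cl1 _)) _.
  rewrite mulrC -ltr_pdivlMr//; exact: le_lt_trans (cl2 _ _) xy.
have ee : - eps <= eps by rewrite ge0_cp// ltW.
have e1 : `|- eps| <= 1 by rewrite normrN gtr0_norm.
have e2 : `|eps| <= 1 by rewrite gtr0_norm.
have /andP[m1 m2] := hm.
have [|h] := IVT (v := m i) ee (within_continuous (A := `[- eps, eps]%classic) cg).
  by rewrite !clE// ge_min m1/= le_max m2 orbT.
rewrite in_itv/= => hh; have hn : `|h| <= eps by rewrite ler_norml.
by rewrite clE; [exists h|exact: le_trans eps1].
Qed.

Lemma node_density_low s t : 0 < s -> 0 < t -> t < 1 -> forall i, chi s i t = 1 ->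
  node_density s i (- eps) t =
  Num.sqrt s / (32 * pi) * f (Num.sqrt s * profile m b rho (fun=> - eps) (- ln t / s)).
Proof.
move=> s0 t0 t1 i hi; rewrite /node_density /profile.
by rewrite (hats_near sep _ (chi_near s0 t0 hi)).1.
Qed.

Lemma near_pinfty_expR (c d e : R) : 0 < d -> 0 < e -> exists2 s0 : R, 1 <= s0 &
  forall s, s0 <= s -> c * expR (- (d * s)) <= e.
Proof.
move=> d0 e0; exists (1 + `|c| / (d * e)); first by rewrite lerDl divr_ge0// mulr_ge0// ltW.
move=> s hs; have de : 0 < d * e by rewrite mulr_gt0.
have h : `|c| <= e * (1 + d * s).
  have hs' : `|c| / (d * e) <= s by apply: le_trans hs; rewrite lerDr.
  rewrite ler_pdivrMr// in hs'; apply: le_trans hs' _; rewrite mulrDr mulr1.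
  by rewrite (_ : s * (d * e) = e * (d * s)) ?lerDr ?ltW//; ring.
rewrite expRN ler_pdivrMr ?expR_gt0//; apply: le_trans (ler_norm c) _; apply: le_trans h _.
by rewrite ler_pM2l// expR_ge1Dx.
Qed.

(** At the lowered height [f_decay] applies, and the annulus lies below expR (- s (b i - rho)); the
    charge is thus of order expR (- th (b i - rho) s). *)
Lemma mass_low i : exists2 s0 : R, 1 <= s0 & forall s, s0 <= s -> mass s i (- eps) <= m i.
Proof.
have [Kc [th [K0 th0 th1 HK]]] := f_decay i0 insc sep eps0 epsk fC1 f0 fcrit.
have p0 : 0 < 32 * pi :> R by apply: mulr_gt0; [rewrite ltr0n|exact: pi_gt0].
have d0 : 0 < th * (b i - rho) by rewrite mulr_gt0.
have [s0 s01 Hs] := near_pinfty_expR (Kc / (32 * pi) / th) d0 (ins_m insc i).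
exists s0 => // s hs; apply: le_trans (Hs s hs); have s1 := le_trans s01 hs.
have sp : 0 < s := lt_le_trans ltr01 s1.
have e1 : `|- eps| <= 1 by rewrite normrN gtr0_norm.
have [B _ HB] := node_density_bounded i sp.
have ii := IntL_mass i sp e1.
apply: le_trans (ler_norm _) _; apply: le_trans (IL_abs ii) _.
rewrite (_ : - (th * (b i - rho) * s) = th * ln (expR (- (s * (b i - rho))))); last by rewrite expRK; ring.
apply: (@IL_pow_le _ _ _ _ B).
- exact: th0.
- by rewrite divr_ge0// ltW.
- exact: expR_gt0.
- by rewrite expR_le1 oppr_le0 mulr_ge0// ltW.
- exact: IntL_mf ii.
- by move=> t It; exact: HB.
- by move=> t yt _; rewrite /chi [t < _]ltNge yt andbF mul0r.
move=> t /andP[t0 ty].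
have t1 : t < 1 by apply: lt_le_trans ty _; rewrite expR_le1 oppr_le0 mulr_ge0// ltW.
have [->|h] := chi_bool s i t; first by rewrite mul0r normr0 mulr_ge0 ?expR_ge0// divr_ge0// ltW.
rewrite h mul1r node_density_low// normrM ger0_norm ?divr_ge0 ?sqrtr_ge0 ?(ltW p0)//.
rewrite mulrAC -[Kc / _ * _]mulrAC ler_pM2r ?invr_gt0//.
by apply: HK => //; rewrite oppr_ge0 ln_le0// ltW.
Qed.

Lemma low_ge s t i : 0 < s -> 0 < t -> t < 1 -> chi s i t = 1 -> forall h, `|h| <= eps ->
  kappa m * rho / 2 <= polygon m b (sigma s t) + h * hat rho (b i) (sigma s t).
Proof.
move=> s0 t0 t1 hi h he; have hn := chi_near s0 t0 hi.
have It : I01 t by rewrite /= in_itv/= ltW.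
have [_ _] := profile_bound i0 insc sep eps0 epsk (fun=> he) (sigma_ge0 s0 It).
by rewrite /profile (hats_near sep _ hn).1; apply; exact: near_node_ge hn.
Qed.

(** On an annulus the profile is at least kappa rho / 2, so after multiplication by sqrt s it
    exceeds the threshold in (g1) once s is large. *)
Lemma f_node_ge : exists c s0 : R, [/\ 0 < c, 1 <= s0 & forall s t i h, s0 <= s -> 0 < t -> t < 1 ->
  chi s i t = 1 -> `|h| <= eps ->
  c * expR (4 * pi * (Num.sqrt s * (polygon m b (sigma s t) + h * hat rho (b i) (sigma s t))) ^+ 2) <=
  f (Num.sqrt s * (polygon m b (sigma s t) + h * hat rho (b i) (sigma s t)))].
Proof.
have [T [c [T0 c0 HT]]] := f_lower fg1.
have kr0 : 0 < kappa m * rho / 2 by rewrite divr_gt0// mulr_gt0// (kappa_gt0 i0 insc).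
exists c, (1 + (T / (kappa m * rho / 2)) ^+ 2); split => //; first by rewrite lerDl sqr_ge0.
move=> s t i h hs t0 t1 hi he; apply: HT.
have s1 : 1 <= s by apply: le_trans hs; rewrite lerDl sqr_ge0.
have s0 : 0 < s := lt_le_trans ltr01 s1.
have q : T / (kappa m * rho / 2) <= Num.sqrt s.
  have T1 : 0 <= T / (kappa m * rho / 2) by apply: divr_ge0; exact: ltW.
  rewrite -[leLHS](ger0_norm T1) -sqrtr_sqr; apply: ler_wsqrtr.
  by apply: le_trans hs; rewrite lerDr.
rewrite ler_pdivrMr// in q; apply: le_trans q _; rewrite ler_wpM2l ?sqrtr_ge0//.
exact: low_ge.
Qed.

(** The raised profile lies outside the parabola near b i. There (g1) gives f >= c e^(s sigma) = c /
    t, whose integral over the annulus of half-width r2 is 2 c r2 s, so the charge grows at least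
    linearly in s. *)
Lemma mass_high i : exists2 s0 : R, 1 <= s0 & forall s, s0 <= s -> m i <= mass s i eps.
Proof.
have [c [s1 [c0 s11 Hf]]] := f_node_ge.
have p0 : 0 < 32 * pi :> R by apply: mulr_gt0; [rewrite ltr0n|exact: pi_gt0].
pose top t := polygon m b t + eps * hat rho (b i) t.
have bi0 : 0 < b i := ins_b insc i.
have ctop : continuous (fun t => 4 * pi * top t ^+ 2 - t).
  move=> t; apply: (@cvgB _ R); last exact: cvg_id.
  apply: (@cvgM _ R); first exact: cvg_cst.
  apply: (continuous_compose (k := top) (g := fun x => x ^+ 2)); last exact: exprn_continuous.
  apply: (@cvgD _ R); first exact: continuous_polygon.
  by apply: (@cvgM _ R); [exact: cvg_cst|exact: is_derive_continuous (is_derive_hat rho (b i) t)].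
have topb : 0 < 4 * pi * top (b i) ^+ 2 - b i.
  rewrite /top hat_center mulr1 subr_gt0 -[ltLHS](ins_node insc i) ltr_pM2l ?mulr_gt0 ?pi_gt0//.
  have := polygon_ge0 insc (ltW bi0); move: (polygon m b (b i)) => p pp.
  by rewrite ltr_pXn2r ?nnegrE ?addr_ge0// ?ltrDl// ltW.
have [r1 r10 Hr] : exists2 r1, 0 < r1 & forall t, `|t - b i| < r1 -> t <= 4 * pi * top t ^+ 2.
  have := ctop (b i); move/cvgrPdist_lt => /(_ _ topb) [r1 /= r10 H]; exists r1 => // t tr.
  have := H t; rewrite /= distrC => /(_ tr); move: (4 * pi * top t ^+ 2) (4 * pi * top (b i) ^+ 2) topb => x y h.
  by rewrite ltr_norml => /andP[_]; lra.
pose r2 := Num.min rho r1 / 2.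
have mr : 0 < Num.min rho r1 by rewrite lt_min r0 r10.
have r20 : 0 < r2 by rewrite divr_gt0.
have r2r : r2 < rho.
  by apply: lt_le_trans (_ : _ < Num.min rho r1) _; [rewrite /r2 ltr_pdivrMr// ltr_pMr// ltr1n|rewrite ge_min lexx].
have r2r1 : r2 < r1.
  by apply: lt_le_trans (_ : _ < Num.min rho r1) _; [rewrite /r2 ltr_pdivrMr// ltr_pMr// ltr1n|rewrite ge_min lexx orbT].
(* The linear rate: the charge is at least q s, the factor sqrt s >= 1 being dropped. *)
pose q := c / (32 * pi) * (2 * r2).
have q0 : 0 < q by apply: mulr_gt0; [exact: divr_gt0|exact: mulr_gt0].
exists (s1 + m i / q); first by apply: le_trans s11 _; rewrite lerDl divr_ge0// ltW ?(ins_m insc).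
move=> s hs; have hs1 : s1 <= s by apply: le_trans hs; rewrite lerDl divr_ge0// ltW ?(ins_m insc).
have s1' := le_trans s11 hs1; have s0 : 0 < s := lt_le_trans ltr01 s1'.
have sq1 : 1 <= Num.sqrt s by rewrite -[leLHS]sqrtr1 ler_wsqrtr.
pose A := expR (- (s * (b i + r2))); pose B := expR (- (s * (b i - r2))).
have AB : A <= B by rewrite ler_expR lerN2 ler_pM2l//; move: r20; move: (b i) => y; lra.
have B1 : B <= 1.
  rewrite expR_le1 oppr_le0 mulr_ge0 ?(ltW s0)//; have := rb i; move: (b i) r2r => y; lra.
have [i1 E1] := IL_itv (expR_gt0 _ : 0 < A) AB B1 (@is_derive_ln_pos R) (@continuous_inv_pos R).
have e1 : `|eps| <= 1 by rewrite gtr0_norm.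
have E2 : ln B - ln A = 2 * r2 * s by rewrite /A /B !expRK; ring.
rewrite E2 in E1.
apply: (@le_trans _ _ (q * s)).
  have : m i / q <= s by apply: le_trans hs; rewrite lerDr ltW// (lt_le_trans ltr01).
  by rewrite ler_pdivrMr// mulrC.
rewrite (_ : q * s = c / (32 * pi) * (2 * r2 * s)); last by rewrite /q; ring.
rewrite -E1 -(IL_Z _ i1); apply: IL_le (IntL_Z _ i1) (IntL_mass i s0 e1) _ => t.
rewrite /= in_itv/= => /andP[t0 t1].
have cp0 : 0 <= c / (32 * pi) by rewrite divr_ge0// ltW.
have nn : 0 <= chi s i t * node_density s i eps t.
  have [->|h] := chi_bool s i t; first by rewrite mul0r.
  rewrite h mul1r mulr_ge0 ?divr_ge0 ?sqrtr_ge0 ?(ltW p0)//.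
  have tp : 0 < t.
    by move: h; rewrite /chi; case: (boolP (_ <= _ < _)) => [/andP[h _] _|_ /eqP]; [exact: lt_le_trans (expR_gt0 _) h|rewrite eq_sym oner_eq0].
  have ee : `|eps| <= eps by rewrite gtr0_norm.
  by apply: le_trans (Hf s t i eps hs1 tp t1 h ee); rewrite mulr_ge0 ?expR_ge0// ltW.
case: (boolP (A <= t < B)) => [/andP[At tB]|_]; last by rewrite mul0r mulr0.
have tp : 0 < t := lt_le_trans (expR_gt0 _) At.
have hc : chi s i t = 1.
  rewrite /chi; have -> : (expR (- (s * (b i + rho))) <= t < expR (- (s * (b i - rho)))); last by [].
  apply/andP; split.
    by apply: le_trans At; rewrite ler_expR lerN2 ler_pM2l// lerD2l ltW.
  by apply: lt_trans tB _; rewrite ltr_expR ltrN2 ltr_pM2l// ltrD2l ltrN2.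
rewrite hc !mul1r.
have ee : `|eps| <= eps by rewrite gtr0_norm.
have := Hf s t i eps hs1 tp t1 hc ee; rewrite -/(top (sigma s t)) => hf.
have st : sigma s t <= 4 * pi * top (sigma s t) ^+ 2.
  apply: Hr; apply: le_lt_trans r2r1; rewrite /sigma ler_norml.
  have l1 : - ln t <= s * (b i + r2) by rewrite lerNl -[leLHS]expRK ler_ln ?posrE ?expR_gt0.
  have l2 : s * (b i - r2) <= - ln t by rewrite lerNr -[leRHS]expRK ler_ln ?posrE ?expR_gt0// ltW.
  apply/andP; split.
    rewrite lerBrDl ler_pdivlMr// mulrC addrC; move: l2; by rewrite addrC.
  by rewrite lerBlDl ler_pdivrMr// mulrC.
have e2 : t^-1 <= expR (4 * pi * (Num.sqrt s * top (sigma s t)) ^+ 2).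
  rewrite -[t in t^-1]lnK ?posrE// -expRN ler_expR exprMn sqr_sqrtr ?(ltW s0)// mulrCA.
  have E : s * sigma s t = - ln t by rewrite /sigma mulrC divfK// gt_eqF.
  by have := ler_wpM2l (ltW s0) st; rewrite E.
rewrite /node_density -/(top (sigma s t)) mulrAC [leRHS]mulrAC ler_pM2r ?invr_gt0//.
apply: le_trans (ler_wpM2l (ltW c0) e2) _; apply: le_trans (hf) _.
have f0' : 0 <= f (Num.sqrt s * top (sigma s t)) by apply: le_trans hf; rewrite mulr_ge0 ?expR_ge0// ltW.
by rewrite ler_peMl.
Qed.

Lemma exists_masses : exists2 s0 : R, 1 <= s0 & forall s, s0 <= s -> exists h : 'I_n -> R,
  [/\ forall i, `|h i| <= eps, forall i, mass s i (h i) = m i &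
      forall i t, 0 < t -> t < 1 -> chi s i t = 1 ->
        0 <= f (Num.sqrt s * (polygon m b (sigma s t) + h i * hat rho (b i) (sigma s t)))].
Proof.
have /choice[S1 H1] : forall i, exists s0 : R, 1 <= s0 /\ forall s, s0 <= s -> mass s i (- eps) <= m i.
  by move=> i; have [s0] := mass_low i; exists s0.
have /choice[S2 H2] : forall i, exists s0 : R, 1 <= s0 /\ forall s, s0 <= s -> m i <= mass s i eps.
  by move=> i; have [s0] := mass_high i; exists s0.
have [c [s3 [c0 s31 H3]]] := f_node_ge.
have S1p i : 0 <= S1 i by apply: le_trans (H1 i).1.
have S2p i : 0 <= S2 i by apply: le_trans (H2 i).1.
(* A sum of nonnegative thresholds serves as their common upper bound. *)
exists (s3 + \sum_i (S1 i + S2 i)).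
  by apply: le_trans s31 _; rewrite lerDl sumr_ge0// => i _; rewrite addr_ge0.
move=> s hs.
have hi i : S1 i + S2 i <= s.
  apply: le_trans hs; rewrite (bigD1 i)//= -[leLHS]add0r; apply: lerD; first by apply: le_trans s31.
  by rewrite lerDl sumr_ge0// => j _; rewrite addr_ge0.
have hs3 : s3 <= s by apply: le_trans hs; rewrite lerDl sumr_ge0// => i _; rewrite addr_ge0.
have s0 : 0 < s by apply: lt_le_trans hs3; exact: lt_le_trans s31.
have /choice[h Hh] : forall i, exists h, `|h| <= eps /\ mass s i h = m i.
  move=> i; have hm : mass s i (- eps) <= m i <= mass s i eps.
    apply/andP; split; first by apply: (H1 i).2; apply: le_trans (hi i); rewrite lerDl.
    by apply: (H2 i).2; apply: le_trans (hi i); rewrite lerDr.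
  by have [h he hh] := mass_ivt s0 hm; exists h.
exists h; split => [i|i|i t t0 t1 hc]; [exact: (Hh i).1|exact: (Hh i).2|].
by apply: le_trans (H3 s t i (h i) hs3 t0 t1 hc (Hh i).1); rewrite mulr_ge0 ?expR_ge0// ltW.
Qed.

End Masses.

(** * Radial Poisson equation *)

Section RadialPotential.
Context {R : realType}.
Local Notation mu := (@lebesgue_measure R).
Local Notation mu2 := ((@lebesgue_measure R \x @lebesgue_measure R)%E).
Local Notation I01 := `[(0 : R), 1[%classic.
Local Notation I u := (Rintegral mu2 disk u).
Local Notation IL u := (Rintegral mu I01 u).
Implicit Types (y t s : R) (psi dpsi k q : R -> R).

Lemma radial_H10grad k q r : (forall y, is_derive y (1 : R) k (q y)) -> continuous q -> r < 1 ->
  (forall y, r <= y -> k y = 0) ->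
  H10grad (fun x => k (sqn x)) (fun x => q (sqn x) * (2 * x.1)) (fun x => q (sqn x) * (2 * x.2)).
Proof.
move=> kq cq r1 k0; have [ck hk] := radial_C1c kq cq r1 k0.
apply: (H10grad_eq (C1c_H10grad ck)) => x _ //.
  by have [_ ->] := C1P_d1 hk x.
by have [_ ->] := C1P_d2 hk x.
Qed.

(** Vanishing of [psi] for large arguments makes the composition with the logarithm C^1 across y =
    0; vanishing for small ones gives support away from y = 1. *)
Lemma log_comp psi dpsi s (al be : R) : 0 < s -> 0 < al ->
  (forall t, is_derive t (1 : R) psi (dpsi t)) -> continuous dpsi ->
  (forall t, t <= al -> psi t = 0 /\ dpsi t = 0) -> (forall t, be <= t -> psi t = 0 /\ dpsi t = 0) ->
  [/\ forall y, is_derive y (1 : R) (fun y => psi (- ln y / s)) (dpsi (- ln y / s) * - (s * y)^-1),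
      continuous (fun y => dpsi (- ln y / s) * - (s * y)^-1) &
      forall y, expR (- (s * al)) <= y -> psi (- ln y / s) = 0 /\ dpsi (- ln y / s) = 0].
Proof.
move=> s0 al0 D cD lo hi.
(* For y <= 0 the default ln y = 0 sends the argument to 0, where [psi] vanishes by [lo]; for small
   positive y the condition [hi] applies. *)
have small y : y < expR (- (s * be)) -> psi (- ln y / s) = 0 /\ dpsi (- ln y / s) = 0.
  move=> hy; have [y0|y0] := leP y 0; first by apply: lo; rewrite ln0// oppr0 mul0r ltW.
  apply: hi; rewrite ler_pdivlMr// lerNr mulrC -[leRHS]expRK ler_ln ?posrE ?expR_gt0//; exact: ltW.
have e0 := expR_gt0 (- (s * be)).
have dpos y : 0 < y -> is_derive y (1 : R) (fun y => - ln y / s) (- (s * y)^-1).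
  move=> y0; have h : is_derive y (1 : R) (fun y => (- s^-1) * ln y) (- s^-1 * y^-1).
    by apply: is_deriveZ; exact: is_derive1_ln.
  rewrite (_ : - (s * y)^-1 = - s^-1 * y^-1); last by rewrite invfM mulNr.
  by rewrite (_ : (fun y => - ln y / s) = (fun y => - s^-1 * ln y)) //; apply/funext => x; rewrite mulrC mulNr mulrN.
split.
- move=> y; have [y0|y0] := leP y 0.
    have ye : y < expR (- (s * be)) := le_lt_trans y0 e0.
    rewrite (small y ye).2 mul0r.
    have h0 : is_derive y (1 : R) (cst (0 : R)) 0 by exact: is_derive_cst.
    apply: near_eq_is_derive h0; near=> t.
    have te : t < expR (- (s * be)) by near: t; exact: lt_nbhsl.
    by rewrite (small t te).1.
  exact: is_derive1_comp (D _) (dpos y y0).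
- move=> y; have [y0|y0] := leP y 0.
    have ye : y < expR (- (s * be)) := le_lt_trans y0 e0.
    apply: (near_cst_continuous 0); near=> t.
    have te : t < expR (- (s * be)) by near: t; exact: lt_nbhsl.
    by rewrite (small t te).2 mul0r.
  apply: (@cvgM _ R).
    by apply: (continuous_compose (k := fun y => - ln y / s)) => //; exact: is_derive_continuous (dpos y y0).
  apply: (@cvgN _ R); apply: (@cvgV _ R); first by rewrite mulf_neq0// gt_eqF.
  by apply: (@cvgM _ R); [exact: cvg_cst|exact: cvg_id].
move=> y hy; have y0 : 0 < y := lt_le_trans (expR_gt0 _) hy.
by apply: lo; rewrite ler_pdivrMr// lerNl mulrC -[leLHS]expRK ler_ln ?posrE ?expR_gt0.
Unshelve. all: by end_near. Qed.

(** In y = |x|^2 the equation - laplacian z = q reads - 4 (y z')' = q, so z' is - 1/4 times this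
    mean of q over [0, y]. The mean is C^1 at 0 since q is assumed constant near 0. *)
Definition mean_value q y : R := if y == 0 then q 0 else primitive q y / y.

Section Potential.
Variables (q : R -> R) (B d : R).
Hypotheses (cq : continuous q) (qB : forall y, `|q y| <= B) (d0 : 0 < d)
  (qd : forall y, `|y| < d -> q y = q 0).

Lemma primitive_linear y : `|y| < d -> primitive q y = q 0 * y.
Proof.
move=> yd.
have D x : is_derive x (1 : R) (fun t => primitive q t - q 0 * t) (q x - q 0).
  apply: is_deriveB; first exact: is_derive_primitive.
  have h : is_derive x (1 : R) (fun t => q 0 * t) (q 0 * 1) by apply: is_deriveZ.
  by rewrite mulr1 in h.
have := @MVT_le _ _ _ 0 0 y D; rewrite primitive0 mulr0 subrr subr0 mul0r => h.
apply/eqP; rewrite -subr_eq0 -normr_le0; apply: h => x /andP[x1 x2].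
rewrite qd ?subrr ?normr0//; apply: le_lt_trans yd; rewrite ler_norml; apply/andP; split.
  apply: le_trans x1; rewrite le_min oppr_le0 normr_ge0 /= lerNl -normrN; exact: ler_norm.
by apply: le_trans x2 _; rewrite ge_max normr_ge0 ler_norm.
Qed.

Lemma mean_value_near y : `|y| < d -> mean_value q y = q 0.
Proof.
move=> yd; rewrite /mean_value; case: eqVneq => // yn.
by rewrite primitive_linear// mulfK.
Qed.

Lemma primitive_le y : `|primitive q y| <= B * `|y|.
Proof.
have := @MVT_le _ (primitive q) q B 0 y (fun x => is_derive_primitive x cq).
by rewrite primitive0 !subr0; apply => x _.
Qed.

Lemma mean_value_bound y : `|mean_value q y| <= B.
Proof.
rewrite /mean_value; case: eqVneq => // yn.
by rewrite normrM normfV ler_pdivrMr ?normr_gt0// primitive_le.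
Qed.

Lemma is_derive_mean_value y : is_derive y (1 : R) (mean_value q) ((q y - mean_value q y) / y).
Proof.
have [yn|yd] := leP d `|y|; last first.
  rewrite mean_value_near// qd// subrr mul0r.
  have h0 : is_derive y (1 : R) (cst (q 0)) 0 by exact: is_derive_cst.
  apply: near_eq_is_derive h0; near=> t.
  rewrite mean_value_near//; near: t.
  have : \forall t \near y, `|y - t| < d - `|y|.
    by exists (d - `|y|) => //=; rewrite subr_gt0.
  apply: filterS => t h; rewrite -(subrK y t); apply: le_lt_trans (ler_normD _ _) _.
  by rewrite distrC -ltrBrDr.
have y0 : y != 0 by rewrite -normr_gt0 (lt_le_trans d0).
have h : is_derive y (1 : R) (fun y => primitive q y * y^-1) (primitive q y *: (- y ^- 2) + y^-1 *: q y).
  apply: is_deriveM; first exact: is_derive_primitive.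
  apply: is_derive_eq; first by apply: is_deriveV.
  by rewrite /GRing.scale/= mulr1.
apply: near_eq_is_derive (is_derive_eq h _).
  exists `|y|; first by rewrite /= normr_gt0.
  move=> t /= yt; rewrite /mean_value; case: eqVneq => // t0.
  by rewrite t0 subr0 ltxx in yt.
by rewrite /mean_value (negbTE y0) /GRing.scale/=; field.
Unshelve. all: by end_near. Qed.

Lemma continuous_mean_value : continuous (mean_value q).
Proof. by move=> y; exact: is_derive_continuous (is_derive_mean_value y). Qed.

Lemma continuous_dmean_value : continuous (fun y => (q y - mean_value q y) / y).
Proof.
move=> y; have [->|y0] := eqVneq y 0.
  apply: (near_cst_continuous 0); exists d => // t /=; rewrite sub0r normrN => td.
  by rewrite mean_value_near// qd// subrr mul0r.
apply: (@cvgM _ R); first by apply: (@cvgB _ R); [exact: cq|exact: continuous_mean_value].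
by apply: (@cvgV _ R); [|exact: cvg_id].
Qed.

(* The radial solution of [- laplacian z = q]. *)
Definition potential y : R := - IL (fun t => (y <= t)%R%:R * (- (mean_value q t) / 4)).

Lemma H10_potential : H10grad (fun x => potential (sqn x))
  (fun x => - (mean_value q (sqn x)) / 4 * (2 * x.1)) (fun x => - (mean_value q (sqn x)) / 4 * (2 * x.2)).
Proof.
apply: (H10_radial (p := fun y => - (mean_value q y) / 4) (y0 := 2) (M := B / 4) _ _ _ (fun y _ => erefl)).2.
- by move=> y; rewrite normrM normrN ger0_norm// ler_wpM2r// mean_value_bound.
- move=> y _; apply: (@cvgM _ R); last exact: cvg_cst.
  by apply: (@cvgN _ R); exact: continuous_mean_value.
- by rewrite /= in_itv/= => /andP[_]; lra.
Qed.

(** The field x M(|x|^2), with M the mean value of q, has divergence 2 M + 2 y M' = 2 q; pairing it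
    with v by [H10_div] gives the weak equation. *)
Lemma potential_weak (v h1 h2 : R * R -> R) : H10grad v h1 h2 ->
  I (fun x => - (mean_value q (sqn x)) / 4 * (2 * x.1) * h1 x + - (mean_value q (sqn x)) / 4 * (2 * x.2) * h2 x) =
  I (fun x => q (sqn x) * v x).
Proof.
move=> hv; have hR := C1P_comp C1P_sqn is_derive_mean_value continuous_dmean_value.
have E := H10_div (C1PM C1P_fst hR) (C1PM C1P_snd hR) hv.
have Lq : L2 (fun x : R * R => q (sqn x)) := L2_continuous (continuous_radial cq).
have Lv : L2 v by case: hv => /H10_L2.
have L1 : L2 h1 by case: hv => _ /is_wd_L2.
have L2' : L2 h2 by case: hv => _ _ /is_wd_L2.
have LX1 := L2_continuous (C1P_continuous (C1PM C1P_fst hR)).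
have LX2 := L2_continuous (C1P_continuous (C1PM C1P_snd hR)).
have j1 := IntD (L2M LX1 L1) (L2M LX2 L2'); have j2 := L2M Lq Lv.
have E2 : I (fun x => x.1 * mean_value q (sqn x) * h1 x + x.2 * mean_value q (sqn x) * h2 x) + 2 * I (fun x => q (sqn x) * v x) = 0.
  rewrite -(I_Z 2 j2) -(I_D j1 (IntZ 2 j2)) -[RHS]E; apply: I_eq => x _.
  have -> : 2 * (q (sqn x) * v x) = (x.1 * ((q (sqn x) - mean_value q (sqn x)) / sqn x * (2 * x.1)) + mean_value q (sqn x) * cst 1 x +
    (x.2 * ((q (sqn x) - mean_value q (sqn x)) / sqn x * (2 * x.2)) + mean_value q (sqn x) * cst 1 x)) * v x; last by [].
  rewrite mulrA; congr (_ * _); rewrite /cst.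
  have -> : x.1 * ((q (sqn x) - mean_value q (sqn x)) / sqn x * (2 * x.1)) + mean_value q (sqn x) * 1 +
    (x.2 * ((q (sqn x) - mean_value q (sqn x)) / sqn x * (2 * x.2)) + mean_value q (sqn x) * 1) =
    2 * (sqn x * ((q (sqn x) - mean_value q (sqn x)) / sqn x)) + 2 * mean_value q (sqn x).
    by move: ((q (sqn x) - mean_value q (sqn x)) / sqn x) (mean_value q (sqn x)) => a c; rewrite /sqn; ring.
  have [e|e] := eqVneq (sqn x) 0.
    by rewrite e mul0r mulr0 add0r /mean_value eqxx.
  by rewrite [sqn x * _]mulrC divfK//; ring.
move: E2 => /eqP; rewrite addr_eq0 => /eqP E3.
transitivity (- (1 / 2) * I (fun x => x.1 * mean_value q (sqn x) * h1 x + x.2 * mean_value q (sqn x) * h2 x)).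
  rewrite -(I_Z _ j1); apply: I_eq => x _.
  by move: (mean_value q (sqn x)) => a; field.
by rewrite E3; field.
Qed.

End Potential.

End RadialPotential.

(** * Concentration *)

Section Concentration.
Context {R : realType}.
Local Notation mu := (@lebesgue_measure R).
Local Notation mu2 := ((@lebesgue_measure R \x @lebesgue_measure R)%E).
Local Notation mR := (measurableTypeR R).
Local Notation mf1 := (@measurable_fun _ _ (measurableTypeR R) R).
Local Notation I01 := `[(0 : R), 1[%classic.
Local Notation I u := (Rintegral mu2 disk u).
Local Notation IL u := (Rintegral mu I01 u).
Local Notation IntL u := (mu.-integrable I01 (EFin \o u)).

Lemma primitive_IL (q : R -> R) (y : R) : continuous q -> I01 y ->
  primitive q y = IL (fun t => (t < y)%R%:R * q t).
Proof.
move=> cq; rewrite /= in_itv/= => /andP[y0 y1].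
have [i1 e1] := IL_ge_primitive cq y0 (ltW y1).
have [i2 e2] := IL_ge_primitive cq (lexx 0) ler01.
rewrite primitive0 subr0 in e2.
transitivity (IL (fun t => (0 <= t)%R%:R * q t - (y <= t)%R%:R * q t)).
  by rewrite (IL_B i2 i1) e1 e2; ring.
apply: IL_eq => t; rewrite /= in_itv/= => /andP[-> _]; rewrite mul1r.
by case: (ltP t y) => _; rewrite ?mul1r ?mul0r ?subr0 ?subrr.
Qed.

Lemma polygon_scale n (m b : 'I_n -> R) (s t : R) : 0 < s ->
  polygon m (fun i => s * b i) t = s * polygon m b (t / s).
Proof.
move=> s0; rewrite /polygon mulr_sumr; apply: eq_bigr => i _.
rewrite mulrCA; congr (_ * _); rewrite minr_pMr ?(ltW s0)//.
by rewrite [s * (t / s)]mulrC divfK// gt_eqF.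
Qed.

Variables (n : nat) (m b : 'I_n -> R) (i0 : 'I_n).
Hypothesis insc : inscribed m b.
Variables (rho eps : R) (sep : well_separated b rho).
Hypotheses (eps0 : 0 < eps) (epsk : eps <= kappa m * rho / 2) (eps1 : eps <= 1)
  (epsr : eps * (2 / rho) <= rho).
Variable f : R -> R.
Hypotheses (fC1 : C1 f) (f0 : f 0 = 0) (fcrit : critical_growth f).
Variables (Kc th : R).
Hypotheses (K0 : 0 < Kc) (th0 : 0 < th) (th1 : th < 1 / 2)
  (HK : forall s tau, 1 <= s -> 0 <= tau ->
      Num.sqrt s * `|f (Num.sqrt s * profile m b rho (fun=> - eps) (tau / s))| <= Kc * expR ((1 - th) * tau)).
Variables (s : R) (h : 'I_n -> R).
Hypotheses (s1 : 1 <= s) (he : forall i, `|h i| <= eps)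
  (hm : forall i, mass m b rho f s i (h i) = m i)
  (hf : forall i t, 0 < t -> t < 1 -> chi b rho s i t = 1 ->
     0 <= f (Num.sqrt s * (polygon m b (sigma s t) + h i * hat rho (b i) (sigma s t)))).
Implicit Types (t y : R) (i : 'I_n).

Local Notation sq := (Num.sqrt s).
Local Notation shell i := (chi b rho s i).
Local Notation top := (polygon m b (reach b)).

(* With [y = |x|^2] this is the dilated corrected tower [delta_(1/s) (mu_C + v)],
   for [v r = hats rho h b (- 2 ln r)]. *)
Definition conc y : R := sq^-1 * tlog m (fun i => s * b i) y + sq * hats rho h b (- ln y / s).

Definition dconc y : R :=
  sq^-1 * dtlog m (fun i => s * b i) y + sq * (dhats rho h b (- ln y / s) * - (s * y)^-1).

Let s0 : 0 < s. Proof. exact: lt_le_trans ltr01 s1. Qed.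

Let sq0 : 0 < sq. Proof. by rewrite sqrtr_gt0. Qed.

Let sqs : sq * sq = s. Proof. by rewrite -expr2 sqr_sqrtr// ltW. Qed.

Let r0 : 0 < rho. Proof. by case: sep. Qed.

Let p32 : 0 < 32 * pi :> R. Proof. by apply: mulr_gt0; [rewrite ltr0n|exact: pi_gt0]. Qed.

Let p8 : 0 < 8 * pi :> R. Proof. by apply: mulr_gt0; [rewrite ltr0n|exact: pi_gt0]. Qed.

Let sb i : 0 < s * b i. Proof. by rewrite mulr_gt0// (ins_b insc). Qed.

Let e0 : 0 < expR (- (s * reach b)). Proof. exact: expR_gt0. Qed.

Let e1 : expR (- (s * reach b)) <= 1.
Proof. by rewrite expR_le1 oppr_le0 mulr_ge0 ?ltW// (reach_gt0 insc). Qed.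

Lemma hats_log : [/\ forall y, is_derive y (1 : R) (fun y => hats rho h b (- ln y / s)) (dhats rho h b (- ln y / s) * - (s * y)^-1),
      continuous (fun y => dhats rho h b (- ln y / s) * - (s * y)^-1) &
      forall y, expR (- (s * rho)) <= y -> hats rho h b (- ln y / s) = 0 /\ dhats rho h b (- ln y / s) = 0].
Proof.
apply: (log_comp (be := reach b) s0 r0 (is_derive_hats rho h b) (@continuous_dhats _ _ rho h b)).
  by move=> t ht; exact: (hats_small sep h ht).
by move=> t ht; exact: (hats_reach insc sep h ht).
Qed.

Lemma continuous_conc : continuous conc.
Proof.
move=> y; apply: (@cvgD _ R).
  by apply: (@cvgM _ R); [exact: cvg_cst|exact: continuous_tlog].
apply: (@cvgM _ R); first exact: cvg_cst.
by have [D _ _] := hats_log; exact: is_derive_continuous (D y).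
Qed.

Lemma conc_pos y : 0 < y -> conc y = sq * profile m b rho h (- ln y / s).
Proof.
move=> y0; rewrite /conc tlogE// polygon_scale// /profile mulrDr; congr (_ + _).
by rewrite mulrA -{2}sqs mulrA mulVf ?mul1r// gt_eqF.
Qed.

(** The profile is constant beyond [reach], hence u is constant near the centre; this is what
    [mean_value] needs in order to be smooth there. *)
Lemma conc_const y : y <= expR (- (s * reach b)) -> conc y = conc 0.
Proof.
move=> hy; have cap z i : z <= expR (- (s * reach b)) -> capped_log (s * b i) z = s * b i.
  move=> hz; rewrite /capped_log max_r ?expRK ?opprK//; apply: le_trans hz _.
  by rewrite ler_expR lerN2 ler_pM2l//; have := le_reach insc i; lra.
have hh z : z <= expR (- (s * reach b)) -> hats rho h b (- ln z / s) = 0.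
  move=> hz; have [z0|z0] := leP z 0.
    by rewrite ln0// oppr0 mul0r; exact: (hats_small sep h (ltW r0)).1.
  apply: (hats_reach insc sep h _).1; rewrite ler_pdivlMr// lerNr mulrC -[leRHS]expRK ler_ln ?posrE//.
rewrite /conc !hh ?(ltW e0)//; congr (_ * _ + _); apply: eq_bigr => i _.
by rewrite !cap// ltW.
Qed.

Lemma conc_bound y : y <= 1 -> 0 <= conc y <= sq * (top + 1).
Proof.
have pos z : 0 < z -> z <= 1 -> 0 <= conc z <= sq * (top + 1).
  move=> z0 z1; rewrite conc_pos//.
  have t0 : 0 <= - ln z / s by rewrite divr_ge0 ?(ltW s0)// oppr_ge0 ln_le0.
  have [p0 _ _] := profile_bound i0 insc sep eps0 epsk he t0.
  rewrite mulr_ge0 ?(ltW sq0)//= ler_wpM2l ?(ltW sq0)// /profile lerD ?polygon_le_reach//.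
  have [hb _] := hats_bound sep (- ln z / s) (ltW eps0) he.
  by apply: le_trans (ler_norm _) _; apply: le_trans hb eps1.
move=> y1; have [y0|y0] := leP y (expR (- (s * reach b))); last by apply: pos => //; exact: lt_trans y0.
by rewrite conc_const// -(conc_const (lexx _)); exact: pos.
Qed.

Lemma H10_conc : H10grad (fun x => conc (sqn x)) (fun x => dconc (sqn x) * (2 * x.1)) (fun x => dconc (sqn x) * (2 * x.2)).
Proof.
have [D cD out] := hats_log.
have e1' : expR (- (s * rho)) < 1 by rewrite expR_lt1 oppr_lt0 mulr_gt0.
have h1 := radial_H10grad D cD e1' (fun y hy => (out y hy).1).
have h2 := (H10_tlog m sb).2.
apply: (H10grad_eq (H10gradD (H10gradZ sq^-1 h2) (H10gradZ sq h1))) => x _ //; rewrite /dconc.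
  by move: (dhats _ _ _ _) (s * _)^-1 => z w; ring.
by move: (dhats _ _ _ _) (s * _)^-1 => z w; ring.
Qed.

Lemma mf_dconc : mf1 I01 dconc.
Proof.
have [_ cD _] := hats_log; apply: measurable_funD; apply: measurable_funM; try exact: measurable_cst.
  by have [] := H10_tlog m sb.
by apply: measurable_funTS; exact: continuous_measurable_fun.
Qed.

(* The minimum with 1 extends the source continuously outside the disk. *)
Definition source y : R := f (conc (Num.min y 1)) / (8 * pi).

Definition charge y : R := sq / (32 * pi) * f (conc y).

Lemma continuous_source : continuous source.
Proof.
move=> y; apply: (@cvgM _ R); last exact: cvg_cst.
have h1 : {for y, continuous (fun y => conc (Num.min y 1))}.
  by apply: (continuous_compose (k := fun y => Num.min y 1)); [exact: continuous_min_l|exact: continuous_conc].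
exact: continuous_compose h1 (f_continuous fC1).
Qed.

Lemma charge_bounded : exists2 B, 0 < B & forall y, y <= 1 -> `|charge y| <= B.
Proof.
have [B B0 HB] := continuous_bounded 0 (sq * (top + 1)) (f_continuous fC1).
have c0 : 0 < sq / (32 * pi) by rewrite divr_gt0.
exists (sq / (32 * pi) * B); first exact: mulr_gt0.
by move=> y y1; rewrite normrM (gtr0_norm c0) ler_pM2l//; apply: HB; exact: conc_bound.
Qed.

Lemma source_bounded : exists B, forall y, `|source y| <= B.
Proof.
have [B B0 HB] := continuous_bounded 0 (sq * (top + 1)) (f_continuous fC1).
exists (B / (8 * pi)) => y; rewrite normrM normfV (gtr0_norm p8) ler_pM2r ?invr_gt0//.
by apply: HB; apply: conc_bound; rewrite ge_min lexx orbT.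
Qed.

Lemma source_near y : `|y| < expR (- (s * reach b)) -> source y = source 0.
Proof.
move=> hy; have hy' := ltW (le_lt_trans (ler_norm y) hy).
rewrite /source !min_l ?(le_trans hy' e1)//; congr (f _ / _).
by rewrite conc_const.
Qed.

Lemma source_charge y : I01 y -> sq / 4 * source y = charge y.
Proof.
rewrite /= in_itv/= => /andP[_ y1]; rewrite /source /charge min_l ?ltW//.
have := lt0r_neq0 (pi_gt0 R); move: (pi : R) => z z0; by field.
Qed.

Lemma mf_charge : mf1 I01 charge.
Proof.
apply: measurable_funTS; apply: measurable_funM; first exact: measurable_cst.
apply: continuous_measurable_fun => y; exact: continuous_compose (continuous_conc (x := y)) (f_continuous fC1).
Qed.

Lemma chi_charge i t : I01 t -> shell i t * charge t = shell i t * node_density m b rho f s i (h i) t.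
Proof.
rewrite /= in_itv/= => /andP[t0 t1]; have [->|hc] := chi_bool b rho s i t; first by rewrite !mul0r.
have tp : 0 < t.
  move: hc; rewrite /chi; case: (boolP (_ <= _ < _)) => [/andP[hc _] _|_ /eqP]; last by rewrite eq_sym oner_eq0.
  exact: lt_le_trans (expR_gt0 _) hc.
by rewrite hc !mul1r /charge conc_pos// /node_density /profile (hats_near sep h (chi_near s0 tp hc)).1.
Qed.

Lemma chi_charge_ge0 i t : I01 t -> 0 <= shell i t * charge t.
Proof.
move=> It; rewrite chi_charge//; have [->|hc] := chi_bool b rho s i t; first by rewrite mul0r.
have := It; rewrite /= in_itv/= => /andP[t0 t1].
have tp : 0 < t.
  move: hc; rewrite /chi; case: (boolP (_ <= _ < _)) => [/andP[hc _] _|_ /eqP]; last by rewrite eq_sym oner_eq0.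
  exact: lt_le_trans (expR_gt0 _) hc.
rewrite hc mul1r /node_density; apply: mulr_ge0; first by rewrite divr_ge0 ?ltW.
exact: hf.
Qed.

Lemma IntL_chi_charge i : IntL (fun t => shell i t * charge t) /\ IL (fun t => shell i t * charge t) = m i.
Proof.
have h1 : `|h i| <= 1 by exact: le_trans (he i) eps1.
have ii := IntL_mass insc rho fC1 i s0 h1.
split; first by apply: IntL_eq ii => t It; rewrite chi_charge.
by rewrite -hm /mass; apply: IL_eq => t It; rewrite chi_charge.
Qed.

Definition rest t : R := (1 - \sum_i shell i t) * charge t.

Lemma restE t : \sum_i shell i t * charge t + rest t = charge t.
Proof. by rewrite /rest -mulr_suml -mulrDl addrC subrK mul1r. Qed.

(** Off the annuli every hat vanishes, so the actual profile coincides with the lowered one, to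
    which the decay hypothesis applies. *)
Lemma rest_bound t : 0 < t -> t < 1 -> `|rest t| <= Kc / (32 * pi) * expR ((1 - th) * - ln t).
Proof.
move=> t0 t1.
have nn : 0 <= Kc / (32 * pi) * expR ((1 - th) * - ln t) by rewrite mulr_ge0 ?expR_ge0// divr_ge0 ?ltW.
have [[i hi]|H] : (exists i, shell i t = 1) \/ (forall i, shell i t = 0).
- have [/existsP[i /eqP hi]|/existsPn H] := boolP [exists i, shell i t == 1]; first by left; exists i.
  by right => i; case: (chi_bool b rho s i t) => // hi; have := H i; rewrite hi eqxx.
- rewrite /rest (bigD1 i)//= hi big1 ?addr0 ?subrr ?mul0r ?normr0// => j ji.
  case: (chi_bool b rho s j t) => // hj.
  by move: ji; rewrite (chi_uniq sep s0 t0 hj hi) eqxx.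
have far := far_of_chi sep s0 t0 H.
rewrite /rest big1 ?subr0 ?mul1r; last by move=> i _; exact: H.
rewrite /charge conc_pos// /profile (hats_far sep h far).1 -(hats_far sep (fun=> - eps) far).1 -/(profile _ _ _ _ _).
have c0 : 0 <= sq / (32 * pi) by rewrite divr_ge0 ?(ltW sq0) ?(ltW p32).
rewrite normrM (ger0_norm c0) mulrAC [leRHS]mulrAC ler_pM2r ?invr_gt0//.
by apply: HK => //; rewrite oppr_ge0 ln_le0// ltW.
Qed.

Lemma chi_sum_bound t : 0 < t -> 0 <= 1 - \sum_i shell i t <= 1.
Proof.
move=> t0; have [[i hi]|H] : (exists i, shell i t = 1) \/ (forall i, shell i t = 0).
- have [/existsP[i /eqP hi]|/existsPn H] := boolP [exists i, shell i t == 1]; first by left; exists i.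
  by right => i; case: (chi_bool b rho s i t) => // hi; have := H i; rewrite hi eqxx.
- rewrite (bigD1 i)//= hi big1 ?addr0 ?subrr ?lexx ?ler01// => j ji.
  case: (chi_bool b rho s j t) => // hj.
  by move: ji; rewrite (chi_uniq sep s0 t0 hj hi) eqxx.
by rewrite big1 ?subr0 ?lexx ?ler01// => i _; exact: H.
Qed.

Lemma chi0 i : shell i 0 = 0.
Proof. by rewrite /chi leNgt expR_gt0. Qed.

Lemma rest_charge t : I01 t -> `|rest t| <= `|charge t|.
Proof.
rewrite /= in_itv/= => /andP[t0 t1]; rewrite /rest normrM; apply: ler_piMl => //.
move: t0; rewrite le_eqVlt => /predU1P[<-|t0].
  by rewrite big1 ?subr0 ?normr1// => i _; exact: chi0.
by have /andP[c0 c1] := chi_sum_bound t0; rewrite ger0_norm.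
Qed.

Lemma mf_rest : mf1 I01 rest.
Proof.
apply: measurable_funM; last exact: mf_charge.
apply: measurable_funB; first exact: measurable_cst.
by apply: measurable_sum => i; exact: measurable_chi.
Qed.

Lemma IntL_rest : IntL rest.
Proof.
have [B B0 HB] := charge_bounded.
apply: (IntL_bounded mf_rest (B := B)) => t It; apply: le_trans (rest_charge It) (HB _ _).
by move: It; rewrite /= in_itv/= => /andP[_ /ltW].
Qed.

Lemma mf_below (q : R -> R) y : mf1 I01 q -> mf1 I01 (fun t => (t < y)%R%:R * q t).
Proof.
move=> mq; have h1 : mf1 I01 (fun t => (0 <= t < y)%R%:R * q t).
  by apply: measurable_funM => //; apply: measurable_funTS; exact: mf_indic.
by apply: eq_measurable_fun h1 => t; rewrite inE /= in_itv/= => /andP[-> _].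
Qed.

Lemma IntL_below (q : R -> R) y : IntL q -> IntL (fun t => (t < y)%R%:R * q t).
Proof.
move=> iq; apply: (IntL_le (mf_below y (IntL_mf iq)) (IntL_norm iq)) => t _.
by case: (t < y); rewrite ?mul1r ?mul0r ?normr0 ?lexx.
Qed.

Lemma IntL_charge : IntL charge.
Proof.
have [B B0 HB] := charge_bounded; apply: (IntL_bounded mf_charge (B := B)) => t It; apply: HB.
by move: It; rewrite /= in_itv/= => /andP[_ /ltW].
Qed.

Lemma inner_charge y : I01 y -> sq / 4 * primitive source y = IL (fun t => (t < y)%R%:R * charge t).
Proof.
move=> Iy; rewrite (primitive_IL continuous_source Iy).
have is_ : IntL source.
  have [B HB] := source_bounded.
  apply: (IntL_bounded (B := B)) => [|t _]; last exact: HB.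
  by apply: measurable_funTS; exact: (continuous_measurable_fun continuous_source).
rewrite -(IL_Z _ (IntL_below y is_)); apply: IL_eq => t It.
by rewrite mulrCA source_charge.
Qed.

Lemma inner_charge_split y : IL (fun t => (t < y)%R%:R * charge t) =
  \sum_i IL (fun t => (t < y)%R%:R * (shell i t * charge t)) + IL (fun t => (t < y)%R%:R * rest t).
Proof.
have [i1 e] := IL_sum (fun i => IntL_below y (IntL_chi_charge i).1).
rewrite -e -(IL_D i1 (IntL_below y IntL_rest)); apply: IL_eq => t _.
by rewrite -mulr_sumr -mulrDr restE.
Qed.

Lemma chi_range i y : shell i y = 1 \/ shell i y = 0 /\
  (y <= expR (- (s * (b i + rho))) \/ expR (- (s * (b i - rho))) <= y).
Proof.
rewrite /chi; case: (boolP (_ <= _ < _)) => [_|]; first by left.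
by rewrite negb_and -ltNge -leNgt => /orP[h1|h1]; right; split => //; [left; exact: ltW|right].
Qed.

(** The accumulated charge and the jump are both 0 below the annulus and both m i above it. Within
    the annulus both lie in [0, m i], as the charge there is nonnegative. *)
Lemma node_charge i y : I01 y ->
  `|IL (fun t => (t < y)%R%:R * (shell i t * charge t)) - m i * (expR (- (s * b i)) < y)%R%:R| <= m i * shell i y.
Proof.
move=> Iy; have [ic mc] := IntL_chi_charge i; have m0 := ins_m insc i.
have b0 : 0 <= IL (fun t => (t < y)%R%:R * (shell i t * charge t)).
  rewrite -[leLHS](IL_cst 0); apply: (IL_le (IntL_cst 0) (IntL_below y ic)) => t It /=.
  by rewrite mulr_ge0// chi_charge_ge0.
have b1 : IL (fun t => (t < y)%R%:R * (shell i t * charge t)) <= m i.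
  rewrite -[leRHS]mc; apply: (IL_le (IntL_below y ic) ic) => t It /=.
  by have := chi_charge_ge0 i It; case: (t < y) => h0; rewrite ?mul1r ?mul0r.
have [->|[-> [hy|hy]]] := chi_range i y; rewrite ?mulr1 ?mulr0.
- rewrite ler_norml; move: b0 b1; move: (IL _) => v v0 v1.
  by case: (_ < y) => /=; apply/andP; split; lra.
- rewrite (_ : (_ < y) = false); last first.
    by apply/negbTE; rewrite -leNgt; apply: le_trans hy _; rewrite ler_expR lerN2 ler_pM2l// lerDl ltW.
  rewrite mulr0 subr0 (_ : IL _ = 0) ?normr0//.
  rewrite -[RHS](IL_cst 0); apply: IL_eq => t _ /=.
  case: (ltP t y) => ty; last by rewrite mul0r.
  by rewrite /chi leNgt (lt_le_trans ty hy) mul0r mulr0.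
- rewrite (_ : (_ < y) = true); last first.
    by apply: lt_le_trans hy; rewrite ltr_expR ltrN2 ltr_pM2l// ltrBlDr ltrDl.
  rewrite mulr1 (_ : IL _ = m i) ?subrr ?normr0//.
  rewrite -[RHS]mc; apply: IL_eq => t _ /=.
  case: (ltP t y) => ty; first by rewrite mul1r.
  by rewrite /chi [t < _]ltNge (le_trans hy ty) andbF !mul0r.
Qed.

Lemma rest_charge_le y : 0 < y -> y <= 1 ->
  `|IL (fun t => (t < y)%R%:R * rest t)| <= Kc / (32 * pi) / th * expR (th * ln y).
Proof.
move=> y0 y1; have [B B0 HB] := charge_bounded.
apply: le_trans (IL_abs (IntL_below y IntL_rest)) _.
apply: (@IL_pow_le _ _ _ _ _ B) => //.
- by rewrite divr_ge0 ?ltW.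
- exact: mf_below mf_rest.
- move=> t It; have t1 : t <= 1 by move: It; rewrite /= in_itv/= => /andP[_ /ltW].
  apply: le_trans (HB t t1); apply: le_trans _ (rest_charge It).
  by case: (t < y); rewrite ?mul1r ?mul0r ?normr0.
- by move=> t yt _; rewrite ltNge yt mul0r.
move=> t /andP[t0 ty]; rewrite ty mul1r; apply: rest_bound => //.
exact: lt_le_trans ty y1.
Qed.

(** A crude bound with a constant of no importance; it keeps the squared flux divided by y bounded
    near 0, so that integrability is settled before the sharp estimate. *)
Lemma rest_charge_linear : exists2 B, 0 <= B & forall y, 0 < y -> y <= 1 ->
  `|IL (fun t => (t < y)%R%:R * rest t)| <= B * y.
Proof.
have [B B0 HB] := charge_bounded; exists B; first exact: ltW.
move=> y y0 y1; apply: le_trans (IL_abs (IntL_below y IntL_rest)) _.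
apply: (@IL_le_primitive _ _ (fun t => B * t) (fun=> B) y B) => //.
- exact: mf_below mf_rest.
- move=> t It; have t1 : t <= 1 by move: It; rewrite /= in_itv/= => /andP[_ /ltW].
  apply: le_trans (HB t t1); apply: le_trans _ (rest_charge It).
  by case: (t < y); rewrite ?mul1r ?mul0r ?normr0.
- by move=> t yt _; rewrite ltNge yt mul0r.
- move=> t _; have h1 : is_derive t (1 : R) (fun t => B * t) (B * 1) by apply: is_deriveZ.
  by rewrite mulr1 in h1.
- by move=> t _; exact: cvg_cst.
- by move=> t t0; rewrite mulr_ge0 ?ltW.
move=> t /andP[t0 ty]; rewrite ty mul1r; have t1 := lt_le_trans ty y1.
apply: le_trans (rest_charge _) (HB _ (ltW t1)); rewrite /= in_itv/= t1.
by rewrite (ltW t0).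
Qed.

Definition step y : R := \sum_i m i * (expR (- (s * b i)) < y)%R%:R.

Lemma step_bound y : 0 <= step y <= kappa m.
Proof.
have m0 i := ins_m insc i.
apply/andP; split; first by apply: sumr_ge0 => i _; rewrite mulr_ge0 ?(ltW (m0 i)).
by apply: ler_sum => i _; case: (_ < y); rewrite ?mulr1 ?mulr0 ?(ltW (m0 i)).
Qed.

Lemma dtlog_step y : 0 < y -> y * dtlog m (fun i => s * b i) y = - step y.
Proof.
move=> y0; rewrite /dtlog /step mulr_sumr -sumrN; apply: eq_bigr => i _.
rewrite mulrCA -mulrN; congr (_ * _); rewrite /dcapped_log.
case: (leP y (expR (- (s * b i)))) => h1; first by rewrite mul0r oppr0 mulr0.
by rewrite mul1r mulrN divff ?gt_eqF.
Qed.

(** Up to sign the left side is the derivative of the profile in sigma: the slope of the line, which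
    is the sum of the jumps still ahead, plus the slope of the hats. *)
Lemma dconc_step y : 0 < y -> sq * y * dconc y = - (step y + dhats rho h b (- ln y / s)).
Proof.
move=> y0; rewrite /dconc mulrDr opprD -(dtlog_step y0); congr (_ + _).
  by rewrite mulrACA [sq * _]mulrC mulVf ?gt_eqF ?mul1r.
move: (dhats _ _ _ _) => z; rewrite !mulrN (_ : sq * y * (sq * (z / (s * y))) = sq * sq * y * (s * y)^-1 * z); last by ring.
by rewrite sqs divff ?mul1r// gt_eqF ?mulr_gt0.
Qed.

Definition outer y : R := (expR (- (s * reach b)) <= y < 1)%R%:R.

Lemma dhats_outer y : 0 < y -> y < 1 -> `|dhats rho h b (- ln y / s)| <= rho * outer y.
Proof.
move=> y0 y1; rewrite /outer y1 andbT; case: (leP (expR (- (s * reach b))) y) => hy.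
  by rewrite mulr1; apply: le_trans (hats_bound sep _ (ltW eps0) he).2 epsr.
rewrite mulr0 normr_le0; apply/eqP; apply: (hats_reach insc sep h _).2.
by rewrite ler_pdivlMr// lerNr mulrC -[leRHS]expRK ler_ln ?posrE ?(ltW hy).
Qed.

(** The measure dy / (s y) is d sigma, so this is the length of the interval [0, [reach]]. *)
Lemma IL_outer : IntL (fun y => outer y * (s * y)^-1) /\ IL (fun y => outer y * (s * y)^-1) = reach b.
Proof.
have D (x : R) : 0 < x -> is_derive x (1 : R) (fun x => s^-1 * ln x) ((s * x)^-1).
  by move=> x0; rewrite invfM; apply: is_deriveZ; exact: is_derive1_ln.
have C (x : R) : 0 < x -> {for x, continuous (fun x => (s * x)^-1)}.
  move=> x0; apply: (@cvgV _ R); first by rewrite mulf_neq0// gt_eqF.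
  by apply: (@cvgM _ R); [exact: cvg_cst|exact: cvg_id].
have [i1 e] := IL_itv e0 e1 (lexx 1) D C; split; first exact: i1.
by rewrite [LHS]e ln1 expRK mulr0 sub0r mulrN opprK mulrA mulVf ?mul1r// gt_eqF.
Qed.

Lemma IL_chi i : IntL (fun y => shell i y * (s * y)^-1) /\ IL (fun y => shell i y * (s * y)^-1) = 2 * rho.
Proof.
have D (x : R) : 0 < x -> is_derive x (1 : R) (fun x => s^-1 * ln x) ((s * x)^-1).
  by move=> x0; rewrite invfM; apply: is_deriveZ; exact: is_derive1_ln.
have C (x : R) : 0 < x -> {for x, continuous (fun x => (s * x)^-1)}.
  move=> x0; apply: (@cvgV _ R); first by rewrite mulf_neq0// gt_eqF.
  by apply: (@cvgM _ R); [exact: cvg_cst|exact: cvg_id].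
have l1 : expR (- (s * (b i + rho))) <= expR (- (s * (b i - rho))).
  by rewrite ler_expR lerN2 ler_pM2l//; move: r0; move: (b i) => x; lra.
have l2 : expR (- (s * (b i - rho))) <= 1.
  rewrite expR_le1 oppr_le0 mulr_ge0 ?(ltW s0)//.
  by have [_ _ /(_ i) hb _] := sep; move: r0 hb; move: (b i) => x; lra.
have [i1 e] := IL_itv (expR_gt0 _) l1 l2 D C; split; first exact: i1.
rewrite [LHS]e !expRK; move: (negbT (gt_eqF s0)) => sn; by field.
Qed.

Lemma mf_inv : mf1 I01 (fun y => (s * y)^-1).
Proof.
have m1 : @measurable_fun _ _ mR bool setT (fun t => 0 < t).
  by apply: measurable_fun_ltr => //; exact: measurable_cst.
have m2 : mf1 setT (fun y => expR (- ln y) / s * (0 < y)%R%:R).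
  apply: measurable_funM; last exact: (@measurable_comp _ _ _ mR bool R setT (fun b : bool => b%:R) setT).
  apply: measurable_funM; last exact: measurable_cst.
  apply: measurableT_comp; first exact: measurable_expR.
  by apply: measurable_funN; exact: measurable_ln.
have m3 : mf1 I01 (fun y => expR (- ln y) / s * (0 < y)%R%:R) by exact: measurable_funTS.
apply: eq_measurable_fun m3 => y; rewrite inE /= in_itv/= => /andP[+ _].
rewrite le_eqVlt => /predU1P[<-|y0]; first by rewrite ltxx !mulr0 invr0.
by rewrite y0 mulr1 expRN lnK ?posrE// invfM mulrC.
Qed.

(** Squaring K y^th / th and dividing by s y leaves a multiple of y^(2 th - 1), with integral 1 / (2
    th). The linear bound provides boundedness at 0. *)
Lemma tail_integral g : mf1 I01 g ->
  (forall y, 0 < y -> y <= 1 -> 0 <= g y <= Kc / (32 * pi) / th * expR (th * ln y)) ->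
  (exists2 B, 0 <= B & forall y, 0 < y -> y <= 1 -> g y <= B * y) ->
  IntL (fun y => g y ^+ 2 * (s * y)^-1) /\
  IL (fun y => g y ^+ 2 * (s * y)^-1) <= (Kc / (32 * pi)) ^+ 2 / (2 * th ^+ 3 * s).
Proof.
move=> mg gk [B B0 gB].
have mG : mf1 I01 (fun y => g y ^+ 2 * (s * y)^-1).
  apply: measurable_funM; first by apply: (measurable_funX 2).
  exact: mf_inv.
have bound t : I01 t -> `|g t ^+ 2 * (s * t)^-1| <= B ^+ 2.
  rewrite /= in_itv/= => /andP[]; rewrite le_eqVlt => /predU1P[<-|t0] t1.
    by rewrite mulr0 invr0 mulr0 normr0 sqr_ge0.
  have st : 0 < s * t by rewrite mulr_gt0.
  have /andP[g0 _] := gk t t0 (ltW t1).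
  rewrite ger0_norm; last by rewrite mulr_ge0 ?sqr_ge0// invr_ge0 ltW.
  rewrite ler_pdivrMr//; apply: le_trans (_ : (B * t) ^+ 2 <= _).
    by rewrite lerXn2r ?nnegrE ?(mulr_ge0 B0 (ltW t0))//; exact: gB (ltW t1).
  rewrite exprMn ler_wpM2l ?sqr_ge0// expr2 ler_pM2r//.
  exact: le_trans (ltW t1) s1.
have iG := IntL_bounded mG bound.
split => //; apply: le_trans (ler_norm _) _; apply: le_trans (IL_abs iG) _.
set K := Kc / _ in gk *; have K1 : 0 < K by rewrite divr_gt0.
have c0 : 0 <= (K / th) ^+ 2 / s by rewrite divr_ge0 ?sqr_ge0 ?ltW.
have th2 : 0 < 2 * th by rewrite mulr_gt0.
rewrite (_ : _ / _ = (K / th) ^+ 2 / s / (2 * th) * expR (2 * th * ln 1)); last first.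
  by rewrite ln1 mulr0 expR0; move: (negbT (gt_eqF s0)) (negbT (gt_eqF th0)) => h1 h2; field; rewrite h1 h2.
apply: (@IL_pow_le _ _ _ _ _ (B ^+ 2)) => //.
  by move=> t t1 /lt_geF; rewrite t1.
move=> t /andP[t0 t1]; have st : 0 < s * t by rewrite mulr_gt0.
have /andP[g0 g1] := gk t t0 (ltW t1).
rewrite ger0_norm; last by rewrite mulr_ge0 ?sqr_ge0// invr_ge0 ltW.
apply: le_trans (_ : (K / th * expR (th * ln t)) ^+ 2 * (s * t)^-1 <= _).
  by rewrite ler_pM2r ?invr_gt0// lerXn2r ?nnegrE// (le_trans g0).
rewrite exprMn -mulrA (_ : expR ((1 - 2 * th) * - ln t) = expR (th * ln t) ^+ 2 / t); last first.
  by rewrite -[in RHS](lnK t0) -expRN expRK -expRM_natl -expRD; congr expR; ring.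
by rewrite -mulrA ler_wpM2l ?sqr_ge0// invfM mulrCA.
Qed.

Definition defect y : R := dconc y - - mean_value source y / 4.

Lemma H10_conc_sub_potential : H10grad (fun x => conc (sqn x) - potential source (sqn x))
  (fun x => defect (sqn x) * (2 * x.1)) (fun x => defect (sqn x) * (2 * x.2)).
Proof.
have [B HB] := source_bounded.
have hp := H10_potential continuous_source HB e0 source_near.
apply: (H10grad_eq (H10gradB H10_conc hp)) => x _ //; by rewrite /defect mulrBl.
Qed.

(** Both fluxes are step functions up to errors: the jumps cancel except within the annuli, and what
    remains is the charge off the nodes and the slope of the hats. *)
Lemma defect_bound y : 0 < y -> y < 1 -> `|sq * y * defect y| <=
  \sum_i m i * shell i y + `|IL (fun t => (t < y)%R%:R * rest t)| + rho * outer y.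
Proof.
move=> y0 y1; have Iy : I01 y by rewrite /= in_itv/= y1 ltW.
have -> : sq * y * defect y =
    \sum_i (IL (fun t => (t < y)%R%:R * (shell i t * charge t)) - m i * (expR (- (s * b i)) < y)%R%:R) +
    IL (fun t => (t < y)%R%:R * rest t) - dhats rho h b (- ln y / s).
  rewrite /defect mulrBr dconc_step// /mean_value gt_eqF// (_ : sq * y * (- (primitive source y / y) / 4) = - (sq / 4 * primitive source y)).
    by rewrite inner_charge// inner_charge_split sumrB /step; move: (IL _) (\sum_i _) (\sum_i _) (dhats _ _ _ _) => p q r d; ring.
  by move: (primitive _ _) => p; field; rewrite gt_eqF.
apply: le_trans (ler_normB _ _) _; apply: lerD; last exact: dhats_outer.
apply: le_trans (ler_normD _ _) _; rewrite lerD2r.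
by apply: le_trans (ler_norm_sum _ _ _) _; apply: ler_sum => i _; exact: node_charge.
Qed.

Lemma mf_defect : mf1 I01 defect.
Proof.
apply: measurable_funB; first exact: mf_dconc.
apply: measurable_funM; last exact: measurable_cst.
apply: measurable_funN; apply: measurable_funTS.
exact: (continuous_measurable_fun (continuous_mean_value continuous_source e0 source_near)).
Qed.

Lemma sqr_sum3_le (p q r : R) : (p + q + r) ^+ 2 <= 3 * (p ^+ 2 + q ^+ 2 + r ^+ 2).
Proof. by have := sqr_ge0 (p - q); have := sqr_ge0 (q - r); have := sqr_ge0 (p - r); rewrite !expr2; nra. Qed.

Lemma chi_sum_sqr y : (\sum_i m i * shell i y) ^+ 2 <= kappa m * \sum_i m i * shell i y.
Proof.
have m0 i := ins_m insc i.
have c01 i : 0 <= shell i y <= 1 by case: (chi_bool b rho s i y) => ->; rewrite ?lexx ?ler01.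
rewrite expr2 ler_wpM2r//.
  by apply: sumr_ge0 => i _; have /andP[c0 _] := c01 i; rewrite mulr_ge0 ?(ltW (m0 i)).
by apply: ler_sum => i _; have /andP[_ c1] := c01 i; rewrite ler_piMr ?(ltW (m0 i)).
Qed.

Lemma outer_bool y : outer y ^+ 2 = outer y.
Proof. by rewrite /outer; case: (_ <= _ < _); rewrite ?expr1n ?expr0n. Qed.

(* By [dconc_step] and [defect_bound] the weighted gradient is the difference of
   two functions increasing by [m i] at the i-th node; they disagree only in the
   annuli [chi], up to the decaying contribution of [rest]. *)
Lemma gradient_defect : grad_norm (fun x => conc (sqn x) - potential source (sqn x)) ^+ 2 <=
  4 * pi * (6 * kappa m ^+ 2 * rho + 3 * rho ^+ 2 * reach b +
            3 * ((Kc / (32 * pi)) ^+ 2 / (2 * th ^+ 3 * s))).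
Proof.
have [B B0 HB] := rest_charge_linear; have c1 : 0 < Kc / (32 * pi) / th by rewrite !divr_gt0.
(* A measurable majorant of the charge off the nodes, with both the sharp and the linear bound. *)
pose g y := Num.min (Kc / (32 * pi) / th * expR (th * ln y)) (B * y).
have mg : mf1 I01 g.
  apply: measurable_minr.
    apply: measurable_funM; first exact: measurable_cst.
    apply: measurableT_comp; first exact: measurable_expR.
    apply: measurable_funM; first exact: measurable_cst.
    by apply: measurable_funTS; exact: measurable_ln.
  by apply: measurable_funM; [exact: measurable_cst|exact: measurable_id].
have gE y : 0 < y -> y <= 1 -> `|IL (fun t => (t < y)%R%:R * rest t)| <= g y.
  by move=> y0 y1; rewrite le_min rest_charge_le// HB.
have [ig eg] : IntL (fun y => g y ^+ 2 * (s * y)^-1) /\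
  IL (fun y => g y ^+ 2 * (s * y)^-1) <= (Kc / (32 * pi)) ^+ 2 / (2 * th ^+ 3 * s).
  apply: tail_integral => //.
    move=> y y0 y1; rewrite ge_min lexx andbT le_min (mulr_ge0 B0 (ltW y0)) andbT.
    by rewrite mulr_ge0 ?expR_ge0// ltW.
  by exists B => // y y0 y1; rewrite ge_min lexx orbT.
pose N i y : R := 3 * kappa m * m i * (shell i y * (s * y)^-1).
have [iN eN] := IL_sum (F := N) (fun i => IntL_Z (3 * kappa m * m i) (IL_chi i).1).
have iO := IntL_Z (3 * rho ^+ 2) IL_outer.1.
have iG := IntL_Z 3 ig.
pose dom y := \sum_i N i y + (3 * rho ^+ 2 * (outer y * (s * y)^-1) + 3 * (g y ^+ 2 * (s * y)^-1)).
have idom : IntL dom := IntL_D iN (IntL_D iO iG).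
have edom : IL dom <= 6 * kappa m ^+ 2 * rho + 3 * rho ^+ 2 * reach b +
            3 * ((Kc / (32 * pi)) ^+ 2 / (2 * th ^+ 3 * s)).
  rewrite (IL_D iN (IntL_D iO iG)) (IL_D iO iG) (IL_Z _ IL_outer.1) (IL_Z _ ig) IL_outer.2 eN -addrA.
  apply: lerD; last by rewrite lerD2l ler_pM2l.
  rewrite (_ : \sum_i _ = 6 * kappa m ^+ 2 * rho)//.
  transitivity (\sum_i m i * (6 * kappa m * rho)); last by rewrite -mulr_suml -/(kappa m); ring.
  by apply: eq_bigr => i _; rewrite (IL_Z _ (IL_chi i).1) (IL_chi i).2; ring.
have le_dom y : I01 y -> `|y * (defect y * defect y)| <= dom y.
  rewrite /= in_itv/= => /andP[]; rewrite le_eqVlt => /predU1P[<-|y0] y1.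
    rewrite mul0r normr0 /dom big1 ?mulr0 ?invr0 ?mulr0 ?addr0// => i _.
    by rewrite /N mulr0 invr0 !mulr0.
  have sy : 0 < s * y by rewrite mulr_gt0.
  rewrite (_ : y * _ = (sq * y * defect y) ^+ 2 / (s * y)); last first.
    by rewrite -{2}sqs; field; rewrite !gt_eqF.
  rewrite ger0_norm ?divr_ge0 ?sqr_ge0 ?(ltW sy)//.
  have -> : dom y = 3 * (kappa m * \sum_i m i * shell i y + rho ^+ 2 * outer y + g y ^+ 2) / (s * y).
    rewrite /dom /N (_ : \sum_i _ = 3 * kappa m * (\sum_i m i * shell i y) / (s * y)); first by ring.
    by rewrite -mulrA mulr_suml mulr_sumr; apply: eq_bigr => i _; ring.
  rewrite ler_pM2r ?invr_gt0//.
  have hb := defect_bound y0 y1; have hg := gE y y0 (ltW y1).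
  have hb' : `|sq * y * defect y| <= \sum_i m i * shell i y + g y + rho * outer y.
    by apply: le_trans hb _; rewrite lerD2r lerD2l.
  rewrite -real_normK ?num_real//; apply: le_trans (_ : (\sum_i m i * shell i y + g y + rho * outer y) ^+ 2 <= _).
    by rewrite lerXn2r ?nnegrE// (le_trans _ hb').
  apply: le_trans (sqr_sum3_le _ _ _) _; rewrite ler_pM2l//.
  by rewrite exprMn outer_bool addrAC !lerD2r chi_sum_sqr.
have idef : IntL (fun y => y * (defect y * defect y)).
  apply: (IntL_le _ idom le_dom); apply: measurable_funM; first exact: measurable_id.
  by apply: measurable_funM; exact: mf_defect.
rewrite (grad_norm_sq H10_conc_sub_potential).
rewrite (_ : I _ = 4 * pi * IL (fun y => y * (defect y * defect y))); last first.
  by rewrite -(I_radial_grad idef); apply: I_eq => x _; rewrite !expr2.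
rewrite ler_pM2l; last by apply: mulr_gt0; [rewrite ltr0n|exact: pi_gt0].
apply: le_trans edom; apply: (IL_le idef idom) => y Iy.
exact: le_trans (ler_norm _) (le_dom y Iy).
Qed.

(** Without the hats the dilated tower has exactly the energy of the tower. The hats add the cross
    term and the square of their slope, each supported on an interval of length [reach] in sigma. *)
Lemma conc_energy : `|grad_norm (fun x => conc (sqn x)) ^+ 2 - 4 * pi * \sum_i m i * polygon m b (b i)| <=
  4 * pi * ((2 * kappa m * rho + rho ^+ 2) * reach b).
Proof.
have [iT eT] := IL_dtlog m sb; pose T := dtlog m (fun i => s * b i).
have iA := IntL_Z s^-1 iT; have eA : IL (fun y => s^-1 * (y * (T y * T y))) = \sum_i m i * polygon m b (b i).
  rewrite (IL_Z _ iT) eT mulr_sumr; apply: eq_bigr => i _.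
  rewrite polygon_scale// [s * b i]mulrC mulfK ?gt_eqF//.
  by rewrite mulrCA [s^-1 * _]mulrA mulVf ?mul1r// gt_eqF.
pose D y := y * (dconc y * dconc y) - s^-1 * (y * (T y * T y)).
have mD : mf1 I01 (fun y => y * (dconc y * dconc y)).
  by apply: measurable_funM; [exact: measurable_id|apply: measurable_funM; exact: mf_dconc].
have le_D y : I01 y -> `|D y| <= (2 * kappa m * rho + rho ^+ 2) * (outer y * (s * y)^-1).
  rewrite /= in_itv/= => /andP[]; rewrite le_eqVlt => /predU1P[<-|y0] y1.
    by rewrite /D !mul0r !mulr0 subrr normr0 invr0 !mulr0.
  have sy : 0 < s * y by rewrite mulr_gt0.
  have dE := dconc_step y0; have tE := dtlog_step y0; have /andP[p0 p1] := step_bound y.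
  have hd := dhats_outer y0 y1; move: (dhats _ _ _ _) dE hd => d dE hd.
  have -> : D y = (2 * step y * d + d ^+ 2) / (s * y).
    transitivity (((sq * y * dconc y) ^+ 2 - (y * T y) ^+ 2) / (s * y)).
      by rewrite /D !exprMn (expr2 sq) sqs; field; rewrite !gt_eqF.
    by rewrite dE /T tE; congr (_ / _); ring.
  rewrite normrM (gtr0_norm (_ : 0 < (s * y)^-1)) ?invr_gt0// mulrA ler_pM2r ?invr_gt0//.
  apply: le_trans (ler_normD _ _) _; rewrite [leRHS]mulrDl; apply: lerD.
    have n2 : 0 <= 2 * step y by rewrite mulr_ge0.
    by rewrite normrM (ger0_norm n2) -[leRHS]mulrA; apply: ler_pM => //; rewrite ler_pM2l.
  by rewrite normrX -(outer_bool y) -exprMn lerXn2r ?nnegrE// (le_trans _ hd).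
have iO := IntL_Z (2 * kappa m * rho + rho ^+ 2) IL_outer.1.
have mf : mf1 I01 D by apply: measurable_funB; [exact: mD|exact: IntL_mf iA].
have iD : IntL D := IntL_le mf iO le_D.
have eD y : I01 y -> s^-1 * (y * (T y * T y)) + D y = y * (dconc y * dconc y).
  by move=> _; rewrite /D addrC subrK.
have iC : IntL (fun y => y * (dconc y * dconc y)) := IntL_eq eD (IntL_D iA iD).
rewrite (grad_norm_sq H10_conc).
rewrite (_ : I _ = 4 * pi * IL (fun y => y * (dconc y * dconc y))); last first.
  by rewrite -(I_radial_grad iC); apply: I_eq => x _; rewrite !expr2.
have p4 : 0 < 4 * pi :> R by apply: mulr_gt0; [rewrite ltr0n|exact: pi_gt0].
rewrite -mulrBr normrM (gtr0_norm p4) ler_pM2l//.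
rewrite -(IL_eq eD) (IL_D iA iD) eA addrAC subrr add0r.
apply: le_trans (IL_abs iD) _; rewrite -IL_outer.2 -(IL_Z _ IL_outer.1).
exact: (IL_le (IntL_norm iD) iO le_D).
Qed.

(** The bound is uniform in s: charges at the nodes are nonnegative and sum to kappa, and the rest
    decays. *)
Lemma IL_charge : IL (fun t => `|charge t|) <= kappa m + Kc / (32 * pi) / th.
Proof.
have [i1 e] := IL_sum (fun i => (IntL_chi_charge i).1).
have i2 := IntL_norm IntL_rest.
apply: le_trans (_ : IL (fun t => \sum_i shell i t * charge t + `|rest t|) <= _).
  apply: (IL_le (IntL_norm IntL_charge) (IntL_D i1 i2)) => t It.
  rewrite -[charge t in leLHS]restE; apply: le_trans (ler_normD _ _) _; rewrite lerD2r ger0_norm//.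
  by apply: sumr_ge0 => i _; exact: chi_charge_ge0.
rewrite (IL_D i1 i2) e; apply: lerD.
  by apply: ler_sum => i _; rewrite (IntL_chi_charge i).2.
have [B B0 HB] := charge_bounded.
rewrite [leRHS](_ : _ = Kc / (32 * pi) / th * expR (th * ln 1)); last by rewrite ln1 mulr0 expR0 mulr1.
apply: (@IL_pow_le _ _ _ _ _ B) => //.
- by rewrite divr_ge0 ?ltW.
- exact: mf_rest.
- move=> t It; have t1 : t <= 1 by move: It; rewrite /= in_itv/= => /andP[_ /ltW].
  exact: le_trans (rest_charge It) (HB t t1).
- by move=> t t1 /lt_geF; rewrite t1.
by move=> t /andP[t0 t1]; exact: rest_bound.
Qed.

Lemma is_derive_ln_sqr_primitive c t : 0 < t ->
  is_derive t (1 : R) (fun t => c * (t * (ln t ^+ 2 - 2 * ln t + 2))) (c * ln t ^+ 2).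
Proof.
move=> t0; have dl := is_derive1_ln t0.
have d3 : is_derive t (1 : R) (fun t => ln t ^+ 2) (2 * (ln t * t^-1)).
  have := is_deriveM dl dl; rewrite [_ *: _ + _](_ : _ = 2 * (ln t * t^-1)); last by rewrite /GRing.scale/=; ring.
  by [].
have d4 : is_derive t (1 : R) (fun t => 2 * ln t) (2 * t^-1) by apply: is_deriveZ.
have d5 := is_deriveD (is_deriveB d3 d4) (is_derive_cst (2 : R) t (1 : R)).
have d6 := is_deriveM (is_derive_id t (1 : R)) d5.
have -> : ln t ^+ 2 = t * (2 * (ln t * t^-1) - 2 * t^-1 + 0) + (ln t ^+ 2 - 2 * ln t + 2) * 1.
  by move: (ln t) => z; field; rewrite gt_eqF.
exact: is_deriveZ.
Qed.

(** The profile is at most 2 kappa sigma, so u^2 <= 4 kappa^2 (ln y)^2 / s, and (ln y)^2 has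
    integral 2 over [0, 1]. *)
Lemma IL_conc_sqr : IntL (fun y => conc y ^+ 2) /\ IL (fun y => conc y ^+ 2) <= 8 * kappa m ^+ 2 / s.
Proof.
have k0 := kappa_gt0 i0 insc.
have mc : mf1 I01 (fun y => conc y ^+ 2).
  by apply: (measurable_funX 2); apply: measurable_funTS; exact: (continuous_measurable_fun continuous_conc).
have bc y : I01 y -> `|conc y ^+ 2| <= (sq * (top + 1)) ^+ 2.
  rewrite /= in_itv/= => /andP[_ y1]; have /andP[c0 c1] := conc_bound (ltW y1).
  by rewrite ger0_norm ?sqr_ge0// lerXn2r ?nnegrE// (le_trans c0).
have ic := IntL_bounded mc bc; split => //.
apply: le_trans (ler_norm _) _; apply: le_trans (IL_abs ic) _.
pose c := 4 * kappa m ^+ 2 / s.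
have c0 : 0 <= c by rewrite divr_ge0 ?(ltW s0)// mulr_ge0// sqr_ge0.
rewrite (_ : 8 * _ / _ = c * (1 * (ln 1 ^+ 2 - 2 * ln 1 + 2))); last by rewrite /c ln1; ring.
apply: (@IL_le_primitive _ _ (fun t => c * (t * (ln t ^+ 2 - 2 * ln t + 2))) (fun t => c * ln t ^+ 2) 1 ((sq * (top + 1)) ^+ 2) ltr01 (lexx 1) mc bc).
- by move=> t t1 /lt_geF; rewrite t1.
- by move=> t t0; exact: is_derive_ln_sqr_primitive.
- move=> t t0; apply: (@cvgM _ R); first exact: cvg_cst.
  by apply: (@cvgM _ R); exact: continuous_ln.
- move=> t t0; rewrite mulr_ge0// mulr_ge0 ?(ltW t0)//.
  by have := sqr_ge0 (ln t - 1); rewrite !expr2; move: (ln t) => z; lra.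
move=> t /andP[t0 t1]; rewrite ger0_norm ?sqr_ge0//.
have /andP[p0 _] := conc_bound (ltW t1).
have z0 : 0 <= - ln t by rewrite oppr_ge0 ln_le0// ltW.
have w0 : 0 <= - ln t / s by rewrite divr_ge0 ?(ltW s0).
have [q0 q1 _] := profile_bound i0 insc sep eps0 epsk he w0.
rewrite conc_pos// exprMn expr2 sqs; apply: le_trans (_ : s * (2 * kappa m * (- ln t / s)) ^+ 2 <= _).
  by rewrite ler_pM2l// lerXn2r ?nnegrE// (le_trans q0).
rewrite /c le_eqVlt; apply/orP; left; apply/eqP; move: (ln t) => z; by field; rewrite gt_eqF.
Qed.

(** With t = u <= sqrt s (top + 1), the product |f(u)| u is at most 32 pi (top + 1) times the charge
    density, whose integral is bounded; the quadratic term is of order 1/s. *)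
Lemma conc_mass_F Cq rq : 0 <= rq -> 0 <= Cq ->
  (forall t, 0 <= t -> `|primitive f t| <= rq * (`|f t| * t) + Cq * t ^+ 2) ->
  `|I (fun x => primitive f (conc (sqn x)))| <=
  pi * (rq * (32 * pi * (top + 1)) * (kappa m + Kc / (32 * pi) / th) + Cq * (8 * kappa m ^+ 2 / s)).
Proof.
move=> rq0 Cq0 HF; have cF : continuous (primitive f).
  by move=> t; exact: is_derive_continuous (is_derive_primitive t (f_continuous fC1)).
have top0 : 0 <= top + 1 by rewrite addr_ge0// (polygon_ge0 insc)// ltW// (reach_gt0 insc).
pose c := 32 * pi * (top + 1).
have c0 : 0 <= c by rewrite mulr_ge0 ?(ltW p32).
have [i2 e2] := IL_conc_sqr; have i1 := IntL_norm IntL_charge.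
pose dom y := rq * c * `|charge y| + Cq * conc y ^+ 2.
have idom : IntL dom := IntL_D (IntL_Z (rq * c) i1) (IntL_Z Cq i2).
have mF : mf1 I01 (fun y => primitive f (conc y)).
  apply: measurable_funTS; apply: continuous_measurable_fun => y.
  exact: continuous_compose (continuous_conc (x := y)) cF.
have le_dom y : I01 y -> `|primitive f (conc y)| <= dom y.
  rewrite /= in_itv/= => /andP[_ y1]; have /andP[p0 p1] := conc_bound (ltW y1).
  apply: le_trans (HF _ p0) _; rewrite lerD2r -mulrA ler_wpM2l//.
  apply: le_trans (_ : `|f (conc y)| * (sq * (top + 1)) <= _); first by rewrite ler_wpM2l.
  have c1 : 0 <= sq / (32 * pi) by rewrite divr_ge0 ?(ltW sq0) ?(ltW p32).
  rewrite /charge normrM (ger0_norm c1) le_eqVlt; apply/orP; left; apply/eqP.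
  move: (`|f _|) => z; rewrite /c; have := lt0r_neq0 (pi_gt0 R); move: (pi : R) => z0 z1; by field.
have iF : IntL (fun y => primitive f (conc y)) := IntL_le mF idom le_dom.
rewrite (radial_Rintegral iF) normrM (gtr0_norm (pi_gt0 R)) ler_pM2l ?pi_gt0//.
apply: le_trans (IL_abs iF) _; apply: le_trans (IL_le (IntL_norm iF) idom le_dom) _.
rewrite (IL_D (IntL_Z (rq * c) i1) (IntL_Z Cq i2)) (IL_Z _ i1) (IL_Z _ i2).
exact: lerD (ler_wpM2l (mulr_ge0 rq0 c0) IL_charge) (ler_wpM2l Cq0 e2).
Qed.

Lemma conc_derivative :
  is_H10_derivative (J f) (fun x => conc (sqn x)) (fun x => conc (sqn x) - potential source (sqn x)).
Proof.
have [B HB] := source_bounded.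
have bu x : disk x -> `|conc (sqn x)| <= sq * (top + 1).
  move=> /disk_I01; rewrite /= in_itv/= => /andP[_ y1]; have /andP[p0 p1] := conc_bound (ltW y1).
  by rewrite ger0_norm.
apply: (H10_derivative_J fC1 f0 fcrit H10_conc bu (H10_potential continuous_source HB e0 source_near)).
move=> v h1 h2 hv; rewrite (potential_weak continuous_source e0 source_near hv).
have Lv : L2 v by case: hv => /H10_L2.
have cf : continuous (fun y => f (conc y)).
  by move=> y; exact: continuous_compose (continuous_conc (x := y)) (f_continuous fC1).
rewrite -(I_Z _ (L2M (L2_continuous (continuous_radial cf)) Lv)).
apply: I_eq => x /disk_I01; rewrite /= in_itv/= => /andP[_ y1].
by rewrite /source min_l ?(ltW y1)// mulrA [_ / _]mulrC.
Qed.

Lemma conc_J Cq rq : 0 <= rq -> 0 <= Cq ->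
  (forall t, 0 <= t -> `|primitive f t| <= rq * (`|f t| * t) + Cq * t ^+ 2) ->
  `|J f (fun x => conc (sqn x)) - 4 * pi * (\sum_i m i * polygon m b (b i)) / 2| <=
  2 * pi * ((2 * kappa m * rho + rho ^+ 2) * reach b) +
  (rq * (32 * pi * (top + 1)) * (kappa m + Kc / (32 * pi) / th) + Cq * (8 * kappa m ^+ 2 / s)) / 8.
Proof.
move=> rq0 Cq0 HF; have h1 := conc_energy; have h2 := conc_mass_F rq0 Cq0 HF.
rewrite /J; move: h1 h2; move: (grad_norm _ ^+ 2) (I _) => G Fi.
move: (4 * pi * _) => E; set A := (2 * kappa m * rho + rho ^+ 2) * reach b.
set Bq := rq * _ * _ + _ => h1 h2.
rewrite (_ : G / 2 - (8 * pi)^-1 * Fi - E / 2 = (G - E) / 2 + - ((8 * pi)^-1 * Fi)); last by ring.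
apply: le_trans (ler_normD _ _) _; rewrite normrN; apply: lerD.
  rewrite normrM [`|2^-1|]ger0_norm// ler_pdivrMr//; apply: le_trans h1 _.
  by rewrite (_ : 4 * pi * A = 2 * pi * A * 2)//; ring.
rewrite normrM gtr0_norm ?invr_gt0// mulrC ler_pdivrMr//; apply: le_trans h2 _.
by rewrite (_ : pi * Bq = Bq / 8 * (8 * pi))//; field.
Qed.

End Concentration.

(** * Choice of the parameters and passage to the limit *)

Section Bubbles.
Context {R : realType}.
Local Notation mu2 := ((@lebesgue_measure R \x @lebesgue_measure R)%E).
Local Notation I u := (Rintegral mu2 disk u).

Lemma grad_norm_eq (u u' : R * R -> R) : (forall x, disk x -> u x = u' x) -> grad_norm u = grad_norm u'.
Proof.
by move=> uu'; rewrite /grad_norm /grad_inner (weak_derivative_eq e1 uu') (weak_derivative_eq e2 uu').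
Qed.

Lemma J_eq (f : R -> R) u u' : (forall x, disk x -> u x = u' x) -> J f u = J f u'.
Proof.
move=> uu'; have E : I (fun x => primitive f (u x)) = I (fun x => primitive f (u' x)).
  by apply: I_eq => x dx; rewrite uu'.
by rewrite /J (grad_norm_eq uu') E.
Qed.

Lemma is_H10_derivative_eq (f : R -> R) u u' w : (forall x, disk x -> u x = u' x) ->
  is_H10_derivative (J f) u w -> is_H10_derivative (J f) u' w.
Proof.
move=> uu' [hu hw H]; split; [exact: (H10_eq uu' hu)|exact: hw|move=> eps eps0].
have [d d0 Hd] := H eps eps0; exists d; [exact: d0|move=> v hv vd].
have E1 := J_eq f uu'; have E2 : J f (u \+ v) = J f (u' \+ v).
  by apply: J_eq => x dx /=; rewrite uu'.
move: (Hd v hv vd) E1 E2; move: (J f u) (J f u') (J f (u \+ v)) (J f (u' \+ v)) => p q r t H1 e1 e2.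
by rewrite e1 e2 in H1.
Qed.

Lemma tlog0 n (m b : 'I_n -> R) : (forall i, 0 < b i) -> tlog m b 0 = \sum_i m i * b i.
Proof.
move=> b0; apply: eq_bigr => i _; rewrite /capped_log max_r ?expR_ge0//.
by rewrite expRK opprK.
Qed.

Section Tower.
Variables (n : nat) (a m : 'I_n -> R).
Let b := fun i => - (2 * ln (a i)).
Hypotheses (n0 : (0 < n)%N) (a01 : forall i, 0 < a i < 1) (insc : inscribed m b).

Lemma dilated_tower rho s h (x : R * R) : well_separated b rho -> 1 <= s -> disk x ->
  radial (dilation s^-1 (tower (range a) \+ (fun r => hats rho h b (- (2 * ln r))))) x =
  conc m b rho s h (sqn x).
Proof.
move=> sep s1 dx; have s0 : 0 < s := lt_le_trans ltr01 s1.
have sq0 : 0 < Num.sqrt s by rewrite sqrtr_gt0.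
have := disk_I01 dx; rewrite /= in_itv/= => /andP[y0 y1].
rewrite /radial /dilation /= sqrtrV ?(ltW s0)// invrK enormE.
move: (sqn x) y0 y1 => y; rewrite le_eqVlt => /predU1P[<-|y0] y1.
  (* At the centre ln 0 = 0 puts both hats at the argument 0, so they agree and only the values of
     the capped logarithms remain to be compared. *)
  rewrite sqrtr0 powR0 ?invr_eq0 ?gt_eqF// (towerE n0 a01 insc) ?lexx ?ltr01// expr0n/=.
  have sb i : 0 < s * b i by rewrite mulr_gt0// (ins_b insc).
  rewrite /conc !ln0// mulr0 oppr0 mul0r (tlog0 m (ins_b insc)) (tlog0 m sb).
  rewrite mulrDr; congr (_ + _); rewrite !mulr_sumr; apply: eq_bigr => i _.
  have e : (Num.sqrt s)^-1 * s = Num.sqrt s.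
    by rewrite -{2}(sqr_sqrtr (ltW s0)) expr2 mulrA mulVf ?mul1r// gt_eqF.
  by rewrite [RHS]mulrCA [_^-1 * _]mulrA e mulrCA.
have q0 : 0 < Num.sqrt y `^ s^-1 by rewrite powR_gt0// sqrtr_gt0.
have lq : 2 * ln (Num.sqrt y `^ s^-1) = ln y / s.
  by rewrite ln_powR -[in RHS](sqr_sqrtr (ltW y0)) ln_sqr ?sqrtr_gt0//; ring.
have q1 : Num.sqrt y `^ s^-1 < 1.
  have l0 : ln y / s < 0 by rewrite pmulr_llt0 ?invr_gt0// ln_lt0// y0.
  rewrite -lq pmulr_rlt0// in l0.
  by rewrite -[ltLHS]lnK ?posrE// expR_lt1.
rewrite (towerE n0 a01 insc) ?q1 ?(ltW q0)// tlogE ?exprn_gt0// ln_sqr// lq.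
by rewrite (conc_pos m b rho h s1 y0) /profile mulNr.
Qed.

(** The derivative of v is that of the hats times - 2 / r. On their support r > expR (- reach / 2),
    and the slope of the hats is at most eps (2 / rho) <= rho. *)
Lemma correction rho eps h : well_separated b rho -> 0 < eps -> eps * (2 / rho) <= rho -> (forall i, `|h i| <= eps) ->
  C1c (radial (fun r => hats rho h b (- (2 * ln r)))) /\
  forall r : R, 0 < r < 1 -> `|derive1 (fun r => hats rho h b (- (2 * ln r))) r| <= 2 * expR (reach b / 2) * rho.
Proof.
move=> sep eps0 epsr he; have r0 : 0 < rho by case: sep.
split.
  have [D cD out] := log_comp ltr01 r0 (is_derive_hats rho h b) (@continuous_dhats _ _ rho h b)
    (fun t ht => hats_small sep h ht) (fun t ht => hats_reach insc sep h ht).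
  have e1 : expR (- (1 * rho)) < 1 by rewrite expR_lt1 mul1r oppr_lt0.
  have [c1 _] := radial_C1c D cD e1 (fun y hy => (out y hy).1).
  rewrite (_ : radial _ = (fun x => hats rho h b (- ln (sqn x) / 1)))//.
  apply/funext => x; rewrite /radial divr1 enormE; congr (hats _ _ _ (- _)).
  have : 0 <= sqn x by rewrite addr_ge0 ?sqr_ge0.
  rewrite le_eqVlt => /predU1P[<-|y0]; first by rewrite sqrtr0 ln0// mulr0.
  by rewrite -ln_sqr ?sqrtr_gt0// sqr_sqrtr// ltW.
move=> r /andP[rp r1].
have D1 : is_derive r (1 : R) (fun r => - (2 * ln r)) (- (2 * r^-1)).
  by apply: is_deriveN; apply: is_deriveZ; exact: is_derive1_ln.
have D2 : is_derive r (1 : R) (fun r => hats rho h b (- (2 * ln r))) (dhats rho h b (- (2 * ln r)) * - (2 * r^-1)).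
  have Dh := is_derive_hats rho h b (- (2 * ln r)).
  exact: (is_derive1_comp (f := hats rho h b) (g := fun r => - (2 * ln r))).
rewrite derive1E; have -> := @derive_val _ _ _ _ _ _ _ D2.
have [hr|hr] := leP (reach b) (- (2 * ln r)).
  by rewrite (hats_reach insc sep h hr).2 mul0r normr0 mulr_ge0 ?(ltW r0)// mulr_ge0// expR_ge0.
rewrite normrM normrN [`|2 * _|]ger0_norm; last by rewrite mulr_ge0// invr_ge0 ltW.
rewrite mulrC; apply: ler_pM => //; first by rewrite mulr_ge0// invr_ge0 ltW.
  rewrite ler_pM2l// -[leLHS]lnK ?posrE ?invr_gt0// lnV ?posrE// ler_expR.
  by move: hr; move: (reach b) (ln r) => L z; lra.
exact: le_trans (hats_bound sep _ (ltW eps0) he).2 epsr.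
Qed.

Lemma exists_concentration (f : R -> R) : C1 f -> f 0 = 0 -> critical_growth f -> cond_g1 f -> cond_g2 f ->
  exists C rho0 : R, [/\ 0 < C, 0 < rho0 & forall rho, 0 < rho <= rho0 ->
    exists (s : R) (v : R -> R) (w : R * R -> R),
      let u := radial (dilation s^-1 (tower (range a) \+ v)) in
      [/\ 0 < s /\ rho^-1 <= s, C1c (radial v), forall r : R, 0 < r < 1 -> `|derive1 v r| <= C * rho,
          `|J f u - grad_norm (radial (tower (range a))) ^+ 2 / 2| <= C * rho &
          is_H10_derivative (J f) u w /\ grad_norm w ^+ 2 <= C * rho]].
Proof.
move=> fC1 f0 fcrit fg1 fg2; pose i0 : 'I_n := Ordinal n0.
have [rho1 rho10 Hsep] := exists_well_separated insc.
have k0 := kappa_gt0 i0 insc; have L0 := reach_gt0 insc; have p0 := pi_gt0 R.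
have p32 : 0 < 32 * pi :> R by apply: mulr_gt0; [rewrite ltr0n|].
(* The three constants bound the gradient of J'(u), the level and the derivative of v; none of them
   involves rho. *)
pose Ca : R := 4 * pi * (6 * kappa m ^+ 2 + 3 * reach b + 3).
pose Cb : R := 2 * pi * ((2 * kappa m + 1) * reach b) + 1 / 4.
pose Cc : R := 2 * expR (reach b / 2).
have Ca0 : 0 < Ca.
  apply: mulr_gt0; first by apply: mulr_gt0; [rewrite ltr0n|].
  by rewrite ltr_wpDl// addr_ge0// mulr_ge0// ?sqr_ge0// ltW.
have Cb0 : 0 < Cb.
  rewrite ltr_wpDl ?divr_gt0//; apply: mulr_ge0; first by rewrite mulr_ge0// ltW.
  by apply: mulr_ge0; rewrite ?(ltW L0)// addr_ge0// mulr_ge0// ltW.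
have Cc0 : 0 < Cc by apply: mulr_gt0 => //; exact: expR_gt0.
exists (Ca + Cb + Cc), rho1; split; [exact: addr_gt0 (addr_gt0 Ca0 Cb0) Cc0|exact: rho10|move=> rho hrho].
have sep := Hsep rho hrho; have /andP[r0 _] := hrho; have rho12 : rho <= 1 / 2 by case: sep.
have rho2 : rho ^+ 2 <= rho by rewrite expr2 ler_piMl ?(ltW r0)//; lra.
(* The square makes the slope eps (2 / rho) of the hats at most rho; the minimum, together with rho
   <= 1/2, gives eps <= kappa rho / 2 and eps <= 1. *)
pose eps := rho ^+ 2 * Num.min (1 / 2) (kappa m).
have mn0 : 0 < Num.min (1 / 2) (kappa m) by rewrite lt_min k0 divr_gt0.
have mn1 : Num.min (1 / 2) (kappa m) <= 1 / 2 by rewrite ge_min lexx.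
have mn2 : Num.min (1 / 2) (kappa m) <= kappa m by rewrite ge_min lexx orbT.
have eps0 : 0 < eps by rewrite mulr_gt0// exprn_gt0.
have epsk : eps <= kappa m * rho / 2.
  rewrite /eps mulrC -mulrA; apply: ler_pM => //; [exact: ltW|exact: sqr_ge0|].
  by rewrite expr2 ler_wpM2l ?(ltW r0)//; lra.
have epsr : eps * (2 / rho) <= rho.
  rewrite /eps expr2 (_ : _ * _ = rho * (2 * Num.min (1 / 2) (kappa m))); last by field; rewrite gt_eqF.
  by rewrite ler_piMr ?(ltW r0)//; move: mn1; move: (Num.min _ _) => z; lra.
have eps1 : eps <= 1.
  rewrite /eps; apply: mulr_ile1; rewrite ?sqr_ge0 ?(ltW mn0)//; first by apply: le_trans rho2 _; lra.
  by apply: le_trans mn1 _; lra.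
have [Kc [th [K0 th0 th1 HK]]] := f_decay i0 insc sep eps0 epsk fC1 f0 fcrit.
have [sm sm1 Hm] := exists_masses i0 insc sep eps0 epsk eps1 fC1 f0 fcrit fg1.
pose top := polygon m b (reach b).
have top0 : 0 < top + 1 by rewrite ltr_wpDl// (polygon_ge0 insc)// ltW.
(* The factor of the charge term in [conc_J]: taking rho / A in [F_le_fg] makes this term equal to
   rho. *)
pose A := 32 * pi * (top + 1) * (kappa m + Kc / (32 * pi) / th).
have A0 : 0 < A.
  by apply: mulr_gt0; [exact: mulr_gt0|rewrite addr_gt0// !divr_gt0].
have rq0 : 0 < rho / A by rewrite divr_gt0.
have [Cq Cq0 HF] := F_le_fg fC1 f0 fcrit fg1 fg2 rq0.
pose X := (Kc / (32 * pi)) ^+ 2 / (2 * th ^+ 3); pose Y := Cq * (8 * kappa m ^+ 2).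
have X0 : 0 <= X by rewrite divr_ge0 ?sqr_ge0// mulr_ge0// exprn_ge0// ltW.
have Y0 : 0 <= Y by rewrite mulr_ge0 ?(ltW Cq0)// mulr_ge0// sqr_ge0.
(* The summands ensure in turn the existence of the heights, s >= 1 / rho, and that the two errors X
   / s and Y / s are at most rho. *)
pose s := sm + rho^-1 + X / rho + Y / rho.
have ri0 : 0 <= rho^-1 by rewrite invr_ge0 ltW.
have Xr : 0 <= X / rho by rewrite mulr_ge0. have Yr : 0 <= Y / rho by rewrite mulr_ge0.
have sms : sm <= s by rewrite /s -!addrA lerDl !addr_ge0.
have s1 : 1 <= s := le_trans sm1 sms; have s0 : 0 < s := lt_le_trans ltr01 s1.
have sr : rho^-1 <= s.
  by rewrite /s; move: sm1 Xr Yr; move: (rho^-1) (X / rho) (Y / rho) => p q r; lra.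
have Xs : X / s <= rho.
  rewrite ler_pdivrMr// mulrC -ler_pdivrMr// /s.
  by move: sm1 ri0 Yr; move: (rho^-1) (X / rho) (Y / rho) => p q r; lra.
have Ys : Y / s <= rho.
  rewrite ler_pdivrMr// mulrC -ler_pdivrMr// /s.
  by move: sm1 ri0 Xr; move: (rho^-1) (X / rho) (Y / rho) => p q r; lra.
have [h [he hm hf]] := Hm s sms.
exists s, (fun r => hats rho h b (- (2 * ln r))), (fun x => conc m b rho s h (sqn x) - potential (source m b rho f s h) (sqn x)).
have eq_u x : disk x -> conc m b rho s h (sqn x) =
    radial (dilation s^-1 (tower (range a) \+ (fun r => hats rho h b (- (2 * ln r))))) x.
  by move=> dx; rewrite (dilated_tower h sep s1 dx).
have [cv dv] := correction sep eps0 epsr he.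
split.
- by split.
- exact: cv.
- move=> r hr; apply: le_trans (dv r hr) _; rewrite ler_pM2r// -/Cc.
  by rewrite lerDr addr_ge0// ltW.
- rewrite -(J_eq f eq_u) (tower_energy n0 a01 insc).
  have := conc_J i0 insc sep eps0 epsk eps1 epsr fC1 K0 th0 HK s1 he hm hf (ltW rq0) (ltW Cq0) HF.
  move=> hJ; apply: le_trans hJ _.
  rewrite (_ : rho / A * (32 * pi * (polygon m b (reach b) + 1)) * (kappa m + Kc / (32 * pi) / th) = rho); last first.
    by rewrite -mulrA divfK// gt_eqF.
  rewrite (_ : Cq * (8 * kappa m ^+ 2 / s) = Y / s); last by rewrite /Y; ring.
  apply: le_trans (_ : Cb * rho <= _); last first.
    by rewrite ler_pM2r// -addrA [Cb + _]addrC addrA lerDr addr_ge0// ltW.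
  rewrite /Cb [leRHS]mulrDl; apply: lerD.
    rewrite -[leRHS]mulrA; apply: ler_wpM2l; first by rewrite mulr_ge0// ltW.
    rewrite [leRHS]mulrAC; apply: ler_wpM2r; first exact: ltW.
    by rewrite [leRHS]mulrDl mul1r lerD2l.
  by move: Ys; move: (Y / s) => z; lra.
split.
  exact: (is_H10_derivative_eq eq_u (conc_derivative i0 insc sep eps0 epsk eps1 fC1 f0 fcrit s1 he)).
have := gradient_defect i0 insc sep eps0 epsk eps1 epsr fC1 K0 th0 HK s1 he hm hf.
move=> hG; apply: le_trans hG _.
apply: le_trans (_ : Ca * rho <= _); last first.
  by rewrite ler_pM2r// -addrA lerDl addr_ge0// ltW.
rewrite /Ca -[leRHS]mulrA; apply: ler_wpM2l; first by rewrite mulr_ge0// ltW.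
rewrite [leRHS]mulrDl; apply: lerD.
  rewrite [leRHS]mulrDl; apply: lerD => //.
  by rewrite [leRHS]mulrAC; apply: ler_wpM2r; rewrite ?(ltW L0)// ler_pM2l.
rewrite ler_pM2l//; apply: le_trans Xs; rewrite /X.
by rewrite [(2 * th ^+ 3 * s)^-1]invfM mulrA.
Qed.

End Tower.

Lemma cvg_rate (C d : R) : C * (d * k.+1%:R^-1) @[k --> \oo] --> (0 : R).
Proof.
rewrite -(mulr0 C); apply: cvgM; first exact: cvg_cst.
by rewrite -(mulr0 d); apply: cvgM; [exact: cvg_cst|exact: cvg_harmonic].
Qed.

Lemma cvg_dist_le (x y : nat -> R) l : (forall k, `|x k - l| <= y k) -> y k @[k --> \oo] --> (0 : R) ->
  x k @[k --> \oo] --> l.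
Proof.
move=> xy y0; apply/cvgrPdist_lt => e e0; have /cvgrPdist_lt/(_ e e0) := y0.
apply: filterS => k; rewrite sub0r normrN distrC => h.
exact: le_lt_trans (xy k) (le_lt_trans (ler_norm _) h).
Qed.

Lemma cvg_sqr0 (x : nat -> R) : x k ^+ 2 @[k --> \oo] --> (0 : R) -> x k @[k --> \oo] --> (0 : R).
Proof.
move=> x0; apply/cvgrPdist_lt => e e0; have e20 : 0 < e ^+ 2 by rewrite exprn_gt0.
have /cvgrPdist_lt/(_ _ e20) := x0; apply: filterS => k; rewrite !sub0r !normrN normrX.
by rewrite ltr_pXn2r ?nnegrE ?(ltW e0).
Qed.

Lemma sup_norm01_le (g : R -> R) (M : R) : (forall r : R, 0 < r < 1 -> `|g r| <= M) ->
  (0 <= sup_norm01 g <= M%:E)%E.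
Proof.
move=> gM; apply/andP; split.
  apply: le_trans (_ : (`|g (1 / 2)|%:E <= _)%E); first by rewrite lee_fin.
  by apply: ereal_sup_ubound; exists (1 / 2) => //=; rewrite in_itv/=; apply/andP; split; lra.
apply: ge_ereal_sup => _ [r + <-]; rewrite /= in_itv/= => hr.
by rewrite lee_fin gM.
Qed.

End Bubbles.

Theorem theorem4p3 (R : realType) (n : nat) (n_gt0 : (0 < n)%N) :
  (forall (a : 'I_n -> R) (f : R -> R),
     (forall i, 0 < a i < 1) ->
     (forall i j : 'I_n, (i < j)%N -> a i < a j) ->
     C1 f -> f 0 = 0 -> critical_growth f ->
     cond_g0 f -> cond_g1 f -> cond_g2 f ->
     exists (s : nat -> R) (v : nat -> R -> R) (w : nat -> R * R -> R),
       let u := fun k => radial (dilation (s k)^-1 (tower (range a) \+ v k)) in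
       [/\ (forall k, 0 < s k) /\ s k @[k --> \oo] --> +oo,
           (forall k, C1c (radial (v k))) /\
             sup_norm01 (derive1 (v k)) @[k --> \oo] --> 0%E,
           J f (u k) @[k --> \oo] --> grad_norm (radial (tower (range a))) ^+ 2 / 2,
           forall k, is_H10_derivative (J f) (u k) (w k) &
           grad_norm (w k) @[k --> \oo] --> (0 : R)]) /\
  (forall c : R, 1 / 2 < c < n%:R / 2 ->
     exists a : 'I_n -> R,
       [/\ forall i, 0 < a i < 1,
           forall i j : 'I_n, (i < j)%N -> a i < a j &
           grad_norm (radial (tower (range a))) ^+ 2 / 2 = c]).
Proof.
split; last by move=> c; exact: exists_tower_energy.
move=> a f a01 alt fC1 f0 fcrit _ fg1 fg2.
have [m insc _] := exists_inscribed a01 alt.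
have [C [rho0 [C0 r0 H]]] := exists_concentration n_gt0 a01 insc fC1 f0 fcrit fg1 fg2.
(* Widths tending to 0 within the admissible range; s k >= 1 / rho k then forces s k to infinity. *)
pose rho k : R := rho0 * k.+1%:R^-1.
have hrho k : 0 < rho k <= rho0.
  rewrite mulr_gt0 ?invr_gt0//= ler_piMr ?(ltW r0)// invf_le1// ler1n.
  by [].
have /choice[s /choice[v /choice[w Hk]]] : forall k, _ := fun k => H (rho k) (hrho k).
exists s, v, w; move=> u.
have s0 k : 0 < s k by have [[]] := Hk k.
have rs k : (rho k)^-1 <= s k by have [[]] := Hk k.
have cv k : C1c (radial (v k)) by have [_] := Hk k.
have dv k r : 0 < r < 1 -> `|derive1 (v k) r| <= C * rho k by have [_ _ h _ _] := Hk k; exact: h.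
have hJ k : `|J f (u k) - grad_norm (radial (tower (range a))) ^+ 2 / 2| <= C * rho k by have [_ _ _ h _] := Hk k.
have hw k : is_H10_derivative (J f) (u k) (w k) by have [_ _ _ _ [h _]] := Hk k.
have gw k : grad_norm (w k) ^+ 2 <= C * rho k by have [_ _ _ _ [_ h]] := Hk k.
have rate := cvg_rate C rho0; split.
- split; first exact: s0.
  apply/cvgryPge => A; near=> k; apply: le_trans (rs k).
  rewrite /rho invfM invrK mulrC ler_pdivlMr//.
  apply: le_trans (_ : k%:R <= _); last by rewrite ler_nat.
  by near: k; exact: nbhs_infty_ger.
- split; first exact: cv.
  apply: (squeeze_cvge (f := fun=> 0%E) (h := fun k => (C * rho k)%:E)).
  + by near=> k; apply: sup_norm01_le; exact: dv.
  + exact: cvg_cst.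
  + by apply: cvg_EFin; [exact: nearW|exact: rate].
- exact: cvg_dist_le hJ rate.
- exact: hw.
apply: cvg_sqr0; apply: (cvg_dist_le (y := fun k => C * rho k)) => // k.
by rewrite subr0 ger0_norm ?sqr_ge0.
Unshelve. all: by end_near.
Qed.
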